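(* Let $(k_{a,c}, p_{a,c}, \varphi_{a,c})$, $(a,c)\in(-a_0,a_0)\times(-c_0,c_0)$, be the family of small periodic solutions described in the context, and let $$\mathcal B_{a,c} = \partial_z^2\left(k_{a,c}^4\partial_z^4+k_{a,c}^2\partial_z^2-c+p_{a,c}\right).$$ There exist positive constants $c_3$ and $a_3$ such that for any $c\in(-c_3,c_3)$ with $c\neq0$ and any $a\in(-a_3,a_3)$ with $a\neq 0$, there exists $\Lambda_{a,c}>0$ such that for any $\Lambda\in(0,\Lambda_{a,c})$ the linear operator $\Lambda\partial_z-\mathcal B_{a,c}$ acting in $L^2(0,2\pi)$ with domain $H^6_{\mathrm{per}}(0,2\pi)$ has a simple negative eigenvalue. Consequently, for these $a$ and $c$, the periodic wave $\varphi_{a,c}$ is transversely linearly unstable with respect to co-periodic longitudinal perturbations.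
   Context: Equation. The fifth-order KP equation is $\partial_t\partial_x u = \partial_x^2(\partial_x^4 u+\partial_x^2u+\frac12u^2)+\partial_y^2u$. Its line traveling waves of speed $c$ considered here are, in a comoving frame, solutions $u=u(x)$ of $$\partial_x^4 u + \partial_x^2 u - cu + \tfrac12 u^2 = 0. \qquad ( * )$$ Function spaces. $H^j_{\mathrm{per}}(0,2\pi)=\{f\in H^j_{\mathrm{loc}}(\mathbb R): f(z+2\pi)=f(z)\ \forall z\in\mathbb R\}$. Periodic waves (previously known existence result). There exist positive constants $c_0,a_0$ such that for any $c\in(-c_0,c_0)$ equation $( * )$ has a one-parameter family of even periodic solutions $(\varphi_{a,c})_{a\in(-a_0,a_0)}$ of the form $\varphi_{a,c}(x)=p_{a,c}(k_{a,c}x)$, $x\in\mathbb R$, such that: (i) the real-valued map $(a,c)\mapsto k_{a,c}$ is analytic on $(-a_0,a_0)\times(-c_0,c_0)$ and $k_{a,c}=k_0(c)+c\,\widetilde k(a,c)$, with $k_0(c)=\left(\frac{1+\sqrt{1+4c}}{2}\right)^{1/2}$ and $\widetilde k(a,c)=\sum_{n\ge1}\widetilde k_{2n}(c)a^{2n}$, where $|\widetilde k_{2n}(c)|\le K_0/\rho_0^{2n}$ for all $n\ge1$ and some positive constants $K_0,\rho_0$; (ii) the map $(a,c)\mapsto p_{a,c}$ is analytic on $(-a_0,a_0)\times(-c_0,c_0)$ with values in $H^6_{\mathrm{per}}(0,2\pi)$ and $$p_{a,c}(z)=ac\cos(z)+c\sum_{n,m\ge0,\ n+m\ge2,\ n-m\ne\pm1}\widetilde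 p_{n,m}(c)\,e^{i(n-m)z}a^{n+m},$$ where the $\widetilde p_{n,m}(c)$ are real, $\widetilde p_{n,m}(c)=\widetilde p_{m,n}(c)$, and $|\widetilde p_{n,m}(c)|\le C_0/\rho_0^{n+m}$ for all $c\in(-c_0,c_0)$ and some positive constant $C_0$; (iii) the Fourier coefficients $\widehat p_q(a,c)$ of $p_{a,c}(z)=\sum_{q\in\mathbb Z}\widehat p_q(a,c)e^{iqz}$ are real, $\widehat p_0(a,c)=O(ca^2)$ and $\widehat p_q(a,c)=O(c|a|^{|q|})$ for $q\ne0$, as $a\to0$; $a\mapsto\widehat p_q(a,c)$ is even (resp. odd) for even (resp. odd) $q$, so that $p_{-a,c}(z)=p_{a,c}(z+\pi)$. The family is fixed once and for all. Operators. In expressions such as $\mathcal B_{a,c}$, functions act by multiplication, i.e. $\mathcal B_{a,c}f=\partial_z^2(k_{a,c}^4\partial_z^4f+k_{a,c}^2\partial_z^2f-cf+p_{a,c}f)$. With $\mathcal A_{a,c}=\partial_x^2(\partial_x^4+\partial_x^2-c+\varphi_{a,c})$, the change of variables $z=k_{a,c}x$, $\lambda=k_{a,c}\Lambda$ transforms $\lambda\partial_x-\mathcal A_{a,c}$ into $k_{a,c}^2(\Lambda\partial_z-\mathcal B_{a,c})$. Instability notion. $\varphi_{a,c}$ is called transversely linearly unstable with respect to co-periodic longitudinal perturbations if there exist $\lambda\in\mathbb C$ with $\Re\lambda>0$ and $\omega\in\mathbb R$ such that $-\omega^2$ is negative and is an isolated eigenvalue of $\lambda\partial_x-\mathcal A_{a,c}$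 acting on functions of $x$ with the same period $2\pi/k_{a,c}$ as $\varphi_{a,c}$ (the $L^2$ space over one period, with domain the $2\pi/k_{a,c}$-periodic functions in $H^6_{\mathrm{loc}}(\mathbb R)$). *)

(* Defs.v *)
From HB Require Import structures.
From mathcomp Require Import all_boot all_order all_algebra.
From mathcomp Require Import complex.
From mathcomp Require Import all_classical all_reals all_analysis.

Set Implicit Arguments.
Unset Strict Implicit.
Unset Printing Implicit Defensive.

Import Order.TTheory GRing.Theory Num.Theory.
Import numFieldNormedType.Exports.

Local Open Scope classical_set_scope.
Local Open Scope complex_scope.
Local Open Scope ring_scope.

(* Test functions are C^1 with compact support, as in Brezis' definition of
   the Sobolev spaces on an interval; this gives the same weak derivatives as
   smooth test functions. *)
Definition test_function (R : realType) (phi : R -> R) : Prop :=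
  [/\ forall x, derivable phi x 1,
      continuous (derive1 phi) &
      exists M : R, forall x, M < `|x| -> phi x = 0].

Definition is_wderiv (R : realType) (f g : R -> R) : Prop :=
  [/\ locally_integrable setT f, locally_integrable setT g &
      forall phi, test_function phi ->
        \int[@lebesgue_measure R]_x (f x * derive1 phi x) =
        - \int[@lebesgue_measure R]_x (g x * phi x)].

(* The weak derivative is unique only up to a null set: [wderiv f] is some
   representative of it, and the zero function if there is none. *)
Definition wderiv (R : realType) (f : R -> R) : R -> R :=
  xget (fun=> 0) [set g | is_wderiv f g].

Definition L2loc (R : realType) (f : R -> R) : Prop :=
  measurable_fun setT f /\ locally_integrable setT (fun x => f x ^+ 2).

Fixpoint Hloc (R : realType) (j : nat) (f : R -> R) : Prop :=
  L2loc f /\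
  if j is i.+1 then exists g, is_wderiv f g /\ Hloc i g else True.

Definition Hper (R : realType) (T : R) (j : nat) (f : R -> R) : Prop :=
  Hloc j f /\ forall z, f (z + T) = f z.

Definition Hnorm (R : realType) (T : R) (j : nat) (f : R -> R) : R :=
  Num.sqrt (\sum_(i < j.+1)
    \int[@lebesgue_measure R]_(x in `]0, T[) (iter i (@wderiv R) f x) ^+ 2).

Definition cHper (R : realType) (T : R) (j : nat) (f : R -> R[i]) : Prop :=
  Hper T j (fun x => complex.Re (f x)) /\ Hper T j (fun x => complex.Im (f x)).

Definition cwderiv (R : realType) (f : R -> R[i]) : R -> R[i] := fun x =>
  wderiv (fun y => complex.Re (f y)) x +i* wderiv (fun y => complex.Im (f y)) x.

Definition cwderivn (R : realType) (n : nat) (f : R -> R[i]) : R -> R[i] :=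
  iter n (@cwderiv R) f.

(* Elements of L^2(0,T) are represented by functions on the line whose values
   outside ]0,T[ are irrelevant; their equality is [L2eq]. *)
Definition L2 (R : realType) (T : R) (f : R -> R[i]) : Prop :=
  [/\ measurable_fun `]0, T[%classic (fun x => complex.Re (f x)),
      measurable_fun `]0, T[%classic (fun x => complex.Im (f x)) &
      (@lebesgue_measure R).-integrable `]0, T[
        (fun x => (complex.Re (f x) ^+ 2 + complex.Im (f x) ^+ 2)%:E)].

Definition L2eq (R : realType) (T : R) (f g : R -> R[i]) : Prop :=
  f = g %[ae @lebesgue_measure R in `]0, T[%classic].

Definition L2norm (R : realType) (T : R) (f : R -> R[i]) : R :=
  Num.sqrt (\int[@lebesgue_measure R]_(x in `]0, T[)
              (complex.Re (f x) ^+ 2 + complex.Im (f x) ^+ 2)).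

(* An operator in L^2(0,T) is given by its domain [dom] and by a map A on
   representatives, whose values matter on [dom] only, up to [L2eq]. *)

Definition shift (R : realType) (A : (R -> R[i]) -> R -> R[i]) (mu : R[i])
  (f : R -> R[i]) : R -> R[i] := fun x => A f x - mu * f x.

Definition eigenvector (R : realType) (T : R) (dom : (R -> R[i]) -> Prop)
    (A : (R -> R[i]) -> R -> R[i]) (mu : R[i]) (f : R -> R[i]) : Prop :=
  [/\ dom f, ~ L2eq T f (fun=> 0) & L2eq T (A f) (fun x => mu * f x)].

Definition eigenvalue (R : realType) (T : R) (dom : (R -> R[i]) -> Prop)
    (A : (R -> R[i]) -> R -> R[i]) (mu : R[i]) : Prop :=
  exists f, eigenvector T dom A mu f.

(* The kernel of (A - mu)^n, with its natural domain; the intermediate [g]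
   replaces [shift A mu f] by an almost everywhere equal function, so that
   membership in [dom] does not depend on the chosen representative. *)
Fixpoint gen_kernel (R : realType) (T : R) (dom : (R -> R[i]) -> Prop)
    (A : (R -> R[i]) -> R -> R[i]) (mu : R[i]) (n : nat) (f : R -> R[i])
    : Prop :=
  if n is m.+1 then
    dom f /\ exists g, L2eq T g (shift A mu f) /\ gen_kernel T dom A mu m g
  else L2eq T f (fun=> 0).

(* Algebraically simple: the generalized eigenspace is a line. *)
Definition simple_eigenvalue (R : realType) (T : R) (dom : (R -> R[i]) -> Prop)
    (A : (R -> R[i]) -> R -> R[i]) (mu : R[i]) : Prop :=
  exists2 f, eigenvector T dom A mu f &
    forall n g, gen_kernel T dom A mu n g ->
      exists alpha : R[i], L2eq T g (fun x => alpha * f x).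

(* [A - mu] is a bijection from [dom] onto L^2(0,T) with bounded inverse. *)
Definition in_resolvent_set (R : realType) (T : R) (dom : (R -> R[i]) -> Prop)
    (A : (R -> R[i]) -> R -> R[i]) (mu : R[i]) : Prop :=
  (forall h, L2 T h -> exists2 f, dom f & L2eq T (shift A mu f) h) /\
  exists M : R, forall f, dom f -> L2norm T f <= M * L2norm T (shift A mu f).

Definition isolated_eigenvalue (R : realType) (T : R)
    (dom : (R -> R[i]) -> Prop) (A : (R -> R[i]) -> R -> R[i]) (mu : R[i])
    : Prop :=
  eigenvalue T dom A mu /\
  exists2 eps : R, 0 < eps &
    forall nu : R[i], 0 < `|nu - mu| < eps%:C -> in_resolvent_set T dom A nu.

Definition opB (R : realType) (k c : R) (p : R -> R) (f : R -> R[i])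
    : R -> R[i] :=
  cwderivn 2 (fun z => (k ^+ 4)%:C * cwderivn 4 f z
    + (k ^+ 2)%:C * cwderivn 2 f z - c%:C * f z + (p z)%:C * f z).

Definition opA (R : realType) (c : R) (phi : R -> R) (f : R -> R[i])
    : R -> R[i] :=
  cwderivn 2 (fun x => cwderivn 4 f x + cwderivn 2 f x - c%:C * f x
    + (phi x)%:C * f x).

Definition coperiodic_transversely_unstable (R : realType) (k c : R)
    (phi : R -> R) : Prop :=
  exists lambda : R[i], 0 < complex.Re lambda /\
  exists omega : R, - omega ^+ 2 < 0 /\
    isolated_eigenvalue (2 * pi / k) (cHper (2 * pi / k) 6)
      (fun f x => lambda * cwderiv f x - opA c phi f x) (- omega ^+ 2)%:C.

(* Real analyticity on [D] of a map of two real variables with values in the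
   subspace [X], normed by [N], of [V]: local convergent power series
   expansions with geometrically bounded coefficients in [X]. *)
Definition analytic2 (R : realType) (V : lmodType R) (X : V -> Prop)
    (N : V -> R) (D : R -> R -> Prop) (F : R -> R -> V) : Prop :=
  (forall a c, D a c -> X (F a c)) /\
  forall a1 c1, D a1 c1 ->
  exists (r M : R) (q : nat -> nat -> V),
    [/\ 0 < r,
        forall m n, X (q m n) /\ N (q m n) * r ^+ (m + n) <= M &
        forall a c, D a c -> `|a - a1| < r -> `|c - c1| < r ->
          (fun n : nat => N (F a c - \sum_(i < n) \sum_(j < n)
             ((a - a1) ^+ i * (c - c1) ^+ j) *: q i j)) @ \oo --> (0 : R)].

Definition rect (R : realType) (a0 c0 a c : R) : Prop :=
  `|a| < a0 /\ `|c| < c0.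

Definition cexpi (R : realType) (t : R) : R[i] := cos t +i* sin t.

Definition ccvg (R : realType) (u : nat -> R[i]) (l : R[i]) : Prop :=
  ((fun n => complex.Re (u n)) @ \oo --> complex.Re l) /\
  ((fun n => complex.Im (u n)) @ \oo --> complex.Im l).

(* The q-th Fourier coefficient (2 pi)^-1 \int_0^{2 pi} f(z) e^{-iqz} dz. *)
Definition fourier (R : realType) (f : R -> R) (q : int) : R[i] :=
  ((2 * pi)^-1 *
     \int[@lebesgue_measure R]_(z in `]0, 2 * pi[) (f z * cos (q%:~R * z)))
  -i* ((2 * pi)^-1 *
     \int[@lebesgue_measure R]_(z in `]0, 2 * pi[) (f z * sin (q%:~R * z))).

Definition wave (R : realType) (k : R) (p : R -> R) : R -> R :=
  fun x => p (k * x).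

Definition travelling_wave (R : realType) (c : R) (u : R -> R) : Prop :=
  (forall (i : nat) x, (i < 4)%N -> derivable (derive1n i u) x 1) /\
  forall x, derive1n 4 u x + derive1n 2 u x - c * u x + 2^-1 * u x ^+ 2 = 0.

Definition k0 (R : realType) (c : R) : R :=
  Num.sqrt ((1 + Num.sqrt (1 + 4 * c)) / 2).

Definition k_expansion (R : realType) (a0 c0 : R) (k : R -> R -> R)
    (rho0 : R) : Prop :=
  exists (K0 : R) (kt : R -> R -> R) (k2 : nat -> R -> R),
  [/\ 0 < K0,
      forall a c, rect a0 c0 a c -> k a c = k0 c + c * kt a c,
      forall a c, rect a0 c0 a c ->
        (fun N : nat => \sum_(1 <= n < N) k2 n c * a ^+ (2 * n)) @ \oo
          --> kt a c &
      forall (n : nat) c, (1 <= n)%N -> `|c| < c0 ->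
        `|k2 n c| <= K0 / rho0 ^+ (2 * n)].

Definition p_index (n m : nat) : bool :=
  [&& (2 <= n + m)%N, n != m.+1 & m != n.+1].

(* The double series is the limit of its square partial sums; by the bound on
   the coefficients it converges absolutely for |a| < rho0. *)
Definition p_expansion (R : realType) (a0 c0 : R) (p : R -> R -> R -> R)
    (rho0 : R) : Prop :=
  exists (C0 : R) (pt : nat -> nat -> R -> R),
  [/\ 0 < C0,
      forall a c z, rect a0 c0 a c ->
        ccvg (fun N : nat => (a * c * cos z)%:C + c%:C *
                \sum_(n < N) \sum_(m < N | p_index n m)
                  (pt n m c)%:C * cexpi ((n%:R - m%:R) * z)
                    * (a ^+ (n + m))%:C)
             (p a c z)%:C,
      forall n m c, p_index n m -> `|c| < c0 -> pt n m c = pt m n c &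
      forall n m c, p_index n m -> `|c| < c0 ->
        `|pt n m c| <= C0 / rho0 ^+ (n + m)].

(* The estimates O(c a^2) and O(c |a|^|q|) as a -> 0 are uniform in c; they
   follow from the bounds in [p_expansion]. *)
Definition p_fourier (R : realType) (a0 c0 : R) (p : R -> R -> R -> R)
    : Prop :=
  [/\ forall a c q, rect a0 c0 a c -> complex.Im (fourier (p a c) q) = 0,
      exists K del : R, 0 < del /\
        forall a c, rect a0 c0 a c -> `|a| < del ->
          `|fourier (p a c) 0| <= (K * `|c| * a ^+ 2)%:C,
      forall q : int, q != 0 -> exists K del : R, 0 < del /\
        forall a c, rect a0 c0 a c -> `|a| < del ->
          `|fourier (p a c) q| <= (K * `|c| * `|a| ^+ `|q|%N)%:C,
      forall a c (q : int), rect a0 c0 a c ->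
        fourier (p (- a) c) q = (-1) ^+ `|q|%N * fourier (p a c) q &
      forall a c z, rect a0 c0 a c -> p (- a) c z = p a c (z + pi)].

(* The waves themselves are phi_{a,c} = wave (k a c) (p a c); solutions of the
   ordinary differential equation are classical solutions. *)
Definition periodic_waves (R : realType) (a0 c0 : R) (k : R -> R -> R)
    (p : R -> R -> R -> R) : Prop :=
  [/\ 0 < a0 /\ 0 < c0,
      forall a c, rect a0 c0 a c ->
        travelling_wave c (wave (k a c) (p a c)) /\
        forall x, wave (k a c) (p a c) (- x) = wave (k a c) (p a c) x,
      @analytic2 R R^o (fun=> True) (fun x : R => `|x|) (rect a0 c0) k /\
      @analytic2 R (R -> R^o) (Hper (2 * pi) 6) (Hnorm (2 * pi) 6)
        (rect a0 c0) p,
      exists2 rho0 : R, 0 < rho0 &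
        k_expansion a0 c0 k rho0 /\ p_expansion a0 c0 p rho0 &
      p_fourier a0 c0 p].

(* Main.v *)
Require Import Defs.
From HB Require Import structures.
From mathcomp Require Import all_boot all_order all_algebra.
From mathcomp Require Import complex.
From mathcomp Require Import all_classical all_reals all_analysis.
From mathcomp Require Import measurable_realfun ring lra zify.
Import Order.TTheory GRing.Theory Num.Theory.
Import numFieldNormedType.Exports.
Local Open Scope classical_set_scope.
Local Open Scope complex_scope.
Local Open Scope ring_scope.
Set Implicit Arguments.
Unset Strict Implicit.

(** Written in Fourier coefficients, the problem has only two modes that
    matter. Both operators of the theorem are instances of [opG], which
    sends a T-periodic f to l f' - (al f^(4) + be f'' - c f + P f)''; here T
    = 2 pi, with P = p_{a,c}, for the operator with B, and T = 2 pi / k,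
    with P = phi_{a,c}, for the one with A. Put kap = 2 pi / T. Divided by
    kap^2 q^2, the q-th coefficient of ([opG] - kap^2 nu) f = 0, for q <> 0,
    is

      (D_q + i Lam / q - nu / q^2) f_q + (s f)_q = 0,
      D_q = A q^4 - B q^2 - d,   s = P - P_0,   Lam = l / kap,

    with A and B close to 1 and d close to 0 because k is close to 1 and c
    and P are small ([symbol_den]). The coefficient of index 0 only says nu
    f_0 = 0. As D_q >= (3/5) q^4 for |q| >= 2, the modes of index 1 and -1
    are the only ones that can resonate; the others are eliminated by a
    Neumann series in the sup norm, s being small.

    The wave equation determines the remaining 2 x 2 matrix. With eps = s_1
    = s_{-1} = a c / 2 and tau = eps^2 / (2 D_2), the relations D_q s_q = -
    (s^2)_q / 2 give s_2 = s_{-2} = - tau and D_1 = tau, up to O(eps^3)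
    ([coef2_near], [Dq1_near]), and the matrix E of the system ([schur]) is,
    again up to O(eps^3),

      i Lam - nu - tau        - tau
      - tau         - i Lam - nu - tau.

    For Lam = 0 the determinant of this model is nu (nu + 2 tau): next to
    the eigenvalue 0 due to translations there is the negative one - 2 tau,
    and the latter survives for small Lam > 0. Since s is real, complex
    conjugation exchanges the two modes when nu is real, so that the
    determinant of E is the real number |E_11|^2 - |E_21|^2; it is positive
    at - 3 tau and negative at - (3/2) tau, hence vanishes in between
    ([det_root]). This yields the negative eigenvalue m = kap^2 nu.

    The eigenvalue is algebraically simple because the left null vector of
    the matrix, (E_21, - E_11), is not orthogonal to the right-hand side of
    the equation of a generalized eigenvector: the pairing is close to E_11
    E_11^* + E_11^2, of real part 2 (Re E_11)^2 ([no_jordan]). It is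
    isolated because nu enters the matrix as - nu Id up to a term with
    Lipschitz constant O(eps^2), which makes the determinant nonzero near
    the root ([det_near]); Cramer's rule then provides a bounded inverse
    ([reduced_inverse]). Instability is the case lambda = l, - omega^2 = m.

    The passage between functions and coefficients rests on three facts: an
    integrable function whose trigonometric coefficients vanish is zero
    almost everywhere ([trig_uniq], by Fejer's argument); for periodic
    functions, weak derivatives are detected by Fourier coefficients
    ([fc_wderiv], [wderiv_fc]); and coefficients that solve the equation
    with enough decay come from a function of the domain ([synthesis]). *)

(** * Integration by parts for primitives of integrable functions *)

Section ibp.
Context {R : realType}.
Notation mu := (@lebesgue_measure R).
Local Notation itg A f := (mu.-integrable A (EFin \o f)).

Lemma integrable_mulb (A : set R) (f g : R -> R) (M : R) : measurable A ->
  itg A f -> measurable_fun A g -> (forall x, A x -> `|g x| <= M) ->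
  itg A (fun x => f x * g x).
Proof.
move=> mA fi mg gM.
have mf : measurable_fun A f by have /measurable_EFinP := measurable_int mu fi.
apply: (@le_integrable _ _ _ mu A mA _ (EFin \o (fun x => M * f x))).
- by apply/measurable_EFinP; exact: measurable_funM.
- move=> x Ax /=; rewrite lee_fin !normrM mulrC ler_wpM2r//.
  by rewrite (le_trans (gM x Ax))// ler_norm.
- exact: (@integrableZl _ _ _ mu A mA M (EFin \o f)).
Qed.

Lemma integrable_bdd (A : set R) (f : R -> R) (M : R) : measurable A ->
  (mu A < +oo)%E -> measurable_fun A f -> (forall x, A x -> `|f x| <= M) -> itg A f.
Proof.
move=> mA Af mf fM; apply: measurable_bounded_integrable => //.
exists M; split; first exact: num_real.
by move=> N MN x Ax; exact: le_trans (fM x Ax) (ltW MN).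
Qed.

Lemma integrable_patch (D : set R) (f : R -> R) : measurable D ->
  itg D f -> itg setT (f \_ D).
Proof.
move=> mD fi; rewrite -restrict_EFin.
by apply/integrable_restrict => //; rewrite setTI.
Qed.

Lemma mem_oo (x a b : R) : (x \in `]a, b[%classic) = (a < x) && (x < b).
Proof. by apply/idP/idP; rewrite inE /= in_itv. Qed.

Lemma measurable_abs_section (H : R * R -> \bar R) :
  measurable_fun [set: measurableTypeR R * measurableTypeR R] H ->
  measurable_fun [set: measurableTypeR R] (fun x => \int[mu]_y `|H (x, y)|)%E.
Proof.
move=> mH.
apply: (@measurable_fun_fubini_tonelli_F _ _ (measurableTypeR R)
  (measurableTypeR R) R mu (abse \o H)); first exact: measurableT_comp.
by move=> z; exact: abse_ge0.
Qed.

(** The kernel is the indicator of a triangle, so that the two inner integrals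
    are primitives of the two factors. *)
Lemma fubini_triangle (pa ga : R -> R) : itg setT pa -> itg setT ga ->
  (\int[mu]_x \int[mu]_y (pa x * ga y * (y < x)%R%:R)%:E =
   \int[mu]_y \int[mu]_x (pa x * ga y * (y < x)%R%:R)%:E)%E.
Proof.
move=> pai gai.
have mga : measurable_fun setT ga by have /measurable_EFinP := measurable_int mu gai.
have mpa : measurable_fun setT pa by have /measurable_EFinP := measurable_int mu pai.
pose H (xt : R * R) : \bar R := (pa xt.1 * ga xt.2 * (xt.2 < xt.1)%R%:R)%:E.
have mH : measurable_fun [set: measurableTypeR R * measurableTypeR R] H.
  apply/measurable_EFinP; apply: measurable_funM; first apply: measurable_funM.
  - exact: (measurableT_comp mpa measurable_fst).
  - exact: (measurableT_comp mga measurable_snd).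
  - apply: (@measurableT_comp _ _ _ _ _ _ (fun c : bool => c%:R : R)) => //.
    exact: (measurable_fun_ltr measurable_snd measurable_fst).
have Hi : (mu \x mu)%E.-integrable setT H.
  apply/integrable12ltyP => //.
  apply: (@le_lt_trans _ _ (\int[mu]_x ((fine (\int[mu]_y `|(ga y)%:E|))%:E * `|(pa x)%:E|)))%E.
    apply: ge0_le_integral => //.
    - by move=> x _; exact: integral_ge0.
    - exact: measurable_abs_section.
    - by apply: measurable_funeM => //; apply/measurable_EFinP; apply: measurableT_comp.
    - move=> x _ /=.
      have gfin : (\int[mu]_y `|(ga y)%:E| \is a fin_num)%E.
        by apply: integrable_fin_num => //; apply: integrable_abse.
      rewrite fineK// muleC -ge0_integralZl//=.
      + apply: ge0_le_integral => //=.
        * by apply/measurable_EFinP; apply: measurableT_comp => //; have /measurable_EFinP := (measurableT_comp mH (@pair1_measurable _ _ _ _ x)).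
        * by apply: measurable_funeM; apply/measurable_EFinP; apply: measurableT_comp.
        * move=> y _; rewrite lee_fin !normrM -[leRHS]mulr1 ler_wpM2l ?mulr_ge0//.
          by case: (y < x)%R; rewrite ?normr0 ?normr1.
      + by apply/measurable_EFinP; apply: measurableT_comp.
  rewrite ge0_integralZl//=; last by apply: fine_ge0; exact: integral_ge0.
    by rewrite lte_mul_pinfty// ?lee_fin ?fine_ge0 ?integral_ge0//; case/integrableP: pai.
  by apply/measurable_EFinP; apply: measurableT_comp.
exact: (Fubini Hi).
Qed.

(** The primitive of a merely integrable function is not differentiable
    everywhere, so the product rule is replaced by computing the integral of
    [g t * dp x] over the triangle [a < t < x < b] in both orders. *)
Lemma ibp_prim (a b : R) (g p dp : R -> R) : a < b -> itg `]a, b[ g ->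
  continuous dp -> (forall x : R, is_derive x 1 p (dp x)) ->
  \int[mu]_(x in `]a, b[) ((\int[mu]_(t in `]a, x[) g t) * dp x) =
  \int[mu]_(t in `]a, b[) (g t * (p b - p t)).
Proof.
move=> ab gi cdp pdp.
have mD : measurable (`]a, b[%classic : set R) by exact: measurable_itv.
pose ga := g \_ `]a, b[; pose pa := dp \_ `]a, b[.
have gai : itg setT ga.
  exact: integrable_patch.
have pai : itg setT pa.
  apply: integrable_patch => //.
  apply: (@integrableS _ _ _ mu `[a, b]%classic) => //; first exact: subset_itv_oo_cc.
  apply: continuous_compact_integrable; first exact: segment_compact.
  exact: continuous_subspaceT.
have F := @fubini_triangle pa ga pai gai; clear pai gai.
transitivity (fine (\int[mu]_x \int[mu]_y (pa x * ga y * (y < x)%R%:R)%:E))%E.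
  clear F.
  rewrite [LHS]/Rintegral; congr fine; rewrite integral_mkcond; apply: eq_integral => x _.
  rewrite restrict_EFin /= /patch; case: ifPn => [xD|xD].
    have [ax xb] : a < x /\ x < b by apply/andP; rewrite -mem_oo.
    rewrite -RintegralZr//; last first.
      apply: integrableS gi => // y /=; rewrite !in_itv/= => /andP[-> yx]/=.
      exact: lt_trans xb.
    rewrite /Rintegral fineK; last first.
      apply: integrable_fin_num => //.
      have : itg `]a, x[ (fun t => g t * dp x).
        apply: (@integrable_mulb _ _ _ `|dp x|) => //.
        apply: integrableS gi => // y /=; rewrite !in_itv/= => /andP[-> yx]/=.
        exact: lt_trans xb.
      by [].
    rewrite integral_mkcond; apply: eq_integral => t _.
    rewrite restrict_EFin /= /pa /ga /patch xD !mem_oo; congr EFin.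
    case: ifPn => [/andP[at' tx]|].
      by rewrite at' tx (lt_trans tx xb) mulr1 mulrC.
    rewrite -[point]/(0 : R); case: (ltP a t) => /= [_ /negbTE ->|_ _].
      by rewrite mulr0.
    by rewrite mulr0 mul0r.
  rewrite integral0_eq => [//|t _]; rewrite /= /pa /patch.
  by rewrite (negbTE xD) !mul0r.
rewrite F {F} [RHS]/Rintegral; congr fine; rewrite [RHS]integral_mkcond; apply: eq_integral => t _.
rewrite restrict_EFin /= /patch; case: ifPn => [tD|tD]; last first.
  rewrite integral0_eq => [//|x _]; rewrite /= /ga /patch.
  by rewrite (negbTE tD) mulr0 mul0r.
have [at' tb] : a < t /\ t < b by apply/andP; rewrite -mem_oo.
transitivity (\int[mu]_(x in `]t, b[) ((g t)%:E * (dp x)%:E))%E.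
  rewrite [RHS]integral_mkcond; apply: eq_integral => x _.
  rewrite /= /pa /ga /patch tD !mem_oo.
  rewrite -[point]/(0 : R); case: (ltP t x) => [tx|xt] /=; last first.
    by rewrite mulr0.
  rewrite (lt_trans at' tx) mulr1 /=.
  by case: ifPn => xb; rewrite ?mul0r// mulrC.
have dpi : itg `[t, b] dp.
  apply: continuous_compact_integrable; first exact: segment_compact.
  exact: continuous_subspaceT.
have dpi' : itg `]t, b[ dp by apply: integrableS dpi => //; exact: subset_itv_oo_cc.
rewrite integralZl// EFinM; congr (_ * _)%E.
transitivity (\int[mu]_(x in `[t, b]) (dp x)%:E)%E.
  rewrite integral_itv_bndo_bndc ?integral_itv_obnd_cbnd//.
    by apply: measurable_funS (measurable_int mu dpi) => //; exact: subset_itv_oc_cc.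
  exact: measurable_int dpi'.
rewrite (@continuous_FTC2 _ dp p t b)//.
- exact: continuous_subspaceT.
- have cp : continuous p.
    by move=> x; apply/differentiable_continuous/derivable1_diffP; have [] := pdp x.
  split; [by move=> x _; have [] := pdp x | |].
    exact/cvg_at_right_filter/cp.
  exact/cvg_at_left_filter/cp.
- by move=> x _; rewrite derive1E; exact: (@derive_val _ _ _ _ _ _ _ (pdp x)).
Qed.
End ibp.

(** * Integrals over bounded intervals *)

Section itv.
Context {R : realType}.
Notation mu := (@lebesgue_measure R).
Local Notation itg A f := (mu.-integrable A (EFin \o f)).

Lemma integrable_meas (A : set R) (f : R -> R) : itg A f -> measurable_fun A f.
Proof. by move=> fi; have /measurable_EFinP := measurable_int mu fi. Qed.

Lemma itgD (A : set R) (f g : R -> R) : measurable A ->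
  itg A f -> itg A g -> itg A (fun x => f x + g x).
Proof. by move=> mA; exact: integrableD. Qed.

Lemma itgB (A : set R) (f g : R -> R) : measurable A ->
  itg A f -> itg A g -> itg A (fun x => f x - g x).
Proof. by move=> mA; exact: integrableB. Qed.

Lemma itgZl (A : set R) (f : R -> R) (k : R) : measurable A ->
  itg A f -> itg A (fun x => k * f x).
Proof. by move=> mA; exact: integrableZl. Qed.

Lemma itgZr (A : set R) (f : R -> R) (k : R) : measurable A ->
  itg A f -> itg A (fun x => f x * k).
Proof.
move=> mA /(itgZl k mA); rewrite (_ : (fun x => k * f x) = (fun x => f x * k))//.
by apply/funext => x; rewrite mulrC.
Qed.

Lemma itg_cst (A : set R) (k : R) : measurable A -> (mu A < +oo)%E ->
  itg A (fun=> k).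
Proof. by move=> mA muA; apply: (@integrable_bdd _ _ _ `|k|). Qed.

Lemma ae_mono (P Q : R -> Prop) : (forall x, P x -> Q x) ->
  {ae mu, forall x, P x} -> {ae mu, forall x, Q x}.
Proof. by move=> PQ; apply: filterS => //; exact: (ae_filter_ringOfSetsType mu). Qed.

Lemma ae_and (P Q : R -> Prop) : {ae mu, forall x, P x} -> {ae mu, forall x, Q x} ->
  {ae mu, forall x, P x /\ Q x}.
Proof. by apply: filterI; exact: (ae_filter_ringOfSetsType mu). Qed.

Lemma mu_oo (a b : R) : a < b -> mu `]a, b[ = (b - a)%:E.
Proof. by move=> ab; rewrite lebesgue_measure_itv/= lte_fin ab EFinB. Qed.

Lemma Rint_cst_oo (a b : R) (r : R) : a < b ->
  \int[mu]_(x in `]a, b[) r = r * (b - a).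
Proof.
move=> ab; rewrite Rintegral_cst//; congr (_ * _).
by rewrite -[RHS]/(fine (b - a)%:E) -(mu_oo ab).
Qed.

Lemma mu_oo_lty (a b : R) : (mu `]a, b[ < +oo)%E.
Proof. by rewrite lebesgue_measure_itv/=; case: ifP; rewrite ?ltry// -EFinB ltry. Qed.

Lemma integrable_oo (a b : R) (f : R -> R) (M : R) :
  measurable_fun `]a, b[ f -> (forall x, a < x < b -> `|f x| <= M) -> itg `]a, b[ f.
Proof.
move=> mf fM; apply: (@integrable_bdd _ _ _ M) => //.
exact: mu_oo_lty.
Qed.

Lemma integrable_cont (a b : R) (f : R -> R) : continuous f -> itg `]a, b[ f.
Proof.
move=> cf; apply: (@integrableS _ _ _ mu `[a, b]%classic) => //.
  exact: subset_itv_oo_cc.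
apply: continuous_compact_integrable; first exact: segment_compact.
exact: continuous_subspaceT.
Qed.

Lemma is_derive_cont (p dp : R -> R) :
  (forall x : R, is_derive x 1 p (dp x)) -> continuous p.
Proof.
by move=> h x; apply/differentiable_continuous/derivable1_diffP; have [] := h x.
Qed.

Lemma Rint_oo_cc (a b : R) (f : R -> R) : itg `[a, b] f ->
  \int[mu]_(x in `]a, b[) f x = \int[mu]_(x in `[a, b]) f x.
Proof.
move=> fi; rewrite Rintegral_itv_bndo_bndc.
  rewrite Rintegral_itv_obnd_cbnd//.
  by apply: integrableS fi => //; exact: subset_itv_oc_cc.
by apply: integrableS fi => //; exact: subset_itv_oo_cc.
Qed.

Lemma Rint_FTC (a b : R) (p dp : R -> R) : a < b -> continuous dp ->
  (forall x : R, is_derive x 1 p (dp x)) ->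
  \int[mu]_(x in `]a, b[) dp x = p b - p a.
Proof.
move=> ab cdp pdp; have cp := is_derive_cont pdp.
rewrite Rint_oo_cc; last first.
  apply: continuous_compact_integrable; first exact: segment_compact.
  exact: continuous_subspaceT.
rewrite /Rintegral (@continuous_FTC2 _ dp p a b)//.
- exact: continuous_subspaceT.
- split; [by move=> x _; have [] := pdp x | |].
    exact/cvg_at_right_filter/cp.
  exact/cvg_at_left_filter/cp.
- by move=> x _; rewrite derive1E; exact: (@derive_val _ _ _ _ _ _ _ (pdp x)).
Qed.

Lemma Rint_bound (A : set R) (f : R -> R) (M : R) : measurable A -> (mu A < +oo)%E ->
  itg A f -> (forall x, A x -> `|f x| <= M) ->
  `|\int[mu]_(x in A) f x| <= M * fine (mu A).
Proof.
move=> mA muA fi fM; apply: le_trans; first exact: le_normr_Rintegral.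
rewrite -Rintegral_cst//; apply: le_Rintegral => //.
  exact: integrable_norm.
by apply: (@integrable_bdd _ _ _ `|M|) => //; exact: measurable_cst.
Qed.

Lemma Rint_co (f : R -> R) (a x : R) : itg setT f ->
  \int[mu]_(t in `]a, x[) f t = \int[mu]_(t in `[a, x]) f t.
Proof. by move=> fi; apply: Rint_oo_cc; apply: integrableS fi. Qed.

Lemma prim_sub (f : R -> R) (a x y : R) : itg setT f -> a <= x -> x <= y ->
  \int[mu]_(t in `]a, y[) f t - \int[mu]_(t in `]a, x[) f t = \int[mu]_(t in `]x, y]) f t.
Proof.
move=> fi ax xy; rewrite !Rint_co//; apply: Rintegral_itvB => //.
exact: integrableS fi.
Qed.

Lemma prim_cont (f : R -> R) (a b : R) : a < b -> itg setT f ->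
  {within `[a, b], continuous (fun x => \int[mu]_(t in `]a, x[) f t)}.
Proof.
move=> ab fi.
have -> : (fun x => \int[mu]_(t in `]a, x[) f t) =
  (fun x => parameterized_integral mu a x f).
  by apply/funext => x; rewrite Rint_co.
by apply: parameterized_integral_continuous; [exact: ltW | exact: integrableS fi].
Qed.

Lemma prim_bound (f : R -> R) (a b : R) : a < b -> itg setT f ->
  exists B, forall x, a < x < b -> `|\int[mu]_(t in `]a, x[) f t| <= B.
Proof.
move=> ab fi; pose U x := \int[mu]_(t in `]a, x[) f t.
have cU := prim_cont ab fi; rewrite -/U in cU.
have [c1 _ h1] := EVT_max (ltW ab) cU; have [c2 _ h2] := EVT_min (ltW ab) cU.
exists (`|U c1| + `|U c2|) => x /andP[ax xb].
have xab : x \in `[a, b] by rewrite in_itv/= !ltW.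
have := h1 x xab; have := h2 x xab; have := ler_norm (U c1).
have := ler_norm (- U c2); rewrite normrN; have := normr_ge0 (U c1); have := normr_ge0 (U c2).
by rewrite -/(U x) => *; rewrite ler_norml; apply/andP; split; lra.
Qed.

Lemma prim_lip (f : R -> R) (a M x y : R) : itg setT f ->
  (forall t, `|f t| <= M) -> a <= x -> x <= y ->
  `|\int[mu]_(t in `]a, y[) f t - \int[mu]_(t in `]a, x[) f t| <= M * (y - x).
Proof.
move=> fi fM ax xy; rewrite prim_sub//.
have muE : fine (mu `]x, y]) = y - x.
  rewrite lebesgue_measure_itv/= lte_fin; case: ltP => //= yx.
  by apply/esym/eqP; rewrite subr_eq0 eq_le yx xy.
rewrite -[X in _ * X]muE; apply: Rint_bound => //.
  by rewrite lebesgue_measure_itv/=; case: ifP; rewrite ?ltry// -EFinB ltry.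
exact: integrableS fi.
Qed.

(** Lebesgue differentiation: a primitive has its integrand as derivative
    almost everywhere. *)
Lemma prim_const_ae (f : R -> R) (a b C : R) : itg setT f ->
  (forall x, a < x < b -> \int[mu]_(t in `]a, x[) f t = C) ->
  {ae mu, forall x, a < x < b -> f x = 0}.
Proof.
move=> fi fC.
have lf : locally_integrable [set: R] f.
  by apply: open_integrable_locally => //; exact: openT.
have := @FTC1 _ f (BRight a) _ lf.
have h (y : R) : itg [set` Interval (BRight a) (BRight y)] f by exact: integrableS fi.
move=> /(_ h).
apply: filterS; first exact: (ae_filter_ringOfSetsType mu).
move=> x H /andP[ax xb]; have [|_ <-] := H; first by rewrite lte_fin.
rewrite derive1E.
rewrite (@near_eq_derive _ _ _ _ (cst C)).
- by rewrite derive_cst.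
- near=> y; rewrite -Rintegral_itv_bndo_bndc; last exact: integrableS fi.
  apply: fC; have : y \in `]a, b[ by near: y; apply: near_in_itvoo; rewrite in_itv/= ax.
  by rewrite in_itv.
Unshelve. all: by end_near. Qed.

End itv.

(** * The Fejer kernel *)

Section fejer.
Context {R : realType}.
Notation mu := (@lebesgue_measure R).
Local Notation itg A f := (mu.-integrable A (EFin \o f)).

Definition dirichlet (N : nat) (t : R) : R := 1 + 2 * \sum_(n < N) cos (n.+1%:R * t).
(** The usual Fejer kernel is [fejer N / N]; without the division the closed
    form [fejer_cos] holds for N = 0 too. *)
Definition fejer (N : nat) (t : R) : R := \sum_(n < N) dirichlet n t.

Lemma dirichlet_cos (N : nat) (t : R) :
  (1 - cos t) * dirichlet N t = cos (N%:R * t) - cos (N.+1%:R * t).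
Proof.
elim: N => [|N IH]; first by rewrite /dirichlet big_ord0 mul0r cos0 mul1r mulr0 addr0 mulr1.
have -> : dirichlet N.+1 t = dirichlet N t + 2 * cos (N.+1%:R * t).
  by rewrite /dirichlet big_ord_recr/= mulrDr addrA.
rewrite mulrDr IH.
have -> : N.+2%:R * t = N.+1%:R * t + t by rewrite -[in LHS]natr1 mulrDl mul1r.
rewrite cosD.
have -> : N%:R * t = N.+1%:R * t - t by rewrite -natr1 mulrDl mul1r addrK.
by rewrite cosB; ring.
Qed.

Lemma fejer_cos (N : nat) (t : R) : (1 - cos t) * fejer N t = 1 - cos (N%:R * t).
Proof.
elim: N => [|N IH]; first by rewrite /fejer big_ord0 mulr0 mul0r cos0 subrr.
by rewrite /fejer big_ord_recr/= mulrDr -/(fejer N t) IH dirichlet_cos; ring.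
Qed.

Lemma dirichlet_le (N : nat) (t : R) : `|dirichlet N t| <= 1 + 2 * N%:R.
Proof.
rewrite (le_trans (ler_normD _ _))// normr1 lerD2l normrM ger0_norm// ler_wpM2l//.
rewrite (le_trans (ler_norm_sum _ _ _))//.
rewrite (@le_trans _ _ (\sum_(n < N) 1))//; last by rewrite sumr_const card_ord.
by apply: ler_sum => i _; exact: cos_max.
Qed.

Lemma fejer_le (N : nat) (t : R) : `|fejer N t| <= N%:R ^+ 2.
Proof.
elim: N => [|N IH]; first by rewrite /fejer big_ord0 normr0 expr0n.
rewrite /fejer big_ord_recr/= (le_trans (ler_normD _ _))//.
rewrite (le_trans (lerD IH (dirichlet_le _ _)))// -natr1.
by rewrite le_eqVlt; apply/orP; left; apply/eqP; ring.
Qed.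

(** The left-hand side is the product of [fejer N t / N ^ 2], at most 1, and
    of [(1 - cos t) * fejer N t], at most 2. *)
Lemma fejer_sq (N : nat) (t : R) : (0 < N)%N ->
  (fejer N t / N%:R) ^+ 2 * (1 - cos t) <= 2.
Proof.
move=> N0; have N0' : (0 : R) < N%:R by rewrite ltr0n.
have -> : (fejer N t / N%:R) ^+ 2 * (1 - cos t) =
  (fejer N t / N%:R ^+ 2) * ((1 - cos t) * fejer N t) by rewrite exprMn exprVn; ring.
rewrite fejer_cos.
have h1 : `|fejer N t / N%:R ^+ 2| <= 1.
  rewrite normrM normfV ler_pdivrMr ?normr_gt0 ?expf_neq0 ?lt0r_neq0// mul1r.
  by rewrite (le_trans (fejer_le _ _))// ler_norm.
have h2 : 0 <= 1 - cos (N%:R * t) <= 2.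
  by rewrite subr_ge0 cos_le1 /= lerBlDr -lerBlDl; have := cos_geN1 (N%:R * t); lra.
have := ler_norm (fejer N t / N%:R ^+ 2); nra.
Qed.

Lemma fejer_cvg0 (t : R) : cos t != 1 -> (fejer N t / N%:R) @[N --> \oo] --> (0 : R).
Proof.
move=> ct.
have c1 : 0 < 1 - cos t by rewrite subr_gt0 lt_neqAle ct cos_le1.
have E N : fejer N t / N%:R = (1 - cos (N%:R * t)) / (1 - cos t) * N%:R^-1.
  by rewrite -fejer_cos [_ * fejer _ _]mulrC mulfK// gt_eqF.
apply/cvgrPdist_le => /= e e0; near=> N; rewrite sub0r normrN E.
have N0 : (0 : R) < N%:R by near: N; exact: nbhs_infty_gtr.
rewrite normrM normrM !normfV (gtr0_norm c1) (gtr0_norm N0) ler_pdivrMr// ler_pdivrMr//.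
apply: (@le_trans _ _ 2).
  rewrite ler_norml; have := cos_le1 (N%:R * t); have := cos_geN1 (N%:R * t); lra.
rewrite mulrAC -ler_pdivrMl ?mulr_gt0//.
by near: N; exact: nbhs_infty_ger.
Unshelve. all: by end_near. Qed.

(** Away from the nonzero multiples of 2 pi, [1 - cos t] controls t^2; with
    [fejer_sq] this bounds [t * fejer N t / N] uniformly in N. The constant is
    the smaller of one for |t| <= 1, where sine is at least [cos 1] times its
    argument, and one for larger t, where the cosine is monotone on each side
    of pi. *)
Lemma cos_quad (d : R) : 0 < d -> exists2 k : R, 0 < k &
  forall t, `|t| <= 2 * pi - d -> k * t ^+ 2 <= 1 - cos t.
Proof.
move=> d0.
have c1 : cos 1 < 1 :> R.
  rewrite -[ltRHS]cos0 ltr_cos ?in_itv/= ?ltr01 ?lexx ?pi_ge0 ?ler01//.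
  by have := @pi_ge2 R; lra.
pose d' := Num.min d pi.
have d'0 : 0 < d' by rewrite lt_min d0 pi_gt0.
have d'pi : d' <= pi by rewrite ge_min lexx orbT.
have d'd : d' <= d by rewrite ge_min lexx.
have cd : cos d' < 1.
  by rewrite -[ltRHS]cos0 ltr_cos ?in_itv/= ?lexx ?pi_ge0 ?(ltW d'0)//.
pose m := Num.min (1 - cos 1) (1 - cos d') : R.
have m0 : 0 < m by rewrite lt_min !subr_gt0 c1 cd.
have co0 := @cos1_gt0 R.
exists (Num.min (cos 1 ^+ 2 / 2) (m / (2 * pi) ^+ 2)).
  by rewrite lt_min !divr_gt0 ?exprn_gt0 ?mulr_gt0 ?pi_gt0.
move=> t; wlog t0 : t / 0 <= t => [H|].
  case: (leP 0 t) => [|t0 ht]; first exact: H.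
  by have := H (- t); rewrite normrN sqrrN cosN oppr_ge0 ltW//; apply.
rewrite ger0_norm// => td.
case: (leP t 1) => t1.
  apply: (@le_trans _ _ (cos 1 ^+ 2 / 2 * t ^+ 2)).
    by rewrite ler_wpM2r ?sqr_ge0// ge_min lexx.
  have : t / 2 * cos 1 <= sin (t / 2).
    have [t00|t00] := leP t 0.
      by have -> : t = 0 by [lra]; rewrite !mul0r sin0.
    have [| |c] := @MVT R sin cos 0 (t / 2).
    - by rewrite divr_gt0.
    - exact/continuous_subspaceT/continuous_sin.
    rewrite in_itv/= => /andP[cl cr]; rewrite sin0 !subr0 => ->.
    rewrite mulrC ler_wpM2r ?divr_ge0// ltW// ltr_cos ?in_itv/=.
    + lra.
    + have := @pi_ge2 R; lra.
    + have := @pi_ge2 R; lra.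
  have -> : cos t = 1 - 2 * sin (t / 2) ^+ 2.
    have {1}-> : t = t / 2 + t / 2 by field.
    by rewrite cosD -!expr2 cos2sin2; ring.
  have : 0 <= t / 2 * cos 1 by rewrite !mulr_ge0// ltW.
  nra.
have tm : m <= 1 - cos t.
  case: (leP t pi) => tpi.
    rewrite ge_min; apply/orP; left; rewrite lerD2l lerN2 ltW// ltr_cos ?in_itv//=; lra.
  rewrite ge_min; apply/orP; right; rewrite lerD2l lerN2.
  have -> : cos t = cos (2 * pi - t).
    by rewrite -cosN -(cosD2pi (- t)); congr cos; ring.
  case: (eqVneq d' (2 * pi - t)) => [->//|ne].
  by rewrite ltW// ltr_cos ?in_itv/= ?(ltW d'0) ?d'pi// ?lt_neqAle ?ne/=; lra.
apply: le_trans tm.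
apply: (@le_trans _ _ (m / (2 * pi) ^+ 2 * t ^+ 2)).
  by rewrite ler_wpM2r ?sqr_ge0// ge_min lexx orbT.
rewrite mulrAC ler_pdivrMr ?exprn_gt0 ?mulr_gt0 ?pi_gt0// ler_wpM2l ?(ltW m0)//.
by rewrite ler_sqr ?nnegrE//; [lra | have := @pi_ge0 R; lra].
Qed.
End fejer.

(** * Uniqueness of trigonometric coefficients *)

Section trig.
Context {R : realType}.
Notation mu := (@lebesgue_measure R).
Local Notation itg A f := (mu.-integrable A (EFin \o f)).

Lemma Rint_bounded_cvg (A : set R) (f_ : nat -> R -> R) (f : R -> R) (M : R) :
  measurable A -> (mu A < +oo)%E -> (forall n, measurable_fun A (f_ n)) ->
  (forall n x, A x -> `|f_ n x| <= M) ->
  (forall x, A x -> f_ ^~ x @ \oo --> f x) ->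
  itg A f /\ (fun n => \int[mu]_(x in A) f_ n x) @ \oo --> \int[mu]_(x in A) f x.
Proof.
move=> mA muA mf_ fM cf.
have mf : measurable_fun A f by apply: measurable_fun_cvg mf_ _.
have Mi : itg A (cst M) by apply: (@integrable_bdd _ _ _ `|M|).
have [] := @dominated_convergence _ _ _ mu A mA (fun n => EFin \o f_ n) (EFin \o f) (EFin \o cst M).
- by move=> n; apply/measurable_EFinP; exact: (mf_ n).
- exact/measurable_EFinP.
- by apply: aeW => x Ax; apply: cvg_EFin; [exact: nearW | exact: cf].
- exact: Mi.
- by apply: aeW => x n Ax; rewrite /= lee_fin; exact: fM.
move=> fi _ h; split => //.
by apply: fine_cvg; rewrite fineK//; exact: integrable_fin_num.
Qed.

Variables (a b : R).
Hypothesis ab : a < b.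
Let kap : R := 2 * pi / (b - a).

Let kap_gt0 : 0 < kap.
Proof. by rewrite /kap divr_gt0 ?subr_gt0// mulr_gt0// pi_gt0. Qed.

Let sin_ab n : sin (n%:R * kap * b) = sin (n%:R * kap * a).
Proof.
have -> : n%:R * kap * b = n%:R * kap * a + pi *+ 2 *+ n.
  rewrite -(mulr_natl _ n) -(mulr_natl _ 2) /kap; field.
  by rewrite subr_eq0 gt_eqF.
exact: (periodicn (@sinD2pi R)).
Qed.

Let cos_ab n : cos (n%:R * kap * b) = cos (n%:R * kap * a).
Proof.
have -> : n%:R * kap * b = n%:R * kap * a + pi *+ 2 *+ n.
  rewrite -(mulr_natl _ n) -(mulr_natl _ 2) /kap; field.
  by rewrite subr_eq0 gt_eqF.
exact: (periodicn (@cosD2pi R)).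
Qed.

Lemma cont_cosk (k : R) : continuous (fun x => cos (k * x)).
Proof.
apply: (@is_derive_cont _ _ (fun x => - (k * sin (k * x)))) => x.
by apply: is_derive_eq; rewrite /GRing.scale /=; ring.
Qed.

Lemma cont_sink (k : R) : continuous (fun x => sin (k * x)).
Proof.
apply: (@is_derive_cont _ _ (fun x => (k * cos (k * x)))) => x.
by apply: is_derive_eq; rewrite /GRing.scale /=; ring.
Qed.

Lemma derive_sink (k x : R) : k != 0 -> is_derive x 1 (fun x => sin (k * x) / k) (cos (k * x)).
Proof.
by move=> k0; apply: is_derive_eq; rewrite /GRing.scale /=; field.
Qed.

Lemma derive_cosk (k x : R) : k != 0 -> is_derive x 1 (fun x => - cos (k * x) / k) (sin (k * x)).
Proof.
by move=> k0; apply: is_derive_eq; rewrite /GRing.scale /=; field.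
Qed.

Let nk n : (0 < n)%N -> n%:R * kap != 0.
Proof. by move=> n0; rewrite mulf_neq0 ?(gt_eqF kap_gt0)// pnatr_eq0 -lt0n. Qed.

Let int_cos n : (0 < n)%N -> \int[mu]_(x in `]a, b[) cos (n%:R * kap * x) = 0.
Proof.
move=> n0; rewrite (Rint_FTC ab (@cont_cosk _) (fun x => derive_sink x (nk n0))).
by rewrite sin_ab subrr.
Qed.

Let int_sin n : (0 < n)%N -> \int[mu]_(x in `]a, b[) sin (n%:R * kap * x) = 0.
Proof.
move=> n0; rewrite (Rint_FTC ab (@cont_sink _) (fun x => derive_cosk x (nk n0))).
by rewrite cos_ab subrr.
Qed.

Section lip.
Variables (V : R -> R) (L : R).
Hypothesis mV : measurable_fun `]a, b[ V.
Hypothesis lipV : forall x y, a < x < b -> a < y < b -> `|V x - V y| <= L * `|x - y|.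
Hypothesis cosV : forall n, (0 < n)%N -> \int[mu]_(x in `]a, b[) (V x * cos (n%:R * kap * x)) = 0.
Hypothesis sinV : forall n, (0 < n)%N -> \int[mu]_(x in `]a, b[) (V x * sin (n%:R * kap * x)) = 0.

(** Fejer's argument at x0. Let W = V - V x0. Against the kernel centred at
    x0, whose mean is 1, the integral of W is that of W alone, because the
    nonconstant trigonometric coefficients of W vanish. On the other hand the
    normalized kernel tends to 0 away from x0, and near x0 it is at most a
    constant times 1 / |x - x0| while |W x| <= L |x - x0|. By bounded
    convergence W has mean 0. *)
Lemma lip_trig_const x0 : a < x0 < b -> V x0 = \int[mu]_(x in `]a, b[) V x / (b - a).
Proof.
move=> x0ab; have /andP[ax0 x0b] := x0ab.
have mD : measurable (`]a, b[%classic : set R) by [].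
pose W x := V x - V x0.
have L0 : 0 <= L.
  pose y := (x0 + b) / 2.
  have yab : a < y < b by rewrite /y; apply/andP; split; lra.
  have := lipV yab x0ab; have : 0 < `|y - x0| by rewrite normr_gt0 subr_eq0 /y; apply/eqP; lra.
  have := normr_ge0 (V y - V x0); nra.
have WM x : a < x < b -> `|W x| <= L * (b - a).
  move=> xab; apply: (le_trans (lipV xab x0ab)); rewrite ler_wpM2l//.
  by move: xab => /andP[? ?]; rewrite ler_norml; apply/andP; split; lra.
have mW : measurable_fun `]a, b[ W by apply: measurable_funB.
have Wi : itg `]a, b[ W by apply: integrable_oo WM.
have Vi : itg `]a, b[ V.
  have : itg `]a, b[ (fun x => W x + V x0).
    by apply: itgD => //; apply: itg_cst => //; exact: mu_oo_lty.
  by apply: eq_integrable => // x _; rewrite /= /W subrK.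
have Wg (g : R -> R) : continuous g -> itg `]a, b[ (fun x => W x * g x).
  move=> cg; rewrite (_ : (fun x => W x * g x) = (fun x => g x * W x)); last first.
    by apply/funext => x; rewrite mulrC.
  apply: (@integrable_mulb _ _ g W (L * (b - a))) => //.
  exact: integrable_cont.
have intW (g : R -> R) : continuous g -> \int[mu]_(x in `]a, b[) g x = 0 ->
    \int[mu]_(x in `]a, b[) (V x * g x) = 0 -> \int[mu]_(x in `]a, b[) (W x * g x) = 0.
  move=> cg g0 Vg0.
  have Vg : itg `]a, b[ (fun x => V x * g x).
    have : itg `]a, b[ (fun x => W x * g x + V x0 * g x).
      by apply: itgD => //; [exact: Wg | apply: itgZl => //; exact: integrable_cont].
    by apply: eq_integrable => // x _; rewrite /= /W; congr EFin; ring.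
  transitivity (\int[mu]_(x in `]a, b[) (V x * g x - V x0 * g x)).
    by apply: eq_Rintegral => x _; rewrite /W; ring.
  rewrite RintegralB//; last by apply: itgZl => //; exact: integrable_cont.
  by rewrite Vg0 RintegralZl// ?g0 ?mulr0 ?subr0//; exact: integrable_cont.
have shiftW n : (0 < n)%N -> \int[mu]_(x in `]a, b[) (W x * cos (n%:R * (kap * (x - x0)))) = 0.
  move=> n0; set A := cos (n%:R * kap * x0); set B := sin (n%:R * kap * x0).
  transitivity (\int[mu]_(x in `]a, b[) ((W x * cos (n%:R * kap * x)) * A + (W x * sin (n%:R * kap * x)) * B)).
    apply: eq_Rintegral => x _.
    have -> : n%:R * (kap * (x - x0)) = n%:R * kap * x - n%:R * kap * x0 by ring.
    by rewrite cosB -/A -/B; ring.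
  have iA := Wg _ (@cont_cosk (n%:R * kap)); have iB := Wg _ (@cont_sink (n%:R * kap)).
  rewrite RintegralD//; [|exact: itgZr|exact: itgZr].
  rewrite !RintegralZr// (intW _ (@cont_cosk _) (int_cos n0) (cosV n0)).
  by rewrite (intW _ (@cont_sink _) (int_sin n0) (sinV n0)) !mul0r addr0.
have cshift n : continuous (fun x => cos (n%:R * (kap * (x - x0)))).
  apply: (@is_derive_cont _ _ (fun x => - (n%:R * kap * sin (n%:R * (kap * (x - x0)))))) => x.
  by apply: is_derive_eq; rewrite /GRing.scale /=; ring.
have cdir N : continuous (fun x => dirichlet N (kap * (x - x0))).
  elim: N => [|N IH].
    rewrite (_ : (fun x => _) = cst 1); first exact: cst_continuous.
    by apply/funext => x; rewrite /dirichlet big_ord0 mulr0 addr0.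
  rewrite (_ : (fun x => _) = (fun x => dirichlet N (kap * (x - x0)) + 2 * cos (N.+1%:R * (kap * (x - x0))))).
    by move=> x; apply: cvgD; [exact: IH | apply: cvgM; [exact: cvg_cst | exact: cshift]].
  by apply/funext => x; rewrite /dirichlet big_ord_recr/= mulrDr addrA.
have cfej N : continuous (fun x => fejer N (kap * (x - x0))).
  elim: N => [|N IH].
    rewrite (_ : (fun x => _) = cst 0); first exact: cst_continuous.
    by apply/funext => x; rewrite /fejer big_ord0.
  rewrite (_ : (fun x => _) = (fun x => fejer N (kap * (x - x0)) + dirichlet N (kap * (x - x0)))).
    by move=> x; apply: cvgD; [exact: IH | exact: cdir].
  by apply/funext => x; rewrite /fejer big_ord_recr.
have intdir N : \int[mu]_(x in `]a, b[) (W x * dirichlet N (kap * (x - x0))) = \int[mu]_(x in `]a, b[) W x.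
  elim: N => [|N IH].
    by apply: eq_Rintegral => x _; rewrite /dirichlet big_ord0 mulr0 addr0 mulr1.
  rewrite -[RHS]addr0 -[in RHS]IH -[X in _ + X](mulr0 2) -(@shiftW N.+1)// -RintegralZl//; last exact: Wg.
  rewrite -RintegralD//; [|exact: Wg|]; last first.
    by apply: itgZl => //; exact: Wg.
  by apply: eq_Rintegral => x _; rewrite /dirichlet big_ord_recr/=; ring.
have intfej N : \int[mu]_(x in `]a, b[) (W x * fejer N (kap * (x - x0))) = N%:R * \int[mu]_(x in `]a, b[) W x.
  elim: N => [|N IH].
    rewrite mul0r; transitivity (\int[mu]_(x in `]a, b[) (0 : R)).
      by apply: eq_Rintegral => x _; rewrite /fejer big_ord0 mulr0.
    by rewrite Rintegral_cst// mul0r.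
  rewrite -natr1 mulrDl mul1r -IH -(intdir N) -RintegralD//; [|exact: Wg|exact: Wg].
  by apply: eq_Rintegral => x _; rewrite /fejer big_ord_recr/= mulrDr.
(* For x in ]a, b[ the angle kap (x - x0) stays away from 2 pi and - 2 pi. *)
have [k k0 hk] : exists2 k : R, 0 < k & forall x, a < x < b -> k * (kap * (x - x0)) ^+ 2 <= 1 - cos (kap * (x - x0)).
  have [|k k0 hk] := @cos_quad R (kap * Num.min (x0 - a) (b - x0)).
    by rewrite mulr_gt0// lt_min !subr_gt0 ax0.
  exists k => // x /andP[ax xb]; apply: hk.
  rewrite normrM (gtr0_norm kap_gt0).
  have -> : 2 * pi = kap * (b - a) by rewrite /kap divfK// subr_eq0 gt_eqF.
  rewrite -mulrBr ler_wpM2l ?(ltW kap_gt0)//.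
  have : Num.min (x0 - a) (b - x0) <= x0 - a by rewrite ge_min lexx.
  have : Num.min (x0 - a) (b - x0) <= b - x0 by rewrite ge_min lexx orbT.
  by move=> ? ?; rewrite ler_norml; apply/andP; split; lra.
suff W0 : \int[mu]_(x in `]a, b[) W x = 0.
  move: W0; rewrite RintegralB//; last by apply: (@integrable_oo _ _ _ _ `|V x0|).
  rewrite (Rint_cst_oo _ ab) => /eqP; rewrite subr_eq0 => /eqP ->.
  by rewrite mulfK// subr_eq0 gt_eqF.
have [] := @Rint_bounded_cvg `]a, b[ (fun N x => W x * (fejer N.+1 (kap * (x - x0)) / N.+1%:R)) (cst 0) (L / kap * (1 + 2 / k)) mD (mu_oo_lty _ _).
- by move=> N; apply: measurable_funM => //; apply: measurable_funM => //; apply: measurable_funTS; exact: continuous_measurable_fun.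
- move=> N x /=; rewrite in_itv/= => xab.
  set F := fejer N.+1 _ / _.
  have h1 := @fejer_sq R N.+1 (kap * (x - x0)) isT; rewrite -/F in h1.
  have h2 := hk x xab.
  have h3 : (F * (kap * (x - x0))) ^+ 2 <= 2 / k.
    by rewrite ler_pdivlMr// exprMn; have := sqr_ge0 F; nra.
  have h4 : `|F * (kap * (x - x0))| <= 1 + 2 / k.
    set Z := F * _ in h3 *; have := real_normK (num_real Z).
    by have := normr_ge0 Z; nra.
  rewrite normrM (le_trans (ler_wpM2r (normr_ge0 _) (lipV xab x0ab)))//.
  have -> : L * `|x - x0| * `|F| = L / kap * `|F * (kap * (x - x0))|.
    by rewrite (normrM F) (normrM kap) (gtr0_norm kap_gt0); field; rewrite gt_eqF.
  by rewrite ler_wpM2l// divr_ge0// ltW.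
- move=> x /=; rewrite in_itv/= => xab.
  have [->|xx0] := eqVneq x x0.
    rewrite /W subrr (_ : (fun n => _) = cst 0); first exact: cvg_cst.
    by apply/funext => n; rewrite mul0r.
  rewrite -[X in _ --> X](mulr0 (W x)); apply: cvgM; first exact: cvg_cst.
  rewrite (cvg_shiftS (fun N => fejer N (kap * (x - x0)) / N%:R)).
  apply: fejer_cvg0; apply/eqP => c1; have := hk x xab; rewrite c1 subrr.
  apply/negP; rewrite -ltNge mulr_gt0// exprn_even_gt0//= mulf_neq0// ?subr_eq0//.
  by rewrite gt_eqF.
move=> _; rewrite Rintegral_cst// mul0r => h.
have E : (fun N => \int[mu]_(x in `]a, b[) (W x * (fejer N.+1 (kap * (x - x0)) / N.+1%:R))) = cst (\int[mu]_(x in `]a, b[) W x).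
  apply/funext => N.
  transitivity (\int[mu]_(x in `]a, b[) (W x * fejer N.+1 (kap * (x - x0)) / N.+1%:R)).
    by apply: eq_Rintegral => x _; rewrite mulrA.
  by rewrite RintegralZr// ?intfej 1?mulrAC ?divff ?mul1r ?pnatr_eq0//; exact: Wg.
by rewrite E in h; apply: (cvg_unique _ (cvg_cst _) h).
Qed.
End lip.

Lemma patch_oo (f : R -> R) x : a < x < b -> (f \_ `]a, b[) x = f x.
Proof. by move=> xab; rewrite /patch mem_oo xab. Qed.

Lemma Rint_patch_oo (f : R -> R) x : x <= b ->
  \int[mu]_(t in `]a, x[) (f \_ `]a, b[) t = \int[mu]_(t in `]a, x[) f t.
Proof.
move=> xb; apply: eq_Rintegral => t; rewrite mem_oo => /andP[at' tx].
by rewrite patch_oo// at' (lt_le_trans tx xb).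
Qed.

Lemma derive_near_cst (F : R -> R) (C x : R) :
  (\forall y \near x, F y = C) -> derive1 F x = 0.
Proof.
move=> h; rewrite derive1E (@near_eq_derive _ _ _ _ (cst C))//.
by rewrite derive_cst.
Qed.

(** Two integrations reduce an integrable u to a Lipschitz function: the
    primitive U of u is bounded, and the primitive V of U minus its mean is
    Lipschitz. Integration by parts transports the vanishing of the
    coefficients from u to U and from U to V, so V is constant by
    [lip_trig_const]; then U is constant, and u vanishes almost everywhere. *)
Lemma trig_uniq (u : R -> R) : itg `]a, b[ u ->
  (forall n, \int[mu]_(x in `]a, b[) (u x * cos (n%:R * kap * x)) = 0) ->
  (forall n, \int[mu]_(x in `]a, b[) (u x * sin (n%:R * kap * x)) = 0) ->
  {ae mu, forall x, a < x < b -> u x = 0}.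
Proof.
move=> ui cosu sinu.
have mD : measurable (`]a, b[%classic : set R) by [].
have ui0 := integrable_patch mD ui.
set u0 := u \_ _ in ui0.
pose U x := \int[mu]_(t in `]a, x[) u0 t.
have cU := prim_cont ab ui0; rewrite -/U in cU.
have mU : measurable_fun `]a, b[ U.
  apply: (@measurable_funS _ _ _ _ `[a, b]%classic) => //; first exact: subset_itv_oo_cc.
  exact: subspace_continuous_measurable_fun.
have [M UM] := prim_bound ab ui0; rewrite -/U in UM.
have Ui : itg `]a, b[ U by apply: integrable_oo UM.
have u1 : \int[mu]_(x in `]a, b[) u x = 0.
  rewrite -[RHS](cosu 0%N); apply: eq_Rintegral => x _.
  by rewrite !mul0r cos0 mulr1.
have ug (g : R -> R) : continuous g -> (exists M, forall x, `|g x| <= M) -> itg `]a, b[ (fun x => u x * g x).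
  move=> cg [N gN]; apply: (@integrable_mulb _ _ u g N) => //.
  by apply: measurable_funTS; exact: continuous_measurable_fun.
have bsin (k : R) : exists M : R, forall x : R, `|sin (k * x)| <= M.
  by exists 1 => x; exact: sin_max.
have bcos (k : R) : exists M : R, forall x : R, `|cos (k * x)| <= M.
  by exists 1 => x; exact: cos_max.
have ibpU (p dp : R -> R) : continuous dp -> (forall x : R, is_derive x 1 p (dp x)) ->
    itg `]a, b[ (fun x => u x * p x) -> \int[mu]_(x in `]a, b[) (u x * p x) = 0 ->
    \int[mu]_(x in `]a, b[) (U x * dp x) = 0.
  move=> cdp pdp upi up0; transitivity (\int[mu]_(t in `]a, b[) (u t * (p b - p t))).
    rewrite -(ibp_prim ab ui cdp pdp); apply: eq_Rintegral => x; rewrite mem_oo => /andP[_ xb].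
    by rewrite /U Rint_patch_oo// ltW.
  transitivity (\int[mu]_(t in `]a, b[) (u t * p b - u t * p t)).
    by apply: eq_Rintegral => t _; rewrite mulrBr.
  by rewrite RintegralB//; [rewrite RintegralZr// u1 up0 mul0r subr0 | exact: itgZr].
have cosU n : (0 < n)%N -> \int[mu]_(x in `]a, b[) (U x * cos (n%:R * kap * x)) = 0.
  move=> n0; have us := ug _ (@cont_sink (n%:R * kap)) (bsin _).
  have E : (fun x => u x * (sin (n%:R * kap * x) / (n%:R * kap))) = (fun x => u x * sin (n%:R * kap * x) / (n%:R * kap)).
    by apply/funext => x; rewrite mulrA.
  apply: (ibpU _ _ (@cont_cosk _) (fun x => derive_sink x (nk n0))).
    by rewrite E; exact: itgZr.
  by rewrite E RintegralZr// sinu mul0r.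
have sinU n : (0 < n)%N -> \int[mu]_(x in `]a, b[) (U x * sin (n%:R * kap * x)) = 0.
  move=> n0; have us := ug _ (@cont_cosk (n%:R * kap)) (bcos _).
  have E : (fun x => u x * (- cos (n%:R * kap * x) / (n%:R * kap))) = (fun x => u x * cos (n%:R * kap * x) * (- (n%:R * kap)^-1)).
    by apply/funext => x; rewrite mulNr mulrN mulrN mulrA.
  apply: (ibpU _ _ (@cont_sink _) (fun x => derive_cosk x (nk n0))).
    by rewrite E; exact: itgZr.
  by rewrite E RintegralZr// cosu mul0r.
pose U0 := \int[mu]_(x in `]a, b[) U x / (b - a).
pose W := (fun x => U x - U0) \_ `]a, b[.
have cU0 : itg `]a, b[ (fun=> U0) by apply: itg_cst => //; exact: mu_oo_lty.
have WiD : itg `]a, b[ (fun x => U x - U0) by exact: itgB.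
have Wi : itg setT W by exact: integrable_patch.
have WM x : `|W x| <= M + `|U0|.
  rewrite /W /patch mem_oo; case: ifP => xab.
    by rewrite (le_trans (ler_normB _ _))// lerD2r; exact: UM.
  rewrite -[point]/(0 : R) normr0 addr_ge0//.
  have : a < (a + b) / 2 < b by rewrite !midf_lt.
  by move/UM; apply: le_trans.
have ba0 : b - a != 0 by rewrite subr_eq0 gt_eqF.
have W0 : \int[mu]_(x in `]a, b[) W x = 0.
  rewrite Rint_patch_oo// RintegralB// (Rint_cst_oo _ ab) /U0 divfK//.
  by rewrite subrr.
pose V x := \int[mu]_(t in `]a, x[) W t.
have cV := prim_cont ab Wi; rewrite -/V in cV.
have mV : measurable_fun `]a, b[ V.
  apply: (@measurable_funS _ _ _ _ `[a, b]%classic) => //; first exact: subset_itv_oo_cc.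
  exact: subspace_continuous_measurable_fun.
have lipV x y : a < x < b -> a < y < b -> `|V x - V y| <= (M + `|U0|) * `|x - y|.
  move=> /andP[ax xb] /andP[ay yb]; case: (leP x y) => xy.
    rewrite distrC (distrC x) [`|y - x|]ger0_norm ?subr_ge0//.
    exact: (prim_lip Wi WM (ltW ax) xy).
  rewrite [`|x - y|]ger0_norm ?subr_ge0 ?(ltW xy)//.
  exact: (prim_lip Wi WM (ltW ay) (ltW xy)).
have Ug (g : R -> R) : continuous g -> (exists M, forall x, `|g x| <= M) -> itg `]a, b[ (fun x => U x * g x).
  move=> cg [N gN]; apply: (@integrable_mulb _ _ U g N) => //.
  by apply: measurable_funTS; exact: continuous_measurable_fun.
have ibpV (p dp : R -> R) : continuous dp -> (forall x : R, is_derive x 1 p (dp x)) ->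
    itg `]a, b[ (fun x => U x * p x) -> \int[mu]_(x in `]a, b[) (U x * p x) = 0 ->
    \int[mu]_(x in `]a, b[) p x = 0 ->
    \int[mu]_(x in `]a, b[) (V x * dp x) = 0.
  move=> cdp pdp Upi Up0 p0; have cp := is_derive_cont pdp.
  have Wi' : itg `]a, b[ W by apply: integrableS Wi.
  have ip := integrable_cont a b cp.
  have E : {in `]a, b[%classic, (fun t => U t * p t - U0 * p t) =1 (fun t => W t * p t)}.
    by move=> t; rewrite mem_oo => tab; rewrite /W patch_oo//; ring.
  have Wp : itg `]a, b[ (fun t => W t * p t).
    have : itg `]a, b[ (fun t => U t * p t - U0 * p t) by apply: itgB => //; exact: itgZl.
    by apply: eq_integrable => // t tD /=; rewrite E.
  rewrite (ibp_prim ab Wi' cdp pdp).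
  transitivity (\int[mu]_(t in `]a, b[) (W t * p b - W t * p t)).
    by apply: eq_Rintegral => t _; rewrite mulrBr.
  rewrite RintegralB//; last exact: itgZr.
  rewrite RintegralZr// W0 mul0r sub0r -(eq_Rintegral mu E) RintegralB//; last exact: itgZl.
  by rewrite Up0 RintegralZl// p0 mulr0 subrr oppr0.
have cosV n : (0 < n)%N -> \int[mu]_(x in `]a, b[) (V x * cos (n%:R * kap * x)) = 0.
  move=> n0; have us := Ug _ (@cont_sink (n%:R * kap)) (bsin _).
  have E : (fun x => U x * (sin (n%:R * kap * x) / (n%:R * kap))) = (fun x => U x * sin (n%:R * kap * x) / (n%:R * kap)).
    by apply/funext => x; rewrite mulrA.
  apply: (ibpV _ _ (@cont_cosk _) (fun x => derive_sink x (nk n0))).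
  - by rewrite E; exact: itgZr.
  - by rewrite E RintegralZr// sinU// mul0r.
  - rewrite RintegralZr// ?int_sin ?mul0r//; exact/integrable_cont/cont_sink.
have sinV n : (0 < n)%N -> \int[mu]_(x in `]a, b[) (V x * sin (n%:R * kap * x)) = 0.
  move=> n0; have us := Ug _ (@cont_cosk (n%:R * kap)) (bcos _).
  have E : (fun x => U x * (- cos (n%:R * kap * x) / (n%:R * kap))) = (fun x => U x * cos (n%:R * kap * x) * (- (n%:R * kap)^-1)).
    by apply/funext => x; rewrite mulNr mulrN mulrN mulrA.
  apply: (ibpV _ _ (@cont_sink _) (fun x => derive_cosk x (nk n0))).
  - by rewrite E; exact: itgZr.
  - by rewrite E RintegralZr// cosU// mul0r.
  - transitivity (\int[mu]_(x in `]a, b[) (cos (n%:R * kap * x) * (- (n%:R * kap)^-1))).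
      by apply: eq_Rintegral => x _; rewrite mulNr mulrN.
    rewrite RintegralZr// ?int_cos ?mul0r//; exact/integrable_cont/cont_cosk.
have VC := lip_trig_const mV lipV cosV sinV.
have UC x : a < x < b -> U x = U0.
  move=> /andP[ax xb].
  have xab : x \in `]a, b[ by rewrite in_itv/= ax.
  have ctW : {for x, continuous W}.
    rewrite /prop_for /continuous_at {2}/W patch_oo ?ax//.
    have : (fun y => U y - U0) @ x --> U x - U0.
      apply: cvgB; last exact: cvg_cst.
      exact: (within_continuous_continuous ab cU).
    apply: cvg_trans; apply: near_eq_cvg; near=> y.
    rewrite /W patch_oo// -[_ && _]/(y \in `]a, b[); near: y; exact: near_in_itvoo.
  have Wib : itg [set` Interval (BRight a) (BRight b)] W by exact: integrableS Wi.
  have [_] := continuous_FTC1 xb Wib (a := BRight a) ax ctW.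
  rewrite (@derive_near_cst _ (\int[mu]_(x in `]a, b[) V x / (b - a))).
    by rewrite /W patch_oo ?ax// => /esym/eqP; rewrite subr_eq0 => /eqP.
  near=> y; have yab : a < y < b.
    by rewrite -[_ && _]/(y \in `]a, b[); near: y; exact: near_in_itvoo.
  rewrite -(VC y)// /V Rintegral_itv_bndo_bndc//.
  exact: integrableS Wi.
have := prim_const_ae (C := U0) ui0 UC.
apply: filterS; first exact: (ae_filter_ringOfSetsType mu).
by move=> x h xab; have := h xab; rewrite /u0 patch_oo.
Unshelve. all: by end_near. Qed.
End trig.

(** * Translations *)

Section shift.
Context {R : realType}.
Notation mu := (@lebesgue_measure R).
Local Notation itg A f := (mu.-integrable A (EFin \o f)).

Lemma measurable_shift (s : R) : measurable_fun [set: measurableTypeR R] (fun x : measurableTypeR R => (x + s : measurableTypeR R)).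
Proof. by apply: (@measurable_funD _ _ R setT id (cst s)). Qed.

(** A measure that agrees with Lebesgue measure on half-open intervals is
    Lebesgue measure. *)
Lemma shift_measure (s : R) (A : set R) : measurable A ->
  pushforward mu (fun x : measurableTypeR R => (x + s : measurableTypeR R)) A = mu A.
Proof.
move=> mA; apply/esym.
have ms := measurable_shift s.
pose f := HB.pack_for {mfun measurableTypeR R >-> measurableTypeR R} (fun x : measurableTypeR R => (x + s : measurableTypeR R)) (isMeasurableFun.Build _ _ _ _ _ ms).
apply: (@lebesgue_measure_unique R (pushforward mu f)) => //= _ [[a b]] _ <-.
rewrite /pushforward /= [X in _ = mu X](_ : _ = `]a - s, b - s]%classic); last first.
  by apply/seteqP; split => x /=; rewrite !in_itv/= ltrBlDr lerBrDr.
by rewrite !lebesgue_measure_itv/= !lte_fin ltrD2r; case: ifP => // _; rewrite -!EFinB; congr EFin; ring.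
Qed.

Lemma itg_shift (f : R -> R) (s : R) : itg setT f -> itg setT (fun x => f (x + s)).
Proof.
move=> fi; have mf := integrable_meas fi.
have ms := measurable_shift s.
apply/integrableP; split.
  by apply/measurable_EFinP; exact: (measurableT_comp mf ms).
case/integrableP : fi => _; apply: le_lt_trans.
rewrite -(ge0_integral_pushforward ms mu (D := setT) (f := fun x => `|(f x)%:E|%E)) //=.
- rewrite (@eq_measure_integral _ _ _ _ mu)// => A mA _; exact: shift_measure.
- by apply/measurable_EFinP; exact: measurableT_comp.
Qed.

Lemma Rint_shift (f : R -> R) (s : R) : itg setT f ->
  \int[mu]_x f (x + s) = \int[mu]_x f x.
Proof.
move=> fi; have mf := integrable_meas fi.
rewrite /Rintegral; congr fine.
have ms := measurable_shift s.
pose g := HB.pack_for {mfun measurableTypeR R >-> measurableTypeR R}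
  (fun x : measurableTypeR R => (x + s : measurableTypeR R)) (isMeasurableFun.Build _ _ _ _ _ ms).
transitivity (\int[pushforward mu g]_x (f x)%:E)%E.
  rewrite (integral_pushforward ms) //; [exact/measurable_EFinP | exact: itg_shift].
by apply: eq_measure_integral => A mA _; exact: shift_measure.
Qed.

Lemma ae_shift (P : R -> Prop) (s : R) : {ae mu, forall x, P x} -> {ae mu, forall x, P (x + s)}.
Proof.
move=> [N [mN N0 sub]].
exists ((fun x => x + s) @^-1` N); split.
- by rewrite -[X in measurable X]setTI; exact: measurable_shift.
- by rewrite -[LHS]/(pushforward mu (fun x : measurableTypeR R => (x + s : measurableTypeR R)) N) shift_measure.
- by move=> x /= h; apply: sub.
Qed.

Lemma Rint_ae_eq (D : set R) (f g : R -> R) : measurable D ->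
  measurable_fun D f -> measurable_fun D g -> {ae mu, forall x, D x -> f x = g x} ->
  \int[mu]_(x in D) f x = \int[mu]_(x in D) g x.
Proof.
move=> mD mf mg fg; rewrite /Rintegral; congr fine; apply: ae_eq_integral => //.
- exact/measurable_EFinP.
- exact/measurable_EFinP.
- by apply: ae_mono fg => x h Dx; congr EFin; exact: h.
Qed.

Lemma Rint_setT_oo (f : R -> R) (a b : R) : itg setT f ->
  (forall x, ~~ (a < x < b) -> f x = 0) -> \int[mu]_x f x = \int[mu]_(x in `]a, b[) f x.
Proof.
move=> fi f0; rewrite [RHS]Rintegral_mkcond; apply: eq_Rintegral => x _.
by rewrite /patch mem_oo; case: ifP => // /negbT /f0.
Qed.

Lemma Rint_shift_oo (f : R -> R) (a b s : R) : itg `]a + s, b + s[ f ->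
  itg `]a, b[ (fun x => f (x + s)) /\
  \int[mu]_(x in `]a, b[) f (x + s) = \int[mu]_(x in `]a + s, b + s[) f x.
Proof.
move=> fi; have fp := integrable_patch (measurable_itv _) fi.
have E : (fun x => (f \_ `]a + s, b + s[) (x + s)) = (fun x => f (x + s)) \_ `]a, b[.
  by apply/funext => x; rewrite /patch !mem_oo ltrD2r ltrD2r.
split.
  have := itg_shift s fp; rewrite E => h.
  have : itg `]a, b[ ((fun x => f (x + s)) \_ `]a, b[) by apply: integrableS h.
  by apply: eq_integrable => // x xD; rewrite /= /patch xD.
by rewrite [LHS]Rintegral_mkcond -E Rint_shift// [RHS]Rintegral_mkcond.
Qed.

End shift.

(** * A raised cosine bump *)

Section test.
Context {R : realType}.
Notation mu := (@lebesgue_measure R).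
Local Notation itg A f := (mu.-integrable A (EFin \o f)).

(** Differentiability at the points M and -M, where [bump M] vanishes to
    second order and changes its formula. *)
Lemma derive_quad0 (f : R -> R) (x K : R) : (forall y, `|f y - f x| <= K * (y - x) ^+ 2) ->
  is_derive x 1 f 0.
Proof.
move=> fK.
have h : (fun h : R => h^-1 *: (f (h *: 1 + x) - f x)) @ 0^' --> (0 : R).
  apply/cvgrPdist_le => /= e e0; near=> t; rewrite sub0r normrN.
  have t0 : t != 0 by near: t; exact: nbhs_dnbhs_neq.
  rewrite /GRing.scale/= mulr1 normrM normfV ler_pdivrMl ?normr_gt0//.
  rewrite (le_trans (fK _))// addrK -[t ^+ 2]real_normK ?num_real// expr2 mulrCA ler_wpM2l//.
  have : `|t| <= e / (1 + `|K|).
    by near: t; apply: dnbhs0_le; rewrite divr_gt0// ltr_pwDl.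
  rewrite ler_pdivlMr ?ltr_pwDl// mulrDr mulr1 => ht.
  have := ler_norm K; have := normr_ge0 t; nra.
by apply: DeriveDef; [apply/cvg_ex; exists 0 | apply/cvg_lim].
Unshelve. all: by end_near. Qed.

Lemma abs_sin_le (u : R) : `|sin u| <= `|u|.
Proof.
wlog u0 : u / 0 <= u => [H|].
  by case: (leP 0 u) => [/H//|u0]; rewrite -normrN -sinN -(normrN u); apply: H; rewrite oppr_ge0 ltW.
have cs : {within `[0, u], continuous (@sin R)} by exact/continuous_subspaceT/continuous_sin.
have [c _] := @MVT_segment R sin cos 0 u u0 (fun x _ => is_derive_sin x) cs.
rewrite sin0 !subr0 => ->; rewrite normrM ler_piMl//; exact: cos_max.
Qed.

Lemma cos_quad_le (u : R) : 1 - cos u <= u ^+ 2.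
Proof.
have -> : cos u = 1 - 2 * sin (u / 2) ^+ 2.
  have {1}-> : u = u / 2 + u / 2 by field.
  by rewrite cosD -!expr2 cos2sin2; ring.
have := abs_sin_le (u / 2); set s := sin _ => h.
have : s ^+ 2 <= (u / 2) ^+ 2.
  by rewrite -[s ^+ 2]real_normK ?num_real// -[(u / 2) ^+ 2]real_normK ?num_real// lerXn2r ?nnegrE.
nra.
Qed.

Definition clamp (M x : R) : R := Num.max (- M) (Num.min M x).
(** A cosine raised to be nonnegative on [-M, M] and extended by 0, the clamp
    freezing it at its value 0. Its products with C^1 functions are test
    functions, it is positive inside, and its translates by M add up to 2,
    which [wderiv_period] exploits. *)
Definition bump (M x : R) : R := 1 + cos (pi / M * clamp M x).
Definition dbump (M x : R) : R := - (pi / M) * sin (pi / M * clamp M x).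

Lemma clamp_cont M : continuous (clamp M).
Proof.
move=> x; apply: (@continuous_max _ _ (cst (- M)) (fun x => Num.min M x)).
  exact: cst_continuous.
by apply: (@continuous_min _ _ (cst M) id); [exact: cst_continuous | exact: id].
Qed.

Lemma bump_cont M : continuous (bump M).
Proof.
move=> x; apply: cvgD; first exact: cvg_cst.
apply: (@continuous_comp _ _ _ (clamp M) (fun y => cos (pi / M * y))); first exact: clamp_cont.
exact: cont_cosk.
Qed.

Lemma dbump_cont M : continuous (dbump M).
Proof.
move=> x; apply: cvgM; first exact: cvg_cst.
apply: (@continuous_comp _ _ _ (clamp M) (fun y => sin (pi / M * y))); first exact: clamp_cont.
exact: cont_sink.
Qed.

Section M.
Variable M : R.
Hypothesis M0 : 0 < M.

Lemma clamp_in x : `|x| <= M -> clamp M x = x.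
Proof. by rewrite ler_norml => /andP[h1 h2]; rewrite /clamp (min_idPr _)// (max_idPr _). Qed.

Lemma clamp_ge x : M <= x -> clamp M x = M.
Proof.
move=> h; rewrite /clamp (min_idPl _)// (max_idPr _)//.
by rewrite (@le_trans _ _ 0)// ?oppr_le0 ltW.
Qed.

Lemma clamp_le x : x <= - M -> clamp M x = - M.
Proof.
move=> h; rewrite /clamp (min_idPr _); first by rewrite (max_idPl _).
by rewrite (le_trans h)// (@le_trans _ _ 0)// ?oppr_le0 ltW.
Qed.

Lemma bump_out x : M <= `|x| -> bump M x = 0 /\ dbump M x = 0.
Proof.
have piM : pi / M * M = pi by rewrite divfK ?gt_eqF.
rewrite /bump /dbump ler_normr => /orP[h|h].
  by rewrite clamp_ge// piM cospi sinpi mulr0 subrr.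
rewrite clamp_le; last by rewrite lerNr.
by rewrite mulrN piM cosN sinN cospi sinpi oppr0 mulr0 subrr.
Qed.

Lemma bump_in x : `|x| <= M -> bump M x = 1 + cos (pi / M * x).
Proof. by move=> h; rewrite /bump clamp_in. Qed.

Lemma bump_gt0 x : `|x| < M -> 0 < bump M x.
Proof.
move=> xM; rewrite bump_in ?(ltW xM)//.
have -> : pi / M * x = pi / M * x / 2 + pi / M * x / 2 by field; rewrite gt_eqF.
rewrite cosD -!expr2 sin2cos2; set t := _ / 2.
have : 0 < cos t.
  apply: cos_gt0_pihalf; rewrite -ltr_norml /t normrM normrM [`|2^-1|]gtr0_norm// [`|pi / M|]gtr0_norm ?divr_gt0 ?pi_gt0//.
  by rewrite ltr_pM2r// mulrAC ltr_pdivrMr// ltr_pM2l// pi_gt0.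
nra.
Qed.

Lemma bump_derive (x : R) : is_derive x 1 (bump M) (dbump M x).
Proof.
have d0 : 0 < pi / M by rewrite divr_gt0 ?pi_gt0.
have [xM|xM|xM] := ltgtP `|x| M.
- apply: (@near_eq_is_derive _ _ _ (fun y => 1 + cos (pi / M * y))).
    near=> y; rewrite bump_in// ltW//; near: y.
    have : x \in `](- M), M[ by rewrite in_itv/= -ltr_norml.
    move=> /near_in_itvoo; apply: filterS => y; rewrite in_itv/= -ltr_norml//.
  rewrite /dbump clamp_in ?(ltW xM)//.
  by apply: is_derive_eq; rewrite /GRing.scale /=; ring.
- have [_ ->] := bump_out (ltW xM).
  apply: (@near_eq_is_derive R R R (cst 0) _ x 1 0).
  near=> y; rewrite (bump_out _).1//; rewrite ltW//; near: y.
  have : (fun y : R => `|y|) @ x --> `|x| by exact: norm_continuous.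
  by move=> /cvgr_gt; apply.
- have [|b0 ->] := @bump_out x; first by rewrite xM.
  apply: (@derive_quad0 _ _ ((pi / M) ^+ 2)) => y; rewrite b0 subr0.
  have [yM|yM] := leP M `|y|.
    by have [-> _] := bump_out yM; rewrite normr0 mulr_ge0 ?sqr_ge0.
  rewrite bump_in ?(ltW yM)// ger0_norm; last by have := cos_geN1 (pi / M * y); lra.
  have piM : pi / M * M = pi by rewrite divfK ?gt_eqF.
  have [x0|x0] := leP 0 x.
    rewrite ger0_norm// in xM; rewrite xM -exprMn mulrBr piM.
    apply: le_trans (cos_quad_le _).
    by rewrite cosB cospi sinpi mulr0 addr0 mulrN1 opprK.
  rewrite ltr0_norm// in xM; have -> : x = - M by rewrite -xM opprK.
  rewrite opprK -exprMn mulrDr piM.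
  apply: le_trans (cos_quad_le _).
  by rewrite cosDpi opprK.
Unshelve. all: by end_near. Qed.

Lemma test_bump (g dg : R -> R) : (forall x : R, is_derive x 1 g (dg x)) -> continuous dg ->
  test_function (fun x => bump M x * g x) /\
  derive1 (fun x => bump M x * g x) = (fun x => dbump M x * g x + bump M x * dg x).
Proof.
move=> hg cdg; have cg := is_derive_cont hg.
have hd (x : R) : is_derive x 1 (fun x => bump M x * g x) (dbump M x * g x + bump M x * dg x).
  have h1 := bump_derive x; have h2 := hg x.
  by apply: is_derive_eq; rewrite /GRing.scale /=; ring.
have E : derive1 (fun x => bump M x * g x) = (fun x => dbump M x * g x + bump M x * dg x).
  by apply/funext => x; rewrite derive1E; exact: (@derive_val _ _ _ _ _ _ _ (hd x)).
split=> //; split.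
- by move=> x; have [] := hd x.
- rewrite E => x; apply: cvgD; apply: cvgM; [exact: dbump_cont|exact: cg|exact: bump_cont|exact: cdg].
- by exists M => x xM; have [-> _] := bump_out (ltW xM); rewrite mul0r.
Qed.
End M.
End test.

(** * Weak derivatives on the line *)

Section wd.
Context {R : realType}.
Notation mu := (@lebesgue_measure R).
Local Notation itg A f := (mu.-integrable A (EFin \o f)).
Local Notation loc f := (locally_integrable setT f).

Lemma loc_meas (f : R -> R) : loc f -> measurable_fun setT f.
Proof. by case. Qed.

Lemma loc_itg_cc (f : R -> R) a b : loc f -> itg `[a, b] f.
Proof.
move=> [mf _ h]; apply/integrableP; split.
  by apply/measurable_EFinP; exact: measurable_funTS.
by apply: h => //; exact: segment_compact.
Qed.

Lemma loc_itg (f : R -> R) a b : loc f -> itg `]a, b[ f.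
Proof.
move=> lf; apply: (@integrableS _ _ _ mu `[a, b]%classic) => //.
  exact: subset_itv_oo_cc.
exact: loc_itg_cc.
Qed.

Lemma itg_loc (f : R -> R) : measurable_fun setT f ->
  (forall N : nat, itg `[- N%:R, N%:R] f) -> loc f.
Proof.
move=> mf h; split => //; first exact: openT.
move=> K _ cK; have [M [_ KM]] := compact_bounded cK.
pose N := Num.bound (`|M| + 1).
have NM : `|M| + 1 < N%:R by apply: archi_boundP; rewrite addr_ge0.
have KN : K `<=` `[- N%:R, N%:R]%classic.
  move=> x Kx /=; rewrite in_itv/= -ler_norml.
  apply: le_trans (ltW NM); apply: KM => //.
  by rewrite (le_lt_trans (ler_norm M))// ltrDl.
have [_ hN] := integrableP _ _ _ (h N).
apply: le_lt_trans hN.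
apply: ge0_subset_integral => //; first exact: compact_measurable.
by apply/measurable_EFinP; apply: measurableT_comp => //; exact: measurable_funTS.
Qed.

Lemma cont_bounded (f : R -> R) a b : continuous f ->
  exists K, forall x, a <= x <= b -> `|f x| <= K.
Proof.
move=> cf; have [ab|ab] := leP a b; last first.
  by exists 0 => x /andP[ax xb]; move: (le_trans ax xb); rewrite leNgt ab.
have cs : {within `[a, b], continuous f} by exact: continuous_subspaceT.
have [c1 _ h1] := EVT_max ab cs; have [c2 _ h2] := EVT_min ab cs.
exists (`|f c1| + `|f c2|) => x xab.
have xi : x \in `[a, b] by rewrite in_itv.
have := h1 x xi; have := h2 x xi; have := ler_norm (f c1).
have := ler_norm (- f c2); rewrite normrN; have := normr_ge0 (f c1); have := normr_ge0 (f c2).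
by move=> *; rewrite ler_norml; apply/andP; split; lra.
Qed.

Lemma itg_mul_cont (f g : R -> R) a b : itg `]a, b[ f -> continuous g ->
  itg `]a, b[ (fun x => f x * g x).
Proof.
move=> fi cg; have [K gK] := cont_bounded a b cg.
apply: (@integrable_mulb _ _ f g K) => //.
  by apply: measurable_funTS; exact: continuous_measurable_fun.
by move=> x /=; rewrite in_itv/= => /andP[ax xb]; apply: gK; rewrite !ltW.
Qed.

Lemma loc_supp (f g : R -> R) a b : loc f -> continuous g ->
  (forall x, ~~ (a < x < b) -> g x = 0) ->
  itg setT (fun x => f x * g x) /\
  \int[mu]_x (f x * g x) = \int[mu]_(x in `]a, b[) (f x * g x).
Proof.
move=> lf cg g0; have fg := itg_mul_cont (loc_itg a b lf) cg.
have fi : itg setT (fun x => f x * g x).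
  rewrite (_ : (fun x => f x * g x) = (fun x => f x * g x) \_ `]a, b[).
    exact: integrable_patch.
  by apply/funext => x; rewrite /patch mem_oo; case: ifP => // /negbT /g0 ->; rewrite mulr0.
by split=> //; apply: Rint_setT_oo => // x /g0 ->; rewrite mulr0.
Qed.

Lemma test_cont (p : R -> R) : test_function p -> continuous p /\ continuous (derive1 p).
Proof.
move=> [dp cdp _]; split=> //.
by move=> x; apply/differentiable_continuous/derivable1_diffP.
Qed.

Lemma test_is_derive (p : R -> R) : test_function p -> forall x : R, is_derive x 1 p (derive1 p x).
Proof. by move=> [dp _ _] x; apply: DeriveDef; [exact: dp | rewrite derive1E]. Qed.

Lemma test_supp (p : R -> R) : test_function p -> exists2 M, 0 < M &
  forall x, M <= `|x| -> p x = 0 /\ derive1 p x = 0.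
Proof.
move=> [dp cdp [M hM]]; exists (`|M| + 1); first by rewrite ltr_wpDl.
move=> x xM; have Mx : M < `|x|.
  by apply: lt_le_trans xM; rewrite (le_lt_trans (ler_norm M))// ltrDl.
split; first exact: hM.
apply: (derive_near_cst (C := 0)); near=> y; apply: hM; near: y.
have : (fun y : R => `|y|) @ x --> `|x| by exact: norm_continuous.
by move=> /cvgr_gt; apply.
Unshelve. all: by end_near. Qed.

Lemma supp_oo (g : R -> R) M a b : a <= - M -> M <= b -> (forall x, M <= `|x| -> g x = 0) ->
  forall x, ~~ (a < x < b) -> g x = 0.
Proof.
move=> aM Mb h x; rewrite negb_and -!leNgt => /orP[h1|h1]; apply: h.
  by rewrite ler_normr lerNr (le_trans h1 aM) orbT.
by rewrite ler_normr (le_trans Mb h1).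
Qed.

(** Test functions [bump M * cos] and [bump M * sin] annihilate (g1 - g2) *
    [bump M], whose trigonometric coefficients on ]-M, M[ are thus all 0;
    [trig_uniq] concludes, since the bump is positive there. *)
Lemma wderiv_uniq (f g1 g2 : R -> R) : is_wderiv f g1 -> is_wderiv f g2 ->
  {ae mu, forall x, g1 x = g2 x}.
Proof.
move=> [lf lg1 h1] [_ lg2 h2].
suff H (n : nat) : {ae mu, forall x, - n.+1%:R < x < n.+1%:R -> g1 x = g2 x}.
  have := ae_foralln H; apply: ae_mono => x hx.
  have xb := archi_boundP (normr_ge0 x).
  have x0 : `|x| < (Num.bound `|x|).+1%:R by rewrite (lt_trans xb)// ltr_nat.
  by apply: (hx (Num.bound `|x|)); rewrite -ltr_norml.
set M : R := n.+1%:R; have M0 : 0 < M by rewrite ltr0n.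
have MM : - M < M by rewrite gtrN.
have key (g dg : R -> R) : (forall x : R, is_derive x 1 g (dg x)) -> continuous dg ->
    \int[mu]_(x in `]- M, M[) ((g1 x - g2 x) * bump M x * g x) = 0.
  move=> hg cdg; have [tb _] := test_bump M0 hg cdg.
  have cb : continuous (fun x => bump M x * g x) by have [] := test_cont tb.
  have supp (x : R) : ~~ (- M < x < M) -> bump M x * g x = 0.
    apply: (@supp_oo (fun x => bump M x * g x) M) => // y yM.
    by have [-> _] := bump_out M0 yM; rewrite mul0r.
  have [_ E1] := loc_supp lg1 cb supp; have [_ E2] := loc_supp lg2 cb supp.
  have : \int[mu]_x (g1 x * (bump M x * g x)) = \int[mu]_x (g2 x * (bump M x * g x)).
    by apply: oppr_inj; rewrite -(h1 _ tb) -(h2 _ tb).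
  rewrite E1 E2 => E.
  transitivity (\int[mu]_(x in `]- M, M[) (g1 x * (bump M x * g x) - g2 x * (bump M x * g x))).
    by apply: eq_Rintegral => x _; ring.
  by rewrite RintegralB// ?E ?subrr//; apply: itg_mul_cont => //; exact: loc_itg.
have ui : itg `]- M, M[ (fun x => (g1 x - g2 x) * bump M x).
  apply: itg_mul_cont; last exact: bump_cont.
  by apply: itgB => //; exact: loc_itg.
pose kap := 2 * pi / (M - - M).
have Hc m : \int[mu]_(x in `]- M, M[) ((g1 x - g2 x) * bump M x * cos (m%:R * kap * x)) = 0.
  apply: (key _ (fun x => - (m%:R * kap * sin (m%:R * kap * x)))) => [x|].
    by apply: is_derive_eq; rewrite /GRing.scale /=; ring.
  by move=> x; apply: cvgN; apply: cvgM; [exact: cvg_cst | exact: cont_sink].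
have Hs m : \int[mu]_(x in `]- M, M[) ((g1 x - g2 x) * bump M x * sin (m%:R * kap * x)) = 0.
  apply: (key _ (fun x => (m%:R * kap * cos (m%:R * kap * x)))) => [x|].
    by apply: is_derive_eq; rewrite /GRing.scale /=; ring.
  by move=> x; apply: cvgM; [exact: cvg_cst | exact: cont_cosk].
have := trig_uniq MM ui Hc Hs; apply: ae_mono => x.
move=> h /[dup] xM; rewrite -ltr_norml => /(bump_gt0 M0) b0.
by have /eqP := h xM; rewrite mulf_eq0 (gt_eqF b0) orbF subr_eq0 => /eqP.
Qed.

Lemma loc_ae (f g : R -> R) : loc f -> measurable_fun setT g ->
  {ae mu, forall x, f x = g x} -> loc g.
Proof.
move=> [mf _ h] mg fg; split => //; first exact: openT.
move=> K KT cK; have -> : (\int[mu]_(x in K) `|g x|%:E = \int[mu]_(x in K) `|f x|%:E)%E; last exact: h.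
apply: ae_eq_integral.
- exact: compact_measurable.
- by apply/measurable_EFinP; apply: measurableT_comp => //; exact: measurable_funTS.
- by apply/measurable_EFinP; apply: measurableT_comp => //; exact: measurable_funTS.
- by apply: ae_mono fg => x -> _.
Qed.

Lemma is_wderiv_ae (f f' g g' : R -> R) : is_wderiv f g ->
  measurable_fun setT f' -> measurable_fun setT g' ->
  {ae mu, forall x, f x = f' x} -> {ae mu, forall x, g x = g' x} -> is_wderiv f' g'.
Proof.
move=> [lf lg h] mf' mg' ff gg; split; [exact: loc_ae ff|exact: loc_ae gg|].
move=> p tp; have [cp cdp] := test_cont tp.
have mp : measurable_fun setT p by exact: continuous_measurable_fun.
have mdp : measurable_fun setT (derive1 p) by exact: continuous_measurable_fun.
have mf := loc_meas lf; have mg := loc_meas lg.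
rewrite -(@Rint_ae_eq _ setT (fun x => f x * derive1 p x)) ?h//.
- congr (- _); apply: Rint_ae_eq => //; [exact: measurable_funM|exact: measurable_funM|].
  by apply: ae_mono gg => x ->.
- exact: measurable_funM.
- exact: measurable_funM.
- by apply: ae_mono ff => x ->.
Qed.

Lemma test_shift (p : R -> R) s : test_function p ->
  test_function (fun x => p (x - s)) /\
  derive1 (fun x => p (x - s)) = (fun x => derive1 p (x - s)).
Proof.
move=> tp; have [cp cdp] := test_cont tp; have hd := test_is_derive tp.
have h (x : R) : is_derive x 1 (fun x : R => p (x - s)) (derive1 p (x - s)).
  have h1 := hd (x - s).
  have := @is_derive1_comp R p (fun x => x - s) x (derive1 p (x - s)) 1 h1.
  by rewrite mulr1; apply; apply: is_derive_eq; rewrite subr0.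
have E : derive1 (fun x => p (x - s)) = (fun x => derive1 p (x - s)).
  by apply/funext => x; rewrite [LHS]derive1E; exact: (@derive_val _ _ _ _ _ _ _ (h x)).
split; last exact: E.
split.
- by move=> x; have [] := h x.
- rewrite E => x; apply: (@continuous_comp _ _ _ (fun x => x - s)); last exact: cdp.
  by apply: cvgB; [exact: cvg_id | exact: cvg_cst].
- have [M M0 hM] := test_supp tp; exists (M + `|s|) => x xM.
  have xs : M <= `|x - s| by have := lerB_dist x s; lra.
  by have [-> _] := hM _ xs.
Qed.

Lemma loc_shift (f : R -> R) s : loc f -> loc (fun x => f (x + s)).
Proof.
move=> lf; apply: itg_loc.
  exact: (measurableT_comp (loc_meas lf) (measurable_shift s)).
move=> N; have [h _] := @Rint_shift_oo _ f (- N%:R - 1) (N%:R + 1) s (loc_itg _ _ lf).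
apply: integrableS h => // x /=; rewrite !in_itv/=; lra.
Qed.

Lemma is_wderiv_shift (f g : R -> R) s : is_wderiv f g ->
  is_wderiv (fun x => f (x + s)) (fun x => g (x + s)).
Proof.
move=> [lf lg h]; split; [exact: loc_shift | exact: loc_shift |].
move=> p tp; have [tps E] := test_shift s tp.
have [M M0 hM] := test_supp tps; have [cp cdp] := test_cont tps.
have := h _ tps.
have [i1 _] := loc_supp lf cdp (supp_oo (lexx _) (lexx _) (fun x xM => (hM x xM).2)).
have [i2 _] := loc_supp lg cp (supp_oo (lexx _) (lexx _) (fun x xM => (hM x xM).1)).
rewrite -(Rint_shift s i1) -(Rint_shift s i2) E.
under eq_Rintegral do rewrite addrK.
by under [X in _ = - X]eq_Rintegral do rewrite addrK.
Qed.

(** A weak derivative is known up to a null set only, and so is its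
    periodicity. *)
Definition aeper (T : R) (f : R -> R) := {ae mu, forall x, f (x + T) = f x}.

Lemma wderiv_aeper T (f g : R -> R) : is_wderiv f g -> aeper T f -> aeper T g.
Proof.
move=> fg pf; have := is_wderiv_shift T fg => fgT.
have [lf lg _] := fg; have [lfT lgT _] := fgT.
have := is_wderiv_ae fgT (loc_meas lf) (loc_meas lgT) pf (aeW _ (fun=> erefl)).
by move=> h; exact: wderiv_uniq h fg.
Qed.

End wd.

(** * Weak derivatives of periodic functions *)

Section fold.
Context {R : realType}.
Notation mu := (@lebesgue_measure R).
Local Notation itg A f := (mu.-integrable A (EFin \o f)).
Local Notation loc f := (locally_integrable setT f).

Lemma Rint_sumn (D : set R) (k : nat) (F : nat -> R -> R) : measurable D ->
  (forall n, itg D (F n)) -> itg D (fun x => \sum_(n < k) F n x) /\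
  \int[mu]_(x in D) (\sum_(n < k) F n x) = \sum_(n < k) \int[mu]_(x in D) F n x.
Proof.
move=> mD Fi; elim: k => [|k [IHi IH]].
  rewrite big_ord0 (_ : (fun x => _) = (fun=> 0)); last by apply/funext => x; rewrite big_ord0.
  split; first exact: (@integrable0 _ _ _ mu).
  by rewrite /Rintegral integral0.
rewrite big_ord_recr/= -IH -RintegralD//.
rewrite (_ : (fun x => _) = (fun x => \sum_(n < k) F n x + F k x)); last first.
  by apply/funext => x; rewrite big_ord_recr.
by split=> //; apply: itgD.
Qed.

Lemma Rint_split (h : R -> R) (a T : R) (k : nat) : itg setT h -> 0 < T ->
  \int[mu]_(x in `]a, a + k%:R * T[) h x =
  \sum_(n < k) \int[mu]_(x in `]0, T[) h (x + (a + n%:R * T)).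
Proof.
move=> hi T0; elim: k => [|k IH].
  rewrite big_ord0 mul0r addr0 set_itv_ge ?Rintegral_set0//.
  by rewrite -leNgt bnd_simp.
rewrite big_ord_recr/= -IH; apply/eqP; rewrite addrC -subr_eq; apply/eqP.
rewrite prim_sub//; last 2 first.
- by rewrite lerDl mulr_ge0// ltW.
- by rewrite lerD2l ler_wpM2r ?ler_nat// ltW.
rewrite -Rintegral_itv_bndo_bndc; last exact: integrableS hi.
have [|_ ->] := @Rint_shift_oo _ h 0 T (a + k%:R * T); first exact: integrableS hi.
by rewrite add0r; congr (Rintegral _ _ _); apply/seteqP; split => x /=; rewrite !in_itv/= -natr1 mulrDl mul1r;
  rewrite (_ : a + (k%:R * T + T) = T + (a + k%:R * T))//; ring.
Qed.

Lemma aepern T (f : R -> R) (n : nat) : aeper T f -> {ae mu, forall x, f (x + n%:R * T) = f x}.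
Proof.
move=> pf; elim: n => [|n IH]; first by apply: aeW => x; rewrite mul0r addr0.
have := ae_and IH (ae_shift (n%:R * T) pf); apply: ae_mono => x [<- <-].
by rewrite -natr1 mulrDl mul1r addrA.
Qed.

Lemma aeperNn T (f : R -> R) (n N : nat) : aeper T f ->
  {ae mu, forall x, f (x + (- (N%:R * T) + n%:R * T)) = f x}.
Proof.
move=> pf; have h1 := ae_shift (- (N%:R * T)) (aepern n pf).
have h2 := ae_shift (- (N%:R * T)) (aepern N pf).
have := ae_and h1 h2; apply: ae_mono => x [].
by rewrite subrK -addrA => -> ->.
Qed.

(** The integral over the line is cut into 2 N periods, and periodicity of f
    moves the translations onto p. *)
Lemma fold_period (T : R) (f p : R -> R) (N : nat) : 0 < T -> loc f -> aeper T f ->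
  continuous p -> (forall x, ~~ (- (N%:R * T) < x < N%:R * T) -> p x = 0) ->
  \int[mu]_x (f x * p x) =
  \int[mu]_(x in `]0, T[) (f x * \sum_(n < N + N) p (x + (- (N%:R * T) + n%:R * T))).
Proof.
move=> T0 lf pf cp supp; have [fpi ->] := loc_supp lf cp supp.
have E : N%:R * T = - (N%:R * T) + (N + N)%:R * T by rewrite natrD; ring.
rewrite [X in Interval _ (BLeft X)]E Rint_split//.
have cs (s : R) : continuous (fun x => p (x + s)).
  move=> x; apply: (@continuous_comp _ _ _ (fun x => x + s)); last exact: cp.
  by apply: cvgD; [exact: cvg_id | exact: cvg_cst].
transitivity (\sum_(n < N + N) \int[mu]_(x in `]0, T[) (f x * p (x + (- (N%:R * T) + n%:R * T)))).
  apply: eq_bigr => n _; apply: Rint_ae_eq => //.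
  - by apply: measurable_funTS; exact: (integrable_meas (itg_shift _ fpi)).
  - apply: measurable_funTS; apply: measurable_funM; first exact: loc_meas.
    by apply: continuous_measurable_fun; exact: cs.
  - by apply: ae_mono (aeperNn n N pf) => x ->.
have Fi (n : nat) : itg `]0, T[ (fun x => f x * p (x + (- (N%:R * T) + n%:R * T))).
  by apply: itg_mul_cont => //; exact: loc_itg.
have [_ <-] := Rint_sumn (N + N) (measurable_itv `]0, T[) Fi.
by apply: eq_Rintegral => x _; rewrite mulr_sumr.
Qed.

(** Integration by parts over one period, without boundary terms. The test
    function is [bump T * e]: on a period the two translates of the bump that
    meet it add up to 2, and those of its derivative to 0, so that folding the
    definition of the weak derivative gives twice the identity. *)
Lemma wderiv_period (T : R) (f g e de : R -> R) : 0 < T -> is_wderiv f g ->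
  aeper T f -> aeper T g -> (forall x : R, is_derive x 1 e (de x)) -> continuous de ->
  (forall x, e (x - T) = e x) -> (forall x, de (x - T) = de x) ->
  \int[mu]_(x in `]0, T[) (g x * e x) = - \int[mu]_(x in `]0, T[) (f x * de x).
Proof.
move=> T0 [lf lg h] pf pg he cde eT deT.
have [tb E] := test_bump T0 he cde; have ce := is_derive_cont he.
have [cb cdb] := test_cont tb; rewrite E in cdb.
have := h _ tb; rewrite E.
have supp1 (x : R) : ~~ (- (1%:R * T) < x < 1%:R * T) -> bump T x * e x = 0.
  rewrite mul1r; apply: (@supp_oo _ (fun x => bump T x * e x) T) => // y yM.
  by have [-> _] := bump_out T0 yM; rewrite mul0r.
have supp2 (x : R) : ~~ (- (1%:R * T) < x < 1%:R * T) -> dbump T x * e x + bump T x * de x = 0.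
  rewrite mul1r; apply: (@supp_oo _ (fun x => dbump T x * e x + bump T x * de x) T) => // y yM.
  by have [-> ->] := bump_out T0 yM; rewrite !mul0r addr0.
rewrite (fold_period T0 lf pf cdb supp2) (fold_period T0 lg pg cb supp1).
have b2 x : 0 < x < T -> bump T (x - T) + bump T x = 2 /\ dbump T (x - T) + dbump T x = 0.
  move=> /andP[x0 xT].
  have h1 : `|x| <= T by rewrite ger0_norm ltW.
  have h2 : `|x - T| <= T by rewrite ler_norml; apply/andP; split; lra.
  have piT : pi / T * T = pi by rewrite divfK ?gt_eqF.
  rewrite /bump /dbump !clamp_in// mulrBr piT.
  by rewrite cosB sinB cospi sinpi; split; ring.
have -> : \int[mu]_(x in `]0, T[) (f x * \sum_(n < 1 + 1) (dbump T (x + (- (1%:R * T) + n%:R * T)) * e (x + (- (1%:R * T) + n%:R * T)) +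
     bump T (x + (- (1%:R * T) + n%:R * T)) * de (x + (- (1%:R * T) + n%:R * T)))) = \int[mu]_(x in `]0, T[) (2 * (f x * de x)).
  apply: eq_Rintegral => x; rewrite mem_oo => xT; have [B2 D2] := b2 x xT.
  rewrite big_ord_recr big_ord1/= !mul1r mul0r addr0 addNr addr0 eT deT.
  have -> : bump T (x - T) = 2 - bump T x by rewrite -B2 addrK.
  have -> : dbump T (x - T) = - dbump T x by apply/eqP; rewrite -subr_eq0 opprK D2.
  by ring.
have -> : \int[mu]_(x in `]0, T[) (g x * \sum_(n < 1 + 1) (bump T (x + (- (1%:R * T) + n%:R * T)) * e (x + (- (1%:R * T) + n%:R * T)))) = \int[mu]_(x in `]0, T[) (2 * (g x * e x)).
  apply: eq_Rintegral => x; rewrite mem_oo => xT; have [B2 D2] := b2 x xT.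
  rewrite big_ord_recr big_ord1/= !mul1r mul0r addr0 addNr addr0 eT.
  by have -> : bump T (x - T) = 2 - bump T x by [rewrite -B2 addrK]; ring.
rewrite !RintegralZl//; last 2 first.
- by apply: itg_mul_cont => //; exact: loc_itg.
- by apply: itg_mul_cont => //; exact: loc_itg.
have two0 : (2 : R) != 0 by rewrite pnatr_eq0.
by rewrite -mulrN => /(mulfI two0) ->; rewrite opprK.
Qed.

(** The converse of [wderiv_period]: trigonometric coefficients detect weak
    derivatives. The primitive Y of y over one period has the coefficients of
    u, except for the mean, so u = Y + C by [trig_uniq]. *)
Lemma wderiv_coef (T : R) (u y : R -> R) (kap := 2 * pi / T) : 0 < T -> loc u -> loc y ->
  aeper T u -> aeper T y -> \int[mu]_(x in `]0, T[) y x = 0 ->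
  (forall n : nat, \int[mu]_(x in `]0, T[) (y x * cos (n%:R * kap * x)) =
             n%:R * kap * \int[mu]_(x in `]0, T[) (u x * sin (n%:R * kap * x))) ->
  (forall n : nat, \int[mu]_(x in `]0, T[) (y x * sin (n%:R * kap * x)) =
             - (n%:R * kap) * \int[mu]_(x in `]0, T[) (u x * cos (n%:R * kap * x))) ->
  is_wderiv u y.
Proof.
move=> T0 lu ly pu py y0 yc ys.
have mD : measurable (`]0, T[%classic : set R) by [].
have yi : itg `]0, T[ y by exact: loc_itg.
have yp := integrable_patch mD yi.
pose Y x := \int[mu]_(t in `]0, x[) (y \_ `]0, T[) t.
have YE x : x <= T -> Y x = \int[mu]_(t in `]0, x[) y t by exact: Rint_patch_oo.
have cY := prim_cont T0 yp; rewrite -/Y in cY.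
have Yi : itg `]0, T[ Y.
  apply: (@integrableS _ _ _ mu `[0, T]%classic) => //; first exact: subset_itv_oo_cc.
  by apply: continuous_compact_integrable; first exact: segment_compact.
have ibpY (p dp : R -> R) : continuous dp -> (forall x : R, is_derive x 1 p (dp x)) ->
   \int[mu]_(x in `]0, T[) (Y x * dp x) = - \int[mu]_(x in `]0, T[) (y x * p x).
  move=> cdp pdp; have cp := is_derive_cont pdp.
  have yp' := itg_mul_cont yi cp.
  transitivity (\int[mu]_(t in `]0, T[) (y t * (p T - p t))).
    rewrite -(ibp_prim T0 yi cdp pdp); apply: eq_Rintegral => x; rewrite mem_oo => /andP[_ xT].
    by rewrite YE// ltW.
  transitivity (\int[mu]_(t in `]0, T[) (y t * p T - y t * p t)).
    by apply: eq_Rintegral => t _; rewrite mulrBr.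
  by rewrite RintegralB//; [rewrite RintegralZr// y0 mul0r sub0r | exact: itgZr].
have ui : itg `]0, T[ u by exact: loc_itg.
pose C := (\int[mu]_(x in `]0, T[) u x - \int[mu]_(x in `]0, T[) Y x) / T.
have Ci : itg `]0, T[ (fun=> C) by apply: itg_cst => //; exact: mu_oo_lty.
pose w x := u x - Y x - C.
have uYi : itg `]0, T[ (fun x => u x - Y x) by exact: itgB.
have wi : itg `]0, T[ w by exact: itgB.
have wg (g : R -> R) : continuous g ->
   \int[mu]_(x in `]0, T[) (w x * g x) = \int[mu]_(x in `]0, T[) (u x * g x)
     - \int[mu]_(x in `]0, T[) (Y x * g x) - C * \int[mu]_(x in `]0, T[) g x.
  move=> cg; have i1 := itg_mul_cont ui cg; have i2 := itg_mul_cont Yi cg.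
  have i3 := integrable_cont 0 T cg.
  transitivity (\int[mu]_(x in `]0, T[) (u x * g x - Y x * g x - C * g x)).
    by apply: eq_Rintegral => x _; rewrite /w; ring.
  rewrite RintegralB//; [|exact: itgB|exact: itgZl].
  by rewrite RintegralB// RintegralZl.
have kap0 : kap != 0 by rewrite /kap mulf_neq0 ?invr_eq0 ?mulf_neq0 ?gt_eqF// pi_gt0.
have kE : kap = 2 * pi / (T - 0) by rewrite subr0.
have kT : kap * T = 2 * pi by rewrite /kap divfK ?gt_eqF.
have nT (n : nat) : n%:R * kap * T = 0 + pi *+ 2 *+ n.
  by rewrite add0r -mulrA kT -(mulr_natl (pi *+ 2) n) -(mulr_natl pi 2).
have sinT (n : nat) : sin (n%:R * kap * T) = 0.
  by rewrite nT (periodicn (@sinD2pi R)) sin0.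
have cosT (n : nat) : cos (n%:R * kap * T) = 1.
  by rewrite nT (periodicn (@cosD2pi R)) cos0.
have w0 : {ae mu, forall x, 0 < x < T -> w x = 0}.
  apply: (trig_uniq T0 wi) => n; rewrite -kE.
  - case: n => [|n].
      rewrite wg; last exact: cont_cosk.
      have E1 (g : R -> R) : \int[mu]_(x in `]0, T[) (g x * cos (0%:R * kap * x)) = \int[mu]_(x in `]0, T[) g x.
        by apply: eq_Rintegral => x _; rewrite !mul0r cos0 mulr1.
      rewrite !E1; have -> : \int[mu]_(x in `]0, T[) cos (0%:R * kap * x) = 1 * (T - 0).
        rewrite -Rint_cst_oo//; by apply: eq_Rintegral => x _; rewrite !mul0r cos0.
      by rewrite /C subr0 mul1r divfK ?subrr// gt_eqF.
    have nk : n.+1%:R * kap != 0 by rewrite mulf_neq0 ?pnatr_eq0.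
    rewrite wg; last exact: cont_cosk.
    rewrite (ibpY (fun x => sin (n.+1%:R * kap * x) / (n.+1%:R * kap)) _ (@cont_cosk _ _) (fun x => derive_sink x nk)).
    rewrite (Rint_FTC T0 (@cont_cosk _ _) (fun x => derive_sink x nk)) sinT mulr0 sin0 subrr mulr0 subr0 opprK.
    transitivity (\int[mu]_(x in `]0, T[) (u x * cos (n.+1%:R * kap * x)) + \int[mu]_(x in `]0, T[) (y x * sin (n.+1%:R * kap * x) / (n.+1%:R * kap))).
      by congr (_ + _); apply: eq_Rintegral => x _; rewrite mulrA.
    rewrite RintegralZr//; last by apply: itg_mul_cont => //; exact: cont_sink.
    by rewrite ys mulNr mulNr (mulrC (_ * _) (Rintegral _ _ _)) mulfK// subrr.
  - case: n => [|n].
      transitivity (\int[mu]_(x in `]0, T[) (0 : R)); last by rewrite Rint_cst_oo// mul0r.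
      by apply: eq_Rintegral => x _; rewrite !mul0r sin0 mulr0.
    have nk : n.+1%:R * kap != 0 by rewrite mulf_neq0 ?pnatr_eq0.
    rewrite wg; last exact: cont_sink.
    rewrite (ibpY (fun x => - cos (n.+1%:R * kap * x) / (n.+1%:R * kap)) _ (@cont_sink _ _) (fun x => derive_cosk x nk)).
    rewrite (Rint_FTC T0 (@cont_sink _ _) (fun x => derive_cosk x nk)) cosT mulr0 cos0 subrr mulr0 subr0 opprK.
    transitivity (\int[mu]_(x in `]0, T[) (u x * sin (n.+1%:R * kap * x)) + \int[mu]_(x in `]0, T[) (y x * cos (n.+1%:R * kap * x) * (- (n.+1%:R * kap)^-1))).
      by congr (_ + _); apply: eq_Rintegral => x _; rewrite mulNr mulrN mulrN mulrA.
    rewrite RintegralZr//; last by apply: itg_mul_cont => //; exact: cont_cosk.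
    by rewrite yc mulrN (mulrC (_ * _) (Rintegral _ _ _)) mulfK// subrr.
(* Folded to one period, the test function is integrated against Y + C; its
   periodisation takes the same value at 0 and T, so that C drops out. *)
split=> // p tp.
have [M M0 hM] := test_supp tp; have [cp cdp] := test_cont tp; have hp := test_is_derive tp.
pose N := Num.bound (M / T).
have NM : M < N%:R * T.
  by rewrite -ltr_pdivrMr//; apply: archi_boundP; rewrite divr_ge0 ?ltW.
have supp1 : forall x : R, ~~ (- (N%:R * T) < x < N%:R * T) -> p x = 0.
  by apply: (@supp_oo _ p M) => [||x /hM[]//]; rewrite ?lerN2 ltW.
have supp2 : forall x : R, ~~ (- (N%:R * T) < x < N%:R * T) -> derive1 p x = 0.
  by apply: (@supp_oo _ (derive1 p) M) => [||x /hM[]//]; rewrite ?lerN2 ltW.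
rewrite (fold_period T0 lu pu cdp supp2) (fold_period T0 ly py cp supp1).
pose s n : R := - (N%:R * T) + n%:R * T.
pose P x := \sum_(n < N + N) p (x + s n).
pose dP x := \sum_(n < N + N) derive1 p (x + s n).
have hP (x : R) : is_derive x 1 P (dP x).
  rewrite /P /dP; elim: (N + N)%N => [|k IH].
    rewrite big_ord0 (_ : (fun x => _) = cst 0); first exact: is_derive_cst.
    by apply/funext => z; rewrite big_ord0.
  rewrite big_ord_recr/= (_ : (fun x => _) = (fun x => \sum_(n < k) p (x + s n) + p (x + s k))).
    have h1 : is_derive x 1 (fun x => p (x + s k)) (derive1 p (x + s k)).
      have h := hp (x + s k).
      have := @is_derive1_comp R p (fun x => x + s k) x (derive1 p (x + s k)) 1 h.
      by rewrite mulr1; apply; apply: is_derive_eq; rewrite addr0.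
    exact: is_deriveD.
  by apply/funext => z; rewrite big_ord_recr.
have cdP : continuous dP.
  rewrite /dP; elim: (N + N)%N => [|k IH].
    rewrite (_ : (fun x => _) = cst 0); first exact: cst_continuous.
    by apply/funext => z; rewrite big_ord0.
  rewrite (_ : (fun x => _) = (fun x => \sum_(n < k) derive1 p (x + s n) + derive1 p (x + s k))).
    move=> x; apply: cvgD; first exact: IH.
    apply: (@continuous_comp _ _ _ (fun x => x + s k)); last exact: cdp.
    by apply: cvgD; [exact: cvg_id | exact: cvg_cst].
  by apply/funext => z; rewrite big_ord_recr.
have PT : P T = P 0.
  have H (k : nat) : \sum_(n < k) p (T + s n) - \sum_(n < k) p (0 + s n) = p (s k) - p (s 0%N).
    elim: k => [|k IH]; first by rewrite !big_ord0 !subrr.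
    rewrite !big_ord_recr/= opprD addrACA IH add0r.
    have -> : T + s k = s k.+1 by rewrite /s -natr1; ring.
    by ring.
  apply/eqP; rewrite -subr_eq0 /P H /s !supp1 ?subrr//.
  - by rewrite mul0r addr0 ltxx.
  - by rewrite natrD mulrDl addKr ltxx andbF.
transitivity (\int[mu]_(x in `]0, T[) ((Y x + C) * dP x)).
  apply: Rint_ae_eq => //.
  - apply: measurable_funM; first by apply: measurable_funTS; exact: loc_meas.
    by apply: measurable_funTS; exact: continuous_measurable_fun.
  - apply: measurable_funM; first by apply: measurable_funD => //; exact: integrable_meas.
    by apply: measurable_funTS; exact: continuous_measurable_fun.
  - apply: ae_mono w0 => x h xT; rewrite -/(dP x).
    have /eqP := h xT; rewrite /w subr_eq0 subr_eq => /eqP ->.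
    by rewrite addrC.
transitivity (\int[mu]_(x in `]0, T[) (Y x * dP x + C * dP x)).
  by apply: eq_Rintegral => x _; rewrite mulrDl.
have i1 := itg_mul_cont Yi cdP; have i2 := integrable_cont 0 T cdP.
rewrite RintegralD//; last exact: itgZl.
rewrite RintegralZl// (Rint_FTC T0 cdP hP) PT subrr mulr0 addr0.
by rewrite (ibpY _ _ cdP hP).
Qed.
End fold.

(** * The spaces H^j_loc *)

Section Hloc.
Context {R : realType}.
Notation mu := (@lebesgue_measure R).
Local Notation itg A f := (mu.-integrable A (EFin \o f)).
Local Notation loc f := (locally_integrable setT f).

Lemma itg_le (A : set R) (f g : R -> R) : measurable A -> measurable_fun A f ->
  (forall x, A x -> `|f x| <= g x) -> itg A g -> itg A f.
Proof.
move=> mA mf fg gi; apply: (@le_integrable _ _ _ mu A mA _ (EFin \o g)) => //.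
  exact/measurable_EFinP.
by move=> x Ax /=; rewrite lee_fin (le_trans (fg x Ax))// ler_norm.
Qed.

Lemma itv_lty (a b : R) : (mu `[a, b] < +oo)%E.
Proof. by rewrite lebesgue_measure_itv/=; case: ifP; rewrite ?ltry// -EFinB ltry. Qed.

Lemma L2loc_loc (f : R -> R) : L2loc f -> loc f.
Proof.
move=> [mf lf]; apply: itg_loc => // N.
apply: (@itg_le _ _ (fun x => 1 + f x ^+ 2)) => //.
- exact: measurable_funTS.
- move=> x _; have := real_normK (num_real (f x)).
  by have := sqr_ge0 (`|f x| - 1); nra.
- apply: itgD => //; last exact: loc_itg_cc.
  by apply: itg_cst => //; exact: itv_lty.
Qed.

Lemma L2loc_ae (f g : R -> R) : L2loc f -> measurable_fun setT g ->
  {ae mu, forall x, f x = g x} -> L2loc g.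
Proof.
move=> [mf lf] mg fg; split=> //; apply: loc_ae lf _ _.
- by apply: measurable_funX.
- by apply: ae_mono fg => x ->.
Qed.

(** The constant may grow with the interval, as for multiplication by an
    unbounded continuous function. *)
Lemma L2loc_le (f g : R -> R) (K : nat -> R) : L2loc f -> measurable_fun setT g ->
  (forall (N : nat) x, - N%:R <= x <= N%:R -> `|g x| <= K N * `|f x|) -> L2loc g.
Proof.
move=> [mf lf] mg gf; split=> //; apply: itg_loc; first exact: measurable_funX.
move=> N; apply: (@itg_le _ _ (fun x => K N ^+ 2 * f x ^+ 2)) => //.
- by apply: measurable_funTS; exact: measurable_funX.
- move=> x /=; rewrite in_itv/= => xN; have := gf N x xN.
  rewrite (ger0_norm (sqr_ge0 _)) -exprMn => h.
  rewrite -[leRHS]real_normK ?num_real// -[leLHS]real_normK ?num_real//.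
  rewrite lerXn2r ?nnegrE ?normr_ge0// normrM; apply: (le_trans h).
  by rewrite ler_wpM2r// ler_norm.
- by apply: itgZl => //; exact: loc_itg_cc.
Qed.

Lemma L2loc_cont (f : R -> R) : continuous f -> L2loc f.
Proof.
move=> cf; split; first exact: continuous_measurable_fun.
apply: itg_loc; first by apply: measurable_funX; exact: continuous_measurable_fun.
move=> N; apply: continuous_compact_integrable; first exact: segment_compact.
apply: continuous_subspaceT => x.
rewrite (_ : (fun x => f x ^+ 2) = (fun x => f x * f x)); last by apply/funext => y; rewrite expr2.
by apply: cvgM; exact: cf.
Qed.

Lemma L2loc_lin (a b : R) (f g : R -> R) : L2loc f -> L2loc g ->
  L2loc (fun x => a * f x + b * g x).
Proof.
move=> [mf lf] [mg lg].
have mh : measurable_fun setT (fun x => a * f x + b * g x).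
  by apply: measurable_funD; apply: measurable_funM.
split=> //; apply: itg_loc; first exact: measurable_funX.
move=> N; apply: (@itg_le _ _ (fun x => (2 * a ^+ 2) * f x ^+ 2 + (2 * b ^+ 2) * g x ^+ 2)) => //.
- by apply: measurable_funTS; exact: measurable_funX.
- move=> x _; rewrite ger0_norm ?sqr_ge0//.
  have := sqr_ge0 (a * f x - b * g x); nra.
- by apply: itgD => //; apply: itgZl => //; exact: loc_itg_cc.
Qed.

Lemma L2loc_mul (p f : R -> R) : continuous p -> L2loc f -> L2loc (fun x => p x * f x).
Proof.
move=> cp Lf; have mf := Lf.1.
pose K (N : nat) : R := xget 0 [set K | forall x, - N%:R <= x <= N%:R -> `|p x| <= K].
apply: (L2loc_le (K := K) Lf).
  by apply: measurable_funM => //; exact: continuous_measurable_fun.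
move=> N x xN; rewrite normrM ler_wpM2r//.
have [K0 hK0] := cont_bounded (- N%:R) N%:R cp.
by rewrite /K; case: xgetP => [y _ /(_ x xN)//|/(_ K0)]; case=> z zN; exact: hK0.
Qed.

Lemma is_wderiv_lin (a b : R) (f g f' g' : R -> R) : is_wderiv f f' -> is_wderiv g g' ->
  is_wderiv (fun x => a * f x + b * g x) (fun x => a * f' x + b * g' x).
Proof.
move=> [lf lf' hf] [lg lg' hg].
have lin (u v : R -> R) : loc u -> loc v -> loc (fun x => a * u x + b * v x).
  move=> lu lv; apply: itg_loc.
    by apply: measurable_funD; apply: measurable_funM => //; exact: loc_meas.
  by move=> N; apply: itgD => //; apply: itgZl => //; exact: loc_itg_cc.
split; [exact: lin|exact: lin|] => p tp.
have [M M0 hM] := test_supp tp; have [cp cdp] := test_cont tp.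
have s1 := supp_oo (lexx _) (lexx _) (fun x xM => (hM x xM).1).
have s2 := supp_oo (lexx _) (lexx _) (fun x xM => (hM x xM).2).
have [i1 _] := loc_supp lf cdp s2; have [i2 _] := loc_supp lg cdp s2.
have [i3 _] := loc_supp lf' cp s1; have [i4 _] := loc_supp lg' cp s1.
transitivity (\int[mu]_x (a * (f x * derive1 p x) + b * (g x * derive1 p x))).
  by apply: eq_Rintegral => x _; ring.
transitivity (- \int[mu]_x (a * (f' x * p x) + b * (g' x * p x))); last first.
  by congr (- _); apply: eq_Rintegral => x _; ring.
by rewrite !RintegralD ?RintegralZl ?hf ?hg//; try ring; exact: itgZl.
Qed.

Lemma test_mul (p q dq : R -> R) : test_function p -> (forall x : R, is_derive x 1 q (dq x)) ->
  continuous dq -> test_function (fun x => q x * p x) /\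
  derive1 (fun x => q x * p x) = (fun x => q x * derive1 p x + dq x * p x).
Proof.
move=> tp hq cdq; have cq := is_derive_cont hq; have [cp cdp] := test_cont tp.
have h (x : R) : is_derive x 1 (fun x => q x * p x) (q x * derive1 p x + dq x * p x).
  have h1 := hq x; have h2 := test_is_derive tp x.
  by apply: is_derive_eq; rewrite /GRing.scale/=; ring.
have E : derive1 (fun x => q x * p x) = (fun x => q x * derive1 p x + dq x * p x).
  by apply/funext => x; rewrite [LHS]derive1E; exact: (@derive_val _ _ _ _ _ _ _ (h x)).
split; last exact: E.
split.
- by move=> x; have [] := h x.
- by rewrite E => x; apply: cvgD; apply: cvgM; [exact: cq|exact: cdp|exact: cdq|exact: cp].
- by have [M M0 hM] := test_supp tp; exists M => x /ltW /hM[-> _]; rewrite mulr0.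
Qed.

Lemma loc_mul (p f : R -> R) : continuous p -> loc f -> loc (fun x => p x * f x).
Proof.
move=> cp lf; apply: itg_loc.
  by apply: measurable_funM; [exact: continuous_measurable_fun | exact: loc_meas].
move=> N; rewrite (_ : (fun x => p x * f x) = (fun x => f x * p x)); last first.
  by apply/funext => x; rewrite mulrC.
apply: (@integrableS _ _ _ mu `](- N%:R - 1), (N%:R + 1)[%classic) => //.
  by move=> x /=; rewrite !in_itv/=; lra.
by apply: itg_mul_cont => //; exact: loc_itg.
Qed.

Lemma is_wderiv_mul (q dq f g : R -> R) : (forall x : R, is_derive x 1 q (dq x)) ->
  continuous dq -> is_wderiv f g ->
  is_wderiv (fun x => q x * f x) (fun x => q x * g x + dq x * f x).
Proof.
move=> hq cdq [lf lg h]; have cq := is_derive_cont hq.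
have l1 := loc_mul cq lf; have l2 := loc_mul cq lg; have l3 := loc_mul cdq lf.
split=> //.
  apply: itg_loc; first by apply: measurable_funD; exact: loc_meas.
  by move=> N; apply: itgD => //; exact: loc_itg_cc.
move=> p tp; have [tqp E] := test_mul tp hq cdq.
have [M M0 hM] := test_supp tp; have [cp cdp] := test_cont tp.
have s1 := supp_oo (lexx _) (lexx _) (fun x xM => (hM x xM).1).
have s2 := supp_oo (lexx _) (lexx _) (fun x xM => (hM x xM).2).
have [i1 _] := loc_supp l1 cdp s2; have [i2 _] := loc_supp l2 cp s1.
have [i3 _] := loc_supp l3 cp s1.
have := h _ tqp; rewrite E.
have -> : \int[mu]_x (f x * (q x * derive1 p x + dq x * p x)) =
  \int[mu]_x (q x * f x * derive1 p x) + \int[mu]_x (dq x * f x * p x).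
  by rewrite -RintegralD//; apply: eq_Rintegral => x _; ring.
have -> : \int[mu]_x (g x * (q x * p x)) = \int[mu]_x (q x * g x * p x).
  by apply: eq_Rintegral => x _; ring.
have -> : \int[mu]_x ((q x * g x + dq x * f x) * p x) =
  \int[mu]_x (q x * g x * p x) + \int[mu]_x (dq x * f x * p x).
  by rewrite -RintegralD//; apply: eq_Rintegral => x _; ring.
by move=> /(canRL (addrK _)) ->; ring.
Qed.

Lemma wderivP (f g : R -> R) : is_wderiv f g ->
  is_wderiv f (wderiv f) /\ {ae mu, forall x, wderiv f x = g x}.
Proof.
move=> fg; have h : is_wderiv f (wderiv f) by rewrite /wderiv; apply: xgetPex; exists g.
by split=> //; exact: wderiv_uniq h fg.
Qed.

Lemma Hloc_L2loc j (f : R -> R) : Hloc j f -> L2loc f.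
Proof. by case: j => [|j] []. Qed.

Lemma Hloc_dec j (f : R -> R) : Hloc j.+1 f -> Hloc j f.
Proof.
elim: j f => [|j IH] f [L [g [fg Hg]]]; split=> //.
by exists g; split=> //; exact: IH.
Qed.

Lemma Hloc_ae j (f g : R -> R) : Hloc j f -> measurable_fun setT g ->
  {ae mu, forall x, f x = g x} -> Hloc j g.
Proof.
case: j => [|j] [L H] mg fg; split=> //; try exact: L2loc_ae L mg fg.
have [d [fd Hd]] := H; exists d; split=> //.
apply: (is_wderiv_ae fd) => //; last exact: aeW.
by apply: loc_meas; apply: L2loc_loc; exact: Hloc_L2loc Hd.
Qed.

Lemma Hloc_wderiv j (f : R -> R) : Hloc j.+1 f ->
  is_wderiv f (wderiv f) /\ Hloc j (wderiv f).
Proof.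
move=> [L [g [fg Hg]]]; have [h1 h2] := wderivP fg; split=> //.
apply: (Hloc_ae Hg); first by have [_ /loc_meas] := h1.
by apply: ae_mono h2 => x ->.
Qed.

Lemma Hloc_lin j (a b : R) (f g : R -> R) : Hloc j f -> Hloc j g ->
  Hloc j (fun x => a * f x + b * g x).
Proof.
elim: j f g => [|j IH] f g [Lf Hf] [Lg Hg]; split => //; try exact: L2loc_lin.
have [f' [ff' Hf']] := Hf; have [g' [gg' Hg']] := Hg.
by exists (fun x => a * f' x + b * g' x); split; [exact: is_wderiv_lin | exact: IH].
Qed.

(** Class C^j, with the successive derivatives as witnesses, which matches the
    recursion of [Hloc]. *)
Fixpoint Cder (j : nat) (p : R -> R) : Prop :=
  continuous p /\ if j is i.+1 then
    exists dp, (forall x : R, is_derive x 1 p (dp x)) /\ Cder i dp else True.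

Lemma Cder_cont j p : Cder j p -> continuous p.
Proof. by case: j => [|j] []. Qed.

Lemma Cder_dec j p : Cder j.+1 p -> Cder j p.
Proof.
elim: j p => [|j IH] p [c [dp [h H]]]; split=> //.
by exists dp; split=> //; exact: IH.
Qed.

(** The Leibniz rule sends a product to a sum of products of lower order, and
    the induction on j applies to both. *)
Lemma Hloc_mul j (p f : R -> R) : Cder j p -> Hloc j f -> Hloc j (fun x => p x * f x).
Proof.
elim: j p f => [|j IH] p f Cp Hf; split => //;
  try by apply: L2loc_mul; [exact: Cder_cont Cp | exact: Hloc_L2loc Hf].
have [_ [dp [hp Cdp]]] := Cp; have [_ [g [fg Hg]]] := Hf.
exists (fun x => p x * g x + dp x * f x); split.
  by apply: is_wderiv_mul => //; exact: Cder_cont Cdp.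
have -> : (fun x => p x * g x + dp x * f x) = (fun x => 1 * (p x * g x) + 1 * (dp x * f x)).
  by apply/funext => x; rewrite !mul1r.
by apply: Hloc_lin; apply: IH => //; [exact: Cder_dec | exact: Hloc_dec].
Qed.

Lemma aeper_lin T (a b : R) (f g : R -> R) : aeper T f -> aeper T g ->
  aeper T (fun x => a * f x + b * g x).
Proof. by move=> pf pg; have := ae_and pf pg; apply: ae_mono => x [-> ->]. Qed.

Lemma aeper_mul T (f g : R -> R) : aeper T f -> aeper T g -> aeper T (fun x => f x * g x).
Proof. by move=> pf pg; have := ae_and pf pg; apply: ae_mono => x [-> ->]. Qed.

End Hloc.

(** * A real-valued norm on complex numbers *)

Section nrm.
Context {R : realType}.
Implicit Types (z w : R[i]).
Local Notation Re := complex.Re.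
Local Notation Im := complex.Im.

(** The l^1 norm of the plane: submultiplicative, real-valued, and piecewise
    linear in the real and imaginary parts. *)
Definition nrm (z : R[i]) : R := `|Re z| + `|Im z|.

Lemma ReD z w : Re (z + w) = Re z + Re w. Proof. by case: z w => [? ?] [? ?]. Qed.
Lemma ImD z w : Im (z + w) = Im z + Im w. Proof. by case: z w => [? ?] [? ?]. Qed.
Lemma ReN z : Re (- z) = - Re z. Proof. by case: z. Qed.
Lemma ImN z : Im (- z) = - Im z. Proof. by case: z. Qed.
Lemma ReB z w : Re (z - w) = Re z - Re w. Proof. by rewrite ReD ReN. Qed.
Lemma ImB z w : Im (z - w) = Im z - Im w. Proof. by rewrite ImD ImN. Qed.
Lemma ReM z w : Re (z * w) = Re z * Re w - Im z * Im w.
Proof. by case: z w => [? ?] [? ?]. Qed.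
Lemma ImM z w : Im (z * w) = Re z * Im w + Im z * Re w.
Proof. by case: z w => [? ?] [? ?]. Qed.
Lemma ReZ (a : R) w : Re (a%:C * w) = a * Re w.
Proof. by rewrite ReM/= mul0r subr0. Qed.
Lemma ImZ (a : R) w : Im (a%:C * w) = a * Im w.
Proof. by rewrite ImM/= mul0r addr0. Qed.
Lemma eq_ReIm z w : Re z = Re w -> Im z = Im w -> z = w.
Proof. by case: z w => [? ?] [? ?] /= -> ->. Qed.

Lemma nrm_ge0 z : 0 <= nrm z. Proof. by rewrite addr_ge0. Qed.
Lemma nrm0 : nrm 0 = 0. Proof. by rewrite /nrm /= normr0 addr0. Qed.
Lemma nrm_eq0 z : nrm z <= 0 -> z = 0.
Proof.
move=> h; have h0 : nrm z == 0 by rewrite eq_le h nrm_ge0.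
move: h0; rewrite paddr_eq0// !normr_eq0 => /andP[/eqP a /eqP b].
exact: eq_ReIm.
Qed.
Lemma nrmD z w : nrm (z + w) <= nrm z + nrm w.
Proof. by rewrite /nrm ReD ImD addrACA lerD// ler_normD. Qed.
Lemma nrmN z : nrm (- z) = nrm z.
Proof. by rewrite /nrm ReN ImN !normrN. Qed.
Lemma nrmB z w : nrm (z - w) <= nrm z + nrm w.
Proof. by rewrite -(nrmN w) nrmD. Qed.
Lemma nrmM z w : nrm (z * w) <= nrm z * nrm w.
Proof.
rewrite /nrm ReM ImM mulrDl !mulrDr -!normrM.
have h1 := ler_normB (Re z * Re w) (Im z * Im w).
have h2 := ler_normD (Re z * Im w) (Im z * Re w); lra.
Qed.
Lemma nrmR (a : R) : nrm a%:C = `|a|.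
Proof. by rewrite /nrm /= normr0 addr0. Qed.
Lemma nrmZ (a : R) z : nrm (a%:C * z) = `|a| * nrm z.
Proof. by rewrite /nrm ReZ ImZ !normrM mulrDr. Qed.
Lemma nrmC z : nrm (z^*)%C = nrm z.
Proof. by case: z => a b; rewrite /nrm /= normrN. Qed.
Lemma Re_nrm z : `|Re z| <= nrm z. Proof. by rewrite lerDl. Qed.
Lemma Im_nrm z : `|Im z| <= nrm z. Proof. by rewrite lerDr. Qed.

Lemma nrmV z (d : R) : 0 < d -> d <= `|Re z| -> nrm z^-1 <= 2 / d.
Proof.
case: z => a b; rewrite /nrm /= => d0 da.
have a0 : 0 < `|a| by exact: lt_le_trans da.
have s0 : 0 < a ^+ 2 + b ^+ 2.
  by rewrite ltr_wpDr ?sqr_ge0// exprn_even_gt0//= -normr_gt0.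
rewrite normrN !normrM !normfV (gtr0_norm s0) -mulrDl ler_pdivrMr// mulrAC ler_pdivlMr//.
have h1 := real_normK (num_real a); have h2 := real_normK (num_real b).
rewrite -h1 -h2; set x := `|a| in da a0 *; set y := `|b|.
have y0 : 0 <= y by rewrite /y.
have := sqr_ge0 (x - y); nra.
Qed.

Lemma conjM z w : ((z * w)^*)%C = (z^*)%C * (w^*)%C.
Proof. by case: z w => [a b] [x y]; apply: eq_ReIm; rewrite ?ReM ?ImM/=; ring. Qed.
Lemma conjD z w : ((z + w)^*)%C = (z^*)%C + (w^*)%C.
Proof. by case: z w => [a b] [x y]; apply: eq_ReIm; rewrite ?ReD ?ImD/=; ring. Qed.
Lemma conjK z : (((z^*)%C)^*)%C = z.
Proof. by case: z => a b; rewrite /= opprK. Qed.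
Lemma conjR (x : R) : ((x%:C)^*)%C = x%:C.
Proof. by rewrite /= oppr0. Qed.

End nrm.

(** * Complex Fourier coefficients *)

Section fc.
Context {R : realType}.
Notation mu := (@lebesgue_measure R).
Local Notation itg A f := (mu.-integrable A (EFin \o f)).
Local Notation loc f := (locally_integrable setT f).
Local Notation Re := complex.Re.
Local Notation Im := complex.Im.
Variable T : R.
Hypothesis T0 : 0 < T.
Let kap := 2 * pi / T.

Definition citg (f : R -> R[i]) :=
  itg `]0, T[ (fun x => Re (f x)) /\ itg `]0, T[ (fun x => Im (f x)).
Definition cint (f : R -> R[i]) : R[i] :=
  (\int[mu]_(x in `]0, T[) Re (f x)) +i* (\int[mu]_(x in `]0, T[) Im (f x)).
Definition ce (q : int) (x : R) : R[i] := cexpi (q%:~R * kap * x).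
Definition fc (q : int) (f : R -> R[i]) : R[i] :=
  (T^-1)%:C * cint (fun x => f x * ce (- q) x).

Lemma ceD p q x : ce (p + q) x = ce p x * ce q x.
Proof.
rewrite /ce /cexpi rmorphD/= !mulrDl cosD sinD.
by apply: eq_ReIm; rewrite ?ReM ?ImM/=; ring.
Qed.
Lemma ce0 x : ce 0 x = 1.
Proof. by rewrite /ce /cexpi !mul0r cos0 sin0. Qed.
Lemma ceN q x : ce (- q) x = ((ce q x)^*)%C.
Proof. by rewrite /ce /cexpi rmorphN/= !mulNr cosN sinN. Qed.
Lemma nrm_ce q x : nrm (ce q x) <= 2.
Proof. by rewrite /nrm /= (le_trans (lerD (cos_max _) (sin_max _))). Qed.

Lemma cosn_per (n : nat) (x : R) : cos (x + n%:R * (2 * pi)) = cos x /\ sin (x + n%:R * (2 * pi)) = sin x.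
Proof.
have -> : n%:R * (2 * pi) = pi *+ 2 *+ n :> R by rewrite -(mulr_natl (pi *+ 2) n) -(mulr_natl pi 2).
by rewrite (periodicn (@sinD2pi R)) (periodicn (@cosD2pi R)).
Qed.

Lemma kapT : kap * T = 2 * pi. Proof. by rewrite /kap divfK ?gt_eqF. Qed.
Lemma kap_gt0 : 0 < kap. Proof. by rewrite divr_gt0// mulr_gt0// pi_gt0. Qed.

Lemma trig_per (q : int) (x : R) : cos (q%:~R * kap * (x + T)) = cos (q%:~R * kap * x) /\
   sin (q%:~R * kap * (x + T)) = sin (q%:~R * kap * x).
Proof.
have -> : q%:~R * kap * (x + T) = q%:~R * kap * x + q%:~R * (2 * pi) by rewrite -kapT; ring.
case: q => n; first exact: cosn_per.
have [h1 h2] := cosn_per n.+1 ((Negz n)%:~R * kap * x + (Negz n)%:~R * (2 * pi)).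
have E : (Negz n)%:~R * kap * x + (Negz n)%:~R * (2 * pi) + n.+1%:R * (2 * pi) = (Negz n)%:~R * kap * x.
  by rewrite NegzE rmorphN/=; ring.
by rewrite E in h1 h2.
Qed.

Lemma ce_per q x : ce q (x + T) = ce q x.
Proof. by rewrite /ce /cexpi; have [-> ->] := trig_per q x. Qed.

Lemma citg_ce q : citg (ce q).
Proof. by split; apply: integrable_cont; [exact: cont_cosk | exact: cont_sink]. Qed.

Lemma mD : measurable (`]0, T[%classic : set R). Proof. by []. Qed.

Lemma citgD f g : citg f -> citg g -> citg (fun x => f x + g x).
Proof.
move=> [f1 f2] [g1 g2]; split.
- under [X in _.-integrable _ (EFin \o X)]eq_fun do rewrite ReD; exact: itgD.
- under [X in _.-integrable _ (EFin \o X)]eq_fun do rewrite ImD; exact: itgD.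
Qed.

Lemma citgZ (a : R[i]) f : citg f -> citg (fun x => a * f x).
Proof.
move=> [f1 f2]; split.
- under [X in _.-integrable _ (EFin \o X)]eq_fun do rewrite ReM; by apply: itgB => //; apply: itgZl.
- under [X in _.-integrable _ (EFin \o X)]eq_fun do rewrite ImM; by apply: itgD => //; apply: itgZl.
Qed.

Lemma citgM f (g : R -> R[i]) : citg f -> continuous (fun x => Re (g x)) ->
  continuous (fun x => Im (g x)) -> citg (fun x => f x * g x).
Proof.
move=> [f1 f2] cr ci; split.
- under [X in _.-integrable _ (EFin \o X)]eq_fun do rewrite ReM; by apply: itgB => //; apply: itg_mul_cont.
- under [X in _.-integrable _ (EFin \o X)]eq_fun do rewrite ImM; by apply: itgD => //; apply: itg_mul_cont.
Qed.

Lemma citg_mul_ce f q : citg f -> citg (fun x => f x * ce q x).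
Proof. by move=> fi; apply: citgM => //; [exact: cont_cosk | exact: cont_sink]. Qed.

Lemma cintD f g : citg f -> citg g -> cint (fun x => f x + g x) = cint f + cint g.
Proof.
move=> [f1 f2] [g1 g2]; rewrite /cint; apply: eq_ReIm; rewrite ?ReD ?ImD/=.
- by rewrite -RintegralD//; apply: eq_Rintegral => x _; rewrite ReD.
- by rewrite -RintegralD//; apply: eq_Rintegral => x _; rewrite ImD.
Qed.

Lemma cintZ (a : R[i]) f : citg f -> cint (fun x => a * f x) = a * cint f.
Proof.
move=> [f1 f2]; rewrite /cint; apply: eq_ReIm; rewrite ?ReM ?ImM/=.
- rewrite -!RintegralZl// -RintegralB; [|exact: mD|exact: itgZl|exact: itgZl].
  by apply: eq_Rintegral => x _; rewrite ReM.
- rewrite -!RintegralZl// -RintegralD; [|exact: mD|exact: itgZl|exact: itgZl].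
  by apply: eq_Rintegral => x _; rewrite ImM.
Qed.

Lemma eq_cint f g : (forall x, 0 < x < T -> f x = g x) -> cint f = cint g.
Proof.
move=> fg; rewrite /cint; congr (_ +i* _); apply: eq_Rintegral => x; rewrite mem_oo => xT;
by rewrite fg.
Qed.

Lemma fcD q f g : citg f -> citg g -> fc q (fun x => f x + g x) = fc q f + fc q g.
Proof.
move=> fi gi; rewrite /fc -mulrDr -cintD; try exact: citg_mul_ce.
by congr (_ * _); apply: eq_cint => x _; rewrite mulrDl.
Qed.

Lemma fcZ q (a : R[i]) f : citg f -> fc q (fun x => a * f x) = a * fc q f.
Proof.
move=> fi; rewrite /fc mulrCA -(cintZ a); last exact: citg_mul_ce.
by congr (_ * _); apply: eq_cint => x _; rewrite mulrA.
Qed.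

Lemma citgN f : citg f -> citg (fun x => - f x).
Proof. by move=> /(citgZ (-1)); under eq_fun do rewrite mulN1r. Qed.
Lemma citgB f g : citg f -> citg g -> citg (fun x => f x - g x).
Proof. by move=> fi gi; apply: citgD => //; exact: citgN. Qed.
Lemma fcN q f : citg f -> fc q (fun x => - f x) = - fc q f.
Proof. by move=> fi; rewrite -mulN1r -fcZ//; congr fc; apply/funext => x; rewrite mulN1r. Qed.
Lemma fcB q f g : citg f -> citg g -> fc q (fun x => f x - g x) = fc q f - fc q g.
Proof. by move=> fi gi; rewrite fcD ?fcN//; exact: citgN. Qed.

Lemma fc_mul_ce q p f : fc q (fun x => ce p x * f x) = fc (q - p) f.
Proof.
rewrite /fc; congr (_ * _); apply: eq_cint => x _.
by rewrite opprB ceD; ring.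
Qed.

Lemma cint_ce q : cint (ce q) = if q == 0 then T%:C else 0.
Proof.
case: eqP => [->|/eqP q0].
  rewrite (@eq_cint _ (fun=> 1)); last by move=> x _; rewrite ce0.
  by rewrite /cint/= !Rint_cst_oo// mul0r mul1r subr0.
have qk : q%:~R * kap != 0 by rewrite mulf_neq0 ?intr_eq0// gt_eqF// kap_gt0.
rewrite /cint /ce /cexpi/=.
rewrite (Rint_FTC T0 (@cont_cosk _ _) (fun x => derive_sink x qk)).
rewrite (Rint_FTC T0 (@cont_sink _ _) (fun x => derive_cosk x qk)).
have [h1 h2] := trig_per q 0; rewrite add0r in h1 h2.
by rewrite h1 h2 !subrr.
Qed.

Lemma fc_ce q p : fc q (ce p) = (q == p)%:R.
Proof.
rewrite /fc (@eq_cint _ (ce (p - q))); last by move=> x _; rewrite ceD.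
rewrite cint_ce subr_eq0 eq_sym; case: eqP => _; last by rewrite mulr0.
by rewrite -rmorphM/= mulVf ?gt_eqF.
Qed.

Lemma fc_bound q f B : citg f -> (forall x, 0 < x < T -> nrm (f x) <= B) -> nrm (fc q f) <= 2 * B.
Proof.
move=> fi fB; have [i1 i2] := citg_mul_ce (- q) fi.
have h (x : R) : 0 < x < T -> `|Re (f x * ce (- q) x)| <= B /\ `|Im (f x * ce (- q) x)| <= B.
  move=> /fB; rewrite /nrm ReM ImM => hB.
  have c1 := cos_max ((- q)%:~R * kap * x); have s1 := sin_max ((- q)%:~R * kap * x).
  split.
    rewrite (le_trans (ler_normB _ _))// !normrM/=; apply: le_trans hB.
    by rewrite lerD// ler_piMr.
  rewrite (le_trans (ler_normD _ _))// !normrM/=; apply: le_trans hB.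
  by rewrite lerD// ler_piMr.
rewrite /fc nrmZ normfV gtr0_norm// ler_pdivrMl// /nrm /cint/=.
have muT : fine (mu `]0, T[) = T by rewrite -[RHS]subr0 -[RHS]/(fine (T - 0)%:E) -(mu_oo T0).
have b1 : `|\int[mu]_(x in `]0, T[) Re (f x * ce (- q) x)| <= B * T.
  rewrite -[X in _ * X]muT; apply: Rint_bound => //; first exact: mu_oo_lty.
  by move=> x /=; rewrite in_itv/= => /h[].
have b2 : `|\int[mu]_(x in `]0, T[) Im (f x * ce (- q) x)| <= B * T.
  rewrite -[X in _ * X]muT; apply: Rint_bound => //; first exact: mu_oo_lty.
  by move=> x /=; rewrite in_itv/= => /h[].
lra.
Qed.

Lemma fc_L1 q f : citg f -> nrm (fc q f) <= 2 / T * \int[mu]_(x in `]0, T[) nrm (f x).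
Proof.
move=> fi; have [i1 i2] := citg_mul_ce (- q) fi; have [f1 f2] := fi.
have ni : itg `]0, T[ (fun x => nrm (f x)).
  by apply: itgD => //; exact: integrable_norm.
have h (x : R) : `|Re (f x * ce (- q) x)| <= nrm (f x) /\ `|Im (f x * ce (- q) x)| <= nrm (f x).
  rewrite /nrm ReM ImM.
  have c1 := cos_max ((- q)%:~R * kap * x); have s1 := sin_max ((- q)%:~R * kap * x).
  split.
    rewrite (le_trans (ler_normB _ _))// !normrM/=.
    by rewrite lerD// ler_piMr.
  rewrite (le_trans (ler_normD _ _))// !normrM/=.
  by rewrite lerD// ler_piMr.
rewrite /fc nrmZ normfV gtr0_norm// mulrAC ler_pdivlMr// mulrAC mulVf ?gt_eqF// mul1r /nrm /cint/=.
rewrite mulr2n mulrDl !mul1r lerD//.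
  rewrite (le_trans (le_normr_Rintegral _ _))//; apply: le_Rintegral => //; first exact: integrable_norm.
  by move=> x _; have [] := h x.
rewrite (le_trans (le_normr_Rintegral _ _))//; apply: le_Rintegral => //; first exact: integrable_norm.
by move=> x _; have [] := h x.
Qed.

Lemma fc_ae q f g : citg f -> citg g -> {ae mu, forall x, 0 < x < T -> f x = g x} -> fc q f = fc q g.
Proof.
move=> fi gi fg; have [i1 i2] := citg_mul_ce (- q) fi; have [i3 i4] := citg_mul_ce (- q) gi.
rewrite /fc /cint; congr (_ * (_ +i* _)).
  apply: Rint_ae_eq => //; try exact: integrable_meas.
  by apply: ae_mono fg => x h; rewrite /= in_itv/= => /h ->.
apply: Rint_ae_eq => //; try exact: integrable_meas.
by apply: ae_mono fg => x h; rewrite /= in_itv/= => /h ->.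
Qed.

Lemma eq_fc q f g : (forall x, 0 < x < T -> f x = g x) -> fc q f = fc q g.
Proof. by move=> fg; rewrite /fc; congr (_ * _); apply: eq_cint => x xT; rewrite fg. Qed.

(** The four real integrals to which the results on real functions apply. *)
Lemma fcE q f : citg f -> let k := q%:~R * kap in
  T%:C * fc q f =
  (\int[mu]_(x in `]0, T[) (Re (f x) * cos (k * x)) + \int[mu]_(x in `]0, T[) (Im (f x) * sin (k * x)))
  +i* (\int[mu]_(x in `]0, T[) (Im (f x) * cos (k * x)) - \int[mu]_(x in `]0, T[) (Re (f x) * sin (k * x))).
Proof.
move=> [f1 f2] k; rewrite /fc mulrA -rmorphM/= mulfV ?gt_eqF// mul1r /cint.
have i1 := itg_mul_cont f1 (@cont_cosk _ k); have i2 := itg_mul_cont f2 (@cont_sink _ k).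
have i3 := itg_mul_cont f2 (@cont_cosk _ k); have i4 := itg_mul_cont f1 (@cont_sink _ k).
congr (_ +i* _).
- rewrite -RintegralD//; apply: eq_Rintegral => x _.
  by rewrite ReM ceN/= -/k; ring.
- rewrite -RintegralB//; apply: eq_Rintegral => x _.
  by rewrite ImM ceN/= -/k; ring.
Qed.

(** Combining the coefficients of index n and -n isolates each of the four
    real trigonometric integrals of f - g. *)
Lemma fc_uniq f g : citg f -> citg g -> (forall q, fc q f = fc q g) ->
  {ae mu, forall x, 0 < x < T -> f x = g x}.
Proof.
move=> fi gi fg.
pose u x := f x - g x; have ui : citg u by exact: citgB.
have u0 q : fc q u = 0 by rewrite fcB// fg subrr.
have kE : kap = 2 * pi / (T - 0) by rewrite subr0.
have H (n : nat) : [/\ \int[mu]_(x in `]0, T[) (Re (u x) * cos (n%:R * kap * x)) = 0,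
   \int[mu]_(x in `]0, T[) (Re (u x) * sin (n%:R * kap * x)) = 0,
   \int[mu]_(x in `]0, T[) (Im (u x) * cos (n%:R * kap * x)) = 0 &
   \int[mu]_(x in `]0, T[) (Im (u x) * sin (n%:R * kap * x)) = 0].
  have := fcE (Posz n) ui; rewrite u0 mulr0/= => -[].
  have := fcE (- Posz n) ui; rewrite u0 mulr0/= => -[].
  rewrite rmorphN/= mulNr.
  have E1 (v : R -> R) : \int[mu]_(x in `]0, T[) (v x * cos (- (n%:R * kap) * x)) = \int[mu]_(x in `]0, T[) (v x * cos (n%:R * kap * x)).
    by apply: eq_Rintegral => x _; rewrite mulNr cosN.
  have E2 (v : R -> R) : itg `]0, T[ v -> \int[mu]_(x in `]0, T[) (v x * sin (- (n%:R * kap) * x)) = - \int[mu]_(x in `]0, T[) (v x * sin (n%:R * kap * x)).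
    move=> vi; rewrite -[RHS]mulN1r -RintegralZl//; last by apply: itg_mul_cont => //; exact: cont_sink.
    by apply: eq_Rintegral => x _; rewrite mulNr sinN; ring.
  have [v1 v2] := ui.
  rewrite -!pmulrn !E1 !E2// => h1 h2 h3 h4.
  by split; lra.
have [v1 v2] := ui.
have a1 : {ae mu, forall x, 0 < x < T -> Re (u x) = 0}.
  by apply: (trig_uniq T0 v1) => n; rewrite -kE; have [] := H n.
have a2 : {ae mu, forall x, 0 < x < T -> Im (u x) = 0}.
  by apply: (trig_uniq T0 v2) => n; rewrite -kE; have [] := H n.
have := ae_and a1 a2; apply: ae_mono => x [h1 h2] xT.
apply/eqP; rewrite -subr_eq0; apply/eqP; apply: eq_ReIm; [exact: h1 | exact: h2].
Qed.

Lemma fc_conj q f : citg f -> fc q (fun x => ((f x)^*)%C) = ((fc (- q) f)^*)%C.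
Proof.
move=> fi; have [i1 i2] := citg_mul_ce q fi.
rewrite /fc conjM conjR opprK; congr (_ * _).
rewrite (_ : cint _ = cint (fun x => ((f x * ce q x)^*)%C)); last first.
  by apply: eq_cint => x _; rewrite ceN conjM.
apply: eq_ReIm => /=.
  by apply: eq_Rintegral => x _; case: (_ * _).
rewrite -[RHS]mulN1r -RintegralZl//.
by apply: eq_Rintegral => x _; case: (_ * _) => a b /=; rewrite mulN1r.
Qed.

End fc.

(** * Weak derivatives and Fourier series *)

Section synth.
Context {R : realType}.
Notation mu := (@lebesgue_measure R).
Local Notation itg A f := (mu.-integrable A (EFin \o f)).
Local Notation loc f := (locally_integrable setT f).
Local Notation Re := complex.Re.
Local Notation Im := complex.Im.
Variable T : R.
Hypothesis T0 : 0 < T.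
Let kap := 2 * pi / T.
Local Notation fc := (fc T).
Local Notation ce := (ce T).
Local Notation citg := (citg T).

Definition ik (q : int) : R[i] := 0 +i* (q%:~R * kap).

Let trigm (q : int) (x : R) : cos (q%:~R * kap * (x - T)) = cos (q%:~R * kap * x) /\
   sin (q%:~R * kap * (x - T)) = sin (q%:~R * kap * x).
Proof. by have := trig_per T0 q (x - T); rewrite subrK => -[-> ->]. Qed.

Lemma wderiv_cos (q : int) (f g : R -> R) : is_wderiv f g -> aeper T f -> aeper T g ->
  \int[mu]_(x in `]0, T[) (g x * cos (q%:~R * kap * x)) =
    q%:~R * kap * \int[mu]_(x in `]0, T[) (f x * sin (q%:~R * kap * x)) /\
  \int[mu]_(x in `]0, T[) (g x * sin (q%:~R * kap * x)) =
    - (q%:~R * kap) * \int[mu]_(x in `]0, T[) (f x * cos (q%:~R * kap * x)).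
Proof.
move=> fg pf pg; set k := q%:~R * kap; have [lf _ _] := fg.
have is1 := itg_mul_cont (loc_itg 0 T lf) (@cont_cosk _ k).
have is2 := itg_mul_cont (loc_itg 0 T lf) (@cont_sink _ k).
split.
  have hd (x : R) : is_derive x 1 (fun x => cos (k * x)) (- k * sin (k * x)).
    by apply: is_derive_eq; rewrite /GRing.scale/=; ring.
  have E : \int[mu]_(x in `]0, T[) (f x * (- k * sin (k * x))) = - k * \int[mu]_(x in `]0, T[) (f x * sin (k * x)).
    by rewrite -RintegralZl//; apply: eq_Rintegral => x _; ring.
  rewrite (wderiv_period T0 fg pf pg hd) ?E ?mulNr ?opprK//.
  - by move=> x; apply: cvgM; [exact: cvg_cst | exact: cont_sink].
  - by move=> x; have [] := trigm q x.
  - by move=> x; have [_ ->] := trigm q x.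
have hd (x : R) : is_derive x 1 (fun x => sin (k * x)) (k * cos (k * x)).
  by apply: is_derive_eq; rewrite /GRing.scale/=; ring.
rewrite (wderiv_period T0 fg pf pg hd).
- rewrite mulNr; congr (- _); rewrite -RintegralZl//.
  by apply: eq_Rintegral => x _; ring.
- by move=> x; apply: cvgM; [exact: cvg_cst | exact: cont_cosk].
- by move=> x; have [] := trigm q x.
- by move=> x; have [-> _] := trigm q x.
Qed.

Definition cwd (f g : R -> R[i]) := is_wderiv (fun x => Re (f x)) (fun x => Re (g x)) /\
  is_wderiv (fun x => Im (f x)) (fun x => Im (g x)).
Definition cper (f : R -> R[i]) := aeper T (fun x => Re (f x)) /\ aeper T (fun x => Im (f x)).

Lemma cwd_cper f g : cwd f g -> cper f -> cper g.
Proof. by move=> [w1 w2] [p1 p2]; split; [exact: wderiv_aeper w1 p1 | exact: wderiv_aeper w2 p2]. Qed.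

Lemma cwd_citg f g : cwd f g -> citg f /\ citg g.
Proof. by move=> [[? ? _] [? ? _]]; split; split; exact: loc_itg. Qed.

Lemma fc_wderiv q f g : cwd f g -> cper f -> fc q g = ik q * fc q f.
Proof.
move=> fg pf; have pg := cwd_cper fg pf; have [fi gi] := cwd_citg fg.
have TC : T%:C != 0 by rewrite eq_complex/= gt_eqF.
have [w1 w2] := fg; have [f1 f2] := pf; have [g1 g2] := pg.
have [a1 a2] := wderiv_cos q w1 f1 g1; have [b1 b2] := wderiv_cos q w2 f2 g2.
suff : T%:C * fc q g = ik q * (T%:C * fc q f) by rewrite (mulrCA (ik q)); move/(mulfI TC).
rewrite (fcE T0 q fi) (fcE T0 q gi) -/kap a1 a2 b1 b2.
by apply: eq_ReIm; rewrite ?ReM ?ImM/=; ring.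
Qed.

(** As in [fc_uniq], the indices n and -n together determine the real
    trigonometric integrals, here those of [wderiv_coef]. *)
Lemma wderiv_fc u y : loc (fun x => Re (u x)) -> loc (fun x => Im (u x)) ->
  loc (fun x => Re (y x)) -> loc (fun x => Im (y x)) -> cper u -> cper y ->
  (forall q, fc q y = ik q * fc q u) -> cwd u y.
Proof.
move=> u1 u2 y1 y2 [pu1 pu2] [py1 py2] H.
have ui : citg u by split; exact: loc_itg.
have yi : citg y by split; exact: loc_itg.
have K (n : nat) : [/\ \int[mu]_(x in `]0, T[) (Re (y x) * cos (n%:R * kap * x)) =
             n%:R * kap * \int[mu]_(x in `]0, T[) (Re (u x) * sin (n%:R * kap * x)),
   \int[mu]_(x in `]0, T[) (Re (y x) * sin (n%:R * kap * x)) =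
             - (n%:R * kap) * \int[mu]_(x in `]0, T[) (Re (u x) * cos (n%:R * kap * x)),
   \int[mu]_(x in `]0, T[) (Im (y x) * cos (n%:R * kap * x)) =
             n%:R * kap * \int[mu]_(x in `]0, T[) (Im (u x) * sin (n%:R * kap * x)) &
   \int[mu]_(x in `]0, T[) (Im (y x) * sin (n%:R * kap * x)) =
             - (n%:R * kap) * \int[mu]_(x in `]0, T[) (Im (u x) * cos (n%:R * kap * x))].
  have F (q : int) : T%:C * fc q y = ik q * (T%:C * fc q u) by rewrite H mulrCA.
  have E1 (v : R -> R) : \int[mu]_(x in `]0, T[) (v x * cos (- (n%:R * kap) * x)) = \int[mu]_(x in `]0, T[) (v x * cos (n%:R * kap * x)).
    by apply: eq_Rintegral => x _; rewrite mulNr cosN.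
  have E2 (v : R -> R) : itg `]0, T[ v -> \int[mu]_(x in `]0, T[) (v x * sin (- (n%:R * kap) * x)) = - \int[mu]_(x in `]0, T[) (v x * sin (n%:R * kap * x)).
    move=> vi; rewrite -[RHS]mulN1r -RintegralZl//; last by apply: itg_mul_cont => //; exact: cont_sink.
    by apply: eq_Rintegral => x _; rewrite mulNr sinN; ring.
  have [v1 v2] := ui; have [w1 w2] := yi.
  have := F (Posz n); rewrite (fcE T0 _ ui) (fcE T0 _ yi) /ik -/kap => -[].
  have := F (- Posz n); rewrite (fcE T0 _ ui) (fcE T0 _ yi) /ik -/kap => -[].
  rewrite rmorphN/= mulNr -!pmulrn !E1 !E2//.
  by move=> h1 h2 h3 h4; split; lra.
have E0 (v : R -> R) : \int[mu]_(x in `]0, T[) v x = \int[mu]_(x in `]0, T[) (v x * cos (0%:R * kap * x)).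
  by apply: eq_Rintegral => x _; rewrite !mul0r cos0 mulr1.
split; apply: (wderiv_coef T0) => //.
- by rewrite E0; have [-> _ _ _] := K 0%N; rewrite !mul0r.
- by move=> n; have [] := K n.
- by move=> n; have [] := K n.
- by rewrite E0; have [_ _ -> _] := K 0%N; rewrite !mul0r.
- by move=> n; have [] := K n.
- by move=> n; have [] := K n.
Qed.

(** A summable weight whose tails telescope ([wtE]); it is the rate of decay
    available for coefficients of size 1 / (1 + q^2). *)
Definition wt (i : nat) : R := (i.+1%:R * i.+2%:R)^-1.
Definition decays (A : R) (c : int -> R[i]) := forall i : nat,
  nrm (c (Posz i)) <= A * wt i /\ nrm (c (Negz i)) <= A * wt i.
Definition psum (c : int -> R[i]) (N : nat) (x : R) : R[i] :=
  \sum_(i < N) (c (Posz i) * ce (Posz i) x + c (Negz i) * ce (Negz i) x).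
(** The frequencies are paired as i and -(i + 1), following the two
    constructors of [int]; for coefficients that decay as in [decays] the
    order is irrelevant. *)
Definition fsum (c : int -> R[i]) (x : R) : R[i] :=
  limn (fun N => Re (psum c N x)) +i* limn (fun N => Im (psum c N x)).

Lemma wtE i : wt i = i.+1%:R^-1 - i.+2%:R^-1.
Proof.
rewrite /wt; set a := i.+1%:R; have -> : i.+2%:R = a + 1 :> R by rewrite /a natr1.
have a0 : 0 < a by rewrite /a ltr0n.
by field; rewrite !gt_eqF// addr_gt0.
Qed.

Lemma psum_diff A c N M x : decays A c -> (N <= M)%N ->
  nrm (psum c M x - psum c N x) <= 4 * A * (N.+1%:R^-1 - M.+1%:R^-1).
Proof.
move=> dc; elim: M => [|M IH] NM.
  by move: NM; rewrite leqn0 => /eqP ->; rewrite !subrr nrm0 mulr0.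
move: NM; rewrite leq_eqVlt => /predU1P[->|]; first by rewrite !subrr nrm0 mulr0.
rewrite ltnS => /IH {}IH.
rewrite /psum big_ord_recr/= -/(psum c M x) addrAC (le_trans (nrmD _ _))//.
have [h1 h2] := dc M.
have t1 : nrm (c (Posz M) * ce (Posz M) x + c (Negz M) * ce (Negz M) x) <= 4 * A * wt M.
  rewrite (le_trans (nrmD _ _))//.
  have n1 := nrmM (c (Posz M)) (ce (Posz M) x); have n2 := nrmM (c (Negz M)) (ce (Negz M) x).
  have c1 := nrm_ce T (Posz M) x; have c2 := nrm_ce T (Negz M) x.
  have p1 := nrm_ge0 (c (Posz M)); have p2 := nrm_ge0 (c (Negz M)).
  nra.
rewrite wtE in t1; set z := psum _ _ _ - _ in IH *.
rewrite (le_trans (lerD IH t1))// -mulrDr.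
by rewrite le_eqVlt; apply/orP; left; apply/eqP; ring.
Qed.

Lemma lim_rate (u : nat -> R) (C : R) :
  (forall N M, (N <= M)%N -> `|u M - u N| <= C * N.+1%:R^-1) ->
  cvgn u /\ forall N, `|limn u - u N| <= C * N.+1%:R^-1.
Proof.
move=> h; have C0 : 0 <= C by have := h 0%N 0%N isT; rewrite subrr normr0 invr1 mulr1.
have cu : cvgn u.
  apply: cauchy_cvg; apply: cauchy_exP => e e0.
  pose N := Num.bound (C / e); exists (u N).
  have Ne : C * N.+1%:R^-1 < e.
    rewrite ltr_pdivrMr// mulrC -ltr_pdivrMr//.
    by rewrite (lt_trans (archi_boundP _)) ?ltr_nat// divr_ge0// ltW.
  suff : \forall n \near \oo, ball (u N) e (u n) by [].
  near=> n; rewrite -ball_normE/= distrC; apply: le_lt_trans Ne; apply: h.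
  by near: n; exact: nbhs_infty_ge.
split=> // N.
have cd : (fun M => `|u M - u N|) @ \oo --> `|limn u - u N|.
  by apply: cvg_norm; apply: cvgB; [exact: cu | exact: cvg_cst].
apply: (closed_cvg (fun y => y <= C * N.+1%:R^-1)) cd; first exact: closed_le.
by near=> M; apply: h; near: M; exact: nbhs_infty_ge.
Unshelve. all: by end_near. Qed.

Lemma fsum_cvg A c x : decays A c ->
  [/\ cvgn (fun N => Re (psum c N x)), cvgn (fun N => Im (psum c N x)) &
  forall N, nrm (fsum c x - psum c N x) <= 8 * A * N.+1%:R^-1].
Proof.
move=> dc.
have A0 : 0 <= A.
  have [h _] := dc 0%N; have := nrm_ge0 (c (Posz 0%N)).
  by rewrite /wt/= in h; move=> h0; have := le_trans h0 h; rewrite pmulr_lge0// invr_gt0 mulr_gt0.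
have d N M : (N <= M)%N -> nrm (psum c M x - psum c N x) <= 4 * A * N.+1%:R^-1.
  move=> NM; apply: (le_trans (psum_diff x dc NM)).
  by rewrite ler_wpM2l ?mulr_ge0// gerBl invr_ge0.
have [|c1 h1] := @lim_rate (fun N => Re (psum c N x)) (4 * A).
  by move=> N M NM; rewrite -ReB (le_trans (Re_nrm _))// d.
have [|c2 h2] := @lim_rate (fun N => Im (psum c N x)) (4 * A).
  by move=> N M NM; rewrite -ImB (le_trans (Im_nrm _))// d.
split=> // N; rewrite {1}/nrm ReB ImB/=.
rewrite (le_trans (lerD (h1 N) (h2 N)))// -mulrDl.
by rewrite ler_wpM2r ?invr_ge0//; lra.
Qed.

Lemma fsum_bound A c x : decays A c -> nrm (fsum c x) <= 8 * A.
Proof.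
move=> dc; have [_ _ h] := fsum_cvg x dc; have := h 0%N.
by rewrite /psum big_ord0 subr0 invr1 mulr1.
Qed.

Lemma psum_cont c N : continuous (fun x => Re (psum c N x)) /\ continuous (fun x => Im (psum c N x)).
Proof.
have H (a : R[i]) q : continuous (fun x => Re (a * ce q x)) /\ continuous (fun x => Im (a * ce q x)).
  split.
    rewrite (_ : (fun x => _) = (fun x => Re a * cos (q%:~R * kap * x) - Im a * sin (q%:~R * kap * x))).
      by move=> x; apply: cvgB; apply: cvgM; [exact: cvg_cst|exact: cont_cosk|exact: cvg_cst|exact: cont_sink].
    by apply/funext => x; rewrite ReM.
  rewrite (_ : (fun x => _) = (fun x => Re a * sin (q%:~R * kap * x) + Im a * cos (q%:~R * kap * x))).
    by move=> x; apply: cvgD; apply: cvgM; [exact: cvg_cst|exact: cont_sink|exact: cvg_cst|exact: cont_cosk].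
  by apply/funext => x; rewrite ImM.
elim: N => [|N [IH1 IH2]].
  by split; rewrite (_ : (fun x => _) = cst 0); try exact: cst_continuous;
    apply/funext => x; rewrite /psum big_ord0.
have [a1 a2] := H (c (Posz N)) (Posz N); have [b1 b2] := H (c (Negz N)) (Negz N).
split.
  rewrite (_ : (fun x => _) = (fun x => Re (psum c N x) + (Re (c (Posz N) * ce (Posz N) x) + Re (c (Negz N) * ce (Negz N) x)))).
    by move=> x; apply: cvgD; [exact: IH1 | apply: cvgD; [exact: a1 | exact: b1]].
  by apply/funext => x; rewrite /psum big_ord_recr/= !ReD.
rewrite (_ : (fun x => _) = (fun x => Im (psum c N x) + (Im (c (Posz N) * ce (Posz N) x) + Im (c (Negz N) * ce (Negz N) x)))).
  by move=> x; apply: cvgD; [exact: IH2 | apply: cvgD; [exact: a2 | exact: b2]].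
by apply/funext => x; rewrite /psum big_ord_recr/= !ImD.
Qed.

Lemma fsum_meas A c : decays A c -> measurable_fun setT (fun x => Re (fsum c x)) /\
  measurable_fun setT (fun x => Im (fsum c x)).
Proof.
move=> dc; split.
  apply: (measurable_fun_cvg (h := fun N x => Re (psum c N x))) => [N|x _].
    by apply: continuous_measurable_fun; have [] := psum_cont c N.
  by have [h _ _] := fsum_cvg x dc.
apply: (measurable_fun_cvg (h := fun N x => Im (psum c N x))) => [N|x _].
  by apply: continuous_measurable_fun; have [] := psum_cont c N.
by have [_ h _] := fsum_cvg x dc.
Qed.

Lemma fsum_per c x : fsum c (x + T) = fsum c x.
Proof.
have E N : psum c N (x + T) = psum c N x.
  by apply: eq_bigr => i _; rewrite !ce_per.
by rewrite /fsum; congr (limn _ +i* limn _); apply/funext => N; rewrite E.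
Qed.

(** Bounded measurable functions: a class closed under products, on which the
    sup norm estimates of the reduction are made. *)
Definition bmf (f : R -> R[i]) := [/\ measurable_fun setT (fun x => Re (f x)),
  measurable_fun setT (fun x => Im (f x)) & exists B, forall x, nrm (f x) <= B].

Lemma bmf_loc f : bmf f -> loc (fun x => Re (f x)) /\ loc (fun x => Im (f x)).
Proof.
move=> [m1 m2 [B hB]]; split; apply: itg_loc => // N.
- apply: (@integrable_bdd _ _ _ B) => //; first exact: itv_lty.
    exact: measurable_funTS.
  by move=> x _; exact: le_trans (Re_nrm _) (hB x).
- apply: (@integrable_bdd _ _ _ B) => //; first exact: itv_lty.
    exact: measurable_funTS.
  by move=> x _; exact: le_trans (Im_nrm _) (hB x).
Qed.

Lemma bmf_citg f : bmf f -> citg f.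
Proof. by move=> /bmf_loc[l1 l2]; split; exact: loc_itg. Qed.

Lemma bmf_fsum A c : decays A c -> bmf (fsum c).
Proof.
move=> dc; have [m1 m2] := fsum_meas dc; split=> //.
by exists (8 * A) => x; exact: fsum_bound.
Qed.

Lemma bmfD f g : bmf f -> bmf g -> bmf (fun x => f x + g x).
Proof.
move=> [a1 a2 [A hA]] [b1 b2 [B hB]]; split.
- by under eq_fun do rewrite ReD; exact: measurable_funD.
- by under eq_fun do rewrite ImD; exact: measurable_funD.
- by exists (A + B) => x; rewrite (le_trans (nrmD _ _))// lerD.
Qed.

Lemma bmfM f g : bmf f -> bmf g -> bmf (fun x => f x * g x).
Proof.
move=> [a1 a2 [A hA]] [b1 b2 [B hB]]; split.
- by under eq_fun do rewrite ReM; apply: measurable_funB; exact: measurable_funM.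
- by under eq_fun do rewrite ImM; apply: measurable_funD; exact: measurable_funM.
- exists (A * B) => x; rewrite (le_trans (nrmM _ _))//.
  by apply: ler_pM => //; exact: nrm_ge0.
Qed.

Lemma bmf_cst (a : R[i]) : bmf (fun=> a).
Proof. by split; try exact: measurable_cst; exists (nrm a). Qed.

Lemma bmf_ce q : bmf (ce q).
Proof.
split; try by apply: continuous_measurable_fun; [exact: cont_cosk || exact: cont_sink].
by exists 2 => x; exact: nrm_ce.
Qed.

Lemma bmfN f : bmf f -> bmf (fun x => - f x).
Proof. by move=> h; have := bmfM (bmf_cst (-1)) h; under eq_fun do rewrite mulN1r. Qed.
Lemma bmfB f g : bmf f -> bmf g -> bmf (fun x => f x - g x).
Proof. by move=> fi gi; apply: bmfD => //; exact: bmfN. Qed.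

Definition idx (q : int) : nat := match q with Posz i => i | Negz i => i end.

Lemma bmf_psum c N : bmf (psum c N).
Proof.
elim: N => [|N IH].
  rewrite (_ : psum c 0 = (fun=> 0)); first exact: bmf_cst.
  by apply/funext => x; rewrite /psum big_ord0.
rewrite (_ : psum c N.+1 = (fun x => psum c N x + (c (Posz N) * ce (Posz N) x + c (Negz N) * ce (Negz N) x))).
  by apply: bmfD => //; apply: bmfD; apply: bmfM; try exact: bmf_cst; exact: bmf_ce.
by apply/funext => x; rewrite /psum big_ord_recr.
Qed.

Lemma fc_psum c N q : fc q (psum c N) = if (idx q < N)%N then c q else 0.
Proof.
elim: N => [|N IH].
  rewrite (@eq_fc _ T q _ (fun x => 0 * ce 0 x)) => [|x _].
    by rewrite fcZ// ?mul0r//; exact: citg_ce.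
  by rewrite /psum big_ord0 mul0r.
have E : psum c N.+1 = (fun x => psum c N x + (c (Posz N) * ce (Posz N) x + c (Negz N) * ce (Negz N) x)).
  by apply/funext => x; rewrite /psum big_ord_recr.
have i1 : citg (fun x => c (Posz N) * ce (Posz N) x) by apply: citgZ => //; exact: citg_ce.
have i2 : citg (fun x => c (Negz N) * ce (Negz N) x) by apply: citgZ => //; exact: citg_ce.
rewrite E fcD ?fcD ?fcZ ?fc_ce//; last first.
- by apply: citgD.
- by apply: bmf_citg; exact: bmf_psum.
- exact: citg_ce.
- exact: citg_ce.
rewrite IH; case: q {IH} => n /=; rewrite [in RHS]ltnS [in RHS]leq_eqVlt.
  rewrite mulr0 addr0 eqz_nat.
  by case: ltngtP => [nN|nN|->]; rewrite ?mulr0 ?addr0 ?add0r ?mulr1.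
rewrite mulr0 add0r; have -> : (Negz n == Negz N) = (n == N) by [].
by case: ltngtP => [nN|nN|->]; rewrite ?mulr0 ?addr0 ?add0r ?mulr1.
Qed.

Lemma fc_fsum A c q : decays A c -> fc q (fsum c) = c q.
Proof.
move=> dc; apply/eqP; rewrite -subr_eq0; apply/eqP; apply: nrm_eq0.
apply/ler_addgt0Pl => e e0; rewrite addr0.
near \oo => N.
have qN : (idx q < N)%N by near: N; exact: nbhs_infty_gt.
have -> : c q = fc q (psum c N) by rewrite fc_psum qN.
have bf := bmf_fsum dc; have bp := bmf_psum c N.
rewrite -fcB//; [|exact: bmf_citg|exact: bmf_citg].
apply: le_trans.
  apply: (@fc_bound _ T T0 q _ (8 * A * N.+1%:R^-1)).
    by apply: citgB => //; exact: bmf_citg.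
  by move=> x _; have [_ _] := fsum_cvg x dc.
rewrite -ler_pdivlMl// -ler_pdivlMr ?invr_gt0// invrK -ler_pdivrMl// ?mulr_gt0// ?invr_gt0//.
rewrite (@le_trans _ _ N%:R) ?ler_nat//; near: N; exact: nbhs_infty_ger.
Unshelve. all: by end_near. Qed.

Lemma fsum_unique A c x z : decays A c -> (exists K, forall N, nrm (z - psum c N x) <= K * N.+1%:R^-1) ->
  z = fsum c x.
Proof.
move=> dc [K hK]; have [_ _ h] := fsum_cvg x dc.
apply/eqP; rewrite -subr_eq0; apply/eqP; apply: nrm_eq0.
apply/ler_addgt0Pl => e e0; rewrite addr0.
near \oo => N.
have -> : z - fsum c x = (z - psum c N x) - (fsum c x - psum c N x) by ring.
rewrite (le_trans (nrmB _ _))// (le_trans (lerD (hK N) (h N)))// -mulrDl ler_pdivrMr// [e * _]mulrC -ler_pdivrMr//.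
rewrite (@le_trans _ _ N%:R) ?ler_nat//; near: N; exact: nbhs_infty_ger.
Unshelve. all: by end_near. Qed.

Lemma fsumD A B c d x : decays A c -> decays B d -> fsum (fun q => c q + d q) x = fsum c x + fsum d x.
Proof.
move=> dc dd; apply/esym.
have dcd : decays (A + B) (fun q => c q + d q).
  move=> i; have [a1 a2] := dc i; have [b1 b2] := dd i.
  by rewrite !mulrDl; split; rewrite (le_trans (nrmD _ _))// lerD.
apply: (fsum_unique dcd); exists (8 * A + 8 * B) => N.
have [_ _ h1] := fsum_cvg x dc; have [_ _ h2] := fsum_cvg x dd.
have -> : fsum c x + fsum d x - psum (fun q => c q + d q) N x = (fsum c x - psum c N x) + (fsum d x - psum d N x).
  have -> : psum (fun q => c q + d q) N x = psum c N x + psum d N x.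
    by rewrite /psum -big_split/=; apply: eq_bigr => i _; ring.
  by ring.
by rewrite (le_trans (nrmD _ _))// mulrDl lerD.
Qed.

Lemma fsumZ A (a : R[i]) c x : decays A c -> fsum (fun q => a * c q) x = a * fsum c x.
Proof.
move=> dc; apply/esym.
have da : decays (nrm a * A) (fun q => a * c q).
  move=> i; have [a1 a2] := dc i.
  by rewrite -!mulrA; split; rewrite (le_trans (nrmM _ _))// ler_wpM2l// nrm_ge0.
apply: (fsum_unique da); exists (nrm a * (8 * A)) => N.
have [_ _ h1] := fsum_cvg x dc.
have -> : a * fsum c x - psum (fun q => a * c q) N x = a * (fsum c x - psum c N x).
  have -> : psum (fun q => a * c q) N x = a * psum c N x.
    by rewrite /psum mulr_sumr; apply: eq_bigr => i _; ring.
  by ring.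
by rewrite (le_trans (nrmM _ _))// -mulrA ler_wpM2l// nrm_ge0.
Qed.

End synth.

(** * Periodic extension and antiderivatives *)

Section per.
Context {R : realType}.
Notation mu := (@lebesgue_measure R).
Local Notation itg A f := (mu.-integrable A (EFin \o f)).
Local Notation loc f := (locally_integrable setT f).
Local Notation Re := complex.Re.
Local Notation Im := complex.Im.
Variable T : R.
Hypothesis T0 : 0 < T.
Let kap := 2 * pi / T.
Local Notation fc := (fc T).
Local Notation ce := (ce T).
Local Notation citg := (citg T).
Local Notation cper := (cper T).
Local Notation ik := (ik T).

(** Elements of L^2(0, T) are given on ]0, T[ only; this extends them to
    periodic functions on the line, as [Hper] requires. *)
Definition per (g : R -> R) (x : R) : R :=
  (g \_ `]0, T[) (x - T * (Num.floor (x / T))%:~R).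

Lemma per_T g x : per g (x + T) = per g x.
Proof.
rewrite /per; have -> : Num.floor ((x + T) / T) = Num.floor (x / T) + 1.
  by rewrite mulrDl divff ?gt_eqF// floorDrz ?floor1 // rpred1.
by congr ((g \_ _) _); rewrite rmorphD/=; ring.
Qed.

Lemma per_in g x : 0 < x < T -> per g x = g x.
Proof.
move=> /andP[x0 xT]; rewrite /per (@floor_def _ _ 0) ?mulr0 ?subr0 ?patch_oo ?x0//.
by rewrite add0r divr_ge0 ?(ltW x0) ?(ltW T0)//= ltr_pdivrMr// mul1r.
Qed.

Lemma per_meas g : measurable_fun `]0, T[ g -> measurable_fun setT (per g).
Proof.
move=> mg; apply: (@measurableT_comp _ _ _ _ _ _ (g \_ `]0, T[)).
  exact/(measurable_restrictT g (measurable_itv _)).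
apply: measurable_funB => //; apply: measurable_funM => //.
apply: (@nondecreasing_measurable R setT (fun x : R => (Num.floor (x / T))%:~R)) => // x y xy.
by rewrite ler_int le_floor// ler_pM2r ?invr_gt0.
Qed.

(** On a bounded interval the extension is dominated by a finite sum of
    translates of g. *)
Lemma per_loc g : itg `]0, T[ g -> loc (per g).
Proof.
move=> gi; have g0i := integrable_patch (measurable_itv _) gi.
apply: itg_loc => [|N]; first by apply: per_meas; exact: integrable_meas.
pose K := (Num.bound (N%:R / T)).+1.
have NK : N%:R < K%:R * T.
  by rewrite -ltr_pdivrMr// (lt_trans (archi_boundP _)) ?ltr_nat// divr_ge0// ltW.
have [hi _] := @Rint_sumn R setT (K + K)%N (fun n x => `|(g \_ `]0, T[) (x + (K%:R * T - n%:R * T))|) measurableT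
  (fun n => integrable_norm (itg_shift (K%:R * T - n%:R * T) g0i)).
apply: (@itg_le _ _ _ _ _ _ _ (integrableS _ _ _ hi)) => //.
  by apply: measurable_funTS; apply: per_meas; exact: integrable_meas.
move=> x /=; rewrite in_itv/= => /andP[xl xr].
have [m hm] : exists m : nat, Num.floor (x / T) + K%:Z = m%:Z.
  have : 0 <= Num.floor (x / T) + K%:Z.
    rewrite -lerBlDr sub0r floor_ge_int//= rmorphN/= ler_pdivlMr// mulNr.
    by rewrite lerNl; apply: le_trans (ltW NK); rewrite lerNl.
  by case: (_ + _) => // m _; exists m.
have mK : (m < K + K)%N.
  rewrite -ltz_nat -hm PoszD ltrD2r floor_lt_int//= ltr_pdivrMr//.
  exact: le_lt_trans NK.
rewrite (bigD1 (Ordinal mK))//= /per.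
have -> : x - T * (Num.floor (x / T))%:~R = x + (K%:R * T - m%:R * T).
  have : (Num.floor (x / T))%:~R + K%:R = m%:R :> R.
    by have /(congr1 (fun z : int => z%:~R : R)) := hm; rewrite rmorphD/=.
  by move=> <-; ring.
by rewrite lerDl sumr_ge0.
Qed.

Lemma per_aeper g : aeper T (per g).
Proof. by apply: aeW => x; rewrite per_T. Qed.

Lemma per_bound g B : (forall x, 0 < x < T -> `|g x| <= B) -> forall x, `|per g x| <= `|B|.
Proof.
move=> gB x; rewrite /per /patch mem_oo; case: ifP => h.
  by rewrite (le_trans (gB _ h))// ler_norm.
by rewrite -[point]/(0 : R) normr0.
Qed.

(** The primitive on ]0, T[, extended by periodicity. The boundary term of
    the integration by parts is a multiple of the mean of y, hence k is
    arbitrary. *)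
Lemma antideriv_real (y : R -> R) : itg `]0, T[ y -> \int[mu]_(x in `]0, T[) y x = 0 ->
  exists Y : R -> R, [/\ measurable_fun setT Y, exists B : R, forall x : R, `|Y x| <= B,
    forall x : R, Y (x + T) = Y x & forall k : R,
    \int[mu]_(x in `]0, T[) (y x * cos (k * x)) = k * \int[mu]_(x in `]0, T[) (Y x * sin (k * x)) /\
    \int[mu]_(x in `]0, T[) (y x * sin (k * x)) = - k * \int[mu]_(x in `]0, T[) (Y x * cos (k * x))].
Proof.
move=> yi y0; have yp := integrable_patch (measurable_itv _) yi.
pose Y0 x := \int[mu]_(t in `]0, x[) (y \_ `]0, T[) t.
have cY := prim_cont T0 yp; rewrite -/Y0 in cY.
have mY0 : measurable_fun `]0, T[ Y0.
  apply: (@measurable_funS _ _ _ _ `[0, T]%classic) => //; first exact: subset_itv_oo_cc.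
  exact: subspace_continuous_measurable_fun.
have [B hB] := prim_bound T0 yp.
have Y0i : itg `]0, T[ Y0 by apply: integrable_oo hB.
have ibpY (p dp : R -> R) : continuous dp -> (forall x : R, is_derive x 1 p (dp x)) ->
   \int[mu]_(x in `]0, T[) (per Y0 x * dp x) = - \int[mu]_(x in `]0, T[) (y x * p x).
  move=> cdp pdp; have cp := is_derive_cont pdp; have yp' := itg_mul_cont yi cp.
  transitivity (\int[mu]_(t in `]0, T[) (y t * (p T - p t))).
    rewrite -(ibp_prim T0 yi cdp pdp); apply: eq_Rintegral => x; rewrite mem_oo => xT.
    by rewrite per_in// /Y0 Rint_patch_oo//; case/andP: xT => _ /ltW.
  transitivity (\int[mu]_(t in `]0, T[) (y t * p T - y t * p t)).
    by apply: eq_Rintegral => t _; rewrite mulrBr.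
  by rewrite RintegralB//; [rewrite RintegralZr// y0 mul0r sub0r | exact: itgZr].
have pYi : itg `]0, T[ (per Y0) by apply: loc_itg; exact: per_loc.
exists (per Y0); split.
- exact: per_meas.
- by exists `|B|; exact: per_bound.
- exact: per_T.
have ck (f' : R -> R) (k d : R) : continuous f' -> continuous (fun x : R => d * f' (k * x)).
  move=> cf x; apply: cvgM; first exact: cvg_cst.
  by apply: (@continuous_comp _ _ _ (fun x : R => k * x) f'); [exact: mulrl_continuous|exact: cf].
have ck1 (f' : R -> R) (k : R) : continuous f' -> continuous (fun x : R => f' (k * x)).
  by move=> cf x; apply: (@continuous_comp _ _ _ (fun x : R => k * x) f'); [exact: mulrl_continuous|exact: cf].
move=> k; split.
  have cd : continuous (fun x : R => - k * sin (k * x)) by apply: ck; exact: continuous_sin.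
  have dd (x : R) : is_derive x 1 (fun x : R => cos (k * x)) (- k * sin (k * x)).
    by apply: is_derive_eq; rewrite /GRing.scale/=; ring.
  have H := ibpY _ _ cd dd; apply: oppr_inj; rewrite -H -mulNr -RintegralZl//; last first.
    by apply: itg_mul_cont => //; apply: ck1; exact: continuous_sin.
  by apply: eq_Rintegral => x _; ring.
have cd : continuous (fun x : R => k * cos (k * x)) by apply: ck; exact: continuous_cos.
have dd (x : R) : is_derive x 1 (fun x : R => sin (k * x)) (k * cos (k * x)).
  by apply: is_derive_eq; rewrite /GRing.scale/=; ring.
have H := ibpY _ _ cd dd; apply: oppr_inj; rewrite -H mulNr opprK -RintegralZl//; last first.
  by apply: itg_mul_cont => //; apply: ck1; exact: continuous_cos.
by apply: eq_Rintegral => x _; ring.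
Qed.

Lemma fc_cst q (a : R[i]) : fc q (fun=> a) = a * (q == 0)%:R.
Proof.
rewrite -(fc_ce T0 q 0) -fcZ//; last exact: citg_ce.
by apply: eq_fc => x _; rewrite ce0 mulr1.
Qed.

(** Division by [ik q] on Fourier coefficients; the coefficient of index 0,
    which it leaves undetermined, can be prescribed. *)
Lemma antideriv (y : R -> R[i]) (C : R[i]) : citg y -> fc 0 y = 0 ->
  exists Y, [/\ bmf Y, forall x, Y (x + T) = Y x, fc 0 Y = C & forall q, fc q y = ik q * fc q Y].
Proof.
move=> yi y0; have [y1 y2] := yi.
have TC : T%:C != 0 by rewrite eq_complex/= gt_eqF.
have := fcE T0 0 yi; rewrite y0 mulr0/=.
have E0 (v : R -> R) : \int[mu]_(x in `]0, T[) (v x * cos (0 * (2 * pi / T) * x)) = \int[mu]_(x in `]0, T[) v x.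
  by apply: eq_Rintegral => x _; rewrite !mul0r cos0 mulr1.
have S0 (v : R -> R) : \int[mu]_(x in `]0, T[) (v x * sin (0 * (2 * pi / T) * x)) = 0.
  rewrite -[RHS](mul0r (T - 0)) -Rint_cst_oo//; apply: eq_Rintegral => x _.
  by rewrite !mul0r sin0 mulr0.
rewrite !E0 !S0 addr0 subr0 => -[/esym z1 /esym z2].
have [Y1 [m1 [B1 b1] p1 h1]] := antideriv_real y1 z1.
have [Y2 [m2 [B2 b2] p2 h2]] := antideriv_real y2 z2.
pose Y x := Y1 x +i* Y2 x.
have bY : bmf Y by split=> //; exists (B1 + B2) => x; rewrite /nrm/= lerD.
have Yi := bmf_citg T bY.
have cst_i (a : R[i]) : citg (fun=> a) by apply: bmf_citg; exact: bmf_cst.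
exists (fun x => Y x + (C - fc 0 Y)); split.
- by apply: bmfD => //; exact: bmf_cst.
- by move=> x; rewrite /Y p1 p2.
- by rewrite fcD// fc_cst mulr1 addrC subrK.
move=> q; rewrite fcD// fc_cst mulrDr.
have -> : ik q * ((C - fc 0 Y) * (q == 0)%:R) = 0.
  by case: eqP => [->|_]; rewrite ?mulr0// /ik mul0r mul0r.
rewrite addr0; suff : T%:C * fc q y = ik q * (T%:C * fc q Y) by rewrite (mulrCA (ik q)); move/(mulfI TC).
rewrite (fcE T0 q yi) (fcE T0 q Yi).
have [a1 a2] := h1 (q%:~R * (2 * pi / T)); have [a3 a4] := h2 (q%:~R * (2 * pi / T)).
rewrite a1 a2 a3 a4 /ik.
by apply: eq_ReIm; rewrite ?ReM ?ImM/=; ring.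
Qed.

End per.

(** * The operator in terms of Fourier coefficients *)

Section op.
Context {R : realType}.
Notation mu := (@lebesgue_measure R).
Local Notation itg A f := (mu.-integrable A (EFin \o f)).
Local Notation loc f := (locally_integrable setT f).
Local Notation Re := complex.Re.
Local Notation Im := complex.Im.
Variable T : R.
Hypothesis T0 : 0 < T.
Let kap := 2 * pi / T.
Local Notation fc := (fc T).
Local Notation ce := (ce T).
Local Notation citg := (citg T).
Local Notation cper := (cper T).
Local Notation ik := (ik T).

(** Periodicity almost everywhere, unlike in [cHper], makes the class stable
    under [cwderiv], whose values are arbitrary representatives. *)
Definition cH (j : nat) (f : R -> R[i]) :=
  [/\ Hloc j (fun x => Re (f x)), Hloc j (fun x => Im (f x)) & cper f].

Lemma cH_wderiv j f : cH j.+1 f ->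
  [/\ cwd f (cwderiv f), cH j (cwderiv f) & forall q, fc q (cwderiv f) = ik q * fc q f].
Proof.
move=> [h1 h2 pf]; have [w1 d1] := Hloc_wderiv h1; have [w2 d2] := Hloc_wderiv h2.
have w : cwd f (cwderiv f) := conj w1 w2.
split=> //; first by split=> //; exact: cwd_cper w pf.
by move=> q; exact: (fc_wderiv T0 q w pf).
Qed.

Lemma cH_dec j f : cH j.+1 f -> cH j f.
Proof. by move=> [h1 h2 pf]; split=> //; exact: Hloc_dec. Qed.

Lemma cHD j f g : cH j f -> cH j g -> cH j (fun x => f x + g x).
Proof.
move=> [f1 f2 [p1 p2]] [g1 g2 [r1 r2]]; split.
- by have := Hloc_lin 1 1 f1 g1; congr Hloc; apply/funext => x; rewrite ReD !mul1r.
- by have := Hloc_lin 1 1 f2 g2; congr Hloc; apply/funext => x; rewrite ImD !mul1r.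
- split.
    by have := aeper_lin 1 1 p1 r1; congr aeper; apply/funext => x; rewrite ReD !mul1r.
  by have := aeper_lin 1 1 p2 r2; congr aeper; apply/funext => x; rewrite ImD !mul1r.
Qed.

Lemma cHZ j (a : R[i]) f : cH j f -> cH j (fun x => a * f x).
Proof.
move=> [f1 f2 [p1 p2]]; split.
- by have := Hloc_lin (Re a) (- Im a) f1 f2; congr Hloc; apply/funext => x; rewrite ReM; ring.
- by have := Hloc_lin (Re a) (Im a) f2 f1; congr Hloc; apply/funext => x; rewrite ImM; ring.
- split.
    by have := aeper_lin (Re a) (- Im a) p1 p2; congr aeper; apply/funext => x; rewrite ReM; ring.
  by have := aeper_lin (Re a) (Im a) p2 p1; congr aeper; apply/funext => x; rewrite ImM; ring.
Qed.

Lemma cHN j f : cH j f -> cH j (fun x => - f x).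
Proof. by move=> /(cHZ (-1)); under eq_fun do rewrite mulN1r. Qed.
Lemma cHB j f g : cH j f -> cH j g -> cH j (fun x => f x - g x).
Proof. by move=> hf hg; apply: cHD => //; exact: cHN. Qed.

Lemma cH_mul j (P : R -> R) f : Cder j P -> (forall x, P (x + T) = P x) -> cH j f ->
  cH j (fun x => (P x)%:C * f x).
Proof.
move=> CP PT [f1 f2 [p1 p2]]; have pP : aeper T P by apply: aeW => x; rewrite PT.
split.
- by have := Hloc_mul CP f1; congr Hloc; apply/funext => x; rewrite ReZ.
- by have := Hloc_mul CP f2; congr Hloc; apply/funext => x; rewrite ImZ.
- split.
    by have := aeper_mul pP p1; congr aeper; apply/funext => x; rewrite ReZ.
  by have := aeper_mul pP p2; congr aeper; apply/funext => x; rewrite ImZ.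
Qed.

Lemma cH_citg j f : cH j f -> citg f.
Proof. by move=> [f1 f2 _]; split; apply: loc_itg; apply: L2loc_loc; [exact: Hloc_L2loc f1|exact: Hloc_L2loc f2]. Qed.

Lemma cH_L2 j f : cH j f -> L2 T f.
Proof.
move=> [/Hloc_L2loc[m1 l1] /Hloc_L2loc[m2 l2] _].
split; [exact: measurable_funTS|exact: measurable_funTS|].
by apply: itgD => //; exact: loc_itg.
Qed.

Lemma cHper_cH j f : cHper T j f -> cH j f.
Proof.
by move=> [[h1 p1] [h2 p2]]; split=> //; split; apply: aeW => x; rewrite ?p1 ?p2.
Qed.

(** The common form of the two operators. For T = 2 pi, al = k^4 and be = k^2
    it is l d_z - B; for T = 2 pi / k and al = be = 1 it is l d_x - A. *)
Definition opG (l al be c : R) (P : R -> R) (f : R -> R[i]) : R -> R[i] := fun x =>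
  l%:C * cwderiv f x - cwderivn 2 (fun z => al%:C * cwderivn 4 f z + be%:C * cwderivn 2 f z
    - c%:C * f z + (P z)%:C * f z) x.

Section ana.
Variables (l al be c : R) (P : R -> R).
Hypothesis CP : Cder 2 P.
Hypothesis PT : forall x, P (x + T) = P x.
Let symb (f : R -> R[i]) (q : int) : R[i] := al%:C * ik q ^+ 4 * fc q f +
  be%:C * ik q ^+ 2 * fc q f - c%:C * fc q f + fc q (fun x => (P x)%:C * f x).

Lemma inner_op f4 f2 f0 : cH 2 f4 -> cH 2 f2 -> cH 2 f0 ->
  cH 2 (fun z => al%:C * f4 z + be%:C * f2 z - c%:C * f0 z + (P z)%:C * f0 z) /\
  forall q, fc q (fun z => al%:C * f4 z + be%:C * f2 z - c%:C * f0 z + (P z)%:C * f0 z) =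
    al%:C * fc q f4 + be%:C * fc q f2 - c%:C * fc q f0 + fc q (fun x => (P x)%:C * f0 x).
Proof.
move=> h4 h2 h0; have hP := cH_mul CP PT h0.
have g4 := cHZ al%:C h4; have g2 := cHZ be%:C h2; have g0 := cHZ c%:C h0.
have g42 := cHD g4 g2; have g420 := cHB g42 g0; split; first exact: cHD.
have [i4 i2 i0] := And3 (cH_citg h4) (cH_citg h2) (cH_citg h0).
move=> q; rewrite (fcD q (cH_citg g420) (cH_citg hP)) (fcB q (cH_citg g42) (cH_citg g0)).
by rewrite (fcD q (cH_citg g4) (cH_citg g2)) !fcZ.
Qed.

Lemma symbol_alg (a b d m z F G D1 O X1 X2 X3 X4 X5 : R[i]) : X1 = z * X2 -> X2 = z * X3 ->
  X3 = a * X4 + b * X5 - d * F + G -> X4 = z ^+ 4 * F -> X5 = z ^+ 2 * F ->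
  D1 = z * F -> O = m * D1 - X1 ->
  O = m * z * F - z ^+ 2 * (a * z ^+ 4 * F + b * z ^+ 2 * F - d * F + G).
Proof. by move=> -> -> -> -> -> -> ->; ring. Qed.

(** On the domain, differentiation is multiplication by [ik q]; the potential
    contributes the coefficient of P f. *)
Lemma analysis f : cHper T 6 f -> [/\ cH 6 f, cH 0 (opG l al be c P f) &
  forall q, fc q (opG l al be c P f) = l%:C * ik q * fc q f - ik q ^+ 2 * symb f q].
Proof.
move=> /cHper_cH hf; have [_ d1 e1] := cH_wderiv hf.
have [_ d2 e2] := cH_wderiv d1; have [_ d3 e3] := cH_wderiv d2.
have [_ d4 e4] := cH_wderiv d3.
have i1 := cH_citg d1.
have f2 : cH 2 f by do 4! apply: cH_dec.
have [hg eg] := inner_op (f4 := cwderivn 4 f) (f2 := cwderivn 2 f) d4 (cH_dec (cH_dec d2)) f2.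
set g := (fun z => _) in hg eg.
have [_ g1 k1] := cH_wderiv hg; have [_ g2 k2] := cH_wderiv g1.
have H : cH 0 (fun x => l%:C * cwderiv f x) by apply: cHZ; do 5! apply: cH_dec.
split=> //; first exact: (cHB H g2).
have e4' q : fc q (cwderivn 4 f) = ik q ^+ 4 * fc q f.
  by rewrite [LHS](e4 q) e3 e2 e1; ring.
have e2' q : fc q (cwderivn 2 f) = ik q ^+ 2 * fc q f by rewrite [LHS](e2 q) e1; ring.
move=> q.
have E : fc q (opG l al be c P f) = l%:C * fc q (cwderiv f) - fc q (cwderiv (cwderiv g)).
  exact: etrans (fcB q (cH_citg H) (cH_citg g2)) (congr1 (fun w => w - _) (fcZ q _ i1)).
exact: (symbol_alg (k2 q) (k1 q) (eg q) (e4' q) (e2' q) (e1 q) E).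
Qed.

Lemma bmf_cper f : (forall x, f (x + T) = f x) -> cper f.
Proof. by move=> h; split; apply: aeW => x; rewrite h. Qed.

Lemma bmf_Hloc0 f : bmf f -> (forall x, f (x + T) = f x) -> cH 0 f.
Proof.
move=> [m1 m2 [B hB]] pf; split; [split=> //|split=> //|exact: bmf_cper].
- apply: (L2loc_le (K := fun=> B) (L2loc_cont (@cst_continuous _ _ (1 : R)))) => // N x _.
  by rewrite normr1 mulr1 (le_trans (Re_nrm _)).
- apply: (L2loc_le (K := fun=> B) (L2loc_cont (@cst_continuous _ _ (1 : R)))) => // N x _.
  by rewrite normr1 mulr1 (le_trans (Im_nrm _)).
Qed.

(** Regularity is gained one derivative at a time, from an identity between
    Fourier coefficients. *)
Lemma cH_step j f g : bmf f -> (forall x, f (x + T) = f x) -> cH j g ->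
  (forall q, fc q g = ik q * fc q f) -> cH j.+1 f.
Proof.
move=> bf pf [g1 g2 pg] H.
have [h1 h2 pf'] := bmf_Hloc0 bf pf; have [l1 l2] := bmf_loc bf.
have [w1 w2] := wderiv_fc T0 l1 l2 (L2loc_loc (Hloc_L2loc g1)) (L2loc_loc (Hloc_L2loc g2)) pf' pg H.
split=> //; split.
- exact: Hloc_L2loc h1.
- by exists (fun x => Re (g x)).
- exact: Hloc_L2loc h2.
- by exists (fun x => Im (g x)).
Qed.

(** The factor 3 absorbs the difference between 1 + q^2 and the weight (i + 1)
    (i + 2) at i = |q| or i = |q| - 1. *)
Lemma decays_quadratic A (x : int -> R[i]) : (forall q, nrm (x q) * (1 + q%:~R ^+ 2) <= A) -> decays (3 * A) x.
Proof.
move=> H i; have A0 : 0 <= A by apply: le_trans (H 0); rewrite mulr_ge0 ?nrm_ge0// addr_ge0// sqr_ge0.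
have key (q : int) : i.+1%:R * i.+2%:R <= 3 * (1 + q%:~R ^+ 2) :> R -> nrm (x q) <= 3 * A * wt i.
  move=> h; rewrite /wt ler_pdivlMr ?mulr_gt0//.
  apply: (@le_trans _ _ (nrm (x q) * (3 * (1 + q%:~R ^+ 2)))).
    by rewrite ler_wpM2l// nrm_ge0.
  by rewrite mulrCA ler_wpM2l.
have i0 : 0 <= i%:R :> R by [].
have E1 : i.+1%:R = i%:R + 1 :> R by rewrite natr1.
have E2 : i.+2%:R = i%:R + 2 :> R by rewrite -!natr1; ring.
split; apply: key; rewrite E1 E2; last by rewrite NegzE rmorphN/= -pmulrn E1; nra.
rewrite -pmulrn; case: i i0 {E1 E2} => [|[|i]] _; rewrite ?expr0n/=; try lra.
have : (2 : R) <= i.+2%:R by rewrite ler_nat.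
by set y := i.+2%:R; nra.
Qed.

(** Decay like q^-4 makes the series of f, f' and f'' converge uniformly, but
    no more. The other derivatives come from the equation: integrating the
    function l f' - nu f - h twice gives U = al f^(4) + be f'' - c f + P f,
    which can be solved for f^(4). Knowing that f, f'' and U are in H^2, one
    obtains f^(4) in H^2, hence f in H^6. *)
Lemma synthesis (nu : R[i]) (h : R -> R[i]) (x : int -> R[i]) A : al != 0 -> L2 T h ->
  (forall q, nrm (x q) * (1 + q%:~R ^+ 2) ^+ 2 <= A) ->
  (forall q, l%:C * ik q * x q - ik q ^+ 2 * (al%:C * ik q ^+ 4 * x q + be%:C * ik q ^+ 2 * x q
     - c%:C * x q + fc q (fun t => (P t)%:C * fsum T x t)) - nu * x q = fc q h) ->
  cHper T 6 (fsum T x) /\ L2eq T (Defs.shift (opG l al be c P) nu (fsum T x)) h.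
Proof.
move=> al0 [mh1 mh2 hi] xA eqn.
have k0 : 0 < kap by exact: kap_gt0.
have n0 (q : int) : 0 <= q%:~R ^+ 2 :> R by exact: sqr_ge0.
have ik2 q : ik q ^+ 2 = (- (kap ^+ 2 * q%:~R ^+ 2))%:C.
  by rewrite /ik; apply: eq_ReIm; rewrite expr2 ?ReM ?ImM/=; rewrite -/kap; ring.
have ikn q : nrm (ik q) <= kap * (1 + q%:~R ^+ 2).
  rewrite /ik /nrm /= normr0 add0r -/kap normrM (gtr0_norm k0) mulrC ler_pM2l//.
  rewrite ler_norml; apply/andP; split; nra.
have N1 (q : int) : 1 <= 1 + q%:~R ^+ 2 :> R by rewrite lerDl.
have d0 : decays (3 * A) x.
  apply: decays_quadratic => q; apply: le_trans (xA q); have := N1 q; have := nrm_ge0 (x q).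
  by set n := nrm _; set N := 1 + _ => ? ?; rewrite expr2 mulrA ler_peMr// mulr_ge0//; lra.
have d1 : decays (3 * (kap * A)) (fun q => ik q * x q).
  apply: decays_quadratic => q; apply: (@le_trans _ _ (kap * (nrm (x q) * (1 + q%:~R ^+ 2) ^+ 2))); last by rewrite ler_pM2l.
  have := ikn q; have := nrmM (ik q) (x q); have := N1 q; have := nrm_ge0 (x q).
  set n := nrm (x q); set N := 1 + _ => n00 N10 le1 le2.
  have -> : kap * (n * N ^+ 2) = kap * N * n * N by ring.
  by rewrite ler_wpM2r//; [lra | apply: (le_trans le1); rewrite ler_wpM2r].
have d2 : decays (3 * (kap ^+ 2 * A)) (fun q => ik q ^+ 2 * x q).
  apply: decays_quadratic => q; apply: (@le_trans _ _ (kap ^+ 2 * (nrm (x q) * (1 + q%:~R ^+ 2) ^+ 2))); last by rewrite ler_pM2l ?exprn_gt0.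
  rewrite ik2 nrmZ normrN ger0_norm; last by apply: mulr_ge0; exact: sqr_ge0.
  have := N1 q; have := n0 q; have := nrm_ge0 (x q); set n := nrm (x q); set N := q%:~R ^+ 2 => n00 N00 N10.
  have -> : kap ^+ 2 * (n * (1 + N) ^+ 2) = kap ^+ 2 * (1 + N) * n * (1 + N) by ring.
  rewrite ler_wpM2r//; first by lra.
  by rewrite ler_wpM2r// ler_wpM2l ?sqr_ge0//; lra.
have [b0 b1 b2] := And3 (bmf_fsum T d0) (bmf_fsum T d1) (bmf_fsum T d2).
set f0 := fsum T x in eqn b0 *; set f1 := fsum T _ in b1; set f2 := fsum T _ in b2.
have p0 t : f0 (t + T) = f0 t by exact: fsum_per.
have p1 t : f1 (t + T) = f1 t by exact: fsum_per.
have p2 t : f2 (t + T) = f2 t by exact: fsum_per.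
have c0 q : fc q f0 = x q by exact: (fc_fsum T0 q d0).
have c1 q : fc q f1 = ik q * x q by exact: (fc_fsum T0 q d1).
have c2 q : fc q f2 = ik q ^+ 2 * x q by exact: (fc_fsum T0 q d2).
have ik0 : ik 0 = 0 by rewrite /ik mul0r.
have bP : bmf (fun t => (P t)%:C * f0 t).
  have cP := Cder_cont CP; have [Q hQ] := cont_bounded 0 T cP.
  apply: bmfM => //; split.
  - exact: continuous_measurable_fun.
  - exact: measurable_cst.
  - exists Q => t; rewrite nrmR.
    have PN (n : nat) y : P (y + n%:R * T) = P y.
      by elim: n => [|n IH]; rewrite ?mul0r ?addr0// -natr1 mulrDl mul1r addrA PT.
    have Pz (m : int) : P (t + m%:~R * T) = P t.
      case: m => n; first exact: PN.
      by rewrite NegzE rmorphN/= -pmulrn -[LHS](PN n.+1); congr P; ring.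
    rewrite -(Pz (- Num.floor (t / T))); apply: hQ.
    have /andP[fl fr] := real_floor_itv (num_real (t / T)).
    have E : t = t / T * T by rewrite divfK ?gt_eqF.
    rewrite intrD in fr; move: fl fr; set m : R := (Num.floor _)%:~R => fl fr.
    rewrite rmorphN/= -/m; apply/andP; split.
      by have := ler_wpM2r (ltW T0) fl; rewrite -E; lra.
    by have := ltW fr; rewrite -(ler_pM2r T0) -E mulrDl mul1r; lra.
have hper (v : R -> R) : measurable_fun `]0, T[ v -> (forall t, `]0, T[%classic t -> v t ^+ 2 <= Re (h t) ^+ 2 + Im (h t) ^+ 2) -> L2loc (per T v).
  move=> mv hv; split; first exact: per_meas.
  have -> : (fun t => per T v t ^+ 2) = per T (fun t => v t ^+ 2).
    apply/funext => t; rewrite /per /patch; case: ifP => // _.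
    by rewrite -[point]/(0 : R) expr2 mulr0.
  apply: per_loc => //; apply: (@itg_le _ _ _ _ _ _ _ hi) => //; first exact: measurable_funX.
  by move=> t tT; rewrite ger0_norm ?sqr_ge0//; exact: hv.
pose H t : R[i] := per T (fun t => Re (h t)) t +i* per T (fun t => Im (h t)) t.
have cHH : cH 0 H.
  split; [split=> //|split=> //|split; exact: per_aeper].
    by apply: hper => // t _; rewrite lerDl sqr_ge0.
  by apply: hper => // t _; rewrite lerDr sqr_ge0.
have HE t : 0 < t < T -> H t = h t by move=> tT; rewrite /H !per_in//; case: (h t).
have eH q : fc q H = fc q h by exact: eq_fc.
pose y t := l%:C * f1 t - nu * f0 t - H t.
have hy : cH 0 y := cHB (cHB (cHZ _ (bmf_Hloc0 b1 p1)) (cHZ _ (bmf_Hloc0 b0 p0))) cHH.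
have [i0 i1 i2] := And3 (bmf_citg T b0) (bmf_citg T b1) (bmf_citg T b2).
have iH := cH_citg cHH; have iy := cH_citg hy.
have ey q : fc q y = l%:C * ik q * x q - nu * x q - fc q h.
  by rewrite /y fcB ?fcB ?fcZ ?c0 ?c1 ?eH ?mulrA//; [exact: citgZ|exact: citgZ|by apply: citgB; exact: citgZ].
(* y is the second derivative of U, and it has mean 0 by the equation at q =
   0. *)
have [|Y1 [bY1 pY1 mY1 eY1]] := antideriv T0 0 iy.
  by rewrite ey -(eqn 0) ik0 expr0n/= !(mulr0, mul0r); ring.
have [U [bU pU mU eU]] := antideriv T0 (- c%:C * x 0 + fc 0 (fun t => (P t)%:C * f0 t)) (bmf_citg T bY1) mY1.
have ikN0 q : q != 0 -> ik q != 0.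
  move=> q0; rewrite /ik eq_complex/= eqxx/= mulf_neq0 ?intr_eq0// gt_eqF//.
have eUX q : fc q U = al%:C * ik q ^+ 4 * x q + be%:C * ik q ^+ 2 * x q
     - c%:C * x q + fc q (fun t => (P t)%:C * f0 t).
  have [->|q0] := eqVneq q 0; first by rewrite mU ik0 !expr0n/= !(mulr0, mul0r); ring.
  apply: (mulfI (expf_neq0 2 (ikN0 q q0))).
  have := eY1 q; rewrite ey -(eqn q) eU => E.
  transitivity (ik q * (ik q * fc q U)); first by ring.
  by rewrite -E; ring.
have iP := bmf_citg T bP; have iU := bmf_citg T bU.
pose ia := (al^-1)%:C : R[i].
have alC : ia * al%:C = 1 by rewrite -rmorphM/= mulVf.
pose f4 t := ia * (U t - be%:C * f2 t + c%:C * f0 t - (P t)%:C * f0 t).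
have bf4 : bmf f4.
  apply: bmfM; first exact: bmf_cst.
  apply: bmfB => //; apply: bmfD; last by apply: bmfM => //; exact: bmf_cst.
  by apply: bmfB => //; apply: bmfM => //; exact: bmf_cst.
have pf4 t : f4 (t + T) = f4 t by rewrite /f4 pU p2 p0 PT.
have e4 q : fc q f4 = ik q ^+ 4 * x q.
  have j2 := citgZ be%:C i2; have j0 := citgZ c%:C i0.
  rewrite /f4 fcZ; last by apply: citgB => //; apply: citgD => //; exact: citgB.
  rewrite fcB//; last by apply: citgD => //; exact: citgB.
  rewrite fcD//; last exact: citgB.
  rewrite fcB// !fcZ// c0 c2 eUX -[RHS]mul1r -alC; ring.
have [|f3 [bf3 pf3 m3 e3]] := antideriv T0 0 (bmf_citg T bf4).
  by rewrite e4 ik0 expr0n/= mul0r.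
have e32 q : fc q f3 = ik q * fc q f2.
  have [->|q0] := eqVneq q 0; first by rewrite m3 ik0 mul0r.
  by apply: (mulfI (ikN0 q q0)); rewrite -e3 e4 c2; ring.
have H2f2 : cH 2 f2 := cH_step b2 p2 (cH_step bf3 pf3 (bmf_Hloc0 bf4 pf4) e3) e32.
have e01 q : fc q f1 = ik q * fc q f0 by rewrite c1 c0.
have e12 q : fc q f2 = ik q * fc q f1 by rewrite c1 c2 expr2 mulrA.
have H2f0 : cH 2 f0 := cH_step b0 p0 (cH_step b1 p1 (bmf_Hloc0 b2 p2) e12) e01.
have H2U : cH 2 U := cH_step bU pU (cH_step bY1 pY1 hy eY1) eU.
have H2f4 : cH 2 f4.
  exact: (cHZ _ (cHB (cHD (cHB H2U (cHZ _ H2f2)) (cHZ _ H2f0)) (cH_mul CP PT H2f0))).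
have H6 : cH 6 f0 :=
  cH_step b0 p0 (cH_step b1 p1 (cH_step b2 p2 (cH_step bf3 pf3 H2f4 e3) e32) e12) e01.
have dom : cHper T 6 f0 by case: H6 => ? ? _; split; split=> // t; rewrite p0.
split=> //; have [_ cO eO] := analysis dom.
have iO := cH_citg cO; have inu := citgZ nu i0.
have ih : citg h.
  have [h1 h2] := iH; split.
    by apply: eq_integrable h1 => // t; rewrite mem_oo/= => tT; rewrite per_in.
  by apply: eq_integrable h2 => // t; rewrite mem_oo/= => tT; rewrite per_in.
have eqc q : fc q (fun t => opG l al be c P f0 t - nu * f0 t) = fc q h.
  by rewrite (fcB q iO inu) (fcZ q nu i0) (eO q) /symb c0 -(eqn q); ring.
have := fc_uniq T0 (citgB iO inu) ih eqc; apply: ae_mono => t ht.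
by rewrite /= in_itv/= => tT; exact: ht.
Qed.
End ana.

(** Cauchy-Schwarz up to a constant, from s |h| <= s^2 + |h|^2 integrated with
    s equal to the L^2 norm of h; the case s = 0 is a limit. *)
Lemma L2_L1 h : L2 T h -> citg h /\ \int[mu]_(x in `]0, T[) nrm (h x) <= (T + 1) * L2norm T h.
Proof.
move=> [m1 m2 hi].
have ch : citg h.
  split.
    apply: (@itg_le _ _ _ (fun x => 1 + (Re (h x) ^+ 2 + Im (h x) ^+ 2))) => //.
      move=> x _; have := real_normK (num_real (Re (h x))); have := sqr_ge0 (`|Re (h x)| - 1).
      by have := sqr_ge0 (Im (h x)); set a := `|_|; nra.
    by apply: itgD => //; apply: itg_cst => //; exact: mu_oo_lty.
  apply: (@itg_le _ _ _ (fun x => 1 + (Re (h x) ^+ 2 + Im (h x) ^+ 2))) => //.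
    move=> x _; have := real_normK (num_real (Im (h x))); have := sqr_ge0 (`|Im (h x)| - 1).
    by have := sqr_ge0 (Re (h x)); set a := `|_|; nra.
  by apply: itgD => //; apply: itg_cst => //; exact: mu_oo_lty.
split=> //; have [h1 h2] := ch.
have ni : itg `]0, T[ (fun x => nrm (h x)) by apply: itgD => //; exact: integrable_norm.
set I := \int[mu]_(x in _) _; set Q := \int[mu]_(x in `]0, T[) (Re (h x) ^+ 2 + Im (h x) ^+ 2).
have Q0 : 0 <= Q by apply: Rintegral_ge0 => x _; rewrite addr_ge0 ?sqr_ge0.
have key (s : R) : 0 < s -> s * I <= s ^+ 2 * T + Q.
  move=> s0; rewrite -RintegralZl//.
  have <- : \int[mu]_(x in `]0, T[) s ^+ 2 = s ^+ 2 * T by rewrite Rint_cst_oo// subr0.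
  have si : itg `]0, T[ (fun=> s ^+ 2) by apply: itg_cst => //; exact: mu_oo_lty.
  rewrite -RintegralD//; apply: le_Rintegral => //; first exact: itgZl.
    exact: itgD.
  move=> x _; rewrite /nrm.
  have := real_normK (num_real (Re (h x))); have := real_normK (num_real (Im (h x))).
  set a := `|_|; set b := `|_| => <- <-.
  by have := sqr_ge0 (s / 2 - a); have := sqr_ge0 (s / 2 - b); nra.
have L0 : L2norm T h ^+ 2 = Q by rewrite sqr_sqrtr.
have Lp : 0 <= L2norm T h by rewrite sqrtr_ge0.
have I0 : 0 <= I by apply: Rintegral_ge0 => x _; exact: nrm_ge0.
have [Lz|Lz] := eqVneq (L2norm T h) 0.
  rewrite Lz mulr0; apply/ler_addgt0Pl => e e0; rewrite addr0.
  have Qz : Q = 0 by rewrite -L0 Lz expr0n.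
  have eT : 0 < e / T by rewrite divr_gt0.
  have := key _ eT; rewrite Qz addr0 expr2 -mulrA ler_pM2l//.
  by rewrite divfK ?gt_eqF.
have Lpos : 0 < L2norm T h by rewrite lt_def Lz.
have := key _ Lpos; rewrite -L0 => k.
by rewrite -(ler_pM2l Lpos); apply: (le_trans k); rewrite le_eqVlt; apply/orP; left; apply/eqP; ring.
Qed.

Lemma L2norm_sup f g B : citg f -> bmf g -> {ae mu, forall x, 0 < x < T -> f x = g x} ->
  0 <= B -> (forall x, nrm (g x) <= B) -> L2norm T f <= (T + 1) * B.
Proof.
move=> [/integrable_meas mf1 /integrable_meas mf2] [mg1 mg2 _] fg B0 hB.
rewrite /L2norm.
have mg : measurable_fun `]0, T[ (fun x => Re (g x) ^+ 2 + Im (g x) ^+ 2).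
  by apply: measurable_funTS; apply: measurable_funD; exact: measurable_funX.
have sq x : 0 <= Re (g x) ^+ 2 + Im (g x) ^+ 2 <= B ^+ 2.
  have := hB x; rewrite /nrm addr_ge0 ?sqr_ge0//=.
  have := real_normK (num_real (Re (g x))); have := real_normK (num_real (Im (g x))).
  have := normr_ge0 (Re (g x)); have := normr_ge0 (Im (g x)).
  set a := `|_|; set b := `|_| => a0 b0 <- <- h; nra.
have -> : \int[mu]_(x in `]0, T[) (Re (f x) ^+ 2 + Im (f x) ^+ 2) =
   \int[mu]_(x in `]0, T[) (Re (g x) ^+ 2 + Im (g x) ^+ 2).
  apply: Rint_ae_eq => //.
    by apply: measurable_funD; exact: measurable_funX.
  by apply: ae_mono fg => x h; rewrite /= in_itv/= => /h ->.
have h : `|\int[mu]_(x in `]0, T[) (Re (g x) ^+ 2 + Im (g x) ^+ 2)| <= B ^+ 2 * T.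
  have muT : fine (mu `]0, T[) = T by rewrite -[RHS]subr0 -[RHS]/(fine (T - 0)%:E) -(mu_oo T0).
  rewrite -[X in _ * X]muT; apply: Rint_bound => //; first exact: mu_oo_lty.
    apply: (@integrable_bdd _ _ _ (B ^+ 2)) => //; first exact: mu_oo_lty.
    by move=> x _; have /andP[? ?] := sq x; rewrite ger0_norm.
  by move=> x _; have /andP[? ?] := sq x; rewrite ger0_norm.
have T1 : 0 <= (T + 1) * B by rewrite mulr_ge0// addr_ge0// ltW.
rewrite -(ler_sqr) ?nnegrE ?sqrtr_ge0// sqr_sqrtr; last by apply: Rintegral_ge0 => x _; rewrite addr_ge0 ?sqr_ge0.
apply: (le_trans (ler_norm _)); apply: (le_trans h).
rewrite exprMn mulrC ler_wpM2r ?sqr_ge0//; have := T0; nra.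
Qed.

End op.

(** * Neumann series in the sup norm *)

Section neumann.
Context {R : realType}.
Local Notation Re := complex.Re.
Local Notation Im := complex.Im.

Lemma third_wt (n : nat) : (wt n : R) / 3 <= wt n.+1.
Proof.
rewrite /wt; have E1 : n.+2%:R = n.+1%:R + 1 :> R by rewrite natr1.
have E2 : n.+3%:R = n.+1%:R + 2 :> R by rewrite -!natr1; ring.
rewrite E1 E2; have : (1 : R) <= n.+1%:R by rewrite ler1n.
set y : R := n.+1%:R => y1.
have -> : (y * (y + 1))^-1 / 3 = (3 * y)^-1 * (y + 1)^-1 by rewrite -!invfM; congr (_^-1); ring.
rewrite [leRHS]invfM mulrC ler_pM2l ?invr_gt0//; last by lra.
by rewrite lef_pV2 ?posrE//; lra.
Qed.

Lemma nrm_small_eq0 (z : R[i]) (B : R) : (forall n : nat, nrm z <= B * n.+1%:R^-1) -> z = 0.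
Proof.
move=> h; apply: nrm_eq0; apply/ler_addgt0Pl => e e0; rewrite addr0.
have := h (Num.bound (`|B| / e)); set n := Num.bound _ => h1.
apply: (le_trans h1); rewrite ler_pdivrMr// mulrC -ler_pdivrMr//.
apply: (@le_trans _ _ (`|B| / e)); first by rewrite ler_pM2r ?invr_gt0// ler_norm.
by apply: (le_trans (ltW (archi_boundP _))); rewrite ?ler_nat// divr_ge0// ltW.
Qed.

(** The map w |-> b - K w contracts by a factor 1/3. Since a third of [wt n]
    is at most [wt n.+1], the differences are also bounded by the weights [wt
    n], so that [lim_rate] gives the limit. *)
Lemma neumann (K : (R -> R[i]) -> R -> R[i]) (kp be : R) (b : R -> R[i]) :
  0 <= kp <= 3^-1 -> (forall f, bmf f -> bmf (K f)) ->
  (forall f g x, bmf f -> bmf g -> K (fun x => f x - g x) x = K f x - K g x) ->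
  (forall f B, bmf f -> (forall x, nrm (f x) <= B) -> forall x, nrm (K f x) <= kp * B) ->
  bmf b -> (forall x, nrm (b x) <= be) ->
  exists G, [/\ bmf G, forall x, G x + K G x = b x & forall x, nrm (G x) <= 3 * be].
Proof.
move=> /andP[kp0 kp3] Kb Ksub Kn bb hb.
have be0 : 0 <= be by apply: le_trans (hb 0); exact: nrm_ge0.
pose w := fix w (n : nat) : R -> R[i] := if n is m.+1 then fun x => b x - K (w m) x else b.
have bw n : bmf (w n).
  by elim: n => [|n IH]//=; apply: bmfB => //; exact: Kb.
have dw n x : nrm (w n.+1 x - w n x) <= be * (2 / 3) * (wt n : R).
  elim: n x => [|n IH] x.
    rewrite /= addrAC subrr add0r nrmN; apply: (le_trans (Kn _ _ bb hb x)).
    by rewrite /wt; apply: (@le_trans _ _ (3^-1 * be)); [rewrite ler_wpM2r|lra].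
  have -> : w n.+2 x - w n.+1 x = - (K (w n.+1) x - K (w n) x) by rewrite /=; ring.
  rewrite nrmN -Ksub//; apply: le_trans; first apply: (Kn _ _ _ IH).
    exact: bmfB.
  have h := third_wt n; have w0 : 0 <= (wt n : R) by rewrite /wt invr_ge0.
  apply: (@le_trans _ _ (3^-1 * (be * (2 / 3) * (wt n : R)))).
    by rewrite ler_wpM2r// mulr_ge0// mulr_ge0.
  by rewrite mulrCA ler_wpM2l ?mulr_ge0//; lra.
have tw N M x : (N <= M)%N -> nrm (w M x - w N x) <= be * (2 / 3) * (N.+1%:R^-1 - M.+1%:R^-1).
  elim: M => [|M IH] NM.
    by move: NM; rewrite leqn0 => /eqP ->; rewrite !subrr nrm0 mulr0.
  move: NM; rewrite leq_eqVlt => /predU1P[->|]; first by rewrite !subrr nrm0 mulr0.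
  rewrite ltnS => /IH {}IH.
  have -> : w M.+1 x - w N x = (w M.+1 x - w M x) + (w M x - w N x) by ring.
  rewrite (le_trans (nrmD _ _))// (le_trans (lerD (dw M x) IH))// wtE.
  by rewrite le_eqVlt; apply/orP; left; apply/eqP; ring.
have tw' N M x : (N <= M)%N -> nrm (w M x - w N x) <= be * (2 / 3) * N.+1%:R^-1.
  move=> NM; apply: (le_trans (tw N M x NM)).
  by rewrite ler_wpM2l ?mulr_ge0// gerBl invr_ge0.
pose G x : R[i] := limn (fun n => Re (w n x)) +i* limn (fun n => Im (w n x)).
have lre x : cvgn (fun n => Re (w n x)) /\ forall N, `|limn (fun n => Re (w n x)) - Re (w N x)| <= be * (2 / 3) * N.+1%:R^-1.
  by apply: lim_rate => N M NM; rewrite -ReB (le_trans (Re_nrm _))// tw'.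
have lim x : cvgn (fun n => Im (w n x)) /\ forall N, `|limn (fun n => Im (w n x)) - Im (w N x)| <= be * (2 / 3) * N.+1%:R^-1.
  by apply: lim_rate => N M NM; rewrite -ImB (le_trans (Im_nrm _))// tw'.
have Gw N x : nrm (G x - w N x) <= be * (4 / 3) * N.+1%:R^-1.
  rewrite /nrm ReB ImB/=; have [_ /(_ N) h1] := lre x; have [_ /(_ N) h2] := lim x.
  apply: (le_trans (lerD h1 h2)); rewrite -mulrDl ler_wpM2r ?invr_ge0//; lra.
have Gb x : nrm (G x) <= 3 * be.
  have -> : G x = (G x - w 0%N x) + b x by rewrite subrK.
  apply: (le_trans (nrmD _ _)); have := Gw 0%N x; have := hb x; rewrite invr1; lra.
have bG : bmf G.
  split; last by exists (3 * be).
    apply: (measurable_fun_cvg (h := fun n x => Re (w n x))) => [n|x _]; first by have [] := bw n.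
    by have [] := lre x.
  apply: (measurable_fun_cvg (h := fun n x => Im (w n x))) => [n|x _]; first by have [] := bw n.
  by have [] := lim x.
exists G; split=> // x; apply/eqP; rewrite -subr_eq0; apply/eqP.
apply: (@nrm_small_eq0 _ (be * (8 / 3))) => n.
have -> : G x + K G x - b x = (G x - w n.+1 x) + (K G x - K (w n) x) by rewrite /=; ring.
rewrite -Ksub//; apply: (le_trans (nrmD _ _)).
have h1 := Gw n.+1 x.
have h2 : nrm (K (fun y => G y - w n y) x) <= kp * (be * (4 / 3) * n.+1%:R^-1).
  by apply: Kn; [exact: bmfB | exact: Gw].
have i1 : n.+2%:R^-1 <= n.+1%:R^-1 :> R by rewrite lef_pV2 ?posrE// ler_nat.
have i0 : 0 <= n.+1%:R^-1 :> R by rewrite invr_ge0.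
have h3 : kp * (be * (4 / 3) * n.+1%:R^-1) <= 3^-1 * (be * (4 / 3) * n.+1%:R^-1).
  by rewrite ler_wpM2r// mulr_ge0// mulr_ge0.
have h4 : be * (4 / 3) * n.+2%:R^-1 <= be * (4 / 3) * n.+1%:R^-1 by rewrite ler_wpM2l// mulr_ge0.
have h5 : 0 <= be * n.+1%:R^-1 by rewrite mulr_ge0.
apply: (le_trans (lerD (le_trans h1 h4) (le_trans h2 h3))).
move: h5; set v := n.+1%:R^-1 => h5.
have -> : be * (4 / 3) * v + 3^-1 * (be * (4 / 3) * v) = (be * v) * (16 / 9) by field.
have -> : be * (8 / 3) * v = (be * v) * (8 / 3) by ring.
by rewrite ler_wpM2l//; lra.
Qed.

End neumann.

(** * Elementary real estimates *)

Section real_aux.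
Context {R : realType}.

Lemma norm_sum_split (u v w : R) : `|u| + `|v| <= w -> (- w <= u <= w) /\ (- w <= v <= w).
Proof. by have := normr_ge0 u; have := normr_ge0 v => *; rewrite -!ler_norml; split; lra. Qed.

Lemma sqr_diff_le (u v M : R) : `|u| <= 1 -> `|v| <= 1 -> `|u - v| <= M -> `|u ^+ 2 - v ^+ 2| <= 2 * M.
Proof.
move=> hu hv huv; rewrite subr_sqr normrM mulrC; apply: ler_pM => //.
by apply: (le_trans (ler_normD _ _)); lra.
Qed.

Lemma sqr_le_abs (u w : R) : - w <= u <= w -> u ^+ 2 <= w ^+ 2.
Proof.
move=> h; have w0 : 0 <= w by lra.
by rewrite -[leLHS]real_normK ?num_real// ler_sqr ?nnegrE// ler_norml.
Qed.

(** The function is only controlled on [a, b]; composed with the projection of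
    the line onto [a, b] it is continuous everywhere. *)
Lemma ivt_lip (f : R -> R) (a b C : R) : a <= b ->
  (forall x y, a <= x <= b -> a <= y <= b -> `|f x - f y| <= C * `|x - y|) ->
  f a < 0 -> 0 < f b -> exists2 x, a <= x <= b & f x = 0.
Proof.
move=> ab lip fa fb.
pose cl x := Num.max a (Num.min x b).
have clb x : a <= cl x <= b by rewrite /cl le_max lexx/= ge_max ab ge_min lexx orbT.
have cll x y : `|cl x - cl y| <= `|x - y|.
  wlog xy : x y / x <= y => [h|].
    by case: (leP x y) => [/h//|/ltW yx]; rewrite distrC [leRHS]distrC h.
  have cE z : cl z = if z < a then a else if z < b then z else b.
    rewrite /cl /Num.min; case: (ltP z b) => zb; rewrite /Num.max.
      by case: (ltP a z) => az; case: (ltP z a) => za //; lra.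
    by case: (ltP a b) => ab'; case: (ltP z a) => za //; lra.
  rewrite [leRHS]ler0_norm ?subr_le0// opprB distrC !cE.
  case: (ltP x a) => xa; case: (ltP y a) => ya; case: (ltP x b) => xb; case: (ltP y b) => yb;
  rewrite ger0_norm; lra.
have C0 : 0 <= C * `|b - a| by apply: le_trans (lip b a _ _); rewrite ?lexx ?ab.
have cf : continuous (f \o cl).
  move=> x; apply/cvgrPdist_lt => d0 d0p.
  pose C1 := `|C| + 1; have C1p : 0 < C1 by rewrite ltr_wpDl.
  near=> y; apply: (@le_lt_trans _ _ (C1 * `|x - y|)).
    apply: (le_trans (lip _ _ (clb x) (clb y))).
    apply: (@le_trans _ _ (`|C| * `|cl x - cl y|)); first by rewrite ler_wpM2r// ler_norm.
    by apply: ler_pM => //; rewrite lerDl.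
  rewrite mulrC -ltr_pdivlMr//; near: y.
  by apply: cvgr_dist_lt => //; rewrite divr_gt0.
have ea : cl a = a by rewrite /cl /Num.min; case: ltP => h; rewrite /Num.max ?ltxx//; case: ltP => //; lra.
have eb : cl b = b by rewrite /cl /Num.min ltxx /Num.max; case: ltP => //; lra.
have [|c _ hc] := @IVT R (f \o cl) a b 0 ab (continuous_subspaceT cf).
  by rewrite /= ea eb ge_min le_max (ltW fa) (ltW fb) orbT.
by exists (cl c).
Unshelve. all: by end_near. Qed.

Lemma sqnorm_lip (z w : R[i]) (M : R) : nrm z <= 1 -> nrm w <= 1 -> nrm (z - w) <= M ->
  `|(complex.Re z ^+ 2 + complex.Im z ^+ 2) - (complex.Re w ^+ 2 + complex.Im w ^+ 2)| <= 4 * M.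
Proof.
move=> hz hw hzw.
have h1 := sqr_diff_le (le_trans (Re_nrm z) hz) (le_trans (Re_nrm w) hw) (M := M).
have h2 := sqr_diff_le (le_trans (Im_nrm z) hz) (le_trans (Im_nrm w) hw) (M := M).
rewrite -ReB in h1; rewrite -ImB in h2.
have {}h1 := h1 (le_trans (Re_nrm _) hzw); have {}h2 := h2 (le_trans (Im_nrm _) hzw).
set a := complex.Re z ^+ 2 in h1 *; set b := complex.Re w ^+ 2 in h1 *.
set c := complex.Im z ^+ 2 in h2 *; set d := complex.Im w ^+ 2 in h2 *.
have -> : a + c - (b + d) = (a - b) + (c - d) by ring.
by apply: (le_trans (ler_normD _ _)); lra.
Qed.

Lemma sub_near (x1 y1 x2 y2 M N : R) : `|x1 - y1| <= M -> `|x2 - y2| <= N ->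
  `|(x1 - x2) - (y1 - y2)| <= M + N.
Proof.
move=> h1 h2; have -> : (x1 - x2) - (y1 - y2) = (x1 - y1) - (x2 - y2) by ring.
by apply: (le_trans (ler_normB _ _)); rewrite lerD.
Qed.

Lemma det_pos (t u1 v1 u2 v2 : R) : 0 < t -> t * (19 / 10) <= u1 ->
  - (t * (11 / 10)) <= u2 <= t * (11 / 10) -> - (t / 10) <= v2 <= t / 10 ->
  0 < u1 ^+ 2 + v1 ^+ 2 - (u2 ^+ 2 + v2 ^+ 2).
Proof.
move=> t0 h1 /sqr_le_abs h2 /sqr_le_abs h3.
have : (t * (19 / 10)) ^+ 2 <= u1 ^+ 2 by rewrite ler_sqr ?nnegrE; lra.
have := sqr_ge0 v1; have : 0 < t ^+ 2 by rewrite exprn_gt0.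
by move: h2 h3; rewrite !exprMn; lra.
Qed.

Lemma det_neg (t u1 v1 u2 v2 : R) : 0 < t -> t * (9 / 10) <= - u2 ->
  - (t * (6 / 10)) <= u1 <= t * (6 / 10) -> - (t * (2 / 10)) <= v1 <= t * (2 / 10) ->
  u1 ^+ 2 + v1 ^+ 2 - (u2 ^+ 2 + v2 ^+ 2) < 0.
Proof.
move=> t0 h1 /sqr_le_abs h2 /sqr_le_abs h3.
have : (t * (9 / 10)) ^+ 2 <= u2 ^+ 2 by rewrite -(sqrrN u2) ler_sqr ?nnegrE; lra.
have := sqr_ge0 v2; have : 0 < t ^+ 2 by rewrite exprn_gt0.
by move: h2 h3; rewrite !exprMn; lra.
Qed.

Lemma det_gap (t x r : R) : 0 < t -> 0 < x -> t / 4 <= r ->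
  ~ `|2 * r| * x <= x * (t / 1000) + (10^-1 ^+ 4 * x * (3 * t + t / 1000 + t) +
     (10^-1 ^+ 4 * x * (3 * t + t / 1000) + (10^-1 ^+ 4 * x * (2 * t + t) + 10^-1 ^+ 4 * x * (2 * t)))).
Proof.
move=> t0 x0 tr; rewrite ger0_norm; last by lra.
have := mulr_gt0 t0 x0; have : t / 2 * x <= 2 * r * x by rewrite ler_wpM2r ?(ltW x0)//; lra.
lra.
Qed.

Lemma nrm_near (z : R[i]) (a b w : R) : `|complex.Re z - a| + `|complex.Im z - b| <= w ->
  nrm z <= `|a| + `|b| + w.
Proof.
move=> h; rewrite /nrm.
have := ler_normD (complex.Re z - a) a; have := ler_normD (complex.Im z - b) b.
rewrite !subrK; lra.
Qed.

Lemma Re_conj_sq (z : R[i]) : complex.Re (z * (z^*)%C + z * z) = 2 * complex.Re z ^+ 2.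
Proof. by case: z => x y; rewrite ReD !ReM/=; ring. Qed.

End real_aux.

(** * Lyapunov-Schmidt reduction to the modes 1 and -1 *)

Section K.
Context {R : realType}.
Notation mu := (@lebesgue_measure R).
Local Notation Re := complex.Re.
Local Notation Im := complex.Im.
Variable T : R.
Hypothesis T0 : 0 < T.
Opaque fc.
Local Notation fc := (fc T).
Local Notation ce := (ce T).

Variables (A B d e : R) (s : R -> R).
Hypotheses (hA : `|A - 1| <= 100^-1) (hB : `|B - 1| <= 100^-1) (hd : `|d| <= 50^-1).
Hypotheses (e0 : 0 <= e) (e1 : e <= 2000^-1) (ms : measurable_fun setT s)
  (sb : forall x, `|s x| <= 6 * e).

(** The symbol of the linear part at frequency q, divided by kap^2 q^2. *)
Definition Dq (q : int) : R := A * q%:~R ^+ 4 - B * q%:~R ^+ 2 - d.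
(** The modes that are not eliminated. *)
Definition small (q : int) : bool := [|| q == 0, q == 1 | q == -1].
(** [Dq] completed by the transport term and the spectral parameter. *)
Definition den (Lam : R) (nu : R[i]) (q : int) : R[i] :=
  (Dq q)%:C + 0 +i* (Lam / q%:~R) - nu * ((q%:~R ^+ 2)^-1)%:C.
(** The multiplier that inverts [den] on the modes to be eliminated. *)
Definition mq (Lam : R) (nu : R[i]) (q : int) : R[i] :=
  if small q then 0 else (den Lam nu q)^-1.

Lemma big_sq (q : int) : ~~ small q -> 4 <= q%:~R ^+ 2 :> R.
Proof.
rewrite /small; case: q => [[|[|n]]|[|n]]//= _.
  have : (2 : R) <= n.+2%:R by rewrite ler_nat.
  by rewrite -pmulrn; nra.
have : (2 : R) <= n.+2%:R by rewrite ler_nat.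
by rewrite NegzE rmorphN/= sqrrN -pmulrn; nra.
Qed.

Let hA' : 1 - 100^-1 <= A <= 1 + 100^-1. Proof. by have := hA; rewrite ler_norml; lra. Qed.
Let hB' : 1 - 100^-1 <= B <= 1 + 100^-1. Proof. by have := hB; rewrite ler_norml; lra. Qed.
Let hd' : - 50^-1 <= d <= 50^-1. Proof. by have := hd; rewrite ler_norml. Qed.

(** At q = 2 the value is close to 12, and 3/5 of 16 is below. *)
Lemma Dq_ge q : ~~ small q -> 3 / 5 * (q%:~R ^+ 2) ^+ 2 <= Dq q.
Proof.
move=> /big_sq; rewrite /Dq; have -> : q%:~R ^+ 4 = (q%:~R ^+ 2) ^+ 2 :> R by rewrite -exprM.
set y : R := q%:~R ^+ 2 => y4; have [/andP[a1 a2] /andP[b1 b2]] := (hA', hB').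
have /andP[d1 d2] := hd'.
have : (1 - 100^-1) * y ^+ 2 <= A * y ^+ 2 by rewrite ler_wpM2r ?sqr_ge0.
have : B * y <= (1 + 100^-1) * y by rewrite ler_wpM2r//; lra.
nra.
Qed.

Variable Lam : R.

Lemma den_ge nu q : nrm nu <= 10^-1 -> ~~ small q ->
  2^-1 * (q%:~R ^+ 2) ^+ 2 <= `|Re (den Lam nu q)|.
Proof.
move=> hnu sq; have y4 := big_sq sq; have D := Dq_ge sq.
rewrite /den ReB ReD ReM /= addr0 mulr0 subr0.
set y : R := q%:~R ^+ 2 in y4 D *.
have h1 := le_trans (Re_nrm nu) hnu.
have h2 : `|Re nu * y^-1| <= 10^-1.
  have yi : y^-1 <= 1 by rewrite invf_le1; lra.
  have yi0 : 0 <= y^-1 by rewrite invr_ge0; lra.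
  rewrite normrM (ger0_norm yi0); have := normr_ge0 (Re nu); nra.
apply: le_trans (ler_norm _); move: h2; rewrite ler_norml => /andP[_ h2]; nra.
Qed.

Lemma den_neq0 nu q : nrm nu <= 10^-1 -> ~~ small q -> den Lam nu q != 0.
Proof.
move=> hnu sq; apply/eqP => z; have := den_ge hnu sq; have := big_sq sq.
by rewrite z/= normr0; set y : R := _ ^+ 2; nra.
Qed.

Lemma mq_den nu q : nrm nu <= 10^-1 -> ~~ small q -> nrm (mq Lam nu q) * (q%:~R ^+ 2) ^+ 2 <= 4.
Proof.
move=> hnu sq; rewrite /mq (negbTE sq); have y4 := big_sq sq; have D := den_ge hnu sq.
set y : R := q%:~R ^+ 2 in y4 D *.
have y0 : 0 < 2^-1 * y ^+ 2 by apply: mulr_gt0 => //; apply: exprn_gt0; lra.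
have y2 : 0 < y ^+ 2 by apply: exprn_gt0; lra.
rewrite -ler_pdivlMr//; apply: (le_trans (nrmV y0 D)); rewrite invfM invrK mulrA ler_wpM2r ?invr_ge0 ?(ltW y2)//; lra.
Qed.

Lemma mq_small nu q : small q -> mq Lam nu q = 0.
Proof. by rewrite /mq => ->. Qed.

Lemma mq_bound nu q : nrm nu <= 10^-1 -> nrm (mq Lam nu q) * (1 + q%:~R ^+ 2) ^+ 2 <= 7.
Proof.
move=> hnu; have [sq|sq] := boolP (small q); first by rewrite mq_small// nrm0 mul0r.
have := mq_den hnu sq; have := big_sq sq; have := nrm_ge0 (mq Lam nu q).
set y : R := _ ^+ 2; set n := nrm _ => n0 y4 h.
have : n * (1 + y) ^+ 2 <= n * (7 / 4 * y ^+ 2) by rewrite ler_wpM2l//; nra.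
lra.
Qed.

Lemma mq_bound1 nu q : nrm nu <= 10^-1 -> nrm (mq Lam nu q) * (1 + q%:~R ^+ 2) <= 2.
Proof.
move=> hnu; have [sq|sq] := boolP (small q); first by rewrite mq_small// nrm0 mul0r.
have := mq_bound q hnu; have := big_sq sq; have := nrm_ge0 (mq Lam nu q).
set y : R := _ ^+ 2; set n := nrm _ => n0 y4 h.
have : n * (1 + y) * 5 <= n * (1 + y) * (1 + y) by rewrite ler_wpM2l ?mulr_ge0//; lra.
lra.
Qed.

Lemma mq_decays nu (c : int -> R[i]) C : nrm nu <= 10^-1 -> (forall q, ~~ small q -> nrm (c q) <= C) ->
  decays (6 * C) (fun q => mq Lam nu q * c q).
Proof.
move=> hnu hc; have C0 : 0 <= C by apply: le_trans (hc 2 isT); exact: nrm_ge0.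
have -> : 6 * C = 3 * (2 * C) by ring.
apply: decays_quadratic => q; have [sq|sq] := boolP (small q); first by rewrite mq_small// mul0r nrm0 mul0r mulr_ge0.
have := mq_bound1 q hnu; have := nrmM (mq Lam nu q) (c q); have := hc q sq; have := nrm_ge0 (c q).
set y : R := 1 + _ ^+ 2; have y0 : 0 <= y by rewrite addr_ge0 ?sqr_ge0.
set n := nrm (mq _ _ _); set x := nrm (c q); set z := nrm (_ * _) => x0 h1 h2 h3.
have : z * y <= n * x * y by rewrite ler_wpM2r.
have : (n * y) * x <= 2 * x by rewrite ler_wpM2r.
lra.
Qed.

Definition sf (f : R -> R[i]) (x : R) : R[i] := (s x)%:C * f x.
(** Multiplication by s, followed by inversion of the linear part on the
    eliminated modes; its sup norm is O(e). *)
Definition Kop (nu : R[i]) (f : R -> R[i]) : R -> R[i] :=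
  fsum T (fun q => mq Lam nu q * fc q (sf f)).

Lemma bmf_s : bmf (fun x => (s x)%:C).
Proof. by split; [exact: ms | exact: measurable_cst | exists (6 * e) => x; rewrite nrmR]. Qed.
Lemma bmf_sf f : bmf f -> bmf (sf f).
Proof. exact: bmfM bmf_s. Qed.
Lemma citg_sf f : bmf f -> citg T (sf f).
Proof. by move=> /bmf_sf/(bmf_citg T). Qed.
Lemma sf_bound f C : (forall x, nrm (f x) <= C) -> forall x, nrm (sf f x) <= 6 * e * C.
Proof. by move=> h x; rewrite /sf nrmZ; apply: ler_pM => //; exact: nrm_ge0. Qed.
Lemma fc_sf f C q : bmf f -> (forall x, nrm (f x) <= C) -> nrm (fc q (sf f)) <= 12 * e * C.
Proof.
move=> bf h; have -> : 12 * e * C = 2 * (6 * e * C) by ring.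
by apply: (fc_bound T0) => [|x _]; [exact: citg_sf | exact: sf_bound].
Qed.
Lemma fc_sfB q f g : bmf f -> bmf g -> fc q (sf (fun x => f x - g x)) = fc q (sf f) - fc q (sf g).
Proof.
move=> bf bg; rewrite -fcB; [|exact: citg_sf|exact: citg_sf].
by congr fc; apply/funext => x; rewrite /sf; ring.
Qed.
Lemma fc_sfD q f g : bmf f -> bmf g -> fc q (sf (fun x => f x + g x)) = fc q (sf f) + fc q (sf g).
Proof.
move=> bf bg; rewrite -fcD; [|exact: citg_sf|exact: citg_sf].
by congr fc; apply/funext => x; rewrite /sf; ring.
Qed.
Lemma fc_sfZ q a f : bmf f -> fc q (sf (fun x => a * f x)) = a * fc q (sf f).
Proof.
move=> bf; rewrite -fcZ; last exact: citg_sf.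
by congr fc; apply/funext => x; rewrite /sf; ring.
Qed.
Lemma fc_sf_ae q f g : bmf f -> bmf g -> (forall q, fc q f = fc q g) -> fc q (sf f) = fc q (sf g).
Proof.
move=> bf bg fg; apply: fc_ae; [exact: citg_sf|exact: citg_sf|].
have := fc_uniq T0 (bmf_citg T bf) (bmf_citg T bg) fg; apply: ae_mono => x h xT.
by rewrite /sf h.
Qed.

Section nu.
Variable nu : R[i].
Hypothesis hnu : nrm nu <= 10^-1.

Lemma Kop_decays f C : bmf f -> (forall x, nrm (f x) <= C) ->
  decays (72 * e * C) (fun q => mq Lam nu q * fc q (sf f)).
Proof.
move=> bf h; have -> : 72 * e * C = 6 * (12 * e * C) by ring.
by apply: mq_decays => // q _; exact: fc_sf.
Qed.
Lemma Kop_decays_ex f : bmf f -> exists C, decays C (fun q => mq Lam nu q * fc q (sf f)).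
Proof. by move=> bf; have [_ _ [C hC]] := bf; exists (72 * e * C); exact: Kop_decays. Qed.
Lemma bmf_Kop f : bmf f -> bmf (Kop nu f).
Proof. by move=> /Kop_decays_ex[C /(bmf_fsum T)]. Qed.
Lemma fc_Kop f q : bmf f -> fc q (Kop nu f) = mq Lam nu q * fc q (sf f).
Proof. by move=> /Kop_decays_ex[C /(fc_fsum T0)]. Qed.
Lemma Kop_bound f C : bmf f -> (forall x, nrm (f x) <= C) -> forall x, nrm (Kop nu f x) <= 576 * e * C.
Proof.
move=> bf h x; have := fsum_bound T x (Kop_decays bf h).
by have -> : 576 * e * C = 8 * (72 * e * C) by ring.
Qed.
Lemma KopB f g x : bmf f -> bmf g -> Kop nu (fun x => f x - g x) x = Kop nu f x - Kop nu g x.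
Proof.
move=> bf bg; have [C1 d1] := Kop_decays_ex bf; have [C2 d2] := Kop_decays_ex bg.
have d3 := Kop_decays_ex (bmfN bg); case: d3 => C3 d3.
have E q : mq Lam nu q * fc q (sf (fun x => f x - g x)) =
   mq Lam nu q * fc q (sf f) + (-1) * (mq Lam nu q * fc q (sf g)).
  by rewrite fc_sfB//; ring.
rewrite /Kop (_ : (fun q => _) = (fun q => mq Lam nu q * fc q (sf f) + (-1) * (mq Lam nu q * fc q (sf g)))); last by apply/funext => q; exact: E.
have d4 : decays C3 (fun q => -1 * (mq Lam nu q * fc q (sf g))).
  move=> i; have [h1 h2] := d3 i.
  have F q : -1 * (mq Lam nu q * fc q (sf g)) = mq Lam nu q * fc q (sf (fun x => - g x)).
    rewrite (_ : sf (fun x => - g x) = sf (fun x => (-1) * g x)); last by apply/funext => y; rewrite /sf mulN1r.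
    by rewrite fc_sfZ//; ring.
  by rewrite !F.
rewrite (fsumD T x d1 d4) (fsumZ T _ x d2); set X := fsum T _ x; set Y := fsum T _ x; ring.
Qed.
Lemma eq_Kop f g x : bmf f -> bmf g -> (forall q, fc q f = fc q g) -> Kop nu f x = Kop nu g x.
Proof.
move=> bf bg fg; rewrite /Kop; congr (fsum T _ x); apply/funext => q.
by rewrite (fc_sf_ae q bf bg fg).
Qed.

Lemma Kop_solve b be : bmf b -> (forall x, nrm (b x) <= be) ->
  exists G, [/\ bmf G, forall x, G x + Kop nu G x = b x & forall x, nrm (G x) <= 3 * be].
Proof.
move=> bb hb; apply: (@neumann _ (Kop nu) (576 * e)) => //.
- by apply/andP; have := e0; have := e1; split; lra.
- exact: bmf_Kop.
- exact: KopB.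
- exact: Kop_bound.
Qed.

(** The equation F + Kop F = g on coefficients, insensitive to modifications
    of F on a null set. *)
Definition Sol (g : int -> R[i]) (F : R -> R[i]) :=
  bmf F /\ forall q, fc q F + mq Lam nu q * fc q (sf F) = g q.

Lemma sol_K G b : bmf G -> bmf b -> (forall x, G x + Kop nu G x = b x) -> Sol (fun q => fc q b) G.
Proof.
move=> bG bb h; split=> // q; rewrite -fc_Kop// -fcD; [|exact: bmf_citg|by apply: bmf_citg; exact: bmf_Kop].
by apply: eq_fc => x _.
Qed.

Lemma solD g1 g' F1 F2 : Sol g1 F1 -> Sol g' F2 ->
  Sol (fun q => g1 q + g' q) (fun x => F1 x + F2 x).
Proof.
move=> [b1 h1] [b2 h2]; split=> [|q]; first exact: bmfD.
by rewrite fc_sfD// fcD ?mulrDr -?h1 -?h2; try exact: bmf_citg; ring.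
Qed.
Lemma solZ g1 F1 a : Sol g1 F1 -> Sol (fun q => a * g1 q) (fun x => a * F1 x).
Proof.
move=> [b1 h1]; split=> [|q]; first by apply: bmfM => //; exact: bmf_cst.
by rewrite fc_sfZ// fcZ -?h1; try exact: bmf_citg; ring.
Qed.

(** The function Kop F, a convergent series, satisfies the homogeneous
    equation at every point, so that its sup norm is at most a third of
    itself. *)
Lemma sol0 F : Sol (fun=> 0) F -> forall q, fc q F = 0.
Proof.
move=> [bF h]; pose Ph := Kop nu F; have bP := bmf_Kop bF.
have bN := bmfN bP.
have hF q : fc q F = fc q (fun x => - Ph x).
  rewrite fcN ?fc_Kop//; last exact: bmf_citg.
  by apply/eqP; rewrite -addr_eq0; apply/eqP; exact: h.
have PE x : Ph x = Kop nu (fun x => - Ph x) x by exact: eq_Kop.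
have [_ _ [C hC]] := bP.
have C0 : 0 <= C by apply: le_trans (hC 0); exact: nrm_ge0.
have hn (n : nat) x : nrm (Ph x) <= C * (3^-1) ^+ n.
  elim: n x => [|n IH] x; first by rewrite mulr1.
  rewrite PE; apply: le_trans.
    by apply: (Kop_bound (C := C * 3^-1 ^+ n)) => // y; rewrite nrmN.
  apply: (@le_trans _ _ (3^-1 * (C * 3^-1 ^+ n))); last by rewrite exprS mulrCA.
  by rewrite ler_wpM2r ?mulr_ge0 ?exprn_ge0//; have := e1; lra.
have PZ x : Ph x = 0.
  apply: (@nrm_small_eq0 _ _ C) => n; apply: (le_trans (hn n x)).
  rewrite ler_wpM2l// exprVn lef_pV2 ?posrE ?exprn_gt0//.
  elim: n => [|n IH]; first by rewrite expr0.
  by rewrite exprS -natr1; have : (1 : R) <= 3 ^+ n by [rewrite exprn_ege1//; lra]; lra.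
move=> q; rewrite hF (@eq_fc _ T q _ (fun=> 0)) => [|x _]; last by rewrite PZ oppr0.
by rewrite fc_cst// mul0r.
Qed.

Lemma sol_uniq g F1 F2 : Sol g F1 -> Sol g F2 -> forall q, fc q F1 = fc q F2.
Proof.
move=> S1 S2 q; have [b1 _] := S1; have [b2 _] := S2.
have S := solD S1 (solZ (-1) S2).
have /(_ q) : forall q, fc q (fun x => F1 x + -1 * F2 x) = 0.
  by apply: sol0; case: S => bS hS; split=> // p; rewrite hS; ring.
rewrite fcD ?fcZ; try exact: bmf_citg; last by apply: bmf_citg; apply: bmfM => //; exact: bmf_cst.
by move=> /eqP; rewrite mulN1r subr_eq0 => /eqP.
Qed.

(** The reaction of all modes to a unit amplitude in mode j. The bound is
    three times that of [ce j]. *)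
Definition is_response (j : int) (G : R -> R[i]) :=
  [/\ bmf G, forall x, G x + Kop nu G x = ce j x & forall x, nrm (G x) <= 6].
Lemma response_ex j : exists G, is_response j G.
Proof.
have [G [bG hG nG]] := Kop_solve (bmf_ce T j) (nrm_ce T j).
by exists G; split=> // x; rewrite (le_trans (nG x))//; lra.
Qed.

Lemma sol_small g F q : Sol g F -> small q -> fc q F = g q.
Proof. by move=> [_ h] sq; rewrite -h mq_small// mul0r addr0. Qed.

(** The eigenvalue equation divided by kap^2 q^2, for functions of mean 0. *)
Definition reduced_eq (H : int -> R[i]) (F : R -> R[i]) :=
  [/\ bmf F, fc 0 F = 0 & forall q, q != 0 -> den Lam nu q * fc q F + fc q (sf F) = H q].

Lemma sol_ex c C : (forall q, ~~ small q -> nrm (c q) <= C) -> exists Gb, [/\ Sol (fun q => mq Lam nu q * c q) Gb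
  & forall x, nrm (Gb x) <= 144 * C].
Proof.
move=> hc; have dc := mq_decays hnu hc.
have [|G [bG hG nG]] := Kop_solve (bmf_fsum T dc) (be := 48 * C).
  by move=> x; have := fsum_bound T x dc; lra.
exists G; split; last by move=> x; have := nG x; lra.
have [_ h] := sol_K bG (bmf_fsum T dc) hG.
by split=> // q; rewrite h (fc_fsum T0 q dc).
Qed.

End nu.

(** One choice of responses for all nu, so that the reduced matrix is a
    function of nu. *)
Lemma responses_ex : exists resp : R[i] -> int -> R -> R[i],
  forall nu, nrm nu <= 10^-1 -> forall j, is_response nu j (resp nu j).
Proof.
have h (nuj : R[i] * int) : exists G, nrm nuj.1 <= 10^-1 -> is_response nuj.1 nuj.2 G.
  have [hn|hn] := boolP (nrm nuj.1 <= 10^-1); last by exists (fun=> 0).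
  by have [G hG] := response_ex hn nuj.2; exists G.
have [f hf] := choice h.
by exists (fun nu j => f (nu, j)) => nu hn j; exact: (hf (nu, j) hn).
Qed.

Variable resp : R[i] -> int -> R -> R[i].
Hypothesis respP : forall nu, nrm nu <= 10^-1 -> forall j, is_response nu j (resp nu j).

Section nuG.
Variable nu : R[i].
Hypothesis hnu : nrm nu <= 10^-1.
Local Notation Sol := (Sol nu).
Local Notation reduced_eq := (reduced_eq nu).

Lemma resp_sol j : Sol (fun q => (q == j)%:R) (resp nu j).
Proof.
have [b h _] := respP hnu j; have [b' h'] := sol_K hnu b (bmf_ce T j) h.
by split=> // q; rewrite h' fc_ce.
Qed.

(** The entry (i, j) of the matrix left after the elimination: its own
    linear part, plus the feedback of mode j on mode i through the
    eliminated modes. *)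
Definition schur (i j : int) : R[i] := (i == j)%:R * den Lam nu i + fc i (sf (resp nu j)).

(** The general solution of the eliminated equations: amplitudes u1 and u2 in
    the two retained modes, and a particular solution Gb. *)
Definition comb (u1 u2 : R[i]) (Gb : R -> R[i]) : R -> R[i] :=
  fun x => u1 * resp nu 1 x + u2 * resp nu (-1) x + Gb x.

Lemma comb_sol u1 u2 g Gb : Sol g Gb ->
  Sol (fun q => u1 * (q == 1)%:R + u2 * (q == -1)%:R + g q) (comb u1 u2 Gb).
Proof. by move=> S; apply: solD S; apply: solD; apply: solZ; exact: resp_sol. Qed.

Lemma fc_sf_comb q u1 u2 Gb : bmf Gb -> fc q (sf (comb u1 u2 Gb)) =
  u1 * fc q (sf (resp nu 1)) + u2 * fc q (sf (resp nu (-1))) + fc q (sf Gb).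
Proof.
move=> bG; have [b1 _ _] := respP hnu 1; have [b2 _ _] := respP hnu (-1).
have c1 := bmfM (bmf_cst u1) b1; have c2 := bmfM (bmf_cst u2) b2.
by rewrite /comb (fc_sfD q (bmfD c1 c2) bG) (fc_sfD q c1 c2) !fc_sfZ.
Qed.

(** A solution is determined by its amplitudes in the modes 1 and -1, and
    these satisfy the 2 x 2 system. *)
Lemma reduced_comb H F Gb : reduced_eq H F -> Sol (fun q => mq Lam nu q * H q) Gb ->
  [/\ schur 1 1 * fc 1 F + schur 1 (-1) * fc (-1) F = H 1 - fc 1 (sf Gb),
      schur (-1) 1 * fc 1 F + schur (-1) (-1) * fc (-1) F = H (-1) - fc (-1) (sf Gb) &
      forall q, fc q F = fc q (comb (fc 1 F) (fc (-1) F) Gb)].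
Proof.
move=> [bF F0 hF] Sb; have [bb _] := Sb.
have Sc := comb_sol (fc 1 F) (fc (-1) F) Sb.
have SF : Sol (fun q => fc 1 F * (q == 1)%:R + fc (-1) F * (q == -1)%:R + mq Lam nu q * H q) F.
  split=> // q; have [sq|sq] := boolP (small q).
    rewrite mq_small// !mul0r !addr0; case/or3P: sq => /eqP ->; rewrite ?F0 /=; ring.
  have q0 : q != 0 by apply: contraNN sq => /eqP ->.
  have q1 : (q == 1) = false by apply: contraNF sq => /eqP ->.
  have q2 : (q == -1) = false by apply: contraNF sq => /eqP ->.
  rewrite q1 q2 !mulr0 !add0r -(hF q q0) /mq (negbTE sq) mulrDr mulrA.
  by rewrite mulVf ?mul1r// den_neq0.
have eqF := sol_uniq hnu SF Sc; have [bC _] := Sc.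
have sfF q := fc_sf_ae q bF bC eqF; split=> //.
- have := hF 1 isT; rewrite sfF fc_sf_comb// /schur eqxx (_ : (1 == -1 :> int) = false)// => <-.
  by rewrite /=; ring.
- have := hF (-1) isT; rewrite sfF fc_sf_comb// /schur eqxx (_ : (-1 == 1 :> int) = false)// => <-.
  by rewrite /=; ring.
Qed.

Lemma comb_reduced H u1 u2 Gb : Sol (fun q => mq Lam nu q * H q) Gb ->
  schur 1 1 * u1 + schur 1 (-1) * u2 = H 1 - fc 1 (sf Gb) ->
  schur (-1) 1 * u1 + schur (-1) (-1) * u2 = H (-1) - fc (-1) (sf Gb) ->
  [/\ reduced_eq H (comb u1 u2 Gb), fc 1 (comb u1 u2 Gb) = u1 & fc (-1) (comb u1 u2 Gb) = u2].
Proof.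
move=> Sb h1 h2; have [bb _] := Sb; have Sc := comb_sol u1 u2 Sb; have [bC hC] := Sc.
have f1 : fc 1 (comb u1 u2 Gb) = u1.
  by rewrite (sol_small Sc)// mq_small//=; ring.
have f2 : fc (-1) (comb u1 u2 Gb) = u2.
  by rewrite (sol_small Sc)// mq_small//=; ring.
have f0 : fc 0 (comb u1 u2 Gb) = 0.
  by rewrite (sol_small Sc)// mq_small//=; ring.
split=> //; split=> // q q0; have [sq|sq] := boolP (small q).
  case/or3P: (sq) => /eqP qE; move: q0; rewrite qE// => _.
    rewrite f1 fc_sf_comb//; rewrite /schur eqxx (_ : (1 == -1 :> int) = false)// in h1.
    by apply/eqP; rewrite -subr_eq0; move/eqP: h1; rewrite -subr_eq0 => /eqP <-; apply/eqP; rewrite /=; ring.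
  rewrite f2 fc_sf_comb//; rewrite /schur eqxx (_ : (-1 == 1 :> int) = false)// in h2.
  by apply/eqP; rewrite -subr_eq0; move/eqP: h2; rewrite -subr_eq0 => /eqP <-; apply/eqP; rewrite /=; ring.
have q1 : (q == 1) = false by apply: contraNF sq => /eqP ->.
have q2 : (q == -1) = false by apply: contraNF sq => /eqP ->.
have := hC q; rewrite q1 q2 !mulr0 !add0r /mq (negbTE sq) => hh.
apply: (mulfI (invr_neq0 (den_neq0 hnu sq))); rewrite -hh mulrDr mulrA.
by rewrite mulVf ?mul1r// den_neq0.
Qed.

End nuG.
(** The resolvent identity. *)
Lemma mq_diff nu nu' q : nrm nu <= 10^-1 -> nrm nu' <= 10^-1 ->
  mq Lam nu q - mq Lam nu' q = mq Lam nu q * (mq Lam nu' q * ((nu - nu') * ((q%:~R ^+ 2)^-1)%:C)).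
Proof.
move=> h h'; have [sq|sq] := boolP (small q); first by rewrite !mq_small// mul0r subr0.
have n1 := den_neq0 h sq; have n2 := den_neq0 h' sq.
have dE : den Lam nu' q - den Lam nu q = (nu - nu') * ((q%:~R ^+ 2)^-1)%:C by rewrite /den; ring.
rewrite /mq (negbTE sq) -dE; move: n1 n2; set X := den _ _ _; set Y := den _ _ _ => n1 n2.
by field; rewrite ?n1 ?n2.
Qed.

Lemma diff_alg (F1 F2 m m' w X Y dl : R[i]) : m - m' = m * (m' * w) ->
  F2 + m' * Y = dl -> F1 + m * X = dl -> F1 - F2 + m * (X - Y) = m * - (m' * w * Y).
Proof.
move=> md s2E s1E; have -> : F1 = F2 + m' * Y - m * X by rewrite s2E -s1E addrK.
transitivity (- (m - m') * Y); first by ring.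
by rewrite md; ring.
Qed.

(** The response to mode j at nu minus that at nu' solves the eliminated
    equations with a right-hand side containing nu - nu' and one factor s; the
    product with s contributes the second factor e. *)
Lemma fc_sf_lip nu nu' i j : nrm nu <= 10^-1 -> nrm nu' <= 10^-1 ->
  nrm (fc i (sf (resp nu j)) - fc i (sf (resp nu' j))) <= 10 ^+ 6 * e ^+ 2 * nrm (nu - nu').
Proof.
move=> h h'; have [b1 h1 n1] := respP h j; have [b2 h2 n2] := respP h' j.
set dl := nrm (nu - nu'); have dl0 : 0 <= dl by exact: nrm_ge0.
have hc q : ~~ small q -> nrm (mq Lam nu' q * ((nu - nu') * ((q%:~R ^+ 2)^-1)%:C) * fc q (sf (resp nu' j))) <= 72 * e * dl.
  move=> sq; have y4 := big_sq sq; have m1 := mq_den h' sq; have f1 := fc_sf q b2 n2.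
  have m2 : nrm (mq Lam nu' q) <= 1.
    have := nrm_ge0 (mq Lam nu' q); set n := nrm _ in m1 *; set y : R := _ ^+ 2 in y4 m1 *; nra.
  have m3 : nrm ((nu - nu') * ((q%:~R ^+ 2)^-1)%:C) <= dl.
    apply: (le_trans (nrmM _ _)); rewrite nrmR -/dl ler_piMr// ger0_norm ?invr_ge0 ?sqr_ge0//.
    by rewrite invf_le1; lra.
  apply: (le_trans (nrmM _ _)); apply: (@le_trans _ _ (dl * (12 * e * 6))); last by lra.
  apply: ler_pM => //; try exact: nrm_ge0.
  apply: (le_trans (nrmM _ _)); rewrite -[leRHS]mul1r.
  by apply: ler_pM => //; exact: nrm_ge0.
have dc := mq_decays h hc.
pose D x := resp nu j x - resp nu' j x.
have bD : bmf D by exact: bmfB.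
have Sd : Sol nu (fun q => mq Lam nu q * (- (mq Lam nu' q * ((nu - nu') * ((q%:~R ^+ 2)^-1)%:C) * fc q (sf (resp nu' j))))) D.
  split=> // q; have [_ s1] := resp_sol h j; have [_ s2] := resp_sol h' j.
  rewrite fcB ?fc_sfB//; try exact: bmf_citg.
  exact: diff_alg (mq_diff q h h') (s2 q) (s1 q).
have hc' q : ~~ small q -> nrm (- (mq Lam nu' q * ((nu - nu') * ((q%:~R ^+ 2)^-1)%:C) * fc q (sf (resp nu' j)))) <= 72 * e * dl.
  by rewrite nrmN; exact: hc.
have [Gb [Sb nb]] := sol_ex h hc'.
have eqG := sol_uniq h Sd Sb; have [bb _] := Sb.
rewrite -fc_sfB// (fc_sf_ae i bD bb eqG).
apply: (le_trans (fc_sf i bb nb)).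
have -> : 12 * e * (144 * (72 * e * dl)) = 12 * 144 * 72 * (e ^+ 2 * dl) by ring.
rewrite -[leRHS]mulrA ler_wpM2r//; first by rewrite mulr_ge0 ?sqr_ge0.
lra.
Qed.

Section eps.
Variable eps : R.
Hypotheses (epsE : `|eps| = e) (s0 : fc 0 (fun x => (s x)%:C) = 0)
  (sp : fc 1 (fun x => (s x)%:C) = eps%:C) (sm : fc (-1) (fun x => (s x)%:C) = eps%:C)
  (sq : forall q, q != 0 -> (Dq q)%:C * fc q (fun x => (s x)%:C) = - (2^-1)%:C * fc q (sf (fun x => (s x)%:C))).
Let sh q := fc q (fun x => (s x)%:C).

Lemma s_bound x : nrm ((s x)%:C) <= 6 * e. Proof. by rewrite nrmR. Qed.

(** By the wave equation the coefficient is that of s^2, which is O(e^2),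
    divided by [Dq q]. *)
Lemma coef_decay q : ~~ small q -> nrm (sh q) * (q%:~R ^+ 2) ^+ 2 <= 60 * e ^+ 2.
Proof.
move=> hq; have q0 : q != 0 by apply: contraNN hq => /eqP ->.
have y4 := big_sq hq; have D := Dq_ge hq; have h := congr1 nrm (sq q0).
rewrite (nrmZ (Dq q) (sh q)) mulNr nrmN (nrmZ 2^-1 (fc q (sf _))) in h.
have := fc_sf q bmf_s s_bound; move: h y4 D; set y : R := q%:~R ^+ 2.
set w := nrm (fc q (sf _)); set z := nrm (sh q) => h y4 D hw.
have z0 : 0 <= z by exact: nrm_ge0.
have y0 : 0 < y ^+ 2 by apply: exprn_gt0; lra.
rewrite ger0_norm in h; last by lra.
rewrite (ger0_norm (_ : 0 <= 2^-1)) ?invr_ge0// in h.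
have : 3 / 5 * y ^+ 2 * z <= Dq q * z by rewrite ler_wpM2r.
have E : 12 * e * (6 * e) = 72 * e ^+ 2 by ring.
rewrite E in hw; lra.
Qed.

Definition rest_coef (q : int) : R[i] := if small q then 0 else sh q.

Lemma rest_coef_decays : decays (60 * e ^+ 2) rest_coef.
Proof.
have -> : 60 * e ^+ 2 = 3 * (20 * e ^+ 2) by ring.
apply: decays_quadratic => q; rewrite /rest_coef; case: ifPn => hq; first by rewrite nrm0 mul0r mulr_ge0 ?sqr_ge0.
have := coef_decay hq; have := big_sq hq; have := nrm_ge0 (sh q).
set z := nrm _; set y : R := q%:~R ^+ 2; have := sqr_ge0 e; set e2 := e ^+ 2 => e20 z0 y4 h.
have : z * (1 + y) * 3 <= z * y ^+ 2 by rewrite -mulrA ler_wpM2l//; nra.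
lra.
Qed.

(** The harmonics of s of index |q| >= 2, a term of size e^2. *)
Definition rest := fsum T rest_coef.
Lemma bmf_rest : bmf rest. Proof. exact: bmf_fsum rest_coef_decays. Qed.
Lemma fc_rest q : fc q rest = rest_coef q. Proof. exact: (fc_fsum T0 q rest_coef_decays). Qed.
Lemma rest_bound x : nrm (rest x) <= 480 * e ^+ 2.
Proof. by apply: (le_trans (fsum_bound T x rest_coef_decays)); lra. Qed.

Lemma fc_rest_mul q f C : bmf f -> (forall x, nrm (f x) <= C) ->
  nrm (fc q (fun x => rest x * f x)) <= 960 * e ^+ 2 * C.
Proof.
move=> bf hf; have -> : 960 * e ^+ 2 * C = 2 * (480 * e ^+ 2 * C) by ring.
apply: (fc_bound T0) => [|x _]; first by apply: bmf_citg; apply: bmfM => //; exact: bmf_rest.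
apply: (le_trans (nrmM _ _)); apply: ler_pM; try exact: nrm_ge0; [exact: rest_bound|exact: hf].
Qed.

(** Up to a null set s is 2 eps cos + rest, and multiplication by the cosine
    shifts frequencies by 1 and -1. *)
Lemma fc_sfE q f : bmf f ->
  fc q (sf f) = eps%:C * (fc (q - 1) f + fc (q + 1) f) + fc q (fun x => rest x * f x).
Proof.
move=> bf.
pose sg x := eps%:C * (ce 1 x + ce (-1) x) + rest x.
have b1 : bmf (fun x => ce 1 x + ce (-1) x) by apply: bmfD; exact: bmf_ce.
have b2 : bmf (fun x => eps%:C * (ce 1 x + ce (-1) x)) by apply: bmfM => //; exact: bmf_cst.
have bs : bmf sg by apply: bmfD => //; exact: bmf_rest.
have eqs p : fc p (fun x => (s x)%:C) = fc p sg.
  rewrite /sg fcD ?fcZ ?fcD ?fc_ce//; try by [exact: citg_ce | exact: bmf_citg | apply: bmf_citg; exact: bmf_rest].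
  rewrite fc_rest /rest_coef; case: ifPn => hp.
    by case/or3P: hp => /eqP ->; rewrite ?s0 ?sp ?sm/=; ring.
  have -> : (p == 1) = false by apply: contraNF hp => /eqP ->.
  have -> : (p == -1) = false by apply: contraNF hp => /eqP ->.
  by rewrite -/(sh p) (_ : false%:R = 0)// addr0 mulr0 add0r.
have cf := bmf_citg T (bmfM bs bf).
transitivity (fc q (fun x => sg x * f x)).
  apply: fc_ae => //; first exact: citg_sf.
  have := fc_uniq T0 (bmf_citg T bmf_s) (bmf_citg T bs) eqs; apply: ae_mono => x h xT.
  by rewrite /sf h.
have c1 : citg T (fun x => ce 1 x * f x) by apply: bmf_citg; apply: bmfM => //; exact: bmf_ce.
have c2 : citg T (fun x => ce (-1) x * f x) by apply: bmf_citg; apply: bmfM => //; exact: bmf_ce.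
have c3 : citg T (fun x => rest x * f x) by apply: bmf_citg; apply: bmfM => //; exact: bmf_rest.
rewrite (_ : (fun x => sg x * f x) = (fun x => eps%:C * (ce 1 x * f x + ce (-1) x * f x) + rest x * f x)); last first.
  by apply/funext => x; rewrite /sg; ring.
rewrite fcD ?fcZ ?fcD//; [|exact: citgD|apply: citgZ; exact: citgD].
by rewrite !fc_mul_ce opprK.
Qed.

Lemma halfC : (2^-1)%:C + (2^-1)%:C = 1 :> R[i].
Proof. by rewrite -rmorphD/=; congr (_%:C); field. Qed.

Lemma invC (x : R) : x != 0 -> (x^-1)%:C = (x%:C)^-1.
Proof.
move=> x0; have xC : x%:C != 0 by rewrite eq_complex/= (negbTE x0).
by apply: (mulfI xC); rewrite -rmorphM/= !mulfV.
Qed.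

Lemma nrm_add (a b : R[i]) (x y : R) : nrm a <= x -> nrm b <= y -> nrm (a + b) <= x + y.
Proof. by move=> h k; rewrite (le_trans (nrmD _ _))// lerD. Qed.

Lemma nrm_mul (a b : R[i]) (x y : R) : nrm a <= x -> nrm b <= y -> nrm (a * b) <= x * y.
Proof. by move=> h k; rewrite (le_trans (nrmM _ _))// ler_pM// nrm_ge0. Qed.

Lemma Dq2_bounds : 11 <= Dq 2 <= 13.
Proof.
have := hA'; have := hB'; have := hd'; rewrite /Dq.
move=> /andP[? ?] /andP[? ?] /andP[? ?]; apply/andP; split; lra.
Qed.

(** Minus the second harmonic of the wave, to leading order. *)
Definition tau : R := eps ^+ 2 / (2 * Dq 2).

Lemma eps2 : eps ^+ 2 = e ^+ 2. Proof. by rewrite -epsE real_normK ?num_real. Qed.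

Lemma tau_bounds : e ^+ 2 / 26 <= tau <= e ^+ 2 / 22.
Proof.
have /andP[d1 d2] := Dq2_bounds; rewrite /tau eps2; have e2 := sqr_ge0 e.
by apply/andP; split; rewrite ler_wpM2l// lef_pV2 ?posrE//; lra.
Qed.

Lemma coef_le q : ~~ small q -> nrm (sh q) <= 4 * e ^+ 2.
Proof.
move=> hq; have := coef_decay hq; have := big_sq hq; have := nrm_ge0 (sh q).
set z := nrm _; set y : R := q%:~R ^+ 2 => z0 y4 h.
have : z * 16 <= z * y ^+ 2 by rewrite ler_wpM2l//; nra.
by have := sqr_ge0 e; lra.
Qed.

Lemma fc_rest_s q : nrm (fc q (fun x => rest x * (s x)%:C)) <= 5760 * e ^+ 3.
Proof.
apply: (le_trans (fc_rest_mul q bmf_s s_bound)); rewrite le_eqVlt; apply/orP; left; apply/eqP; ring.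
Qed.

(** In the wave equation at q = 2 or -2 the leading term of (s^2)_q is
    eps^2. *)
Lemma second_harmonic (q r : int) : q != 0 -> Dq q = Dq 2 -> ~~ small r ->
  fc (q - 1) (fun x => (s x)%:C) + fc (q + 1) (fun x => (s x)%:C) = eps%:C + sh r ->
  nrm (sh q + tau%:C) <= 10 ^+ 3 * e ^+ 3.
Proof.
move=> q0 Dq2 hr hsh; have /andP[d1 d2] := Dq2_bounds.
have h := sq q0; rewrite (fc_sfE q bmf_s) hsh in h; rewrite -/(sh q) Dq2 in h.
have r1 := fc_rest_s q; have r2 := coef_le hr; move: h r1 r2.
set X := sh q; set Y := sh r; set Z := fc q (fun x => rest x * _) => h r1 r2.
have E : (Dq 2)%:C * (X + tau%:C) = - (2^-1)%:C * (eps%:C * Y + Z).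
  have D0 : Dq 2 != 0 by rewrite gt_eqF//; lra.
  have -> : (Dq 2)%:C * (X + tau%:C) = (Dq 2)%:C * X + (2^-1)%:C * (eps%:C * eps%:C).
    rewrite mulrDr; congr (_ + _); rewrite -!rmorphM/= /tau; congr (_%:C); by field.
  by rewrite h; ring.
have := congr1 nrm E; rewrite nrmZ mulNr nrmN nrmZ => {}E.
have n1 : nrm (eps%:C * Y + Z) <= e * (4 * e ^+ 2) + 5760 * e ^+ 3.
  by apply: nrm_add => //; apply: nrm_mul => //; rewrite nrmR epsE.
rewrite ger0_norm in E; last by lra.
rewrite (ger0_norm (_ : 0 <= 2^-1)) ?invr_ge0// in E.
have z0 := nrm_ge0 (X + tau%:C).
have : 11 * nrm (X + tau%:C) <= Dq 2 * nrm (X + tau%:C) by rewrite ler_wpM2r.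
have : 0 <= e ^+ 3 by rewrite exprn_ge0// e0.
lra.
Qed.

Lemma coef2_near : nrm (sh 2 + tau%:C) <= 10 ^+ 3 * e ^+ 3.
Proof. by apply: (@second_harmonic 2 3) => //; rewrite sp. Qed.
Lemma coefm2_near : nrm (sh (-2) + tau%:C) <= 10 ^+ 3 * e ^+ 3.
Proof.
apply: (@second_harmonic (-2) (-3)) => //; last by rewrite [X in _ + X]sm addrC.
by rewrite /Dq rmorphN/=; ring.
Qed.

Hypothesis ep : 0 < e.

Lemma e3_ge0 : 0 <= e ^+ 3. Proof. by rewrite exprn_ge0// ltW// ep. Qed.

(** In the wave equation at q = 1 the leading term of (s^2)_1 is 2 eps s_2, so
    D_1 is - s_2 to leading order. *)
Lemma Dq1_near : nrm ((Dq 1)%:C - tau%:C) <= 10 ^+ 6 * e ^+ 3.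
Proof.
have h := sq (isT : (1 : int) != 0); rewrite (fc_sfE 1 bmf_s) sp in h.
have Er : fc 1 (fun x => rest x * (s x)%:C) = fc 1 (sf rest).
  by apply: eq_fc => x _; rewrite /sf mulrC.
rewrite Er (fc_sfE 1 bmf_rest) !fc_rest in h.
have E0 : fc (1 - 1) (fun x => (s x)%:C) = 0 by rewrite subrr s0.
have r0 : rest_coef (1 - 1) = 0 by [].
have r2 : rest_coef (1 + 1) = sh 2 by [].
rewrite E0 r0 r2 !add0r -/(sh (1 + 1)) in h.
have := fc_rest_mul 1 bmf_rest rest_bound; move: h; have := coef2_near.
set X := sh 2; set Z := fc 1 (fun x => rest x * rest x) => h2 h hZ.
have E : eps%:C * ((Dq 1)%:C + X) = - (2^-1)%:C * Z.
  rewrite mulrDr [eps%:C * (Dq 1)%:C]mulrC h.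
  move: halfC; set H := (2^-1)%:C => hh.
  transitivity ((1 - (H + H)) * (eps%:C * X) - H * Z); first by ring.
  by rewrite hh subrr mul0r; ring.
have := congr1 nrm E; rewrite nrmZ mulNr nrmN nrmZ epsE => {}E.
rewrite (ger0_norm (_ : 0 <= 2^-1)) ?invr_ge0// in E.
have n1 : nrm ((Dq 1)%:C + X) <= 240 * 960 * e ^+ 3.
  rewrite -(ler_pM2l ep) E; lra.
have -> : (Dq 1)%:C - tau%:C = ((Dq 1)%:C + X) - (X + tau%:C) by ring.
apply: (le_trans (nrmB _ _)); have := e3_ge0; lra.
Qed.

Section nu2.
Variable nu : R[i].
Hypothesis hnu : nrm nu <= 10^-1.
Let G := resp nu 1.
Let g q := fc q G.

Lemma response_small q : small q -> g q = (q == 1)%:R.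
Proof. exact: sol_small (resp_sol hnu 1). Qed.

Lemma mq_le q : ~~ small q -> nrm (mq Lam nu q) <= 4^-1.
Proof.
move=> hq; have := mq_den hnu hq; have := big_sq hq; have := nrm_ge0 (mq Lam nu q).
set n := nrm _; set y : R := q%:~R ^+ 2 => n0 y4 h.
have : n * 16 <= n * y ^+ 2 by rewrite ler_wpM2l//; nra.
lra.
Qed.

Lemma response_eq q : ~~ small q -> g q = - (mq Lam nu q * fc q (sf G)).
Proof.
move=> hq; have [_ h] := resp_sol hnu 1; have := h q.
have -> : (q == 1) = false by apply: contraNF hq => /eqP ->.
by move=> /eqP; rewrite addr_eq0 => /eqP.
Qed.

Lemma response_le q : ~~ small q -> nrm (g q) <= 18 * e.
Proof.
move=> hq; rewrite response_eq// nrmN; have [bG _ nG] := respP hnu 1.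
apply: (le_trans (nrm_mul (mq_le hq) (fc_sf q bG nG))); have := e0; lra.
Qed.

Lemma rest_response_le q : nrm (fc q (fun x => rest x * G x)) <= 5760 * e ^+ 2.
Proof. by have [bG _ nG] := respP hnu 1; apply: (le_trans (fc_rest_mul q bG nG)); have := sqr_ge0 e; lra. Qed.

(** The mode 1 excites the mode 2 through the term eps of s. *)
Lemma response2_near : nrm (g 2 + mq Lam nu 2 * eps%:C) <= 1445 * e ^+ 2.
Proof.
have [bG _ nG] := respP hnu 1.
have g1 : g (2 - 1) = 1 by rewrite response_small.
rewrite response_eq// (fc_sfE 2 bG) -/G -[fc (2 - 1) G]/(g (2 - 1)) g1 -[fc (2 + 1) G]/(g 3).
have -> : - (mq Lam nu 2 * (eps%:C * (1 + g 3) + fc 2 (fun x => rest x * G x))) + mq Lam nu 2 * eps%:C =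
  mq Lam nu 2 * (- (eps%:C * g 3 + fc 2 (fun x => rest x * G x))) by ring.
have n1 : nrm (eps%:C * g 3) <= e * (18 * e) by apply: nrm_mul; [rewrite nrmR epsE|exact: response_le].
have := nrm_add n1 (rest_response_le 2); rewrite -nrmN => n2.
by apply: (le_trans (nrm_mul (mq_le (isT : ~~ small 2)) n2)); have := sqr_ge0 e; lra.
Qed.

Lemma response_m2_small : nrm (g (-2)) <= 1445 * e ^+ 2.
Proof.
have [bG _ nG] := respP hnu 1.
have g1 : g (-2 + 1) = 0 by rewrite response_small.
rewrite response_eq// (fc_sfE (-2) bG) -/G -[fc (-2 + 1) G]/(g (-2 + 1)) g1 -[fc (-2 - 1) G]/(g (-3)) addr0.
have n1 : nrm (eps%:C * g (-3)) <= e * (18 * e) by apply: nrm_mul; [rewrite nrmR epsE|exact: response_le].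
rewrite nrmN.
by apply: (le_trans (nrm_mul (mq_le (isT : ~~ small (-2))) (nrm_add n1 (rest_response_le (-2))))); have := sqr_ge0 e; lra.
Qed.

Lemma rest_response_near q : nrm (fc q (fun x => rest x * G x) - rest_coef (q - 1)) <= 4 * 10 ^+ 6 * e ^+ 3.
Proof.
have [bG hG nG] := respP hnu 1; have bK := bmf_Kop hnu bG.
have i1 := bmf_citg T (bmfM bmf_rest (bmf_ce T 1)); have i2 := bmf_citg T (bmfM bmf_rest bK).
have -> : fc q (fun x => rest x * G x) - rest_coef (q - 1) = - fc q (fun x => rest x * Kop nu G x).
  have -> : rest_coef (q - 1) = fc q (fun x => rest x * ce 1 x).
    by rewrite -fc_rest -fc_mul_ce; apply: eq_fc => x _; rewrite mulrC.
  apply/eqP; rewrite subr_eq addrC -fcB//; apply/eqP; apply: eq_fc => x _.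
  by have := hG x; rewrite -/G => <-; ring.
rewrite nrmN; apply: (le_trans (fc_rest_mul q bK (Kop_bound hnu bG nG))); have := e3_ge0; lra.
Qed.

(** Mode 1 acts on itself through mode 2: a factor eps each way. *)
Lemma feedback11_near : nrm (fc 1 (sf G) + mq Lam nu 2 * (eps ^+ 2)%:C) <= 5 * 10 ^+ 6 * e ^+ 3.
Proof.
have [bG _ nG] := respP hnu 1.
have g0 : g (1 - 1) = 0 by rewrite response_small.
rewrite (fc_sfE 1 bG) -[fc (1 - 1) G]/(g (1 - 1)) g0 add0r -[fc (1 + 1) G]/(g 2).
have r0 : rest_coef (1 - 1) = 0 by [].
have := rest_response_near 1; rewrite r0 subr0 => h1.
have -> : eps%:C * g 2 + fc 1 (fun x => rest x * G x) + mq Lam nu 2 * (eps ^+ 2)%:C =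
  eps%:C * (g 2 + mq Lam nu 2 * eps%:C) + fc 1 (fun x => rest x * G x) by rewrite rmorphXn/=; ring.
have n1 : nrm (eps%:C * (g 2 + mq Lam nu 2 * eps%:C)) <= e * (1445 * e ^+ 2).
  by apply: nrm_mul; [rewrite nrmR epsE|exact: response2_near].
by apply: (le_trans (nrm_add n1 h1)); have := e3_ge0; lra.
Qed.

(** Mode 1 acts on mode -1 through the harmonic s_{-2} of the wave. *)
Lemma feedback21_near : nrm (fc (-1) (sf G) + tau%:C) <= 5 * 10 ^+ 6 * e ^+ 3.
Proof.
have [bG _ nG] := respP hnu 1.
have g0 : g (-1 + 1) = 0 by rewrite response_small.
rewrite (fc_sfE (-1) bG) -[fc (-1 + 1) G]/(g (-1 + 1)) g0 addr0 -[fc (-1 - 1) G]/(g (-2)).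
have r0 : rest_coef (-1 - 1) = sh (-2) by [].
have := rest_response_near (-1); rewrite r0 => h1.
have -> : eps%:C * g (-2) + fc (-1) (fun x => rest x * G x) + tau%:C =
  eps%:C * g (-2) + (fc (-1) (fun x => rest x * G x) - sh (-2)) + (sh (-2) + tau%:C) by ring.
have n1 : nrm (eps%:C * g (-2)) <= e * (1445 * e ^+ 2).
  by apply: nrm_mul; [rewrite nrmR epsE|exact: response_m2_small].
by apply: (le_trans (nrm_add (nrm_add n1 h1) coefm2_near)); have := e3_ge0; lra.
Qed.

(** The multiplier [mq Lam nu 2] is close to 1 / D_2. *)
Lemma mq2_near : 0 <= Lam <= tau -> nrm nu <= 4 * tau ->
  nrm (mq Lam nu 2 * (eps ^+ 2)%:C - 2 * tau%:C) <= e ^+ 3.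
Proof.
move=> /andP[l0 l1] n4; have /andP[d1 d2] := Dq2_bounds; have /andP[t1 t2] := tau_bounds.
have D0 : Dq 2 != 0 by rewrite gt_eqF//; lra.
have DC : (Dq 2)%:C != 0 by rewrite eq_complex/= (negbTE D0).
have d0 := den_neq0 hnu (isT : ~~ small 2).
have E : mq Lam nu 2 * (eps ^+ 2)%:C - 2 * tau%:C =
   (eps ^+ 2 / Dq 2)%:C * (mq Lam nu 2 * ((Dq 2)%:C - den Lam nu 2)).
  have -> : 2 * tau%:C = (eps ^+ 2)%:C * ((Dq 2)%:C)^-1.
    rewrite -invC// -rmorphM/= mulr2n mulrDl mul1r -rmorphD/=; congr (_%:C); rewrite /tau; by field.
  have -> : (eps ^+ 2 / Dq 2)%:C = (eps ^+ 2)%:C * ((Dq 2)%:C)^-1 by rewrite -invC// -rmorphM.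
  have -> : mq Lam nu 2 = (den Lam nu 2)^-1 by [].
  move: d0 DC; set X := den _ _ _; set Y := (Dq 2)%:C => d0 DC.
  by field; rewrite ?d0 ?DC.
rewrite E nrmZ.
have n1 : nrm ((Dq 2)%:C - den Lam nu 2) <= 2 * tau.
  have -> : (Dq 2)%:C - den Lam nu 2 = - (0 +i* (Lam / 2)) + (4^-1)%:C * nu.
    rewrite /den; have -> : ((2 : int)%:~R ^+ 2)^-1 = 4^-1 :> R by congr (_^-1); rewrite expr2; ring.
    by ring.
  have n1 : nrm (- (0 +i* (Lam / 2))) <= tau / 2.
    by rewrite nrmN /nrm/= normr0 add0r ger0_norm; lra.
  have n2 : nrm ((4^-1)%:C * nu) <= 4^-1 * (4 * tau).
    by apply: nrm_mul => //; rewrite nrmR ger0_norm// invr_ge0.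
  by apply: (le_trans (nrm_add n1 n2)); lra.
have n2 := nrm_mul (mq_le (isT : ~~ small 2)) n1.
have n3 : `|eps ^+ 2 / Dq 2| <= e ^+ 2.
  by rewrite ger0_norm ?divr_ge0 ?sqr_ge0//; [rewrite ler_pdivrMr ?eps2 ?ler_peMr ?sqr_ge0//; lra | lra].
apply: (@le_trans _ _ (e ^+ 2 * (4^-1 * (2 * tau)))).
  by apply: ler_pM => //; exact: nrm_ge0.
have e1' := e1; have ep' := ep; have e3' := e3_ge0.
have : e ^+ 2 * tau <= e ^+ 2 * e by rewrite ler_wpM2l ?sqr_ge0//; nra.
by rewrite -exprSr; lra.
Qed.

(** The terms D_1 = tau and - 2 tau, from [feedback11_near], add up to -
    tau. *)
Lemma schur11_near : 0 <= Lam <= tau -> nrm nu <= 4 * tau ->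
  nrm (schur nu 1 1 - (0 +i* Lam - nu - tau%:C)) <= 10 ^+ 7 * e ^+ 3.
Proof.
move=> hL n4; have h1 := mq2_near hL n4; have h2 := feedback11_near; have h3 := Dq1_near.
have -> : schur nu 1 1 - (0 +i* Lam - nu - tau%:C) = ((Dq 1)%:C - tau%:C) +
   ((fc 1 (sf G) + mq Lam nu 2 * (eps ^+ 2)%:C) - (mq Lam nu 2 * (eps ^+ 2)%:C - 2 * tau%:C)).
  have dE : den Lam nu 1 = (Dq 1)%:C + 0 +i* Lam - nu.
    by rewrite /den divr1 expr1n invr1 mulr1.
  by rewrite /schur eqxx mul1r dE -/G; ring.
rewrite -nrmN in h1.
by apply: (le_trans (nrm_add h3 (nrm_add h2 h1))); have := e3_ge0; lra.
Qed.

Lemma schur21_near : nrm (schur nu (-1) 1 + tau%:C) <= 10 ^+ 7 * e ^+ 3.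
Proof.
have h2 := feedback21_near; rewrite /schur (_ : (-1 == 1 :> int) = false)// mul0r add0r -/G.
by apply: (le_trans h2); have := e3_ge0; lra.
Qed.

End nu2.
Lemma DqN q : Dq (- q) = Dq q. Proof. by rewrite /Dq rmorphN/=; ring. Qed.

Lemma denN (x : R) q : den Lam x%:C (- q) = ((den Lam x%:C q)^*)%C.
Proof.
rewrite /den DqN rmorphN/= sqrrN invrN mulrN.
by apply: eq_ReIm; rewrite !(ReB, ImB, ReD, ImD, ReM, ImM)/= ?(ReB, ImB, ReD, ImD, ReM, ImM)/=; ring.
Qed.

Lemma mqN (x : R) q : nrm x%:C <= 10^-1 -> mq Lam x%:C (- q) = ((mq Lam x%:C q)^*)%C.
Proof.
move=> hx; have sN : small (- q) = small q.
  by rewrite /small oppr_eq0 !eqr_oppLR opprK [(q == -1) || _]orbC.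
rewrite /mq sN; case: ifPn => hq; first by rewrite /= oppr0.
have n1 := den_neq0 hx hq; have hq' : ~~ small (- q) by rewrite sN.
apply: (mulfI (den_neq0 hx hq')); rewrite mulfV ?den_neq0// denN -conjM mulfV//.
by rewrite /= oppr0.
Qed.

Section real_nu.
Variable x : R.
Hypothesis hx : nrm x%:C <= 10^-1.
Let G1c y := ((resp x%:C 1 y)^*)%C.

(** Since s is real, conjugation turns the response of mode 1 into that of
    mode -1, when nu is real. *)
Lemma G1c_sol : Sol x%:C (fun q => (q == -1)%:R) G1c.
Proof.
have [bG _ _] := respP hx 1; have [[m1 m2 [M hM]] [_ h]] := (bG, resp_sol hx 1).
have bc : bmf G1c.
  split; rewrite /G1c.
  - by rewrite (_ : (fun y => _) = (fun y => Re (resp x%:C 1 y)))//; apply/funext => y; case: (resp _ _ _).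
  - rewrite (_ : (fun y => _) = (fun y => - Im (resp x%:C 1 y))); last by apply/funext => y; case: (resp _ _ _).
    exact: measurableT_comp.
  - by exists M => y; rewrite nrmC.
split=> // q; have := h (- q); rewrite (mqN _ hx) => /(congr1 (fun z : R[i] => (z^*)%C)).
rewrite (conjD (fc _ _)) (conjM ((mq Lam x%:C q)^*)%C) conjK -(fc_conj q (bmf_citg T bG)).
rewrite -(fc_conj q (citg_sf bG)).
have -> : fc q (fun y => ((sf (resp x%:C 1) y)^*)%C) = fc q (sf G1c).
  by apply: eq_fc => y _; rewrite /sf conjM conjR.
move=> ->; by rewrite eqr_oppLR; case: eqP => _ /=; rewrite oppr0.
Qed.

Lemma sf_conj q : fc q (sf (resp x%:C (-1))) = ((fc (- q) (sf (resp x%:C 1)))^*)%C.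
Proof.
have [bG _ _] := respP hx 1; have [bG' _ _] := respP hx (-1).
have [bc _] := G1c_sol.
rewrite (fc_sf_ae q bG' bc (sol_uniq hx (resp_sol hx (-1)) G1c_sol)).
rewrite -(fc_conj q (citg_sf bG)).
by apply: eq_fc => y _; rewrite /sf conjM conjR.
Qed.

Lemma schur22_conj : schur x%:C (-1) (-1) = ((schur x%:C 1 1)^*)%C.
Proof. rewrite /schur sf_conj opprK denN !eqxx !mul1r.
by move: (den _ _ _) (fc _ _) => X Y; rewrite conjD. Qed.
Lemma schur12_conj : schur x%:C 1 (-1) = ((schur x%:C (-1) 1)^*)%C.
Proof.
by rewrite /schur sf_conj (_ : (1 == -1 :> int) = false)// (_ : (-1 == 1 :> int) = false)// !mul0r !add0r.
Qed.
End real_nu.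

(** The diagonal depends on nu through - nu and, like the other entries,
    through the responses. *)
Lemma schur_lip nu nu' i j : i \in [:: 1; -1] -> nrm nu <= 10^-1 -> nrm nu' <= 10^-1 ->
  nrm (schur nu i j - schur nu' i j + (i == j)%:R * (nu - nu')) <= 10 ^+ 6 * e ^+ 2 * nrm (nu - nu').
Proof.
move=> hi h h'; apply: le_trans (fc_sf_lip i j h h'); rewrite /schur.
have dE : den Lam nu i - den Lam nu' i = - (nu - nu').
  rewrite /den; have -> : (i%:~R ^+ 2)^-1 = 1 :> R.
    by move: hi; rewrite !inE => /orP[] /eqP ->; rewrite ?rmorphN/= ?sqrrN expr1n invr1.
  by ring.
set X := fc i (sf (resp nu j)); set Y := fc i (sf (resp nu' j)).
rewrite (_ : _ + _ = X - Y)//.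
transitivity ((i == j)%:R * (den Lam nu i - den Lam nu' i + (nu - nu')) + (X - Y)); first by ring.
by rewrite dE addNr mulr0 add0r.
Qed.

Hypothesis he : 10 ^+ 11 * e <= 1.
Hypothesis hL : 0 < Lam <= tau / 10.

Lemma tau_pos : 0 < tau.
Proof. by have /andP[h _] := tau_bounds; apply: lt_le_trans h; rewrite divr_gt0// exprn_gt0// ep. Qed.

Lemma e3_small : 10 ^+ 7 * e ^+ 3 <= tau / 100.
Proof.
have /andP[h _] := tau_bounds; have h2 : 0 <= e ^+ 2 by exact: sqr_ge0.
have : e ^+ 2 * (10 ^+ 11 * e) <= e ^+ 2 * 1 by rewrite ler_wpM2l// he.
rewrite exprSr; lra.
Qed.

Lemma e2_small : 10 ^+ 8 * e ^+ 2 <= 10^-1 ^+ 4.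
Proof.
have h := he; have h0 := ep; have : e * (10 ^+ 11 * e) <= e * 1 by rewrite ler_wpM2l// ltW.
rewrite expr2; lra.
Qed.

Lemma tau_small : tau <= 100^-1.
Proof. by have /andP[_ h] := tau_bounds; have := e2_small; have := sqr_ge0 e; lra. Qed.

(** An interval around - 2 tau, the root of the determinant to leading
    order. *)
Definition rng (x : R) := - (3 * tau) <= x <= - (3 / 2 * tau).

Lemma rng_nu x : rng x -> nrm x%:C <= 10^-1 /\ nrm x%:C <= 4 * tau.
Proof.
move=> /andP[h1 h2]; have h3 := tau_small; have h4 := tau_pos.
have x0 : x <= 0 by lra.
by rewrite nrmR ler0_norm//; split; lra.
Qed.

Lemma schur_entries x : rng x -> `|Re (schur x%:C 1 1) + x + tau| + `|Im (schur x%:C 1 1) - Lam| <= tau / 100 /\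
  `|Re (schur x%:C (-1) 1) + tau| + `|Im (schur x%:C (-1) 1)| <= tau / 100.
Proof.
move=> hx; have [n1 n2] := rng_nu hx; have t0 := tau_pos; have s3 := e3_small.
have hL' : 0 <= Lam <= tau by case/andP: hL => ? ?; apply/andP; split; lra.
have h1 := le_trans (schur11_near n1 hL' n2) s3; have h2 := le_trans (schur21_near n1) s3.
move: (schur x%:C 1 1) (schur x%:C (-1) 1) h1 h2 => Z1 Z2; rewrite /nrm !(ReB, ImB, ReD, ImD)/=.
have -> : Re Z1 - (0 - x - tau) = Re Z1 + x + tau by ring.
have -> : Im Z1 - (Lam - 0 - 0) = Im Z1 - Lam by ring.
by rewrite addr0.
Qed.

(** The determinant of [schur] at a real nu, by the symmetries [schur22_conj]
    and [schur12_conj]. *)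
Definition det (x : R) : R := Re (schur x%:C 1 1) ^+ 2 + Im (schur x%:C 1 1) ^+ 2 -
  (Re (schur x%:C (-1) 1) ^+ 2 + Im (schur x%:C (-1) 1) ^+ 2).

Lemma schur_bounds x : rng x -> nrm (schur x%:C 1 1) <= 3 * tau /\ nrm (schur x%:C (-1) 1) <= 2 * tau.
Proof.
move=> hx; have [h1 h2] := schur_entries hx; have /andP[x1 x2] := hx; have t0 := tau_pos.
have /andP[L1 L2] := hL.
rewrite (_ : Re (schur x%:C 1 1) + x + tau = Re (schur x%:C 1 1) - (- x - tau)) in h1; last by ring.
split.
  have n1 : `|- x - tau| <= 2 * tau by rewrite ler_norml; apply/andP; split; lra.
  have n2 : `|Lam| <= tau / 10 by rewrite gtr0_norm.
  by apply: (le_trans (nrm_near h1)); lra.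
have {}h2 : `|Re (schur x%:C (-1) 1) - (- tau)| + `|Im (schur x%:C (-1) 1) - 0| <= tau / 100 by rewrite opprK subr0.
by apply: (le_trans (nrm_near h2)); rewrite normr0 normrN gtr0_norm//; lra.
Qed.

Lemma det_lip x y : rng x -> rng y -> `|det x - det y| <= 100 * `|x - y|.
Proof.
move=> hx hy; have t1 := tau_small; have t0 := tau_pos.
have t3 : 3 * tau <= 1 by lra.
have t2 : 2 * tau <= 1 by lra.
have [a1 a2] := schur_bounds hx; have [b1 b2] := schur_bounds hy.
have [n1 _] := rng_nu hx; have [n2 _] := rng_nu hy.
have l1 := schur_lip 1 (isT : (1 : int) \in [:: 1; -1]) n1 n2.
have l2 := schur_lip 1 (isT : (-1 : int) \in [:: 1; -1]) n1 n2.
have xy : nrm (x%:C - y%:C) = `|x - y| by rewrite -rmorphB/= nrmR.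
rewrite eqxx mul1r xy in l1; rewrite (_ : (-1 == 1 :> int) = false)// mul0r addr0 xy in l2.
have s2 : 10 ^+ 6 * e ^+ 2 <= 1 by have := e2_small; have := sqr_ge0 e; lra.
have d0 := normr_ge0 (x - y).
have k1 : 10 ^+ 6 * e ^+ 2 * `|x - y| <= `|x - y| by rewrite -[leRHS]mul1r ler_wpM2r.
have {}l2 := le_trans l2 k1.
have k2 : nrm (- (x%:C - y%:C)) <= `|x - y| by rewrite nrmN xy.
have {}l1 := nrm_add (le_trans l1 k1) k2; rewrite addrK in l1.
have q1 := sqnorm_lip (le_trans a1 _) (le_trans b1 _) l1.
have q2 := sqnorm_lip (le_trans a2 _) (le_trans b2 _) l2.
apply: (le_trans (sub_near (q1 t3 t3) (q2 t2 t2))).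
lra.
Qed.

(** The model determinant nu (nu + 2 tau) + Lam^2 equals about 3 tau^2 at
    one end and - (3/4) tau^2 at the other, and the error terms are far
    smaller. *)
Lemma det_root : exists2 x, rng x & det x = 0.
Proof.
have t0 := tau_pos.
have r1 : rng (- (3 * tau)) by apply/andP; split; lra.
have r2 : rng (- (3 / 2 * tau)) by apply/andP; split; lra.
have [a1 a2] := schur_entries r1; have [b1 b2] := schur_entries r2.
have L := hL; move/andP: L => [L1 L2].
have d1 : 0 < det (- (3 * tau)).
  rewrite /det; move: (schur _ 1 1) (schur _ (-1) 1) a1 a2; case=> [u1 v1] [u2 v2] /= a1 a2.
  have [/andP[? ?] /andP[? ?]] := norm_sum_split a1.
  have [/andP[? ?] /andP[? ?]] := norm_sum_split a2.
  by apply: (@det_pos _ tau) => //; try (apply/andP; split); lra.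
have d2 : det (- (3 / 2 * tau)) < 0.
  rewrite /det; move: (schur _ 1 1) (schur _ (-1) 1) b1 b2; case=> [u1 v1] [u2 v2] /= b1 b2.
  have [/andP[? ?] /andP[? ?]] := norm_sum_split b1.
  have [/andP[? ?] /andP[? ?]] := norm_sum_split b2.
  by apply: (@det_neg _ tau) => //; try (apply/andP; split); lra.
have [|x y hx hy|||x hx h0] := @ivt_lip R (fun x => - det x) (- (3 * tau)) (- (3 / 2 * tau)) 100.
- lra.
- by rewrite opprK addrC distrC; exact: det_lip.
- by rewrite oppr_lt0.
- by rewrite oppr_gt0.
by exists x => //; apply: oppr_inj; rewrite h0 oppr0.
Qed.

Lemma solve2 (a b c d' r1 r2 : R[i]) : a * d' - b * c != 0 ->
  let D := a * d' - b * c in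
  a * ((d' * r1 - b * r2) / D) + b * ((a * r2 - c * r1) / D) = r1 /\
  c * ((d' * r1 - b * r2) / D) + d' * ((a * r2 - c * r1) / D) = r2.
Proof. by move=> D0 D; rewrite /D; split; field. Qed.

Lemma sol_0 nu : Sol nu (fun q => mq Lam nu q * 0) (fun=> 0).
Proof.
split=> [|q]; first exact: bmf_cst.
have -> : sf (fun=> 0) = (fun=> 0) by apply/funext => y; rewrite /sf mulr0.
by rewrite fc_cst// mul0r mulr0 addr0.
Qed.

Lemma fc_sf0 q : fc q (sf (fun=> 0)) = 0.
Proof.
have -> : sf (fun=> 0) = (fun=> 0) by apply/funext => y; rewrite /sf mulr0.
by rewrite fc_cst// mul0r.
Qed.

Lemma reduced_decay nu H F C : nrm nu <= 10^-1 -> reduced_eq nu H F -> (forall q, q != 0 -> nrm (H q) <= C) ->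
  exists M, forall q, nrm (fc q F) * (1 + q%:~R ^+ 2) ^+ 2 <= M.
Proof.
move=> hn [bF _ hF] hH; have [_ _ [M hM]] := bF.
have M0 : 0 <= M by apply: le_trans (hM 0); exact: nrm_ge0.
have C0 : 0 <= C by apply: le_trans (hH 1 isT); exact: nrm_ge0.
have eM : 0 <= e * M by rewrite mulr_ge0.
exists (7 * (C + 12 * e * M) + 8 * M) => q; have [hq|hq] := boolP (small q).
  have q1 : q%:~R ^+ 2 <= 1 :> R.
    by case/or3P: hq => /eqP ->; rewrite ?rmorphN/= ?sqrrN ?expr1n// expr0n.
  have q0 : 0 <= q%:~R ^+ 2 :> R by exact: sqr_ge0.
  have h := fc_bound T0 q (bmf_citg T bF) (fun x _ => hM x).
  apply: (@le_trans _ _ (2 * M * 4)); last by lra.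
  by apply: ler_pM => //; [exact: nrm_ge0|exact: sqr_ge0|nra].
have q0 : q != 0 by apply: contraNN hq => /eqP ->.
have -> : fc q F = mq Lam nu q * (H q - fc q (sf F)).
  by rewrite -(hF q q0) addrK /mq (negbTE hq) mulKf// den_neq0.
have n1 : nrm (H q - fc q (sf F)) <= C + 12 * e * M.
  by rewrite -nrmN opprB addrC; apply: nrm_add; [rewrite nrmN; exact: hH|exact: fc_sf].
have := mq_bound q hn; have := nrmM (mq Lam nu q) (H q - fc q (sf F)).
have := nrm_ge0 (mq Lam nu q); have := nrm_ge0 (H q - fc q (sf F)).
set a := nrm (mq _ _ _); set b := nrm (H q - _); set y : R := (1 + _) ^+ 2; have y0 : 0 <= y by exact: sqr_ge0.
set z := nrm (_ * _) => b0 a0 h1 h2.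
have h3 : z * y <= a * b * y by rewrite ler_wpM2r.
have h4 : (a * y) * b <= 7 * (C + 12 * e * M) by apply: ler_pM => //; rewrite mulr_ge0.
by rewrite -mulrA in h4; lra.
Qed.

Section root.
Variable x0 : R.
Hypotheses (hx0 : rng x0) (hdt : det x0 = 0).
Let nu : R[i] := x0%:C.
Let a := schur nu 1 1.
Let b := schur nu (-1) 1.
Let hnu : nrm nu <= 10^-1. Proof. exact: (rng_nu hx0).1. Qed.

Lemma schur11_Re : tau / 4 <= Re a.
Proof.
have [h1 _] := schur_entries hx0; have /andP[x1 x2] := hx0; have t0 := tau_pos.
have [/andP[? ?] _] := norm_sum_split h1; rewrite /a /nu; lra.
Qed.

Lemma a_neq0 : a != 0.
Proof. apply/eqP => z; have := schur11_Re; rewrite z /=; have := tau_pos; lra. Qed.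

Lemma root_eq : a * (a^*)%C = b * (b^*)%C.
Proof.
have := hdt; rewrite /det -/nu -/a -/b; move: a b => [a1 a2] [b1 b2] /= h.
by apply: eq_ReIm; rewrite ?ReM ?ImM/=; [lra|ring].
Qed.

(** The amplitudes form the null vector of the matrix at the root. *)
Definition phi := comb nu (b^*)%C (- a) (fun=> 0).

Lemma phiP : [/\ reduced_eq nu (fun=> 0) phi, fc 1 phi = (b^*)%C & fc (-1) phi = - a].
Proof.
apply: comb_reduced => //; rewrite ?fc_sf0 ?subr0.
- exact: sol_0.
- by rewrite schur12_conj// -/nu -/a -/b; ring.
- by rewrite schur22_conj// -/nu -/a -/b; have := root_eq; rewrite [a * _]mulrC mulrN => ->; ring.
Qed.

Lemma ker_phi F : reduced_eq nu (fun=> 0) F -> exists al, forall q, fc q F = al * fc q phi.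
Proof.
move=> RF; have [e1' _ h] := reduced_comb hnu RF (sol_0 nu).
rewrite fc_sf0 subr0 schur12_conj// -/nu -/a -/b in e1'.
exists (- (fc (-1) F / a)) => q; have [[bph _ _] f1 f2] := phiP.
have u1 : fc 1 F = - (fc (-1) F / a) * (b^*)%C.
  apply: (mulfI a_neq0); move: e1' => /eqP; rewrite addr_eq0 => /eqP ->.
  by field; exact: a_neq0.
have u2 : fc (-1) F = - (fc (-1) F / a) * - a by field; exact: a_neq0.
rewrite h -fcZ; last exact: bmf_citg.
apply: eq_fc => y _; rewrite /phi /comb {1}u1 {2}u2; ring.
Qed.

Lemma phi_bound : forall y, nrm (phi y) <= 30 * tau.
Proof.
move=> y; have [n1 n2] := schur_bounds hx0; rewrite -/nu -/a -/b in n1 n2.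
have [_ _ g1] := respP hnu 1; have [_ _ g2'] := respP hnu (-1).
rewrite /phi /comb addr0; rewrite -nrmC in n2; rewrite -nrmN in n1.
by apply: (le_trans (nrm_add (nrm_mul n2 (g1 y)) (nrm_mul n1 (g2' y)))); lra.
Qed.

(** The vector (b, - a) annihilates the columns of the matrix. Applied to the
    system for F it leaves al (b b^* + a^2) on one side and on the other a
    term in the eliminated modes of phi, whence |al| <= |al| / 2. *)
Lemma no_jordan F al : reduced_eq nu (fun q => al * fc q phi * ((q%:~R ^+ 2)^-1)%:C) F -> al = 0.
Proof.
move=> RF; have [[bph _ hph] f1 f2] := phiP; have t0 := tau_pos.
have al0 := nrm_ge0 al; have e0' := e0.
have hc q : ~~ small q -> nrm (al * fc q phi * ((q%:~R ^+ 2)^-1)%:C) <= 360 * e * tau * nrm al.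
  move=> hq; have q0 : q != 0 by apply: contraNN hq => /eqP ->.
  have E1 : fc q phi = mq Lam nu q * (- fc q (sf phi)).
    have := hph q q0 => /eqP; rewrite addr_eq0 => /eqP <-.
    by rewrite /mq (negbTE hq) mulKf// den_neq0.
  have n1 : nrm (fc q phi) <= 4^-1 * (12 * e * (30 * tau)).
    by rewrite E1; apply: nrm_mul; [exact: mq_le|rewrite nrmN; apply: fc_sf => //; exact: phi_bound].
  have n2 : nrm (((q%:~R ^+ 2)^-1)%:C : R[i]) <= 1.
    have y4 := big_sq hq; rewrite nrmR ger0_norm ?invr_ge0 ?sqr_ge0// invf_le1; lra.
  apply: (le_trans (nrm_mul (nrm_mul (lexx (nrm al)) n1) n2)).
  have : 0 <= e * tau * nrm al by apply: mulr_ge0 => //; apply: mulr_ge0 => //; exact: ltW.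
  lra.
have [Gb [SG nG]] := sol_ex hnu hc; have [bG _] := SG.
have [E1 E2 _] := reduced_comb hnu RF SG.
have z1 := fc_sf 1 bG nG; have z2 := fc_sf (-1) bG nG.
rewrite f1 schur12_conj// -/nu -/a -/b in E1; rewrite f2 schur22_conj// -/nu -/a -/b in E2.
move: E1 E2 z1 z2; set u1 := fc 1 F; set u2 := fc (-1) F.
set y1 := fc 1 (sf Gb); set y2 := fc (-1) (sf Gb) => E1 E2 z1 z2.
have s1 : ((1 : int)%:~R ^+ 2)^-1 = 1 :> R by rewrite expr1n invr1.
have s2 : ((-1 : int)%:~R ^+ 2)^-1 = 1 :> R by rewrite rmorphN sqrrN expr1n invr1.
rewrite s1 mulr1 in E1; rewrite s2 mulr1 in E2.
(* The left null vector (b, - a) is applied to the two equations. *)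
have key : al * (b * (b^*)%C + a * a) = b * y1 - a * y2.
  have h1 := congr1 (fun z => b * z) E1; have h2 := congr1 (fun z => a * z) E2.
  have hab := root_eq.
  have : b * (a * u1 + (b^*)%C * u2) - a * (b * u1 + (a^*)%C * u2) = 0.
    transitivity ((b * (b^*)%C - a * (a^*)%C) * u2); first by ring.
    by rewrite hab subrr mul0r.
  rewrite E1 E2 => h; apply/eqP; rewrite -subr_eq0; apply/eqP; rewrite -[RHS]h; ring.
set w := b * (b^*)%C + a * a in key.
have [na nb] := schur_bounds hx0; rewrite -/nu -/a -/b in na nb.
have wre : tau ^+ 2 / 8 <= `|Re w|.
  have : Re w = 2 * Re a ^+ 2.
    by rewrite /w -root_eq; exact: Re_conj_sq.
  move=> ->; apply: le_trans (ler_norm _).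
  have : (tau / 4) ^+ 2 <= Re a ^+ 2 by rewrite ler_sqr ?nnegrE; have := schur11_Re; lra.
  lra.
have t2 : 0 < tau ^+ 2 / 8 by rewrite divr_gt0// exprn_gt0.
have w0 : w != 0 by apply/eqP => z; move: wre; rewrite z/= normr0 leNgt t2.
have alE : al = w^-1 * (b * y1 - a * y2) by rewrite -key mulrC mulfK.
have n1 := nrmV t2 wre.
have n2 : nrm (b * y1 - a * y2) <= 5 * tau * (12 * e * (144 * (360 * e * tau * nrm al))).
  have z2' : nrm (- y2) <= 12 * e * (144 * (360 * e * tau * nrm al)) by rewrite nrmN.
  by rewrite -mulrN; apply: (le_trans (nrm_add (nrm_mul nb z1) (nrm_mul na z2'))); lra.
have n3 : nrm al <= 2 / (tau ^+ 2 / 8) * (5 * tau * (12 * e * (144 * (360 * e * tau * nrm al)))).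
  by rewrite {1}alE; exact: nrm_mul.
have n4 : 2 / (tau ^+ 2 / 8) * (5 * tau * (12 * e * (144 * (360 * e * tau * nrm al)))) =
   80 * 12 * 144 * 360 * e ^+ 2 * nrm al by field; rewrite gt_eqF.
rewrite n4 in n3; apply: nrm_eq0.
have sme := e2_small; have : (80 * 12 * 144 * 360 * e ^+ 2) * nrm al <= 2^-1 * nrm al.
  by rewrite ler_wpM2r//; have := sqr_ge0 e; lra.
lra.
Qed.

(** Subtracting the determinant at the root, which is 0, leaves - 2 (Re a) dl
    plus terms below tau |dl| / 100, whereas 2 Re a is at least tau / 2. *)
Lemma det_near nu' : 0 < nrm (nu' - nu) < tau / 1000 ->
  nrm nu' <= 10^-1 /\ schur nu' 1 1 * schur nu' (-1) (-1) - schur nu' 1 (-1) * schur nu' (-1) 1 != 0.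
Proof.
move=> /andP[dl0 dl1]; have t0 := tau_pos; have ts := tau_small.
have hn' : nrm nu' <= 10^-1.
  have -> : nu' = (nu' - nu) + nu by rewrite subrK.
  have n4 : nrm nu <= 3 * tau.
    by have /andP[x1 x2] := hx0; rewrite /nu nrmR ler_norml; apply/andP; split; lra.
  by apply: (le_trans (nrm_add (ltW dl1) n4)); lra.
split=> //.
have sme : 10 ^+ 6 * e ^+ 2 <= 10^-1 ^+ 4 by have := e2_small; have := sqr_ge0 e; lra.
set dl := nu' - nu in dl0 dl1.
have c4 : 10^-1 ^+ 4 * nrm dl <= tau by lra.
have L i j (hi : i \in [:: 1; -1]) : nrm (schur nu' i j - schur nu i j + (i == j)%:R * dl) <= 10^-1 ^+ 4 * nrm dl.
  by apply: (le_trans (schur_lip j hi hn' hnu)); rewrite ler_wpM2r// ltW.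
have l1 := L 1 1 isT; have l2 := L (-1) (-1) isT; have l3 := L 1 (-1) isT; have l4 := L (-1) 1 isT.
rewrite eqxx mul1r in l1; rewrite eqxx mul1r in l2.
rewrite (_ : (1 == -1 :> int) = false)// mul0r addr0 in l3.
rewrite (_ : (-1 == 1 :> int) = false)// mul0r addr0 in l4.
have [na nb] := schur_bounds hx0; rewrite -/nu -/a -/b in na nb.
rewrite schur22_conj// -/nu -/a in l2; rewrite schur12_conj// -/nu -/b in l3; rewrite -/a in l1; rewrite -/b in l4.
have Rea := schur11_Re; have hab := root_eq.
set X1 := _ + _ in l1; set X2 := _ + _ in l2; set X3 := _ - _ in l3; set X4 := _ - _ in l4.
have -> : schur nu' 1 1 = a - dl + X1 by rewrite /X1; ring.
have -> : schur nu' (-1) (-1) = (a^*)%C - dl + X2 by rewrite /X2; ring.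
have -> : schur nu' 1 (-1) = (b^*)%C + X3 by rewrite /X3; ring.
have -> : schur nu' (-1) 1 = b + X4 by rewrite /X4; ring.
clearbody X1 X2 X3 X4.
have ac : a + (a^*)%C = (2 * Re a)%:C.
  by move: (a) => [a1 a2]; apply: eq_ReIm; rewrite /=; ring.
have n2 : nrm (a^*)%C <= 3 * tau by rewrite nrmC.
have n3 : nrm (b^*)%C <= 2 * tau by rewrite nrmC.
apply/eqP => z.
(* The determinant at the root, 0, has been subtracted. *)
have key : (2 * Re a)%:C * dl = dl * dl + (X1 * ((a^*)%C - dl + X2) + (X2 * (a - dl) + (- X3 * (b + X4) + - X4 * (b^*)%C))).
  rewrite -ac; apply/eqP; rewrite -subr_eq0; apply/eqP; rewrite -[RHS]oppr0 -[in RHS]z.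
  set dd := _ - (b^*%C + X3) * (b + X4).
  transitivity (- dd + (a * (a^*)%C - b * (b^*)%C)); first by rewrite /dd; ring.
  by rewrite hab subrr addr0.
have := congr1 nrm key; rewrite nrmZ => kn.
have nd : nrm (- dl) <= tau / 1000 by rewrite nrmN ltW.
have dlb : nrm dl <= tau / 1000 by rewrite ltW.
have m1 := nrm_mul l1 (nrm_add (nrm_add n2 nd) (le_trans l2 c4)).
have m2 := nrm_mul l2 (nrm_add na nd).
have l3' : nrm (- X3) <= 10^-1 ^+ 4 * nrm dl by rewrite nrmN.
have l4' : nrm (- X4) <= 10^-1 ^+ 4 * nrm dl by rewrite nrmN.
have m3 := nrm_mul l3' (nrm_add nb (le_trans l4 c4)).
have m4 := nrm_mul l4' n3.
have m0 := nrm_mul (lexx (nrm dl)) dlb.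
have bnd := nrm_add m0 (nrm_add m1 (nrm_add m2 (nrm_add m3 m4))).
rewrite -kn in bnd; exact: (det_gap t0 dl0 Rea bnd).
Qed.

End root.

Lemma solve2_uniq (a b c d' r1 r2 u1 u2 : R[i]) : a * d' - b * c != 0 ->
  a * u1 + b * u2 = r1 -> c * u1 + d' * u2 = r2 ->
  u1 = (d' * r1 - b * r2) / (a * d' - b * c) /\ u2 = (a * r2 - c * r1) / (a * d' - b * c).
Proof. by move=> D0 <- <-; split; field. Qed.

(** Cramer's rule on the 2 x 2 system; the constant M depends on nu. *)
Lemma reduced_inverse nu : nrm nu <= 10^-1 ->
  schur nu 1 1 * schur nu (-1) (-1) - schur nu 1 (-1) * schur nu (-1) 1 != 0 ->
  exists M : R, forall (C : R) (H : int -> R[i]), (forall q, q != 0 -> nrm (H q) <= C) ->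
    (exists F, reduced_eq nu H F /\ forall y, nrm (F y) <= M * C) /\
    forall F F', reduced_eq nu H F -> reduced_eq nu H F' -> forall q, fc q F = fc q F'.
Proof.
move=> hn D0.
have ec : 12 * 144 * e <= 1 by have := e1; lra.
have W11 := nrm_ge0 (schur nu 1 1); have W12 := nrm_ge0 (schur nu 1 (-1)).
have W21 := nrm_ge0 (schur nu (-1) 1); have W22 := nrm_ge0 (schur nu (-1) (-1)).
pose W := (nrm (schur nu (-1) (-1)) + nrm (schur nu 1 (-1))) + (nrm (schur nu 1 1) + nrm (schur nu (-1) 1)).
have W1 : nrm (schur nu (-1) (-1)) + nrm (schur nu 1 (-1)) <= W by rewrite lerDl addr_ge0.
have W2 : nrm (schur nu 1 1) + nrm (schur nu (-1) 1) <= W by rewrite lerDr addr_ge0.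
pose Di := nrm (schur nu 1 1 * schur nu (-1) (-1) - schur nu 1 (-1) * schur nu (-1) 1)^-1.
exists (24 * W * Di + 144) => C H hC.
have C0 : 0 <= C by apply: le_trans (hC 1 isT); exact: nrm_ge0.
have he1 : 12 * e * (144 * C) <= C.
  by have -> : 12 * e * (144 * C) = 12 * 144 * e * C by [ring]; rewrite ler_piMl.
have hc q : ~~ small q -> nrm (H q) <= C.
  by move=> hq; apply: hC; apply: contraNN hq => /eqP ->.
have [Gb [SG nG]] := sol_ex hn hc; have [bG _] := SG.
have [_ _ g1] := respP hn 1; have [_ _ g2'] := respP hn (-1).
set r1 := H 1 - fc 1 (sf Gb); set r2 := H (-1) - fc (-1) (sf Gb).
have CC : C + C = 2 * C by ring.
have n1 : nrm r1 <= 2 * C.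
  by rewrite /r1 -CC; apply: (le_trans (nrmB _ _)); rewrite lerD ?hC// (le_trans (fc_sf 1 bG nG)).
have n2 : nrm r2 <= 2 * C.
  by rewrite /r2 -CC; apply: (le_trans (nrmB _ _)); rewrite lerD ?hC// (le_trans (fc_sf (-1) bG nG)).
have [s1 s2] := solve2 r1 r2 D0.
have Di0 : 0 <= Di by exact: nrm_ge0.
split.
  have [RF f1 f2] := comb_reduced hn SG s1 s2.
  exists (comb nu ((schur nu (-1) (-1) * r1 - schur nu 1 (-1) * r2) /
     (schur nu 1 1 * schur nu (-1) (-1) - schur nu 1 (-1) * schur nu (-1) 1)) ((schur nu 1 1 * r2 - schur nu (-1) 1 * r1) /
     (schur nu 1 1 * schur nu (-1) (-1) - schur nu 1 (-1) * schur nu (-1) 1)) Gb); split=> // y.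
  have U (p q : R[i]) : nrm p + nrm q <= W ->
     nrm ((p * r1 - q * r2) / (schur nu 1 1 * schur nu (-1) (-1) - schur nu 1 (-1) * schur nu (-1) 1)) <= W * (2 * C) * Di /\
     nrm ((p * r2 - q * r1) / (schur nu 1 1 * schur nu (-1) (-1) - schur nu 1 (-1) * schur nu (-1) 1)) <= W * (2 * C) * Di.
    move=> pq; split; apply: nrm_mul => //.
      apply: (@le_trans _ _ ((nrm p + nrm q) * (2 * C))); last by rewrite ler_wpM2r// mulr_ge0.
      by rewrite mulrDl -mulNr; apply: nrm_add; apply: nrm_mul => //; rewrite nrmN.
    apply: (@le_trans _ _ ((nrm p + nrm q) * (2 * C))); last by rewrite ler_wpM2r// mulr_ge0.
    by rewrite mulrDl -mulNr; apply: nrm_add; apply: nrm_mul => //; rewrite nrmN.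
  have [u1 _] := U _ _ W1; have [_ u2] := U _ _ W2.
  rewrite /comb; apply: (le_trans (nrm_add (nrm_add (nrm_mul u1 (g1 y)) (nrm_mul u2 (g2' y))) (nG y))).
  by rewrite le_eqVlt; apply/orP; left; apply/eqP; ring.
move=> F F' RF RF' q.
have [a1 a2 ->] := reduced_comb hn RF SG; have [b1 b2 ->] := reduced_comb hn RF' SG.
have [-> ->] := solve2_uniq D0 a1 a2; have [-> ->] := solve2_uniq D0 b1 b2.
by [].
Qed.

Theorem reduced_spectrum : exists (x0 : R) (ph : R -> R[i]),
  [/\ - (3 * tau) <= x0 <= - (3 / 2 * tau), reduced_eq x0%:C (fun=> 0) ph /\ fc (-1) ph != 0,
      forall F, reduced_eq x0%:C (fun=> 0) F -> exists al, forall q, fc q F = al * fc q ph,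
      forall F al, reduced_eq x0%:C (fun q => al * fc q ph * ((q%:~R ^+ 2)^-1)%:C) F -> al = 0 &
      forall nu, 0 < nrm (nu - x0%:C) < tau / 1000 -> nrm nu <= 10^-1 /\
        exists M : R, forall (C : R) (H : int -> R[i]), (forall q, q != 0 -> nrm (H q) <= C) ->
          (exists F, reduced_eq nu H F /\ forall y, nrm (F y) <= M * C) /\
          forall F F', reduced_eq nu H F -> reduced_eq nu H F' -> forall q, fc q F = fc q F'].
Proof.
have [x0 hx0 h0] := det_root; exists x0, (phi x0).
have [RPh f1 f2] := phiP hx0 h0; split=> //.
- by split=> //; rewrite f2 oppr_eq0; exact: a_neq0.
- by move=> F; exact: ker_phi.
- by move=> F al; exact: no_jordan.
- move=> nu hnu; have [h1 h2] := det_near hx0 h0 hnu; split=> //.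
  exact: reduced_inverse.
Qed.

End eps.
End K.

(** * The critical eigenvalue of the full operator *)

Section spectrum.
Context {R : realType}.
Notation mu := (@lebesgue_measure R).
Local Notation Re := complex.Re.
Local Notation Im := complex.Im.
Variable T : R.
Hypothesis T0 : 0 < T.
Let kap := 2 * pi / T.
Opaque fc.
Local Notation fc := (fc T).
Local Notation ce := (ce T).
Local Notation citg := (citg T).
Local Notation ik := (ik T).
Variables (al be c eps : R) (P : R -> R).
Let A := al * kap ^+ 4.
Let B := be * kap ^+ 2.
Let e := `|eps|.
Let PC (x : R) : R[i] := (P x)%:C.
Hypotheses (CP : Cder 2 P) (PT : forall x, P (x + T) = P x).
Hypotheses (hA : `|A - 1| <= 100^-1) (hB : `|B - 1| <= 100^-1) (hc : `|c| <= 100^-1).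
Hypotheses (eps0 : eps != 0) (he : 10 ^+ 11 * e <= 1) (Pb : forall x, `|P x| <= 3 * e).
Hypotheses (P1 : fc 1 PC = eps%:C) (Pm1 : fc (-1) PC = eps%:C).
Hypothesis Peq : forall q : int, q != 0 ->
  (A * q%:~R ^+ 4 - B * q%:~R ^+ 2 - c)%:C * fc q PC + (2^-1)%:C * fc q (fun x => PC x * PC x) = 0.

Lemma L2eqP (f g : R -> R[i]) : L2eq T f g <-> {ae mu, forall x, 0 < x < T -> f x = g x}.
Proof.
split=> h.
  have {}h : {ae mu, forall x, `]0, T[%classic x -> f x = g x} := h.
  by apply: ae_mono h => x h xT; apply: h; rewrite /= in_itv.
have : {ae mu, forall x, `]0, T[%classic x -> f x = g x}; last by [].
by apply: ae_mono h => x h; rewrite /= in_itv/=; exact: h.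
Qed.

Definition meanP := Re (fc 0 PC).
Let d := c - meanP.
(** Removing the mean of P puts it into the constant d, and makes s_0 = 0. *)
Definition osc (x : R) : R := P x - meanP.
Let sC (x : R) : R[i] := (osc x)%:C.

Let e0 : 0 <= e. Proof. exact: normr_ge0. Qed.
Let ep : 0 < e. Proof. by rewrite normr_gt0. Qed.
Let e1 : e <= 2000^-1. Proof. by have := he; have := e0; lra. Qed.

Lemma bmf_P : bmf PC.
Proof.
split; [by apply: continuous_measurable_fun; exact: Cder_cont CP|exact: measurable_cst|].
by exists (3 * e) => x; rewrite nrmR.
Qed.
Let iP := bmf_citg T bmf_P.

Lemma mean_real : fc 0 PC = meanP%:C.
Proof.
have h := fc_conj 0 iP; rewrite oppr0 in h.
have E : fc 0 (fun x => ((PC x)^*)%C) = fc 0 PC.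
  by apply: eq_fc => x _; rewrite /PC /= oppr0.
rewrite E in h; rewrite /meanP; move: h; case: (fc 0 PC) => a b /= [h].
by apply: eq_ReIm => //=; lra.
Qed.

Lemma mean_le : `|meanP| <= 3 * e.
Proof.
have [i1 _] := iP.
have := fcE T0 0 iP; rewrite mean_real => /(congr1 (fun z : R[i] => Re z)) /=.
rewrite mul0r subr0.
have -> : \int[mu]_(x in `]0, T[) (0 * sin (0 * (2 * pi / T) * x)) = 0.
  by rewrite -[RHS](mul0r (T - 0)) -Rint_cst_oo//; apply: eq_Rintegral => x _; rewrite mul0r.
have -> : \int[mu]_(x in `]0, T[) (P x * cos (0 * (2 * pi / T) * x)) = \int[mu]_(x in `]0, T[) P x.
  by apply: eq_Rintegral => x _; rewrite !mul0r cos0 mulr1.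
rewrite addr0 => h.
have muT : fine (mu `]0, T[) = T by rewrite -[RHS]subr0 -[RHS]/(fine (T - 0)%:E) -(mu_oo T0).
have : `|\int[mu]_(x in `]0, T[) P x| <= 3 * e * T.
  by rewrite -[X in _ * X]muT; apply: Rint_bound => //; exact: mu_oo_lty.
by rewrite -h normrM (gtr0_norm T0) mulrC ler_pM2r.
Qed.

Let hd : `|d| <= 50^-1.
Proof.
rewrite /d; apply: (le_trans (ler_normB _ _)); have := hc; have := mean_le; have := e1; lra.
Qed.

Let sb x : `|osc x| <= 6 * e.
Proof. by rewrite /osc; apply: (le_trans (ler_normB _ _)); have := Pb x; have := mean_le; lra. Qed.

Let ms : measurable_fun setT osc.
Proof. by apply: measurable_funB => //; apply: continuous_measurable_fun; exact: Cder_cont CP. Qed.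

Lemma P_split x : (P x)%:C = meanP%:C + (osc x)%:C :> R[i].
Proof. by rewrite -rmorphD/=; congr (_%:C); rewrite /osc addrC subrK. Qed.

Lemma fc_osc q : fc q sC = fc q PC - meanP%:C * (q == 0)%:R.
Proof.
rewrite -(fc_cst T0 q meanP%:C) -fcB//; last by apply: bmf_citg; exact: bmf_cst.
by apply: eq_fc => x _; rewrite /sC /PC /osc rmorphB.
Qed.

(** The wave equation for P, shifted by its mean: the cross term 2 P_0 P_q of
    the square changes c into d = c - P_0. *)
Lemma sq_osc q : q != 0 -> (Dq A B d q)%:C * fc q sC = - (2^-1)%:C * fc q (sf osc sC).
Proof.
move=> q0; have bP := bmf_P; have iPP := bmf_citg T (bmfM bP bP).
have E : fc q (sf osc sC) = fc q (fun x => PC x * PC x) - (2 * meanP)%:C * fc q PC.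
  have i2 := citgZ (2 * meanP)%:C iP.
  have i3 : citg (fun=> (meanP ^+ 2)%:C) by apply: bmf_citg; exact: bmf_cst.
  rewrite -fcZ// -fcB//.
  rewrite -[RHS]addr0 -[X in _ + X](_ : fc q (fun=> (meanP ^+ 2)%:C) = 0); last by rewrite fc_cst// (negbTE q0) mulr0.
  rewrite -fcD//; last exact: citgB.
  apply: eq_fc => x _; rewrite /sf /sC /PC /osc.
  by rewrite -!rmorphM/= -!rmorphB/= -rmorphD/=; congr (_%:C); ring.
have h := Peq q0; rewrite E fc_osc (negbTE q0) mulr0 subr0.
have D : (Dq A B d q)%:C = (A * q%:~R ^+ 4 - B * q%:~R ^+ 2 - c)%:C + meanP%:C.
  by rewrite -rmorphD/=; congr (_%:C); rewrite /Dq /d; ring.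
rewrite D mulrDl; move: h; set X := _ * fc q PC; set Y := fc q (fun x => _) => h.
have -> : X = - ((2^-1)%:C * Y) by apply/eqP; rewrite -addr_eq0 h.
have -> : (2 * meanP)%:C = (2^-1)%:C * (4%:R * meanP%:C) :> R[i].
  have -> : 4%:R = (4%:R : R)%:C by rewrite rmorphMn.
  by rewrite -!rmorphM/=; congr (_%:C); field.
have hh := @halfC R; move: hh; set hf := (2^-1)%:C => hh.
transitivity (- (hf * Y) + (hf + hf) * (hf + hf) * (meanP%:C * fc q PC)); first by rewrite hh !mul1r.
have hf4 : hf * 4%:R = (hf + hf) + (hf + hf) by ring.
ring.
Qed.

Section fixed_l.
Variable l : R.
Let Lam := l / kap.
Let k0 : 0 < kap. Proof. exact: kap_gt0. Qed.
Local Notation op := (opG l al be c P).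
Local Notation dn := (den A B d Lam).
Local Notation sfo := (sf osc).
Local Notation reduced_osc := (reduced_eq T A B d osc Lam).

(** The coefficient equation of [analysis] is [kap ^+ 2 * q ^+ 2] times the
    reduced one. *)
Lemma symbol_den (nu F S : R[i]) q : q != 0 ->
  l%:C * ik q * F - ik q ^+ 2 * (al%:C * ik q ^+ 4 * F + be%:C * ik q ^+ 2 * F - c%:C * F
     + (meanP%:C * F + S)) - (kap ^+ 2)%:C * nu * F =
  (kap ^+ 2 * q%:~R ^+ 2)%:C * (dn nu q * F + S).
Proof.
move=> q0; have qR : q%:~R != 0 :> R by rewrite intr_eq0.
have kn : kap != 0 by rewrite gt_eqF.
have ik2 : ik q ^+ 2 = - (kap ^+ 2 * q%:~R ^+ 2)%:C.
  by rewrite /ik; apply: eq_ReIm; rewrite expr2 ?ReM ?ImM ?ReN ?ImN/=; rewrite -/kap; ring.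
have ik4 : ik q ^+ 4 = (kap ^+ 4 * q%:~R ^+ 4)%:C.
  have -> : ik q ^+ 4 = (ik q ^+ 2) ^+ 2 by ring.
  by rewrite ik2 sqrrN -rmorphXn/=; congr (_%:C); ring.
have E1 : l%:C * ik q = (kap ^+ 2 * q%:~R ^+ 2)%:C * (0 +i* (Lam / q%:~R)).
  rewrite /ik /Lam; apply: eq_ReIm; rewrite ?ReM ?ImM/=; rewrite -/kap; first by ring.
  by field; rewrite qR.
have E2 : (kap ^+ 2)%:C * nu = (kap ^+ 2 * q%:~R ^+ 2)%:C * (nu * ((q%:~R ^+ 2)^-1)%:C).
  have -> : (kap ^+ 2)%:C = (kap ^+ 2 * q%:~R ^+ 2)%:C * ((q%:~R ^+ 2)^-1)%:C.
    by rewrite -rmorphM/=; congr (_%:C); field; exact: qR.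
  ring.
have E3 : al%:C * ik q ^+ 4 + be%:C * ik q ^+ 2 - c%:C + meanP%:C = (Dq A B d q)%:C.
  rewrite ik2 ik4 mulrN -!rmorphM/= -!rmorphB/= -rmorphD/=; congr (_%:C).
  by rewrite /Dq /A /B /d; ring.
rewrite E1 E2 /den -E3 ik2; move: (ik q) (_%:C) => Z W; ring.
Qed.

Lemma fc_P f q : bmf f -> fc q (fun x => (P x)%:C * f x) = meanP%:C * fc q f + fc q (sfo f).
Proof.
move=> bf; rewrite -fcZ; last exact: bmf_citg.
rewrite -fcD; [|by apply: citgZ; exact: bmf_citg|by apply: citg_sf => //; exact: ms].
by apply: eq_fc => x _; rewrite P_split /sf; ring.
Qed.

(** The mode 0, once known, acts on the others as the source - g0 s_q. *)
Definition rhs (g0 : R[i]) (gh : int -> R[i]) (q : int) : R[i] :=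
  ((kap ^+ 2 * q%:~R ^+ 2)^-1)%:C * gh q - g0 * fc q sC.

Lemma rhs_bound g0 gh C C0 q : q != 0 -> nrm g0 <= C0 -> nrm (gh q) <= C ->
  nrm (rhs g0 gh q) <= (kap ^+ 2)^-1 * C + C0 * (12 * e).
Proof.
move=> q0 h0 hq; rewrite /rhs; apply: (le_trans (nrmB _ _)); apply: lerD; apply: nrm_mul => //.
  have K20 : 0 < kap ^+ 2 by exact: exprn_gt0.
  have q1 : 1 <= q%:~R ^+ 2 :> R.
    have q1 : (1 : R) <= `|q%:~R|.
      by rewrite -intr_norm -[1]/(1%:~R) ler_int -gtz0_ge1 normr_gt0.
    by rewrite -[leRHS]real_normK ?num_real// exprn_ege1.
  move: (kap ^+ 2) (q%:~R ^+ 2) K20 q1 => K y K20 y1.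
  have Ky : K <= K * y by rewrite ler_peMr// ltW.
  rewrite nrmR ger0_norm ?invr_ge0; last by apply: ltW; exact: lt_le_trans Ky.
  by rewrite lef_pV2 ?posrE//; exact: lt_le_trans Ky.
have -> : 12 * e = 2 * (6 * e) by ring.
by apply: (fc_bound T0) => [|x _]; [apply: bmf_citg; exact: bmf_s ms sb | rewrite nrmR; exact: sb].
Qed.

Lemma al_neq0 : al != 0.
Proof.
apply/eqP => z; have := hA; rewrite /A z mul0r sub0r normrN normr1; lra.
Qed.

Lemma fc_sf_cst q u : fc q (sfo (fun=> u)) = u * fc q sC.
Proof.
rewrite -fcZ; last by apply: bmf_citg; exact: bmf_s ms sb.
by apply: eq_fc => x _; rewrite /sf mulrC.
Qed.

Lemma inv_K q : q != 0 -> ((kap ^+ 2 * q%:~R ^+ 2)^-1)%:C * (kap ^+ 2 * q%:~R ^+ 2)%:C = 1 :> R[i].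
Proof.
move=> q0; have kn : kap != 0 by rewrite gt_eqF.
by rewrite -rmorphM/= mulVf// mulf_neq0// expf_neq0// intr_eq0.
Qed.

(** Solutions of the reduced equation have coefficients O(q^-4), to which
    [synthesis] applies. *)
Lemma reduced_to_domain nu h F u0 : nrm nu <= 10^-1 -> L2 T h -> reduced_osc nu (rhs u0 (fun q => fc q h)) F ->
  - ((kap ^+ 2)%:C * nu) * u0 = fc 0 h ->
  exists f, [/\ cHper T 6 f, L2eq T (Defs.shift op ((kap ^+ 2)%:C * nu) f) h, bmf f &
    forall q, fc q f = fc q F + u0 * (q == 0)%:R].
Proof.
move=> hn Lh RF h0; have [ch _] := L2_L1 T0 Lh; have [bF F0 hF] := RF.
have [bs be0] := (bmf_s ms sb, bmf_cst u0).
set C := 2 / T * \int[mu]_(x in `]0, T[) nrm (h x).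
have hC q : nrm (fc q h) <= C by exact: fc_L1.
have hb q : q != 0 -> nrm (rhs u0 (fun q => fc q h) q) <= (kap ^+ 2)^-1 * C + nrm u0 * (12 * e).
  by move=> q0; apply: rhs_bound => //; exact: hC.
have [M hM] := reduced_decay T0 hA hB hd e0 ms sb hn RF hb.
pose x q := fc q F + u0 * (q == 0)%:R.
have xA q : nrm (x q) * (1 + q%:~R ^+ 2) ^+ 2 <= M + nrm u0.
  rewrite /x; case: (eqVneq q 0) => [->|q0] /=.
    by have := hM 0; rewrite expr0n/= addr0 expr1n !mulr1 => h1; apply: nrm_add.
  by rewrite mulr0 addr0; apply: (le_trans (hM q)); rewrite lerDl nrm_ge0.
have d1 : decays (3 * (M + nrm u0)) x.
  apply: decays_quadratic => q; apply: le_trans (xA q).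
  have N1 : 1 <= 1 + q%:~R ^+ 2 :> R by rewrite lerDl sqr_ge0.
  have n0 := nrm_ge0 (x q).
  rewrite expr2 mulrA ler_peMr//; apply: mulr_ge0 => //; lra.
have bf := bmf_fsum T d1; have cf q : fc q (fsum T x) = x q by exact: (fc_fsum T0 q d1).
have eqFu q : fc q (fsum T x) = fc q (fun t => F t + u0).
  by rewrite cf fcD; [rewrite fc_cst|exact: bmf_citg|exact: bmf_citg].
have [|dom eqh] := @synthesis _ T T0 l al be c P CP PT ((kap ^+ 2)%:C * nu) h x (M + nrm u0) al_neq0 Lh xA.
  move=> q; rewrite (fc_P q bf) (fc_sf_ae T0 ms sb q bf (bmfD bF be0) eqFu) (fc_sfD T ms sb)// fc_sf_cst cf.
  have [->|q0] := eqVneq q 0.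
    have -> : ik 0 = 0 by rewrite /ik mul0r.
    by rewrite /x eqxx F0 add0r mulr1 -h0; ring.
  rewrite symbol_den// /x (negbTE q0) mulr0 addr0 addrA (hF q q0) /rhs subrK mulrA.
  by rewrite [X in X * _]mulrC inv_K// mul1r.
by exists (fsum T x).
Qed.

(** Conversely the Fourier series of an element of the domain is a bounded
    representative of it. *)
Lemma domain_to_reduced nu f g : nrm nu <= 10^-1 -> cHper T 6 f -> citg g ->
  L2eq T (Defs.shift op ((kap ^+ 2)%:C * nu) f) g ->
  exists F, [/\ bmf F /\ {ae mu, forall x, 0 < x < T -> f x = F x}, forall q, fc q f = fc q F,
    - ((kap ^+ 2)%:C * nu) * fc 0 F = fc 0 g &
    reduced_osc nu (rhs (fc 0 F) (fun q => fc q g)) (fun x => F x - fc 0 F)].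
Proof.
move=> hn dom gi eqg; have [hf cO eO] := analysis T0 l al be c CP PT dom.
have fi := cH_citg hf; have iO := cH_citg cO.
have f2 : cH T 2 f by do 4! apply: cH_dec.
have Pf := cH_citg (cH_mul CP PT f2).
have sfi : citg (sfo f).
  have -> : sfo f = (fun x => (P x)%:C * f x - meanP%:C * f x); last by apply: citgB => //; exact: citgZ.
  by apply/funext => x; rewrite P_split /sf; ring.
have ePf q : fc q (fun x => (P x)%:C * f x) = meanP%:C * fc q f + fc q (sfo f).
  rewrite -fcZ// -fcD//; last exact: citgZ.
  by apply: eq_fc => x _; rewrite P_split /sf; ring.
have eg q : fc q g = fc q (op f) - (kap ^+ 2)%:C * nu * fc q f.
  rewrite -fcZ// -fcB//; last exact: citgZ.
  apply/esym; apply: fc_ae => //; first by apply: citgB => //; exact: citgZ.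
have key q : q != 0 -> dn nu q * fc q f + fc q (sfo f) = ((kap ^+ 2 * q%:~R ^+ 2)^-1)%:C * fc q g.
  move=> q0; rewrite eg eO ePf symbol_den// mulrA inv_K// mul1r; by [].
have h0 : - ((kap ^+ 2)%:C * nu) * fc 0 f = fc 0 g.
  rewrite eg eO; have -> : ik 0 = 0 by rewrite /ik mul0r.
  ring.
set Cf := 2 / T * \int[mu]_(x in `]0, T[) nrm (f x).
set Cs := 2 / T * \int[mu]_(x in `]0, T[) nrm (sfo f x).
set Cg := 2 / T * \int[mu]_(x in `]0, T[) nrm (g x).
have bf q : nrm (fc q f) <= Cf by exact: fc_L1.
have bs q : nrm (fc q (sfo f)) <= Cs by exact: fc_L1.
have bg q : nrm (fc q g) <= Cg by exact: fc_L1.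
have Cf0 : 0 <= Cf by apply: le_trans (bf 0); exact: nrm_ge0.
have Cs0 : 0 <= Cs by apply: le_trans (bs 0); exact: nrm_ge0.
have Cg0 : 0 <= Cg by apply: le_trans (bg 0); exact: nrm_ge0.
pose Q := (kap ^+ 2)^-1 * Cg + Cs.
have d1 : decays (3 * (2 * Cf + 2 * Q)) (fun q => fc q f).
  have Q0 : 0 <= Q by apply: addr_ge0 => //; apply: mulr_ge0 => //; rewrite invr_ge0 sqr_ge0.
  apply: decays_quadratic => q; have [hq|hq] := boolP (small q).
    have q1 : q%:~R ^+ 2 <= 1 :> R.
      by case/or3P: hq => /eqP ->; rewrite ?rmorphN/= ?sqrrN ?expr1n// expr0n.
    apply: (@le_trans _ _ (Cf * 2)); last by lra.
    apply: ler_pM => //; [exact: nrm_ge0|by rewrite addr_ge0 ?sqr_ge0|lra].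
  have q0 : q != 0 by apply: contraNN hq => /eqP ->.
  have E1 : fc q f = mq A B d Lam nu q * (((kap ^+ 2 * q%:~R ^+ 2)^-1)%:C * fc q g - fc q (sfo f)).
    by rewrite -key// addrK /mq (negbTE hq) mulKf// den_neq0.
  have n1 : nrm (((kap ^+ 2 * q%:~R ^+ 2)^-1)%:C * fc q g - fc q (sfo f)) <= Q.
    have := @rhs_bound 0 (fun q => fc q g) Cg 0 q q0; rewrite nrm0 /rhs !mul0r subr0 addr0 => h.
    by apply: nrm_add; [exact: h|rewrite nrmN].
  have := mq_bound1 hA hB hd Lam q hn; have := nrm_mul (lexx (nrm (mq A B d Lam nu q))) n1.
  rewrite -E1; set m := nrm (mq _ _ _ _ _ _); set y : R := 1 + _ => h1 h2.
  have y0 : 0 <= y by rewrite addr_ge0 ?sqr_ge0.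
  have h3 : nrm (fc q f) * y <= m * Q * y by rewrite ler_wpM2r.
  have h4 : (m * y) * Q <= 2 * Q by rewrite ler_wpM2r.
  by rewrite mulrAC in h3; lra.
have bF := bmf_fsum T d1; set F := fsum T _ in bF.
have cF q : fc q F = fc q f by exact: (fc_fsum T0 q d1).
have aef : {ae mu, forall x, 0 < x < T -> f x = F x}.
  by apply: (fc_uniq T0 fi (bmf_citg T bF)) => q; rewrite cF.
exists F; split=> //; first by rewrite cF.
have bu := bmf_cst (fc 0 F).
have iF := bmf_citg T bF; have iu := bmf_citg T bu.
split; first exact: bmfB.
  by rewrite fcB// fc_cst// mulr1 subrr.
move=> q q0; rewrite fcB// fc_cst// (negbTE q0) mulr0 subr0 (fc_sfB T ms sb)// fc_sf_cst.
rewrite /rhs -key// cF [fc 0 F]cF addrA; congr (_ + _ - _).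
apply: fc_ae => //; first exact: citg_sf.
by apply: ae_mono aef => x h xT; rewrite /sf h.
Qed.

Lemma nrm_norm (z : R[i]) (r : R) : 0 < `|z| < r%:C -> 0 < nrm z < 2 * r.
Proof.
case: z => a b; rewrite normc_def !ltcR => /andP[h1 h2]; rewrite /nrm/=.
have s0 : 0 <= a ^+ 2 + b ^+ 2 by rewrite addr_ge0 ?sqr_ge0.
have h3 : a ^+ 2 + b ^+ 2 = Num.sqrt (a ^+ 2 + b ^+ 2) ^+ 2 by rewrite sqr_sqrtr.
move: h1 h2 h3; set q := Num.sqrt _ => q0 qr h3.
have Ha := real_normK (num_real a); have Hb := real_normK (num_real b).
have a0 := normr_ge0 a; have b0 := normr_ge0 b.
rewrite -Ha -Hb in h3; move: h3 a0 b0; set x := `|a|; set y := `|b| => h3 a0 b0.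
apply/andP; split.
  rewrite lt_def addr_ge0// andbT paddr_eq0//; apply/negP => /andP[/eqP x0 /eqP y0].
  by rewrite x0 y0 expr0n/= addr0 in h3; have := exprn_gt0 2 q0; rewrite -h3 ltxx.
have x1 : x <= q by rewrite -ler_sqr ?nnegrE ?(ltW q0)// -h3 lerDl sqr_ge0.
have y1 : y <= q by rewrite -ler_sqr ?nnegrE ?(ltW q0)// -h3 lerDr sqr_ge0.
lra.
Qed.

Definition threshold := kap * tau A B d eps / 10.

Lemma tau_gt0 : 0 < tau A B d eps.
Proof. exact: (tau_pos hA hB hd (erefl e) ep). Qed.

Lemma threshold_gt0 : 0 < threshold.
Proof. by rewrite /threshold divr_gt0// mulr_gt0// tau_gt0. Qed.

Lemma L2_0 : L2 T (fun=> 0 : R[i]).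
Proof.
have h : cH T 0 (fun=> 0 : R[i]) by apply: bmf_Hloc0 => //; exact: bmf_cst.
exact: cH_L2 h.
Qed.

(** The mode 0 only contributes [- kap ^+ 2 * nu * f_0], and nu is nonzero
    near the root, so every spectral property is read off
    [reduced_spectrum]. *)
Theorem transverse_spectrum : 0 < l < threshold ->
  exists m : R, [/\ m < 0, simple_eigenvalue T (cHper T 6) op m%:C &
    isolated_eigenvalue T (cHper T 6) op m%:C].
Proof.
move=> /andP[l0 lt].
have hL : 0 < Lam <= tau A B d eps / 10.
  rewrite divr_gt0//= ler_pdivrMr// ltW//; move: lt; rewrite /threshold; lra.
have ok : 0 < kap by [].
have [resp respP] := responses_ex T0 hA hB hd e0 e1 ms sb Lam.
have s0 : fc 0 sC = 0 by rewrite fc_osc mean_real eqxx mulr1 subrr.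
have s1 : fc 1 sC = eps%:C by rewrite fc_osc P1 mulr0 subr0.
have s2 : fc (-1) sC = eps%:C by rewrite fc_osc Pm1 mulr0 subr0.
have [x0 [ph [hx [Rph phn] kerp nojor near]]] :=
  reduced_spectrum T0 hA hB hd e0 e1 ms sb respP (erefl e) s0 s1 s2 sq_osc ep he hL.
have t0 := tau_gt0.
have K0 : 0 < kap ^+ 2 by exact: exprn_gt0.
have hnx : nrm x0%:C <= 10^-1.
  have ts := tau_small hA hB hd e0 (erefl e) ep he.
  move/andP: hx => [h1 h2]; rewrite nrmR ler_norml; apply/andP; split; lra.
pose m := kap ^+ 2 * x0; exists m.
have mC : m%:C = (kap ^+ 2)%:C * x0%:C by rewrite /m rmorphM.
have x0n : x0 < 0 by case/andP: hx => h1 h2; lra.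
have m0 : m < 0 by rewrite /m pmulr_rlt0.
have mC0 : m%:C != 0 by rewrite eq_complex/= lt_eqF.
have [bph ph0 hph] := Rph.
have L0 := L2_0.
have fc0 q : fc q (fun=> 0) = 0 by rewrite fc_cst// mul0r.
have Rph' : reduced_osc x0%:C (rhs 0 (fun q => fc q (fun=> 0))) ph.
  by split=> // q q0; rewrite (hph q q0) /rhs fc0 mulr0 mul0r subr0.
have [|f [domf eqf bf cf]] := reduced_to_domain hnx L0 Rph'; first by rewrite fc0 mulr0.
have {}cf q : fc q f = fc q ph by rewrite cf mul0r addr0.
have fi := bmf_citg T bf.
have evf : eigenvector T (cHper T 6) op m%:C f.
  split=> //.
    move=> /L2eqP z; have i0 := bmf_citg T (bmf_cst (0 : R[i])).
    by move: phn; rewrite -cf (fc_ae (-1) fi i0 z) fc0 eqxx.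
  apply/L2eqP; have /L2eqP := eqf; apply: ae_mono => x h xT.
  by have := h xT; rewrite /Defs.shift -mC => /eqP; rewrite subr_eq0 => /eqP.
split=> //.
  exists f => //; elim=> [|n IH] g /=.
    by move=> z; exists 0; apply/L2eqP; have /L2eqP := z; apply: ae_mono => x h xT; rewrite h// mul0r.
  move=> [domg [g' [eqg' /IH[be' eqb]]]].
  have eqs : L2eq T (Defs.shift op ((kap ^+ 2)%:C * x0%:C) g) (fun x => be' * f x).
    apply/L2eqP; have /L2eqP h1 := eqg'; have /L2eqP h2 := eqb.
    have := ae_and h1 h2; apply: ae_mono => x [a1 a2] xT.
    by rewrite -mC -a1// a2.
  have [F [[bF Fg] cF F0 RF]] := domain_to_reduced hnx domg (citgZ be' fi) eqs.
  have z0 : fc 0 F = 0.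
    move/eqP: F0; rewrite fcZ// cf ph0 mulr0 -mC mulf_eq0 oppr_eq0 (negbTE mC0) /=.
    by move/eqP.
  have RF' : reduced_osc x0%:C (fun q => (be' / (kap ^+ 2)%:C) * fc q ph * ((q%:~R ^+ 2)^-1)%:C) F.
    case: RF => _ _ h; split=> // q q0; have := h q q0.
    rewrite z0; under [X in fc q X]eq_fun do rewrite subr0.
    under [X in fc q (sfo X)]eq_fun do rewrite subr0.
    move=> ->; rewrite /rhs mul0r subr0 fcZ// cf.
    rewrite invfM rmorphM/= invC ?gt_eqF//; ring.
  have be0 : be' = 0.
    have := nojor _ _ RF' => /eqP; rewrite mulf_eq0 invr_eq0.
    have -> : ((kap ^+ 2)%:C == 0 :> R[i]) = false by rewrite eq_complex/= gt_eqF.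
    by rewrite orbF => /eqP.
  have RF0 : reduced_osc x0%:C (fun=> 0) F.
    by case: RF' => a1 a2 h; split=> // q q0; rewrite (h q q0) be0 !mul0r.
  have [al' hal] := kerp F RF0; exists al'; apply/L2eqP.
  have a2 : {ae mu, forall x, 0 < x < T -> F x = al' * f x}.
    apply: (fc_uniq T0 (bmf_citg T bF) (citgZ al' fi)) => q; by rewrite fcZ// cf.
  have := ae_and Fg a2; apply: ae_mono => x [h1 h2] xT.
  by rewrite h1// h2.
split; first by exists f.
pose dl := kap ^+ 2 * (tau A B d eps / 1000) / 2.
have t3 : 0 < tau A B d eps / 1000 by lra.
have dl0 : 0 < dl := divr_gt0 (mulr_gt0 K0 t3) (ltr0Sn _ 1).
exists dl => // nu /nrm_norm hnu.
pose nu' := nu / (kap ^+ 2)%:C.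
have KC : (kap ^+ 2)%:C != 0 :> R[i] by rewrite eq_complex/= gt_eqF.
have nuE : nu = (kap ^+ 2)%:C * nu' by rewrite /nu' mulrC divfK.
have hn' : 0 < nrm (nu' - x0%:C) < tau A B d eps / 1000.
  have E : nu - m%:C = (kap ^+ 2)%:C * (nu' - x0%:C) by rewrite mulrBr -nuE -mC.
  move: hnu; rewrite E nrmZ gtr0_norm// => /andP[h1 h2]; rewrite pmulr_rgt0// in h1.
  rewrite h1/=; rewrite -(ltr_pM2l K0); apply: (lt_le_trans h2).
  by rewrite /dl; lra.
have [hnn [M hM]] := near nu' hn'.
have nu0 : nu != 0.
  apply/eqP => z; move: hn'; rewrite /nu' z mul0r sub0r nrmN nrmR => /andP[_].
  by rewrite ltr0_norm//; case/andP: hx => h1 h2; lra.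
have M0 : 0 <= M.
  have [q q0|[F [_ hF]] _] := hM 1 (fun=> 0); first by rewrite nrm0.
  by have := hF 0; rewrite mulr1; apply: le_trans; exact: nrm_ge0.
split.
  move=> h Lh; have [ch _] := L2_L1 T0 Lh.
  pose u0 := - nu^-1 * fc 0 h.
  set C := 2 / T * \int[mu]_(x in `]0, T[) nrm (h x).
  have hC q : nrm (fc q h) <= C by exact: fc_L1.
  have hb q : q != 0 -> nrm (rhs u0 (fun q => fc q h) q) <= (kap ^+ 2)^-1 * C + nrm u0 * (12 * e).
    by move=> q0; apply: rhs_bound => //; exact: hC.
  have [[F [RF _]] _] := hM _ _ hb.
  have [|fr [domr eqr _ _]] := reduced_to_domain hnn Lh RF.
    by rewrite /u0 -nuE; field.
  by exists fr => //; rewrite nuE.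
pose C1 := 2 / T * (T + 1).
pose C2 := nrm nu^-1 * C1.
pose C3 := (kap ^+ 2)^-1 * C1 + C2 * (12 * e).
have C10 : 0 <= C1 := mulr_ge0 (divr_ge0 (ler0n _ 2) (ltW T0)) (addr_ge0 (ltW T0) ler01).
have C20 : 0 <= C2 by apply: mulr_ge0 => //; exact: nrm_ge0.
have C30 : 0 <= C3.
  apply: addr_ge0; first by apply: mulr_ge0 => //; rewrite invr_ge0 ltW.
  exact: (mulr_ge0 C20 (mulr_ge0 (ler0n _ 12) e0)).
exists ((T + 1) * (M * C3 + C2)) => g domg.
have [hg cO _] := analysis T0 l al be c CP PT domg.
have hs : cH T 0 (Defs.shift op nu g).
  exact: (cHB cO (cHZ _ (cH_dec (cH_dec (cH_dec (cH_dec (cH_dec (cH_dec hg)))))))).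
have Ls := cH_L2 hs; have [cs Ns] := L2_L1 T0 Ls.
set h := Defs.shift op nu g in hs Ls cs Ns *.
set N := L2norm T h in Ns *.
have N0 : 0 <= N by exact: sqrtr_ge0.
have eqh : L2eq T (Defs.shift op ((kap ^+ 2)%:C * nu') g) h by rewrite -nuE; apply/L2eqP; apply: aeW.
have [F [[bF Fg] cF F0 RF]] := domain_to_reduced hnn domg cs eqh.
have hC q : nrm (fc q h) <= C1 * N.
  apply: (le_trans (fc_L1 T0 q cs)); rewrite /C1 (_ : 2 / T * (T + 1) * N = 2 / T * ((T + 1) * N)); last by ring.
  by apply: ler_wpM2l => //; apply: divr_ge0 => //; exact: ltW.
have u0E : fc 0 F = - nu^-1 * fc 0 h.
  by rewrite -F0 -nuE; field.
have hu : nrm (fc 0 F) <= C2 * N.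
  rewrite u0E /C2 -mulrA; apply: nrm_mul; last exact: hC.
  by rewrite nrmN.
have hb q : q != 0 -> nrm (rhs (fc 0 F) (fun q => fc q h) q) <= C3 * N.
  move=> q0; apply: (le_trans (rhs_bound q0 hu (hC q))).
  by rewrite /C3 le_eqVlt; apply/orP; left; apply/eqP; ring.
have [[F1 [RF1 bF1]] uniq] := hM _ _ hb.
have [b1 _ _] := RF1; have [b2 _ _] := RF.
have eqF := uniq _ _ RF RF1.
have aeF := fc_uniq T0 (bmf_citg T b2) (bmf_citg T b1) eqF.
have bG : bmf (fun x => F1 x + fc 0 F) by apply: bmfD => //; exact: bmf_cst.
have gi := cH_citg hg.
rewrite -mulrA; apply: (L2norm_sup T0 gi bG).
- have := ae_and Fg aeF; apply: ae_mono => x [h1 h2] xT.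
  by rewrite h1// -h2// subrK.
- apply: mulr_ge0 => //; apply: addr_ge0 => //; apply: mulr_ge0 => //.
- move=> x; rewrite mulrDl -mulrA; exact: nrm_add.
Qed.

End fixed_l.
End spectrum.

(** * Fourier coefficients of a wave *)

Section profile.
Context {R : realType}.
Notation mu := (@lebesgue_measure R).
Local Notation Re := complex.Re.
Local Notation Im := complex.Im.
Variable T : R.
Hypothesis T0 : 0 < T.
Let kap := 2 * pi / T.
Opaque fc.
Local Notation fc := (fc T).
Local Notation ce := (ce T).
Local Notation citg := (citg T).
Local Notation ik := (ik T).

Definition cosj (j : int) (x : R) : R := cos (j%:~R * kap * x).

Lemma cosj_ce j x : (cosj j x)%:C = (2^-1)%:C * (ce j x + ce (- j) x).
Proof.
rewrite ceN /ce /cexpi /cosj -/kap; apply: eq_ReIm; rewrite ?ReM ?ImM/=; last by ring.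
set y := cos _; by field.
Qed.

Lemma citg_cosj j : citg (fun x => (cosj j x)%:C).
Proof. by split; apply: integrable_cont; [exact: cont_cosk|exact: cst_continuous]. Qed.

Lemma fc_cosj q j : fc q (fun x => (cosj j x)%:C) = (2^-1)%:C * ((q == j)%:R + (q == - j)%:R).
Proof.
rewrite (@eq_fc _ T q _ (fun x => (2^-1)%:C * (ce j x + ce (- j) x))); last by move=> x _; exact: cosj_ce.
by rewrite fcZ ?fcD ?fc_ce//; [exact: citg_ce|exact: citg_ce|apply: citgD; exact: citg_ce].
Qed.

Lemma fc_sum q N (f : nat -> R -> R[i]) : (forall n, citg (f n)) ->
  citg (fun x => \sum_(n < N) f n x) /\ fc q (fun x => \sum_(n < N) f n x) = \sum_(n < N) fc q (f n).
Proof.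
move=> fi; elim: N => [|N [IH1 IH2]].
  have E : (fun x => \sum_(n < 0) f n x) = (fun=> 0) by apply/funext => x; rewrite big_ord0.
  rewrite E big_ord0; split; first by apply: bmf_citg; exact: bmf_cst.
  by rewrite fc_cst// mul0r.
have E : (fun x => \sum_(n < N.+1) f n x) = (fun x => \sum_(n < N) f n x + f N x).
  by apply/funext => x; rewrite big_ord_recr.
by rewrite E big_ord_recr/= -IH2 fcD//; split=> //; exact: citgD.
Qed.

Section series.
Variables (b c W : R) (w : nat -> nat -> R) (P : R -> R).
(** Partial sums of the expansion of the wave, for b = a c; the frequencies n
    - m = 1 and n - m = -1 are absent from the double sum. *)
Definition Qsum (N : nat) (x : R) : R := b * cosj 1 x +
  c * \sum_(n < N) \sum_(m < N) w n m * cosj (n%:Z - m%:Z) x.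
Hypothesis hcv : forall x, Qsum ^~ x @ \oo --> P x.
Hypothesis hw : forall n m, n = m.+1 \/ m = n.+1 -> w n m = 0.
Hypothesis hW : forall N, \sum_(n < N) \sum_(m < N) `|w n m| <= W.

Lemma Qsum_bound N x : `|Qsum N x| <= `|b| + `|c| * W.
Proof.
rewrite /Qsum (le_trans (ler_normD _ _))//; apply: lerD.
  by rewrite normrM ler_piMr// cos_max.
rewrite normrM ler_wpM2l//; apply: le_trans (hW N).
apply: (le_trans (ler_norm_sum _ _ _)); apply: ler_sum => n _.
apply: (le_trans (ler_norm_sum _ _ _)); apply: ler_sum => m _.
by rewrite normrM ler_piMr// cos_max.
Qed.

Lemma profile_bound x : `|P x| <= `|b| + `|c| * W.
Proof.
have cn : (fun N => `|Qsum N x|) @ \oo --> `|P x| by apply: cvg_norm; exact: hcv.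
apply: (closed_cvg (fun y => y <= `|b| + `|c| * W)) cn; first exact: closed_le.
by near=> N; exact: Qsum_bound.
Unshelve. all: by end_near. Qed.

Lemma cont_sum (N : nat) (f : nat -> R -> R) : (forall n, continuous (f n)) ->
  continuous (fun x => \sum_(n < N) f n x).
Proof.
move=> cf; elim: N => [|N IH].
  rewrite (_ : (fun x => _) = (fun=> 0)); first exact: cst_continuous.
  by apply/funext => x; rewrite big_ord0.
rewrite (_ : (fun x => _) = (fun x => \sum_(n < N) f n x + f N x)).
  by move=> x; apply: cvgD; [exact: IH|exact: cf].
by apply/funext => x; rewrite big_ord_recr.
Qed.

Lemma Qsum_cont N : continuous (Qsum N).
Proof.
have cj j : continuous (cosj j) by exact: cont_cosk.
move=> x; apply: cvgD; first by apply: cvgM; [exact: cvg_cst|exact: cj].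
apply: cvgM; first exact: cvg_cst.
apply: (@cont_sum N (fun n x => \sum_(m < N) w n m * cosj (n%:Z - m%:Z) x)) => n.
apply: (@cont_sum N (fun m x => w n m * cosj (n%:Z - m%:Z) x)) => m y.
by apply: cvgM; [exact: cvg_cst|exact: cj].
Qed.

Lemma fc_Qsum N q : q = 1 \/ q = -1 -> fc q (fun x => (Qsum N x)%:C) = (b / 2)%:C.
Proof.
move=> hq.
have E : (fun x => (Qsum N x)%:C) = (fun x => b%:C * (cosj 1 x)%:C + c%:C *
   \sum_(n < N) \sum_(m < N) (w n m)%:C * (cosj (n%:Z - m%:Z) x)%:C).
  apply/funext => x; rewrite /Qsum rmorphD !rmorphM rmorph_sum/=; congr (_ + _ * _).
  by apply: eq_bigr => n _; rewrite rmorph_sum; apply: eq_bigr => m _; rewrite rmorphM.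
have i1 n m : citg (fun x => (w n m)%:C * (cosj (n%:Z - m%:Z) x)%:C) by apply: citgZ; exact: citg_cosj.
have [i2 f2] := fc_sum q N (fun n => (fc_sum q N (i1 n)).1).
rewrite E fcD; [|by apply: citgZ; exact: citg_cosj|exact: citgZ].
rewrite !fcZ//; last exact: citg_cosj.
rewrite f2 big1 ?mulr0 ?addr0.
  have -> : (b / 2)%:C = b%:C * (2^-1)%:C by rewrite -rmorphM.
  by rewrite fc_cosj; case: hq => ->; rewrite /= ?mulr1n ?addr0 ?add0r mulr1.
move=> n _; rewrite (fc_sum q N (i1 n)).2 big1// => m _.
rewrite fcZ; last exact: citg_cosj.
have [h|h] := eqVneq (n : nat) m.+1; first by rewrite hw ?mul0r//; left.
have [h'|h'] := eqVneq (m : nat) n.+1; first by rewrite hw ?mul0r//; right.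
rewrite fc_cosj.
have -> : (q == n%:Z - m%:Z) = false.
  by apply/eqP => z; move/eqP: h; move/eqP: h'; case: hq z => -> z; lia.
have -> : (q == - (n%:Z - m%:Z)) = false.
  by apply/eqP => z; move/eqP: h; move/eqP: h'; case: hq z => -> z; lia.
by rewrite addr0 !mulr0.
Qed.

(** The first coefficients of the partial sums are all equal to b / 2, and
    pass to the limit by bounded convergence. *)
Lemma fc_profile1 q : q = 1 \/ q = -1 -> fc q (fun x => (P x)%:C) = (b / 2)%:C.
Proof.
move=> hq.
have bnd (g : R -> R) : (forall x, `|g x| <= 1) -> continuous g ->
   mu.-integrable `]0, T[ (EFin \o (fun x => P x * g x)) /\
   (fun N => \int[mu]_(x in `]0, T[) (Qsum N x * g x)) @ \oo --> \int[mu]_(x in `]0, T[) (P x * g x).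
  move=> g1 cg; apply: (@Rint_bounded_cvg _ _ _ _ (`|b| + `|c| * W)) => //.
  - exact: mu_oo_lty.
  - move=> N; apply: measurable_funTS; apply: continuous_measurable_fun => x.
    by apply: cvgM; [exact: Qsum_cont|exact: cg].
  - move=> N x _; rewrite normrM; apply: le_trans (Qsum_bound N x).
    by rewrite ler_piMr.
  - by move=> x _; apply: cvgM; [exact: hcv|exact: cvg_cst].
have [iP _] := bnd (fun=> 1) (fun x => ltac:(by rewrite normr1)) (@cst_continuous _ _ _).
have {}iP : citg (fun x => (P x)%:C).
  split; last by apply: integrable_cont; exact: cst_continuous.
  by move: iP; congr (_.-integrable _ _); apply/funext => x /=; rewrite mulr1.
have iQ N : citg (fun x => (Qsum N x)%:C).
  by split; apply: integrable_cont; [exact: Qsum_cont|exact: cst_continuous].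
set k := q%:~R * kap.
have [_ c1] := bnd (fun x => cos (k * x)) (fun x => cos_max _) (@cont_cosk _ k).
have [_ c2] := bnd (fun x => sin (k * x)) (fun x => sin_max _) (@cont_sink _ k).
have Z1 (h : R -> R) : \int[mu]_(x in `]0, T[) (0 * h x) = 0.
  by rewrite -[RHS](mul0r (T - 0)) -Rint_cst_oo//; apply: eq_Rintegral => x _; rewrite mul0r.
have EQ N : \int[mu]_(x in `]0, T[) (Qsum N x * cos (k * x)) = T * (b / 2) /\
    \int[mu]_(x in `]0, T[) (Qsum N x * sin (k * x)) = 0.
  have := fcE T0 q (iQ N); rewrite fc_Qsum// -rmorphM/= !Z1 addr0 sub0r => -[h1 h2].
  by split; [rewrite h1|apply: oppr_inj; rewrite -h2 oppr0].
have TC : T%:C != 0 :> R[i] by rewrite eq_complex/= gt_eqF.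
apply: (mulfI TC); rewrite (fcE T0 q iP)/= !Z1 addr0 sub0r -/kap -/k.
have -> : \int[mu]_(x in `]0, T[) (P x * cos (k * x)) = T * (b / 2).
  rewrite (_ : (fun N => _) = (fun=> T * (b / 2))) in c1; last by apply/funext => N; rewrite (EQ N).1.
  exact: (cvg_unique _ c1 (cvg_cst _)).
have -> : \int[mu]_(x in `]0, T[) (P x * sin (k * x)) = 0.
  rewrite (_ : (fun N => _) = (fun=> 0)) in c2; last by apply/funext => N; rewrite (EQ N).2.
  exact: (cvg_unique _ c2 (cvg_cst _)).
by apply: eq_ReIm; rewrite ?ReM ?ImM/=; ring.
Qed.

End series.

Lemma fc_deriv q (f df : R -> R) : (forall x : R, is_derive x 1 f (df x)) -> continuous df ->
  f T = f 0 -> fc q (fun x => (df x)%:C) = ik q * fc q (fun x => (f x)%:C).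
Proof.
move=> hf cdf fT; have cf := is_derive_cont hf.
have i1 : citg (fun x => (df x)%:C) by split; apply: integrable_cont; [exact: cdf|exact: cst_continuous].
have i2 : citg (fun x => (f x)%:C) by split; apply: integrable_cont; [exact: cf|exact: cst_continuous].
have TC : T%:C != 0 :> R[i] by rewrite eq_complex/= gt_eqF.
suff : T%:C * fc q (fun x => (df x)%:C) = ik q * (T%:C * fc q (fun x => (f x)%:C)).
  by rewrite (mulrCA (ik q)); move/(mulfI TC).
rewrite (fcE T0 q i1) (fcE T0 q i2)/=; set k := q%:~R * _.
have [t1 t2] := trig_per T0 q 0; rewrite add0r -/kap -/k in t1 t2.
have Z1 (h : R -> R) : \int[mu]_(x in `]0, T[) (0 * h x) = 0.
  by rewrite -[RHS](mul0r (T - 0)) -Rint_cst_oo//; apply: eq_Rintegral => x _; rewrite mul0r.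
have a1 := itg_mul_cont i1.1 (@cont_cosk _ k); have a2 := itg_mul_cont i1.1 (@cont_sink _ k).
have a3 := itg_mul_cont i2.1 (@cont_cosk _ k); have a4 := itg_mul_cont i2.1 (@cont_sink _ k).
have E1 : \int[mu]_(x in `]0, T[) (df x * cos (k * x)) - k * \int[mu]_(x in `]0, T[) (f x * sin (k * x)) = 0.
  rewrite -RintegralZl// -RintegralB//; last exact: itgZl.
  transitivity (f T * cos (k * T) - f 0 * cos (k * 0)); last by rewrite t1 fT subrr.
  apply: (@Rint_FTC _ 0 T (fun x => f x * cos (k * x)) (fun x => df x * cos (k * x) - k * (f x * sin (k * x))) T0).
    move=> x; apply: cvgB; first by apply: cvgM; [exact: cdf|exact: cont_cosk].
    by apply: cvgM; [exact: cvg_cst|apply: cvgM; [exact: cf|exact: cont_sink]].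
  move=> x; have h := hf x; apply: is_derive_eq; rewrite /GRing.scale/=; ring.
have E2 : \int[mu]_(x in `]0, T[) (df x * sin (k * x)) + k * \int[mu]_(x in `]0, T[) (f x * cos (k * x)) = 0.
  rewrite -RintegralZl// -RintegralD//; last exact: itgZl.
  transitivity (f T * sin (k * T) - f 0 * sin (k * 0)); last by rewrite t2 fT subrr.
  apply: (@Rint_FTC _ 0 T (fun x => f x * sin (k * x)) (fun x => df x * sin (k * x) + k * (f x * cos (k * x))) T0).
    move=> x; apply: cvgD; first by apply: cvgM; [exact: cdf|exact: cont_sink].
    by apply: cvgM; [exact: cvg_cst|apply: cvgM; [exact: cf|exact: cont_cosk]].
  move=> x; have h := hf x; apply: is_derive_eq; rewrite /GRing.scale/=; ring.
rewrite /ik -/kap -/k !Z1; move/eqP: E1; rewrite subr_eq0 => /eqP ->.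
move/eqP: E2; rewrite addr_eq0 => /eqP ->.
by apply: eq_ReIm; rewrite ?ReM ?ImM/=; ring.
Qed.

(** The travelling wave equation on Fourier coefficients. The fourth
    derivative is continuous by the equation itself. *)
Lemma ode_coef (al be c : R) (P P1 P2 P3 P4 : R -> R) :
  (forall x : R, is_derive x 1 P (P1 x)) -> (forall x : R, is_derive x 1 P1 (P2 x)) ->
  (forall x : R, is_derive x 1 P2 (P3 x)) -> (forall x : R, is_derive x 1 P3 (P4 x)) ->
  (forall x, al * P4 x + be * P2 x - c * P x + 2^-1 * P x ^+ 2 = 0) -> al != 0 ->
  [/\ P T = P 0, P1 T = P1 0, P2 T = P2 0 & P3 T = P3 0] ->
  forall q, (al * kap ^+ 4 * q%:~R ^+ 4 - be * kap ^+ 2 * q%:~R ^+ 2 - c)%:C * fc q (fun x => (P x)%:C)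
    + (2^-1)%:C * fc q (fun x => (P x)%:C * (P x)%:C) = 0.
Proof.
move=> d1 d2 d3 d4 ode al0 [t0 t1 t2 t3] q.
have [c0 c1 c2] := And3 (is_derive_cont d1) (is_derive_cont d2) (is_derive_cont d3).
have c3 := is_derive_cont d4.
have P4E x : P4 x = al^-1 * (- (be * P2 x) + c * P x - 2^-1 * (P x * P x)).
  by have /eqP := ode x; rewrite -addrA -addrA addr_eq0 => /eqP h; apply: (mulfI al0); rewrite h; field.
have c4 : continuous P4.
  rewrite (_ : P4 = (fun x => al^-1 * (- (be * P2 x) + c * P x - 2^-1 * (P x * P x)))); last exact/funext.
  move=> x; apply: cvgM; first exact: cvg_cst.
  apply: cvgB; last by apply: cvgM; [exact: cvg_cst|apply: cvgM; exact: c0].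
  apply: cvgD; last by apply: cvgM; [exact: cvg_cst|exact: c0].
  by apply: cvgN; apply: cvgM; [exact: cvg_cst|exact: c2].
have i0 (f : R -> R) : continuous f -> citg (fun x => (f x)%:C).
  by move=> cf; split; apply: integrable_cont; [exact: cf|exact: cst_continuous].
have iPP : citg (fun x => (P x)%:C * (P x)%:C).
  rewrite (_ : (fun x => _) = (fun x => (P x * P x)%:C)); last by apply/funext => x; rewrite rmorphM.
  by apply: i0 => x; apply: cvgM; exact: c0.
have e1 := fc_deriv q d1 c1 t0; have e2 := fc_deriv q d2 c2 t1.
have e3 := fc_deriv q d3 c3 t2; have e4 := fc_deriv q d4 c4 t3.
have Z : al%:C * fc q (fun x => (P4 x)%:C) + be%:C * fc q (fun x => (P2 x)%:C) +
   (- c%:C) * fc q (fun x => (P x)%:C) + (2^-1)%:C * fc q (fun x => (P x)%:C * (P x)%:C) = 0.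
  have j4 := citgZ al%:C (i0 _ c4); have j2 := citgZ be%:C (i0 _ c2).
  have j0 := citgZ (- c%:C) (i0 _ c0); have jP := citgZ (2^-1)%:C iPP.
  rewrite -!fcZ//; try exact: i0.
  rewrite -!fcD//; try exact: citgD; try by apply: citgD => //; exact: citgD.
  rewrite (@eq_fc _ T q _ (fun=> 0)); first by rewrite fc_cst// mul0r.
  move=> x _; rewrite -!rmorphM/= -rmorphN/= -!rmorphM/= -!rmorphD/=; congr (_%:C).
  by rewrite -[RHS](ode x); ring.
rewrite e4 e3 e2 e1 in Z.
have ik2 : ik q ^+ 2 = - (kap ^+ 2 * q%:~R ^+ 2)%:C.
  by rewrite /ik; apply: eq_ReIm; rewrite expr2 ?ReM ?ImM ?ReN ?ImN/=; rewrite -/kap; ring.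
rewrite -[RHS]Z; set X := fc q _; set Y := fc q (fun x => (P x)%:C * _).
have -> : (al * kap ^+ 4 * q%:~R ^+ 4 - be * kap ^+ 2 * q%:~R ^+ 2 - c)%:C =
   al%:C * (- (kap ^+ 2 * q%:~R ^+ 2)%:C) ^+ 2 + be%:C * (- (kap ^+ 2 * q%:~R ^+ 2)%:C) - c%:C.
  by apply: eq_ReIm; rewrite expr2 !(ReB, ReD, ReM, ReN, ImB, ImD, ImM, ImN)/=; ring.
rewrite -ik2; ring.
Qed.

End profile.

(** * Smallness along the family of waves *)

Section family.
Context {R : realType}.
Local Notation Re := complex.Re.
Local Notation Im := complex.Im.

Lemma geo_half N : \sum_(n < N) (2^-1 : R) ^+ n <= 2.
Proof.
suff : \sum_(n < N) (2^-1 : R) ^+ n = 2 - 2 * 2^-1 ^+ N.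
  by move=> ->; rewrite gerBl mulr_ge0// exprn_ge0// invr_ge0.
elim: N => [|N IH]; first by rewrite big_ord0 expr0; lra.
by rewrite big_ord_recr/= IH exprS; set z := 2^-1 ^+ N; field.
Qed.

Lemma geo_half1 N : \sum_(1 <= n < N) (2^-1 : R) ^+ n <= 2.
Proof.
apply: le_trans (geo_half N); rewrite -(big_mkord xpredT (fun n => (2^-1 : R) ^+ n)).
case: N => [|N]; first by rewrite !big_geq.
by rewrite [leRHS]big_ltn// lerDr exprn_ge0// invr_ge0.
Qed.

(** With |a| <= th rho the general term is at most C th^(n+2), where two
    factors are kept and the others are bounded by 1/2. *)
Lemma pow_bound (th rho a C z : R) n : 0 < rho -> 0 <= C -> `|a| <= th * rho -> 0 <= th <= 2^-1 ->
  `|z| <= C / rho ^+ n.+2 -> `|z * a ^+ n.+2| <= C * th ^+ 2 * 2^-1 ^+ n.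
Proof.
move=> rho0 C0 ha /andP[th0 th1] hz; rewrite normrM normrX.
have rp (k : nat) : 0 < rho ^+ k by rewrite exprn_gt0.
apply: (@le_trans _ _ (C / rho ^+ n.+2 * (th * rho) ^+ n.+2)).
  apply: ler_pM => //; rewrite ?exprn_ge0//.
  by rewrite lerXn2r ?nnegrE// mulr_ge0// ltW.
rewrite exprMn (mulrC (th ^+ _)) -mulrA mulKf ?gt_eqF//.
have -> : th ^+ n.+2 = th ^+ 2 * th ^+ n by rewrite -exprD.
rewrite -mulrA ler_wpM2l// ler_wpM2l ?sqr_ge0// lerXn2r ?nnegrE ?invr_ge0//.
Qed.

(** Every index has n + m >= 2, so that two factors th can be set aside before
    the geometric series is summed. *)
Lemma wsum_bound (th rho a C : R) (z : nat -> nat -> R) N : 0 < rho -> 0 <= C -> `|a| <= th * rho ->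
  0 <= th <= 2^-1 -> (forall n m, p_index n m -> `|z n m| <= C / rho ^+ (n + m)) ->
  \sum_(n < N) \sum_(m < N) `|if p_index n m then z n m * a ^+ (n + m) else 0| <= 16 * (C * th ^+ 2).
Proof.
move=> rho0 C0 ha hth hz; set D := C * th ^+ 2.
have D0 : 0 <= D by rewrite mulr_ge0// sqr_ge0.
have q0 (k : nat) : 0 <= (2^-1 : R) ^+ k by rewrite exprn_ge0// invr_ge0.
have key n m : `|if p_index n m then z n m * a ^+ (n + m) else 0| <= 4 * D * 2^-1 ^+ n * 2^-1 ^+ m.
  case: ifPn => h; last by rewrite normr0; apply: mulr_ge0 => //; apply: mulr_ge0 => //; apply: mulr_ge0.
  have h2 : (2 <= n + m)%N by case/and3P: h.
  have E : (n + m = (n + m - 2).+2)%N by rewrite -[RHS]addn2 subnK.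
  have := @pow_bound th rho a C (z n m) (n + m - 2) rho0 C0 ha hth.
  rewrite -E => /(_ (hz n m h)) hb; apply: (le_trans hb); rewrite -/D.
  rewrite -mulrA -exprD [in leRHS]E !exprS -/D; set q := 2^-1 ^+ _; lra.
apply: (@le_trans _ _ (\sum_(n < N) \sum_(m < N) 4 * D * 2^-1 ^+ n * 2^-1 ^+ m)).
  by apply: ler_sum => n _; apply: ler_sum => m _; exact: key.
have g := geo_half N; set G := \sum_(n < N) _ in g.
have -> : \sum_(n < N) \sum_(m < N) 4 * D * 2^-1 ^+ n * 2^-1 ^+ m = 4 * D * G * G.
  under eq_bigr do rewrite -mulr_sumr.
  by rewrite -mulr_suml -mulr_sumr.
have G0 : 0 <= G by apply: sumr_ge0 => n _; rewrite exprn_ge0// invr_ge0.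
have h1 : 4 * D * G <= 4 * D * 2 by rewrite ler_wpM2l// mulr_ge0.
have : 4 * D * G * G <= 4 * D * 2 * 2 by apply: ler_pM => //; apply: mulr_ge0 => //; apply: mulr_ge0.
lra.
Qed.

Lemma sqrt_near1 (x : R) : 0 <= x -> `|Num.sqrt x - 1| <= `|x - 1|.
Proof.
move=> x0; have s0 : 0 <= Num.sqrt x by exact: sqrtr_ge0.
have -> : x - 1 = (Num.sqrt x - 1) * (Num.sqrt x + 1).
  by rewrite -{1}(sqr_sqrtr x0); ring.
rewrite normrM ler_peMr//.
by apply: le_trans (ler_norm _); lra.
Qed.

Lemma k0_near (c : R) : `|c| <= 10^-1 -> `|k0 c - 1| <= 2 * `|c|.
Proof.
rewrite ler_norml => /andP[c1 c2]; rewrite /k0.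
have s1 := @sqrt_near1 (1 + 4 * c) _.
have {}s1 : `|Num.sqrt (1 + 4 * c) - 1| <= 4 * `|c|.
  by apply: (le_trans (s1 _)); [lra|rewrite addrAC subrr add0r normrM ger0_norm].
have s0 : 0 <= Num.sqrt (1 + 4 * c) by exact: sqrtr_ge0.
apply: (le_trans (sqrt_near1 _)); first by lra.
have -> : (1 + Num.sqrt (1 + 4 * c)) / 2 - 1 = 2^-1 * (Num.sqrt (1 + 4 * c) - 1) by field.
rewrite normrM ger0_norm ?invr_ge0//; lra.
Qed.

Lemma powers_near1 (x : R) : `|x - 1| <= 1000^-1 -> `|x ^+ 4 - 1| <= 100^-1 /\ `|x ^+ 2 - 1| <= 100^-1.
Proof.
move=> h; have E2 : x ^+ 2 - 1 = (x - 1) * ((x - 1) + 2) by ring.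
have h2 : `|x ^+ 2 - 1| <= 300^-1.
  rewrite E2 normrM; have : `|x - 1 + 2| <= 3.
    by apply: (le_trans (ler_normD _ _)); rewrite (ger0_norm (_ : 0 <= 2))//; lra.
  have := normr_ge0 (x - 1); set u := `|x - 1| in h *; set v := `|_| => u0 v3.
  have : u * v <= u * 3 by rewrite ler_wpM2l.
  lra.
split; last by lra.
have -> : x ^+ 4 - 1 = (x ^+ 2 - 1) * ((x ^+ 2 - 1) + 2) by ring.
rewrite normrM; have : `|x ^+ 2 - 1 + 2| <= 3.
  by apply: (le_trans (ler_normD _ _)); rewrite (ger0_norm (_ : 0 <= 2))//; lra.
have := normr_ge0 (x ^+ 2 - 1); set u := `|x ^+ 2 - 1| in h2 *; set v := `|_| => u0 v3.
have : u * v <= u * 3 by rewrite ler_wpM2l.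
lra.
Qed.

Lemma derive1_per (f : R -> R) (L x : R) : (forall x, f (x + L) = f x) -> derive1 f (x + L) = derive1 f x.
Proof.
move=> h.
have E : (fun t => t^-1 *: (f (t + (x + L)) - f (x + L))) = (fun t => t^-1 *: (f (t + x) - f x)).
  by apply/funext => t; rewrite addrA !h.
by rewrite /derive1 E.
Qed.

Lemma derive1n_per (f : R -> R) (L : R) i : (forall x, f (x + L) = f x) ->
  forall x, derive1n i f (x + L) = derive1n i f x.
Proof.
by move=> h; elim: i => [|i IH] x; [exact: h|rewrite !derive1nS; exact: derive1_per].
Qed.

Section wave.
Variables (K c r T al be b W : R) (p : R -> R) (w : nat -> nat -> R).
Hypotheses (r0 : 0 < r) (K0 : 0 < K) (TE : T = 2 * pi / (K * r)).
Hypotheses (alE : al * r ^+ 4 = 1) (beE : be * r ^+ 2 = 1).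
Hypothesis tw : travelling_wave c (wave K p).
Hypothesis pper : forall z, p (z + 2 * pi) = p z.
Let phi := wave K p.
Let P x := phi (r * x).
Hypothesis hcv : forall z, (fun N : nat => b * cos z + c *
   \sum_(n < N) \sum_(m < N) w n m * cos ((n%:R - m%:R) * z)) @ \oo --> p z.
Hypothesis hw : forall n m, n = m.+1 \/ m = n.+1 -> w n m = 0.
Hypothesis hW : forall N, \sum_(n < N) \sum_(m < N) `|w n m| <= W.
Hypotheses (hK : `|K - 1| <= 1000^-1) (hc : `|c| <= 100^-1).
Hypotheses (b0 : b != 0) (hb : 10 ^+ 11 * `|b| <= 1) (hcW : `|c| * W <= `|b| / 2).

Let pi0 : 0 < pi :> R. Proof. exact: pi_gt0. Qed.
Let T0 : 0 < T.
Proof. by rewrite TE divr_gt0 ?mulr_gt0. Qed.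
Let kapE : 2 * pi / T = K * r.
Proof.
have n2 : 2 * pi != 0 :> R by rewrite gt_eqF// mulr_gt0.
by rewrite TE invf_div mulrC divfK.
Qed.

Lemma phi_per x : phi (x + 2 * pi / K) = phi x.
Proof.
by rewrite /phi /wave mulrDr [K * (_ / _)]mulrC divfK ?gt_eqF// pper.
Qed.

Let f i x := r ^+ i * derive1n i phi (r * x).

Lemma f_deriv i : (i < 4)%N -> forall x : R, is_derive x 1 (f i) (f i.+1 x).
Proof.
move=> hi x; have [h _] := tw.
have d1 : is_derive (r * x) 1 (derive1n i phi) (derive1n i.+1 phi (r * x)).
  by rewrite derive1nS derive1E; apply: DeriveDef => //; exact: h.
have d2 : is_derive x 1 (fun x : R => r * x) r.
  by apply: is_derive_eq; rewrite /GRing.scale/=; ring.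
have d3 := is_derive1_comp d1 d2.
have d4 : is_derive x 1 (fun x => r ^+ i * (derive1n i phi \o (fun x : R => r * x)) x) (r ^+ i * (derive1n i.+1 phi (r * x) * r)).
  by apply: is_derive_eq; rewrite /GRing.scale/=; ring.
have -> : f i.+1 x = r ^+ i * (derive1n i.+1 phi (r * x) * r) by rewrite /f exprS; ring.
exact: d4.
Qed.

Lemma f_per i x : f i (x + T) = f i x.
Proof.
rewrite /f mulrDr; have -> : r * T = 2 * pi / K by rewrite TE; field; rewrite !gt_eqF.
by rewrite (derive1n_per i phi_per).
Qed.

Lemma f0E : f 0 = P. Proof. by apply/funext => x; rewrite /f expr0 mul1r. Qed.

Lemma P_per x : P (x + T) = P x. Proof. by rewrite -f0E f_per. Qed.

Lemma P_Cder : Cder 2 P.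
Proof.
have cf i : (i < 4)%N -> continuous (f i) by move=> hi; exact: is_derive_cont (f_deriv hi).
rewrite -f0E; split; first exact: cf.
exists (f 1); split; first exact: f_deriv.
split; first exact: cf.
exists (f 2); split; first exact: f_deriv.
by split => //; exact: cf.
Qed.

Lemma P_ode x : al * f 4 x + be * f 2 x - c * P x + 2^-1 * P x ^+ 2 = 0.
Proof.
have [_ h] := tw; have := h (r * x); rewrite -/phi /f /P.
move: (derive1n 4 phi (r * x)) (derive1n 2 phi (r * x)) (phi (r * x)) => u4 u2 u0 E.
by rewrite (mulrA al) alE (mulrA be) beE !mul1r.
Qed.

Lemma P_cv x : Qsum T b c w ^~ x @ \oo --> P x.
Proof.
have := @hcv (K * (r * x)); rewrite (_ : (fun N : nat => _) = (Qsum T b c w ^~ x))//.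
apply/funext => N; rewrite /Qsum /cosj kapE mul1r mulrA; congr (_ + _ * _).
apply: eq_bigr => n _; apply: eq_bigr => m _; congr (_ * cos _).
by rewrite rmorphB/= -!pmulrn; ring.
Qed.

(** The rescaled wave P x = p (K r x) covers both operators: r = 1 / K gives
    p itself, with al = K^4 and be = K^2, and r = 1 gives phi, with al = be =
    1. In both cases al r^4 = be r^2 = 1 preserves the travelling wave
    equation. *)
Lemma wave_spectrum : exists l0 : R, 0 < l0 /\ forall l, 0 < l < l0 ->
  exists m : R, [/\ m < 0, simple_eigenvalue T (cHper T 6) (opG l al be c P) m%:C
    & isolated_eigenvalue T (cHper T 6) (opG l al be c P) m%:C].
Proof.
have [n4 n2] := powers_near1 hK.
have hA : `|al * (2 * pi / T) ^+ 4 - 1| <= 100^-1 by rewrite kapE exprMn mulrCA alE mulr1.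
have hB : `|be * (2 * pi / T) ^+ 2 - 1| <= 100^-1 by rewrite kapE exprMn mulrCA beE mulr1.
have e0 : b / 2 != 0 by rewrite mulf_neq0// invr_neq0.
have eE : `|b / 2| = `|b| / 2 by rewrite normrM normfV (ger0_norm (_ : 0 <= 2)).
have he : 10 ^+ 11 * `|b / 2| <= 1 by rewrite eE; have := hb; have := normr_ge0 b; lra.
have Pb x : `|P x| <= 3 * `|b / 2|.
  by apply: (le_trans (profile_bound P_cv hW x)); rewrite eE; have := hcW; lra.
have s1 := fc_profile1 T0 P_cv hw hW (or_introl (erefl 1)).
have s2 := fc_profile1 T0 P_cv hw hW (or_intror (erefl (-1))).
have al0 : al != 0 by apply/eqP => z; move: alE; rewrite z mul0r => /esym/eqP; rewrite oner_eq0.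
have pT i : f i T = f i 0 by rewrite -[T]add0r f_per.
have d0 (x : R) : is_derive x 1 P (f 1 x) by rewrite -f0E; exact: f_deriv.
have t0 : P T = P 0 by rewrite -f0E; exact: pT.
have ode q := @ode_coef _ T T0 al be c P (f 1) (f 2) (f 3) (f 4)
  d0 (f_deriv (isT : (1 < 4)%N)) (f_deriv (isT : (2 < 4)%N))
  (f_deriv (isT : (3 < 4)%N)) P_ode al0 (And4 t0 (pT 1) (pT 2) (pT 3)) q.
exists (threshold T al be c (b / 2) P); split.
  exact: (threshold_gt0 T0 P_Cder hA hB hc e0 he Pb).
move=> l hl.
exact: (transverse_spectrum T0 P_Cder P_per hA hB hc e0 he Pb s1 s2 (fun q _ => ode q) hl).
Qed.

End wave.

Lemma oneC (z : R[i]) : 1%:C * z = z. Proof. exact: mul1r. Qed.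

Lemma oneC4 (u v w t : R[i]) : u + v - w + t = 1%:C * u + 1%:C * v - w + t.
Proof. by rewrite !oneC. Qed.

Lemma opA_opG l c (phi : R -> R) :
  (fun f x => l%:C * cwderiv f x - opA c phi f x) = opG l 1 1 c phi.
Proof.
apply/funext => f; apply/funext => x; rewrite /opG /opA; congr (_ - cwderivn 2 _ x).
by apply/funext => y; exact: oneC4.
Qed.

(** The smallness of a alone bounds the correction of the wave number, and the
    factor c in front of it makes it small. *)
Lemma even_series_bound (rho K0 a th kt : R) (k2 : nat -> R) : 0 < rho -> 0 < K0 ->
  `|a| = th * rho -> 0 <= th <= 2^-1 ->
  (fun N : nat => \sum_(1 <= n < N) k2 n * a ^+ (2 * n)) @ \oo --> kt ->
  (forall n : nat, (1 <= n)%N -> `|k2 n| <= K0 / rho ^+ (2 * n)) -> `|kt| <= 2 * K0.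
Proof.
move=> rho0 K00 aE hth kcv kb; have /andP[th0 thh] := hth.
have cn : (fun N : nat => `|\sum_(1 <= n < N) k2 n * a ^+ (2 * n)|) @ \oo --> `|kt|.
  by apply: cvg_norm; exact: kcv.
apply: (closed_cvg (fun y => y <= 2 * K0)) cn; first exact: closed_le.
near=> N; apply: (le_trans (ler_norm_sum _ _ _)).
apply: (@le_trans _ _ (\sum_(1 <= n < N) K0 * 2^-1 ^+ n)).
  rewrite big_nat_cond [leRHS]big_nat_cond; apply: ler_sum => n /andP[/andP[n1 _] _].
  case: n n1 => // n _; have := kb n.+1 isT; rewrite mulnS add2n => h.
  apply: (le_trans (pow_bound rho0 (ltW K00) _ hth h)); first by rewrite aE.
  rewrite -mulrA ler_wpM2l//; first exact: ltW.
  have e2 : th ^+ 2 <= 2^-1 by rewrite expr2; have := ler_pM th0 th0 thh thh; lra.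
  have e3 : (2^-1 : R) ^+ (2 * n) <= 2^-1 ^+ n.
    have h0 : 0 <= (2^-1 : R) by rewrite invr_ge0.
    have h1 : (2^-1 : R) <= 1 by lra.
    by rewrite mul2n -addnn exprD ler_piMr ?exprn_ge0// exprn_ile1.
  by rewrite [in leRHS]exprS; apply: ler_pM => //; exact: sqr_ge0.
rewrite -mulr_sumr mulrC ler_wpM2r//; first exact: ltW.
exact: geo_half1.
Unshelve. all: by end_near. Qed.

Lemma wave_number_near1 (K0 c kt : R) : 0 < K0 -> (1000 * (2 + 2 * K0) + 100) * `|c| < 1 ->
  `|kt| <= 2 * K0 -> `|c| <= 100^-1 /\ `|k0 c + c * kt - 1| <= 1000^-1.
Proof.
move=> K00 cs hkt; have c0 := normr_ge0 c.
have cK : 0 <= K0 * `|c| by rewrite mulr_ge0// ltW.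
have hc : `|c| <= 100^-1 by lra.
split=> //; rewrite addrAC; apply: (le_trans (ler_normD _ _)); rewrite normrM.
have h1 : `|k0 c - 1| <= 2 * `|c| by apply: k0_near; lra.
have h2 : `|c| * `|kt| <= `|c| * (2 * K0) by rewrite ler_wpM2l.
lra.
Qed.

Lemma profile_cvg (a c z pz : R) (v : nat -> nat -> R) :
  ccvg (fun N : nat => (a * c * cos z)%:C + c%:C *
          \sum_(n < N) \sum_(m < N | p_index n m)
            (v n m)%:C * cexpi ((n%:R - m%:R) * z) * (a ^+ (n + m))%:C) pz%:C ->
  (fun N : nat => a * c * cos z + c * \sum_(n < N) \sum_(m < N)
     (if p_index n m then v n m * a ^+ (n + m) else 0) * cos ((n%:R - m%:R) * z)) @ \oo --> pz.
Proof.
move=> [h _]; move: h; rewrite /= (_ : (fun N : nat => Re _) = (fun N : nat => a * c * cos z +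
  c * \sum_(n < N) \sum_(m < N) (if p_index n m then v n m * a ^+ (n + m) else 0) *
    cos ((n%:R - m%:R) * z)))//; apply/funext => N.
rewrite ReD ReZ/=; congr (_ + _ * _); have Re0 : Re (0 : R[i]) = 0 by [].
rewrite (big_morph _ (@ReD R) Re0); apply: eq_bigr => n _.
rewrite (big_morph _ (@ReD R) Re0) big_mkcond; apply: eq_bigr => m _.
by case: ifP => _; [rewrite ReM ReZ/=; ring|rewrite mul0r].
Qed.

Lemma small_wave_unstable (K c b W : R) (p : R -> R) (w : nat -> nat -> R) :
  `|K - 1| <= 1000^-1 -> `|c| <= 100^-1 -> travelling_wave c (wave K p) ->
  (forall z, p (z + 2 * pi) = p z) ->
  (forall z, (fun N : nat => b * cos z + c *
     \sum_(n < N) \sum_(m < N) w n m * cos ((n%:R - m%:R) * z)) @ \oo --> p z) ->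
  (forall n m, n = m.+1 \/ m = n.+1 -> w n m = 0) ->
  (forall N, \sum_(n < N) \sum_(m < N) `|w n m| <= W) ->
  b != 0 -> 10 ^+ 11 * `|b| <= 1 -> `|c| * W <= `|b| / 2 ->
  (exists Lam0 : R, 0 < Lam0 /\ forall Lam : R, 0 < Lam < Lam0 -> exists mu : R, mu < 0 /\
     simple_eigenvalue (2 * pi) (cHper (2 * pi) 6)
       (fun f z => Lam%:C * cwderiv f z - opB K c p f z) mu%:C) /\
  coperiodic_transversely_unstable K c (wave K p).
Proof.
move=> hK hc tw pper hcv hw hW b0 hb hcW.
have K1 : 0 < K by move: hK; rewrite ler_norml => /andP[h1 _]; clear -h1; lra.
have kn0 : K != 0 by rewrite gt_eqF.
split.
  have TE : 2 * pi = 2 * pi / (K * K^-1) :> R by rewrite mulfV// divr1.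
  have r0 : 0 < K^-1 by rewrite invr_gt0.
  have alE : K ^+ 4 * K^-1 ^+ 4 = 1 by rewrite -exprMn mulfV// expr1n.
  have beE : K ^+ 2 * K^-1 ^+ 2 = 1 by rewrite -exprMn mulfV// expr1n.
  have [l0 [l00 H]] := wave_spectrum r0 K1 TE alE beE tw pper hcv hw hW hK hc b0 hb hcW.
  have pE : (fun x => wave K p (K^-1 * x)) = p.
    by apply/funext => x; rewrite /wave mulrA mulfV// mul1r.
  rewrite pE in H; exists l0; split; first exact: l00.
  by move=> l hl; have [m [m0 sm _]] := H l hl; exists m; split; [exact: m0|exact: sm].
have TE : 2 * pi / K = 2 * pi / (K * 1) :> R by rewrite mulr1.
have [l0 [l00 H]] := wave_spectrum (ltr01 : 0 < (1 : R)) K1 TE (etrans (mul1r _) (expr1n _ 4))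
  (etrans (mul1r _) (expr1n _ 2)) tw pper hcv hw hW hK hc b0 hb hcW.
have hl : 0 < l0 / 2 < l0 by clear -l00; apply/andP; split; lra.
have [m [m0 _ im]] := H (l0 / 2) hl.
have /andP[hl0 _] := hl; exists (l0 / 2)%:C; split; first exact: hl0.
exists (Num.sqrt (- m)).
have sE : - Num.sqrt (- m) ^+ 2 = m by rewrite sqr_sqrtr ?opprK// oppr_ge0 ltW.
split; first by rewrite sE.
have pE : (fun x => wave K p (1 * x)) = wave K p by apply/funext => x; rewrite mul1r.
by rewrite pE in im; rewrite sE opA_opG; exact: im.
Qed.

End family.

(** * Transverse instability *)

Theorem theorem1 (R : realType) (a0 c0 : R) (k : R -> R -> R)
    (p : R -> R -> R -> R) (hfam : periodic_waves a0 c0 k p) :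
  exists c3 a3 : R, 0 < c3 <= c0 /\ 0 < a3 <= a0 /\
    forall a c : R, `|c| < c3 -> c != 0 -> `|a| < a3 -> a != 0 ->
      (exists Lam0 : R, 0 < Lam0 /\
        forall Lam : R, 0 < Lam < Lam0 ->
          exists mu : R, mu < 0 /\
            simple_eigenvalue (2 * pi) (cHper (2 * pi) 6)
              (fun f z => Lam%:C * cwderiv f z - opB (k a c) c (p a c) f z)
              mu%:C) /\
      coperiodic_transversely_unstable (k a c) c (wave (k a c) (p a c)).
Proof.
move: hfam => [[a00 c00] tw [_ [pX _]] [rho rho0 [[K0 [kt [k2 [K00 kE kcv kb]]]]
  [C0 [pt [C00 pcv _ pb]]]]] _].
(* Below c3 the wave number is within 1/1000 of 1, through |kt| <= 2 K0; the
   bound th0 on |a| / rho makes the terms of the expansion other than a c cos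
   z at most half of it. *)
pose c3 := Num.min c0 (1000 * (2 + 2 * K0) + 100)^-1.
pose th0 := Num.min 2^-1 (rho / (32 * C0)).
pose a3 := Num.min a0 (Num.min (th0 * rho) (10^-1 ^+ 11)).
have X0 : 0 < 1000 * (2 + 2 * K0) + 100 by clear -K00; lra.
have th00 : 0 < th0 by rewrite lt_min invr_gt0 ltr0n/= divr_gt0// mulr_gt0.
exists c3, a3; split; first by rewrite lt_min c00 invr_gt0 X0 ge_min lexx.
split; first by rewrite !lt_min a00 mulr_gt0// exprn_gt0 ?invr_gt0// ge_min lexx.
move=> a c; rewrite !lt_min => /andP[cc0 cs] c_n0 /andP[aa0 /andP[as1 as2]] a_n0.
have rc : rect a0 c0 a c by [].
pose th := `|a| / rho.
have aE : `|a| = th * rho by rewrite /th divfK// gt_eqF.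
have th_ge0 : 0 <= th by rewrite divr_ge0// ltW.
have [thh thr] : th <= 2^-1 /\ th <= rho / (32 * C0).
  have : th < th0 by rewrite /th ltr_pdivrMr.
  by rewrite lt_min => /andP[/ltW ? /ltW ?].
have hth : 0 <= th <= 2^-1 by apply/andP.
have cs' : (1000 * (2 + 2 * K0) + 100) * `|c| < 1.
  by move: X0 cs; move: (_ + 100) => X X0 cs; rewrite -[X^-1]mulr1 ltr_pdivlMl in cs.
have ktb := even_series_bound rho0 K00 aE hth (kcv a c rc) (fun n n1 => kb n c n1 cc0).
have [hc hK] := wave_number_near1 K00 cs' ktb; rewrite -kE// in hK.
pose w n m := if p_index n m then pt n m c * a ^+ (n + m) else 0.
apply: (small_wave_unstable (b := a * c) (w := w) (W := 16 * (C0 * th ^+ 2)) hK hc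
  (tw a c rc).1 (pX a c rc).2
  (fun z => @profile_cvg _ a c z (p a c z) (fun n m => pt n m c) (pcv a c z rc))).
- by move=> n m [] ->; rewrite /w /p_index eqxx ?andbF.
- move=> N; apply: (@wsum_bound R th rho a C0 (fun n m => pt n m c)) => //; first exact: ltW.
    by rewrite aE.
  by move=> n m h; exact: pb.
- by rewrite mulf_neq0.
- rewrite normrM; have ac : `|a| * `|c| <= `|a| * 1.
    by rewrite ler_wpM2l//; clear -hc; lra.
  have := ltW as2; rewrite exprVn -[leRHS]mul1r ler_pdivlMr ?exprn_gt0//.
  by clear -ac; lra.
- have h1 : 32 * C0 * th * th <= rho * th.
    by rewrite ler_wpM2r// mulrC -ler_pdivlMr ?mulr_gt0.
  have h2 : `|c| * (16 * (C0 * th ^+ 2)) <= `|c| * (`|a| / 2).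
    by rewrite ler_wpM2l// aE expr2; clear -h1; lra.
  by rewrite normrM; clear -h2; lra.
Qed.
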